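(* Let $\rho_0\in\mathcal{P}_2(\mathbb{R}^d)$ with $\mathcal{F}(\rho_0)<\infty$. If $\Psi\in C^2(\mathbb{R}^d)$ satisfies either Assumption (Sub) or Assumption (Super) (both stated in the context), then for every $\tau>0$ and every $\rho\in\mathcal{P}_2(\mathbb{R}^d)$, $$J_\tau(\rho|\rho_0)=\inf_{\rho_{(\cdot)}\in C_{W_2}(\rho_0,\rho)}\frac1{4\tau}\int_0^1\Big\|\frac{\partial\rho_t}{\partial t}-\tau(\Delta\rho_t+\operatorname{div}(\rho_t\nabla\Psi))\Big\|^2_{-1,\rho_t}\,dt.$$
   Context: $\mathcal{P}(\mathbb{R}^d)$ is the set of Borel probability measures on $\mathbb{R}^d$; $\mathcal{P}_2(\mathbb{R}^d)$ is the subset with finite second moment, with the 2-Wasserstein metric $W_2$. $C_{W_2}(\rho_0,\rho)$ is the set of $W_2$-continuous curves $[0,1]\to\mathcal{P}_2(\mathbb{R}^d)$ starting in $\rho_0$ and ending in $\rho$. Free energy: $\mathcal{F}=\mathcal{S}+\mathcal{E}$, $\mathcal{E}(\rho)=\int\Psi\,d\rho$, $\mathcal{S}(\rho)=\int\rho(x)\log\rho(x)\,dx$ if $\rho(dx)=\rho(x)dx$ and $+\infty$ otherwise. Rate functional: $J_\tau(\rho|\rho_0)=\inf\{\mathcal{H}(\gamma|\rho_0\otimes p_\tau):\gamma\in\Pi(\rho_0,\rho)\}$, where $\Pi(\rho_0,\rho)$ is the set of Borel probability measures on $\mathbb{R}^{2d}$ with first marginal $\rho_0$ and second marginal $\rho$;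 $p_\tau(dy|x)$ is the fundamental solution of $\partial_t\rho=\Delta\rho+\operatorname{div}(\rho\nabla\Psi)$ (equivalently, the transition probability at time $\tau$ of $dX=-\nabla\Psi(X)\,dt+\sqrt2\,dW$ started at $x$); $(\rho_0\otimes p_\tau)(dx\,dy)=\rho_0(dx)p_\tau(dy|x)$; $\mathcal{H}(\mu|\nu)=\int\log\frac{d\mu}{d\nu}\,d\mu$ if $\mu\ll\nu$, $+\infty$ otherwise. $\mathcal{D}=C_c^\infty(\mathbb{R}^d)$, $\mathcal{D}'$ the distributions, $\langle\cdot,\cdot\rangle$ the pairing; measures are identified with distributions. For $s\in\mathcal{D}'$, $\|s\|^2_{-1,\rho}=\sup_{p\in\mathcal{D}}\{2\langle s,p\rangle-\int|\nabla p|^2d\rho\}\in[0,\infty]$. Absolute continuity in the distributional sense of $\rho_{(\cdot)}:[0,1]\to\mathcal{D}'$: for each compact $K\subset\mathbb{R}^d$ there are a neighbourhood $U_K$ of $0$ in $\mathcal{D}_K$ (test functions supported in $K$) and an absolutely continuous $G_K:[0,1]\to\mathbb{R}$ with $|\langle\rho_{t_2},f\rangle-\langle\rho_{t_1},f\rangle|\le|G_K(t_2)-G_K(t_1)|$ for all $0<t_1,t_2<1$, $f\in U_K$; then $\partial\rho_t/\partial t\in\mathcal{D}'$ exists for a.e. $t$. Convention: the time integral in the infimum is $+\infty$ if the curve is not absolutely continuous in the distributional sense; $\inf\emptyset=+\infty$. Assumption (Sub) (subquadratic case): $\Psi\in C^2(\mathbb{R}^d)$ and (1) $\Psi$ is bounded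 from below; (2) there is $C>0$ with $|x||\nabla\Psi(x)|\le C(1+|x|^2)$ for all $x$; (3) $\Psi$ is convex; (4) $\Delta\Psi$ is bounded. Assumption (Super) (superquadratic case): $\Psi\in C^4(\mathbb{R}^d)$ and (1) there is $\lambda_\Psi\in\mathbb{R}$ with $z^TD^2\Psi(x)z\ge\lambda_\Psi|z|^2$ for all $x,z$; (2) $\int_{\mathbb{R}^d}\Psi(x)e^{-2\Psi(x)}dx<\infty$; (3) $\lim_{|x|\to\infty}\Psi(x)/|x|^2=+\infty$; (4) there is $\omega\in C(\mathbb{R}_+)$ with $\omega(0)=0$ such that for all $x,y$: $\Psi(y)-\Psi(x)\le\omega(|y-x|)(1+\Psi(x))$ and $|\Psi(y)-\Psi(x)|^2\le\omega(|y-x|)(1+|\nabla\Psi(x)|^2+\Psi(x))$; (5) $\zeta:=|\nabla\Psi|^2-2\Delta\Psi$ satisfies $\lim_{|x|\to\infty}\zeta(x)/|x|^2=+\infty$; (6) there is $\lambda_\zeta\in\mathbb{R}$ with $z^TD^2\zeta(x)z\ge\lambda_\zeta|z|^2$ for all $x,z$. *)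

(* Defs.v *)
From HB Require Import structures.
From mathcomp Require Import all_boot all_order all_algebra.
From mathcomp Require Import all_classical all_reals all_analysis measurable_realfun.

Set Implicit Arguments.
Unset Strict Implicit.
Unset Printing Implicit Defensive.
Import Order.TTheory GRing.Theory Num.Theory.
Import numFieldNormedType.Exports.

Local Open Scope classical_set_scope.
Local Open Scope ring_scope.

(* Borel sigma-algebra of matrices, in particular of R^d = 'rV[R]_d. *)
HB.instance Definition _ (R : realType) (m n : nat) :=
  @isMeasurable.Build (sigma_display (@open 'M[R]_(m, n))) 'M[R]_(m, n)
    <<s @open 'M[R]_(m, n) >> (@sigma_algebra0 _ setT _)
    (@sigma_algebraC _ _) (@sigma_algebra_bigcup _ setT _).

Section borel_rV.
Context {R : realType}.

Lemma measurable_coord_rV n (i : 'I_n) :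
  measurable_fun [set: 'rV[R]_n] (fun v => v ord0 i : measurableTypeR R).
Proof.
apply: (measurability _ (RGenOpens.measurableE R)).
move=> _ [_ [a [b ->] <-]]; rewrite setTI.
apply: sub_sigma_algebra.
apply: (@open_comp 'rV[R]_n R (fun v => v ord0 i)); last exact: interval_open.
by move=> v _; exact: coord_continuous.
Qed.

Lemma open_boxE n (U : set 'rV[R]_n) : open U ->
  let box (q : 'rV[rat]_n * 'rV[rat]_n) := [set v : 'rV[R]_n |
    forall i, ratr (q.1 ord0 i) < v ord0 i < ratr (q.2 ord0 i)] in
  U = \bigcup_(q in [set q | box q `<=` U]) box q.
Proof.
move=> oU box; apply/seteqP; split; last by move=> v [q qU]; exact: qU.
move=> v Uv.
have /nbhs_ballP[e /= e0 eU] : nbhs v U by exact: open_nbhs_nbhs.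
have pa i : exists a : rat, v ord0 i - e < ratr a < v ord0 i.
  have := @rat_in_itvoo R (v ord0 i - e) (v ord0 i).
  by rewrite ltrBlDr ltrDl => /(_ e0) [a]; rewrite in_itv/=; exists a.
have pb i : exists b : rat, v ord0 i < ratr b < v ord0 i + e.
  have := @rat_in_itvoo R (v ord0 i) (v ord0 i + e).
  by rewrite ltrDl => /(_ e0) [a]; rewrite in_itv/=; exists a.
exists (\row_i sval (cid (pa i)), \row_i sval (cid (pb i))).
  move=> w bw; apply: eU; split => // j i; rewrite ord1.
  have := bw i; rewrite /= !mxE; case: cid => a /= /andP[a1 a2].
  case: cid => b /= /andP[b1 b2] /andP[w1 w2].
  rewrite /ball /= ltr_distlC.
  by rewrite (lt_trans a1 w1) (lt_trans w2 b2).
move=> i; rewrite /= !mxE; case: cid => a /= /andP[a1 a2].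
by case: cid => b /= /andP[b1 b2]; rewrite a2 b1.
Qed.

Lemma measurable_fun_rV d (T : measurableType d) n (f : T -> 'rV[R]_n) :
  (forall i, measurable_fun [set: T] (fun x => f x ord0 i : measurableTypeR R)) ->
  measurable_fun [set: T] f.
Proof.
move=> mf; apply: (@measurability _ _ _ _ _ _ (@open 'rV[R]_n)) => //.
move=> _ [U oU <-]; rewrite setTI (open_boxE oU) preimage_bigcup.
rewrite bigcup_mkcond; apply: countable_bigcupT_measurable => // -[a b].
case: ifPn => // _.
rewrite [X in measurable X](_ : _ = \bigcap_(i in [set: 'I_n])
    ((fun x => f x ord0 i) @^-1` `](ratr (a ord0 i) : R), ratr (b ord0 i)[)).
  apply: fin_bigcap_measurable => // i _; rewrite -[X in measurable X]setTI.
  by apply: mf => //; exact: measurable_itv.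
by apply/seteqP; split => x /= h i; have := h i; rewrite /= in_itv/= => ->.
Qed.

End borel_rV.

Section lebesgue_rV.
Context {R : realType}.
Local Open Scope ereal_scope.

Definition consrV n (xv : measurableTypeR R * 'rV[R]_n) : 'rV[R]_n.+1 :=
  row_mx (xv.1)%:M%R xv.2.

(* Lebesgue measure on R^n, via R^(m+1) = R x R^m. *)
Fixpoint lebesgue_rV (n : nat) : set 'rV[R]_n -> \bar R :=
  match n with
  | 0 => \d_(0%R : 'rV[R]_0)
  | m.+1 => pushforward (@lebesgue_measure R \x @lebesgue_rV m) (@consrV m)
  end.

Lemma consrV0 n (xv : measurableTypeR R * 'rV[R]_n) :
  consrV xv ord0 ord0 = xv.1.
Proof.
have := row_mxEl (xv.1)%:M%R xv.2 ord0 ord0.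
rewrite [RHS]mxE eqxx mulr1n => <-.
by congr (row_mx _ _ _ _); exact: val_inj.
Qed.

Lemma consrVS n (xv : measurableTypeR R * 'rV[R]_n) i :
  consrV xv ord0 (lift ord0 i) = xv.2 ord0 i.
Proof.
rewrite -(row_mxEr (xv.1)%:M%R xv.2 ord0 i).
by congr (row_mx _ _ _ _); exact: val_inj.
Qed.

Lemma measurable_consrV n : measurable_fun setT (@consrV n).
Proof.
apply: measurable_fun_rV => i.
have [->|[j ->]] : i = ord0 \/ exists j, i = lift ord0 j.
  by case: (unliftP ord0 i) => [j ->|->]; [right; exists j|left].
  under eq_fun do rewrite consrV0.
  exact: measurable_fst.
under eq_fun do rewrite consrVS.
by apply: measurableT_comp (measurable_coord_rV j) _; exact: measurable_snd.
Qed.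

Section step.
Variables (n : nat) (mu : {sigma_finite_measure set 'rV[R]_n -> \bar R}).

Definition lebesgue_step : set 'rV[R]_n.+1 -> \bar R :=
  pushforward (@lebesgue_measure R \x mu) (@consrV n).

Let step0 : lebesgue_step set0 = 0.
Proof. by rewrite /lebesgue_step /pushforward preimage_set0 measure0. Qed.

Let step_ge0 A : 0 <= lebesgue_step A.
Proof. by apply: integral_ge0 => x _; exact: measure_ge0. Qed.

Let mstep A : measurable A -> measurable (@consrV n @^-1` A).
Proof. by move=> mA; rewrite -[X in measurable X]setTI; exact: measurable_consrV. Qed.

Let step_sigma_additive : semi_sigma_additive lebesgue_step.
Proof.
move=> F mF tF mUF; rewrite /lebesgue_step /pushforward preimage_bigcup.
apply: (measure_semi_sigma_additive (s := (@lebesgue_measure R \x mu))).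
- by move=> k; exact: mstep.
- apply/trivIsetP => /= i j _ _ ij; rewrite -preimage_setI.
  by move/trivIsetP : tF => /(_ _ _ _ _ ij) ->//; rewrite preimage_set0.
- by rewrite -preimage_bigcup; exact: mstep.
Qed.

HB.instance Definition _ :=
  isMeasure.Build _ _ _ lebesgue_step step0 step_ge0 step_sigma_additive.

Let step_sigma_finite : sigma_finite setT lebesgue_step.
Proof.
have /sigma_finiteP[F [TF ndF Foo]] := sigma_finiteT (@lebesgue_measure R).
have /sigma_finiteP[G [TG ndG Goo]] := sigma_finiteT mu.
have TFG : [set: measurableTypeR R * 'rV[R]_n] = \bigcup_k (F k `*` G k).
  rewrite -setXTT TF TG; apply/seteqP; split=> [[x v] [/= [i _ Fx] [j _ Gv]]|].
    exists (maxn i j) => //; split.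
    - by move: x Fx; exact/subsetPset/ndF/leq_maxl.
    - by move: v Gv; exact/subsetPset/ndG/leq_maxr.
  by move=> [x v] [i _ [/= Fx Gv]]; split; exists i.
pose tail (w : 'rV[R]_n.+1) : 'rV[R]_n := \row_j w ord0 (lift ord0 j).
pose uncons (w : 'rV[R]_n.+1) : measurableTypeR R * 'rV[R]_n :=
  (w ord0 ord0, tail w).
have uncons1 w : consrV (uncons w) = w.
  apply/rowP => i; case: (unliftP ord0 i) => [j ->|->].
    by rewrite consrVS mxE.
  by rewrite consrV0.
have uncons2 xv : uncons (consrV xv) = xv.
  rewrite /uncons consrV0; case: xv => x v; congr pair.
  by apply/rowP => j; rewrite mxE consrVS.
have muncons : measurable_fun setT uncons.
  apply/measurable_fun_pairP; split; first exact: measurable_coord_rV.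
  apply: measurable_fun_rV => i; under eq_fun do rewrite /= mxE.
  exact: measurable_coord_rV.
exists (fun k => uncons @^-1` (F k `*` G k)).
  by rewrite -preimage_bigcup -TFG preimage_setT.
move=> k; have [mFk Fkoo] := Foo k; have [mGk Gkoo] := Goo k; split.
  by rewrite -[X in measurable X]setTI; apply: muncons => //; exact: measurableX.
rewrite /lebesgue_step /pushforward -comp_preimage (_ : _ \o _ = id).
  by rewrite product_measure1E// lte_mul_pinfty// ge0_fin_numE.
by apply/funext => xv /=; exact: uncons2.
Qed.

HB.instance Definition _ :=
  Measure_isSigmaFinite.Build _ _ _ lebesgue_step step_sigma_finite.

End step.

Lemma lebesgue_rV_ex n :
  exists mu : {sigma_finite_measure set 'rV[R]_n -> \bar R},
    (mu : set 'rV[R]_n -> \bar R) = @lebesgue_rV n.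
Proof.
elim: n => [|n [mu muE]] /=.
  by exists (\d_(0%R : 'rV[R]_0)).
by rewrite -muE; exists (lebesgue_step mu).
Qed.

Let leb0 n : @lebesgue_rV n set0 = 0.
Proof. by have [mu <-] := lebesgue_rV_ex n; exact: measure0. Qed.

Let leb_ge0 n A : 0 <= @lebesgue_rV n A.
Proof. by have [mu <-] := lebesgue_rV_ex n; exact: measure_ge0. Qed.

Let leb_sigma_additive n : semi_sigma_additive (@lebesgue_rV n).
Proof.
by have [mu <-] := lebesgue_rV_ex n; exact: measure_semi_sigma_additive.
Qed.

HB.instance Definition _ n := isMeasure.Build _ _ _ (@lebesgue_rV n)
  (@leb0 n) (@leb_ge0 n) (@leb_sigma_additive n).

Let leb_sigma_finite n : sigma_finite setT (@lebesgue_rV n).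
Proof. by have [mu <-] := lebesgue_rV_ex n; exact: sigma_finiteT. Qed.

HB.instance Definition _ n := Measure_isSigmaFinite.Build _ _ _
  (@lebesgue_rV n) (@leb_sigma_finite n).

End lebesgue_rV.

Section semidirect.
Context d1 d2 (T1 : measurableType d1) (T2 : measurableType d2) (R : realType).
Local Open Scope ereal_scope.
Variables (mu : probability T1 R) (k : R.-pker T1 ~> T2).

(* mu (x) k, i.e. mu(dx) k(dy|x). *)
Definition semidirect (A : set (T1 * T2)) := \int[mu]_x k x (xsection A x).

Let semidirect0 : semidirect set0 = 0.
Proof. by apply: integral0_eq => x _; rewrite xsection0 measure0. Qed.

Let semidirect_ge0 A : 0 <= semidirect A.
Proof. by apply: integral_ge0 => x _; exact: measure_ge0. Qed.

Let semidirect_sigma_additive : semi_sigma_additive semidirect.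
Proof.
move=> F mF tF mUF.
rewrite [X in _ --> X](_ : _ = \sum_(n <oo) semidirect (F n)).
  by apply/cvg_closeP; split; [exact: is_cvg_nneseries|rewrite closeE].
rewrite /semidirect -integral_nneseries//; last first.
  by move=> n; apply: measurable_fun_xsection_finite_kernel; exact/mem_set.
apply: eq_integral => x _; apply/esym/cvg_lim => //=; rewrite xsection_bigcup.
apply: (measure_sigma_additive _ (trivIset_xsection tF)) => ?.
exact: measurable_xsection.
Qed.

HB.instance Definition _ := isMeasure.Build _ _ _ semidirect
  semidirect0 semidirect_ge0 semidirect_sigma_additive.

Let semidirect_setT : semidirect setT = 1.
Proof.
rewrite /semidirect.
rewrite (eq_integral (cst 1)); last first.
  move=> x _ /=; rewrite (_ : xsection setT x = setT) ?prob_kernel//.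
  by apply/seteqP; split => // y _; rewrite /xsection/= inE.
by rewrite integral_cst//= mul1e; exact: probability_setT.
Qed.

HB.instance Definition _ :=
  Measure_isProbability.Build _ _ _ semidirect semidirect_setT.

End semidirect.

Section calculus.
Context {R : realType} {d : nat}.
Local Notation Rd := 'rV[R]_d.
Implicit Types (x y z : Rd) (f : Rd -> R).

(* The library norm `|x| on matrices is the max norm; all moments, distances
   and gradients below use the Euclidean structure instead. *)
Definition dotp x y : R := \sum_(i < d) x ord0 i * y ord0 i.
Definition enorm x : R := Num.sqrt (dotp x x).

(* Iterated partial derivative along the list of directions s (a multi-index
   of order size s). *)
Definition partial (s : seq 'I_d) f : Rd -> R :=
  foldr (fun i g => 'D_(delta_mx ord0 i) g) f s.

Definition C_k (k : nat) f := forall s : seq 'I_d, (size s <= k)%N ->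
  continuous (partial s f) /\
  ((size s < k)%N ->
    forall i x, derivable (partial s f) x (delta_mx ord0 i)).

Definition C_infty f := forall k, C_k k f.

Definition grad f x : Rd := \row_i partial [:: i] f x.
Definition laplacian f x : R := \sum_(i < d) partial [:: i; i] f x.
Definition hessian f x : 'M[R]_d := \matrix_(i, j) partial [:: i; j] f x.
Definition hessian_form f x z : R := (z *m hessian f x *m z^T) ord0 ord0.

Definition cvg_infty_at_infty f :=
  forall A : R, exists M : R, 0 < M /\ forall x, M <= enorm x -> A <= f x.

Definition supp f : set Rd := closure [set x | f x != 0].
Definition test_function f := C_infty f /\ compact (supp f).

Definition test_function_on (K : set Rd) : set (Rd -> R) :=
  [set f | C_infty f /\ supp f `<=` K].

(* Neighbourhoods of 0 in D_K, whose topology is given by the seminorms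
   max_(size s <= N) sup_x |partial s f x|. *)
Definition nbhs0_test_on (K : set Rd) (U : set (Rd -> R)) :=
  U `<=` test_function_on K /\
  exists (N : nat) (e : R), 0 < e /\
    [set f | test_function_on K f /\
       forall s x, (size s <= N)%N -> `|partial s f x| < e] `<=` U.

End calculus.

Section assumptions.
Context {R : realType} {d : nat}.
Variable Psi : 'rV[R]_d -> R.

Definition subquadratic :=
  [/\ C_k 2 Psi,
      exists m : R, forall x, m <= Psi x,
      exists C : R, 0 < C /\
        forall x, enorm x * enorm (grad Psi x) <= C * (1 + enorm x ^+ 2),
      convex_function [set: convex_lmodType 'rV[R]_d] Psi &
      exists M : R, forall x, `|laplacian Psi x| <= M].

Definition zeta (x : 'rV[R]_d) : R :=
  enorm (grad Psi x) ^+ 2 - 2 * laplacian Psi x.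

Definition semiconvex (f : 'rV[R]_d -> R) :=
  exists lambda : R, forall x z, lambda * enorm z ^+ 2 <= hessian_form f x z.

Definition modulus_condition := exists omega : R -> R,
  [/\ {within `[0, +oo[, continuous omega},
      omega 0 = 0,
      forall x y, Psi y - Psi x <= omega (enorm (y - x)) * (1 + Psi x) &
      forall x y, `|Psi y - Psi x| ^+ 2 <=
        omega (enorm (y - x)) * (1 + enorm (grad Psi x) ^+ 2 + Psi x)].

Definition superquadratic :=
  C_k 4 Psi /\
  [/\ semiconvex Psi,
      (\int[@lebesgue_rV R d]_x (Psi x * expR (- 2 * Psi x))%:E < +oo)%E,
      cvg_infty_at_infty (fun x => Psi x / enorm x ^+ 2),
      modulus_condition &
      cvg_infty_at_infty (fun x => zeta x / enorm x ^+ 2) /\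
      semiconvex zeta].

End assumptions.

Section wasserstein.
Context {R : realType} {d : nat}.
Local Notation Rd := 'rV[R]_d.
Implicit Types (mu nu rho : probability Rd R).
Local Open Scope ereal_scope.

Definition P2 : set (probability Rd R) :=
  [set rho | \int[rho]_x (enorm x ^+ 2)%:E < +oo].

Definition coupling mu nu : set (probability (Rd * Rd)%type R) :=
  [set g | forall A, measurable A ->
     g (A `*` setT) = mu A /\ g (setT `*` A) = nu A].

Definition W2 mu nu : \bar R :=
  (ereal_inf [set \int[g]_xy (enorm (xy.1 - xy.2)%R ^+ 2)%:E
    | g in coupling mu nu]) `^ 2^-1.

(* Only the values on [0, 1] of a curve are relevant. *)
Definition W2_curve (rho0 rho1 : probability Rd R)
    : set (R -> probability Rd R) :=
  [set c | [/\ forall t : R, `[0%R, 1%R]%classic t -> P2 (c t),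
      forall t : R, `[0%R, 1%R]%classic t ->
        W2 (c s) (c t) @[s --> within `[0%R, 1%R]%classic (nbhs t)] --> 0,
      forall A, measurable A -> c 0%R A = rho0 A &
      forall A, measurable A -> c 1%R A = rho1 A]].

End wasserstein.

Section functionals.
Context {R : realType} {d : nat}.
Local Notation Rd := 'rV[R]_d.
Implicit Types (rho : probability Rd R).
Local Open Scope ereal_scope.

(* Radon_Nikodym requires a charge as its first measure. *)
Definition relative_entropy dT (T : measurableType dT)
    (mu nu : probability T R) : \bar R :=
  if `[< mu `<< nu >] then
    \int[mu]_x
      (ln (fine (Radon_Nikodym (charge_of_finite_measure mu) nu x)))%:E
  else +oo.

Definition entropy rho : \bar R :=
  if `[< rho `<< @lebesgue_rV R d >] then
    let f x := fine
      (Radon_Nikodym (charge_of_finite_measure rho) (@lebesgue_rV R d) x) in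
    \int[@lebesgue_rV R d]_x (f x * ln (f x))%:E
  else +oo.

Definition potential_energy (Psi : Rd -> R) rho : \bar R :=
  \int[rho]_x (Psi x)%:E.

Definition free_energy (Psi : Rd -> R) rho : \bar R :=
  entropy rho + potential_energy Psi rho.

(* p t x is p_t(dy|x): for every x, t |-> p t x is a distributional solution on
   ]0, +oo[ of the equation  d/dt rho = Laplacian rho + div (rho grad Psi)
   with initial datum the Dirac mass at x. *)
Definition fundamental_solution (Psi : Rd -> R)
    (p : R -> R.-pker Rd ~> Rd) : Prop :=
  forall x f, test_function f ->
    (forall t : R, (0 < t)%R ->
      is_derive t (1 : R)%R (fun s => \int[p s x]_y f y)%R
        (\int[p t x]_y (laplacian f y - dotp (grad Psi y) (grad f y)))%R) /\
    (\int[p t x]_y f y)%R @[t --> 0^'+] --> f x.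

Definition rate_functional (p : R -> R.-pker Rd ~> Rd) (tau : R)
    rho (rho0 : probability Rd R) : \bar R :=
  ereal_inf [set relative_entropy g (semidirect rho0 (p tau))
    | g in coupling rho0 rho].

End functionals.

Section action.
Context {R : realType} {d : nat}.
Local Notation Rd := 'rV[R]_d.
Implicit Types (rho : probability Rd R) (c : R -> probability Rd R).

(* ||s||^2_{-1,rho}, where the distribution s is given by its pairing with test
   functions. *)
Definition sqnorm_m1 (s : (Rd -> R) -> R) rho : \bar R :=
  ereal_sup [set (2 * s f - \int[rho]_x (enorm (grad f x) ^+ 2))%:E
    | f in test_function].

Definition absolutely_continuous01 (G : R -> R) :=
  forall e : R, 0 < e -> exists2 dl : R, 0 < dl &
    forall (n : nat) (a b : 'I_n -> R),
      (forall i, 0 <= a i /\ a i <= b i /\ b i <= 1) ->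
      trivIset setT (fun i => `]a i, b i[%classic) ->
      \sum_(i < n) (b i - a i) < dl ->
      \sum_(i < n) `|G (b i) - G (a i)| < e.

Definition distr_abs_continuous c :=
  forall K : set Rd, compact K -> exists U G,
    [/\ nbhs0_test_on K U,
        absolutely_continuous01 G &
        forall (t1 t2 : R) f, 0 < t1 < 1 -> 0 < t2 < 1 -> U f ->
          `|\int[c t2]_x f x - \int[c t1]_x f x| <= `|G t2 - G t1|].

(* The distribution  d/dt c_t - tau (Laplacian c_t + div (c_t grad Psi)),
   paired with f.  The time derivative is the distributional one: it exists for
   almost every t when c is absolutely continuous in the distributional sense,
   and the junk value of derive1 at the remaining times does not affect the
   time integral in action. *)
Definition continuity_defect (Psi : Rd -> R) (tau : R) c (t : R)
    (f : Rd -> R) : R :=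
  derive1 (fun s => \int[c s]_x f x) t -
  tau * \int[c t]_x (laplacian f x - dotp (grad Psi x) (grad f x)).

Definition action (Psi : Rd -> R) (tau : R) c : \bar R :=
  if `[< distr_abs_continuous c >] then
    ((4 * tau)^-1%:E * \int[@lebesgue_measure R]_(t in `[0%R, 1%R])
       sqnorm_m1 (continuity_defect Psi tau c t) (c t))%E
  else +oo%E.

End action.

(* Main.v *)
(* Write L f = Lap f - grad Psi . grad f. Either assumption gives the Lyapunov bound
   L ln(1 + |x|^2) <= C, and nothing else about Psi is needed beyond continuity of grad Psi.

   J <= action. For a curve of finite action and a positive test datum, approximate
   solutions w of the backward equation built by a monotone finite-difference scheme, cut off
   far away with the Lyapunov function, make t |-> int ln w_(1-t) d rho_t almost monotone
   up to the action (2 s f - int |grad f|^2 with f = ln w). In the limit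
   int phi d rho - int ln (P_tau e^phi) d rho_0 <= action for all test functions phi; the same
   comparison, applied to the transition probabilities, gives the Chapman-Kolmogorov
   equation. A near maximizer of the dual problem converges in mean to the density
   of a coupling whose relative entropy is at most the action.

   action <= J. A coupling g = h . (rho_0 (x) p_tau) is mixed with the bridges of the diffusion:
   rho_t is the law at time t tau of the process with path density h(X_0, X_tau). With
   E(t) the entropy of the conditional expectation of h given X_0 and X_(t tau), Gibbs' variational
   principle on [s, t] bounds exponential functionals of (X_s, X_t) by E(t) - E(s).
   Short-time expansions turn this into
   d/dt int f d rho_t - tau int (L f + |grad f|^2) d rho_t <= E'(t), hence the action is at most
   E(1) - E(0) <= H(g | rho_0 (x) p_tau); applied to squares of increments and to saturated moments
   it yields absolute continuity and W_2-continuity of the curve. *)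
From HB Require Import structures.
From mathcomp Require Import all_boot all_order all_algebra.
From mathcomp Require Import all_classical all_reals all_analysis measurable_realfun.
From mathcomp Require Import ring lra.
Require Import Defs.

Set Implicit Arguments.
Unset Strict Implicit.
Unset Printing Implicit Defensive.
Import Order.TTheory GRing.Theory Num.Theory.
Import numFieldNormedType.Exports.

Local Open Scope classical_set_scope.
Local Open Scope ring_scope.

(** * Smooth functions with quantitative derivative bounds *)

Section bounded_derivatives.
Context {R : realType} {d : nat}.
Local Notation Rd := 'rV[R]_d.
Implicit Types (f g : Rd -> R) (x v : Rd).

(** The drift enters as a continuous, possibly unbounded field, and [p] and the curves are known
    only through compactly supported smooth functions; so neither a regular solution of the backward
    equation nor a growing function can be inserted directly. The drift is replaced on a compact set
    by a smooth one, and the error [(b - bt) . grad v] is absorbed by the [(1 - q) |grad v|^2] left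
    over when the quadratic term carries a factor q < 1; this avoids any uniform gradient bound, and
    q tends to 1 at the end. A smooth concave truncation of [w + dl * V] is constant outside a
    compact set, so its logarithm minus a constant is a test function. Comparison is one-sided;
    since the scheme is linear and preserves constants, a second comparison started from
    [al + be * w0] with be < 0 bounds [w] itself by the semigroup. In the converse direction the
    entropy along a bridge is used only through its monotonicity and its bound; regularity in time
    comes from multiplying the tested function by a large factor [la], which divides the entropy
    increment by [la]. *)

Definition ei (j : 'I_d) : Rd := delta_mx ord0 j.

(** A single constant serves all orders up to k, so that one step of the scheme multiplies every
    bound by the same factor. Joint continuity of the partial derivatives is part of the
    definition. *)
Fixpoint bnd (k : nat) (M : R) f : Prop :=
  [/\ continuous f, forall x, `|f x| <= M &
    if k is k'.+1 then
      (forall j x, derivable f x (ei j)) /\ (forall j, bnd k' M ('D_(ei j) f))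
    else True].

Lemma bnd_continuous k M f : bnd k M f -> continuous f.
Proof. by case: k => [|k] []. Qed.

Lemma bnd_le_norm k M f x : bnd k M f -> `|f x| <= M.
Proof. by case: k => [|k] []. Qed.

Lemma bnd_ge0 k M f : bnd k M f -> 0 <= M.
Proof. by move=> /(@bnd_le_norm _ _ _ 0); exact: le_trans (normr_ge0 _). Qed.

Lemma bnd_derivable k M f j x : bnd k.+1 M f -> derivable f x (ei j).
Proof. by move=> [_ _ [+ _]]; apply. Qed.

Lemma bnd_derive k M f j : bnd k.+1 M f -> bnd k M ('D_(ei j) f).
Proof. by move=> [_ _ [_]]; apply. Qed.

Lemma bnd0 M f : continuous f -> (forall x, `|f x| <= M) -> bnd 0 M f.
Proof. by split. Qed.

Lemma bndS k M f : bnd 0 M f -> (forall j x, derivable f x (ei j)) ->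
  (forall j, bnd k M ('D_(ei j) f)) -> bnd k.+1 M f.
Proof. by move=> [fc fM _] df Df; split. Qed.

Lemma bnd_le k M N f : M <= N -> bnd k M f -> bnd k N f.
Proof.
move=> MN; elim: k f => [|k IH] f /=.
  by move=> [fc fM _]; split => // x; exact: le_trans (fM x) MN.
move=> [fc fM [df Df]]; split => //; first by move=> x; exact: le_trans (fM x) MN.
by split => // j; exact: IH.
Qed.

Lemma bnd_weak k l M f : (l <= k)%N -> bnd k M f -> bnd l M f.
Proof.
elim: k l f => [|k IH] [|l] f //=.
  by move=> _ [fc fM _]; split.
move=> lk [fc fM [df Df]]; split => //; split => // j; exact: IH.
Qed.

Lemma bndW k M f : bnd k.+1 M f -> bnd k M f.
Proof. exact: bnd_weak. Qed.

Lemma bnd_ext k M f g : f =1 g -> bnd k M f -> bnd k M g.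
Proof. by move=> /funext ->. Qed.

Lemma bnd_cst k (c : R) : bnd k `|c| (fun=> c).
Proof.
elim: k c => [|k IH] c /=.
  by split => //; exact: cst_continuous.
split => //; first exact: cst_continuous.
split => [j x|j]; first exact: derivable_cst.
rewrite [X in bnd k _ X](_ : _ = fun=> 0).
  by apply: (@bnd_le _ `|0|) => //; rewrite normr0.
by apply/funext => x; rewrite derive_cst.
Qed.

Lemma bndD k M N f g : bnd k M f -> bnd k N g ->
  bnd k (M + N) (fun x => f x + g x).
Proof.
elim: k f g => [|k IH] f g /=.
  move=> [fc fM _] [gc gM _]; split => //.
    by move=> x; apply: continuousD; [exact: fc|exact: gc].
  by move=> x; rewrite (le_trans (ler_normD _ _))// lerD.
move=> [fc fM [df Df]] [gc gM [dg Dg]]; split.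
- by move=> x; apply: continuousD; [exact: fc|exact: gc].
- by move=> x; rewrite (le_trans (ler_normD _ _))// lerD.
split=> [j x|j].
  by apply: derivableD; [exact: df|exact: dg].
rewrite [X in bnd k _ X](_ : _ = fun x => 'D_(ei j) f x + 'D_(ei j) g x).
  by apply: IH; [exact: Df|exact: Dg].
by apply/funext => x; apply: (deriveD (df j x) (dg j x)).
Qed.

Lemma bndZ k M (c : R) f : bnd k M f -> bnd k (`|c| * M) (fun x => c * f x).
Proof.
elim: k f => [|k IH] f /=.
  move=> [fc fM _]; split => //.
    by move=> x; apply: continuousM; [exact: cst_continuous|exact: fc].
  by move=> x; rewrite normrM ler_wpM2l.
move=> [fc fM [df Df]]; split.
- by move=> x; apply: continuousM; [exact: cst_continuous|exact: fc].
- by move=> x; rewrite normrM ler_wpM2l.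
split=> [j x|j].
  by apply: (derivableZ (k := c)); exact: df.
rewrite [X in bnd k _ X](_ : _ = fun x => c * 'D_(ei j) f x).
  by apply: IH; exact: Df.
by apply/funext => x; apply: (deriveZ c (df j x)).
Qed.

Lemma bndN k M f : bnd k M f -> bnd k M (fun x => - f x).
Proof.
move=> /(bndZ (-1)); rewrite normrN1 mul1r; apply: bnd_ext => x.
by rewrite mulN1r.
Qed.

Lemma bndB k M N f g : bnd k M f -> bnd k N g ->
  bnd k (M + N) (fun x => f x - g x).
Proof. by move=> fM /bndN; exact: bndD. Qed.

(** The factor 2^k counts the terms of the Leibniz rule: it doubles at each order because [f * D g]
    and [g * D f] are bounded separately. *)
Lemma bndM k M N f g : bnd k M f -> bnd k N g ->
  bnd k (2 ^+ k * M * N) (fun x => f x * g x).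
Proof.
elim: k M N f g => [|k IH] M N f g.
  rewrite expr0 mul1r => /= -[fc fM _] [gc gM _]; split => //.
    by move=> x; apply: continuousM; [exact: fc|exact: gc].
  by move=> x; rewrite normrM ler_pM.
move=> fM gN; have M0 := bnd_ge0 fM; have N0 := bnd_ge0 gN.
have [fc fM' [df Df]] := fM; have [gc gM' [dg Dg]] := gN; split.
- by move=> x; apply: continuousM; [exact: fc|exact: gc].
- move=> x; apply: (@le_trans _ _ (M * N)); first by rewrite normrM ler_pM.
  by rewrite -mulrA ler_peMl ?mulr_ge0// exprn_ege1// ler1n.
split=> [j x|j].
  by apply: derivableM; [exact: df|exact: dg].
rewrite [X in bnd k _ X](_ : _ =
    fun x => f x * 'D_(ei j) g x + g x * 'D_(ei j) f x).
  rewrite [X in bnd k X _](_ : _ = 2 ^+ k * M * N + 2 ^+ k * N * M); last first.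
    by rewrite exprS; ring.
  by apply: bndD; apply: IH; [exact: bndW|exact: Dg|exact: bndW|exact: Df].
by apply/funext => x; apply: (deriveM (df j x) (dg j x)).
Qed.

Lemma derivable_shift_arg f x v w :
  derivable f (x + w) v -> derivable (fun y => f (y + w)) x v.
Proof.
rewrite /derivable => df; rewrite (_ : (fun h => _) =
  fun h => h^-1 *: ((f \o shift (x + w)) (h *: v) - f (x + w))) //.
by apply/funext => h /=; rewrite addrA.
Qed.

Lemma derive_shift_arg f x v w :
  'D_v (fun y => f (y + w)) x = 'D_v f (x + w).
Proof.
rewrite /derive (_ : (fun h => _) =
  fun h => h^-1 *: ((f \o shift (x + w)) (h *: v) - f (x + w))) //.
by apply/funext => h /=; rewrite addrA.
Qed.

Lemma bnd_shift k M f w : bnd k M f -> bnd k M (fun x => f (x + w)).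
Proof.
have cs g : continuous g -> continuous (fun x => g (x + w)).
  move=> gc x; apply: (@continuous_comp _ _ _ (fun x => x + w) g).
    by apply: continuousD; [exact: cvg_id|exact: cst_continuous].
  exact: gc.
elim: k f => [|k IH] f /= [fc fM]; first by split => //; exact: cs.
move=> [df Df]; split; [exact: cs|by move=> x; exact: fM|].
split => [j x|j]; first by apply: derivable_shift_arg; exact: df.
rewrite [X in bnd k _ X](_ : _ = fun x => 'D_(ei j) f (x + w)).
  exact: (IH _ (Df j)).
by apply/funext => x; rewrite derive_shift_arg.
Qed.

Lemma bnd_sum k (I : Type) (s : seq I) (P : pred I) (F : I -> Rd -> R) (M : I -> R) :
  (forall i, bnd k (M i) (F i)) ->
  bnd k (\sum_(i <- s | P i) M i) (fun x => \sum_(i <- s | P i) F i x).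
Proof.
move=> FM; elim: s => [|a s IH].
  rewrite big_nil; apply: (@bnd_ext _ _ (fun=> 0)) => [x|]; first by rewrite big_nil.
  by have := bnd_cst k (0 : R); rewrite normr0.
rewrite big_cons; case: ifP => Pa.
  apply: (@bnd_ext _ _ (fun x => F a x + \sum_(i <- s | P i) F i x)).
    by move=> x; rewrite big_cons Pa.
  exact: bndD.
by apply: bnd_ext IH => x; rewrite big_cons Pa.
Qed.

Lemma is_derive_line (W : normedModType R) (f : W -> R) (x v : W) (df : R) :
  is_derive x v f df <-> is_derive (0 : R) (1 : R) (fun h : R => f (h *: v + x)) df.
Proof.
have E : (fun h : R => h^-1 *: ((f \o shift x) (h *: v) - f x)) =
  (fun h : R => h^-1 *: (((fun h : R => f (h *: v + x)) \o shift (0 : R)) (h *: (1 : R))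
     - f (0 *: v + x))).
  by apply/funext => h /=; rewrite addr0 scale0r add0r [_%:A]mulr1.
split=> -[D V]; split; move: D V; rewrite /derivable /derive /=.
- by rewrite -E.
- by rewrite -E.
- by rewrite E.
- by rewrite E.
Qed.

Lemma is_derive_comp1 f x v (df : R) (g : R -> R) (dg : R) :
  is_derive x v f df -> is_derive (f x) 1 g dg ->
  is_derive x v (fun y => g (f y)) (dg * df).
Proof.
move=> /is_derive_line Df Dg; apply/is_derive_line.
have Dg' : is_derive ((fun h : R => f (h *: v + x)) 0) 1 g dg.
  by rewrite /= scale0r add0r.
exact: is_derive1_comp.
Qed.

(* G n stands for the n-th derivative of the one-variable function G 0 on D,
   a set containing the range of f. *)
Lemma bnd_comp k (G : nat -> R -> R) (D : set R) (M : R) :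
  (forall n y, D y -> is_derive y 1 (G n) (G n.+1 y)) ->
  (forall n, exists B, forall y, D y -> `|G n y| <= B) ->
  exists M', forall f, (forall x, D (f x)) -> continuous f ->
    (forall j x, derivable f x (ei j)) ->
    (forall j, bnd k.-1 M ('D_(ei j) f)) -> bnd k M' (fun x => G 0%N (f x)).
Proof.
elim: k G => [|k IH] G dG GB.
  have [B BG] := GB 0%N; exists B => f fD fc df Df; split => //; last first.
    by move=> x; exact: BG.
  move=> x; apply: continuous_comp; first exact: fc.
  by apply/differentiable_continuous/derivable1_diffP; have [] := dG 0%N _ (fD x).
have [B BG] := GB 0%N.
have [M1 HM1] := IH (fun n => G n.+1) (fun n => dG n.+1) (fun n => GB n.+1).
exists (Num.max B (2 ^+ k * M1 * M)) => f fD fc df Df.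
have dGf j x : is_derive x (ei j) (fun y => G 0%N (f y)) (G 1%N (f x) * 'D_(ei j) f x).
  by apply: is_derive_comp1; [exact/derivableP/df|exact: dG].
apply: bndS => [|j x|j].
- apply: (@bnd_le _ B); first by rewrite le_max lexx.
  apply: bnd0 => x; last exact: BG.
  apply: continuous_comp; first exact: fc.
  by apply/differentiable_continuous/derivable1_diffP; have [] := dG 0%N _ (fD x).
- by case: (dGf j x).
- rewrite [X in bnd k _ X](_ : _ = fun x => G 1%N (f x) * 'D_(ei j) f x); last first.
    by apply/funext => x; case: (dGf j x).
  apply: (@bnd_le _ (2 ^+ k * M1 * M)); first by rewrite le_max lexx orbT.
  apply: bndM; last exact: Df.
  by apply: HM1 => // i; apply: bnd_weak (leq_pred k) _; exact: Df.
Qed.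

Definition bsmooth f := forall k, exists M, bnd k M f.

Lemma bsmooth_partial f : bsmooth f ->
  forall s, bsmooth (partial s f) /\ forall j x, derivable (partial s f) x (ei j).
Proof.
move=> fb; elim => [|i s [IHb IHd]] /=.
  by split => // j x; have [M fM] := fb 1%N; apply: bnd_derivable fM.
have b : bsmooth ('D_(ei i) (partial s f)).
  by move=> k; have [M] := IHb k.+1 => /bnd_derive H; exists M; exact: H.
by split; [exact: b|move=> j x; have [M bM] := b 1%N; exact: bnd_derivable bM].
Qed.

Lemma bnd_partial k M f s : bnd k M f -> (size s <= k)%N ->
  bnd (k - size s) M (partial s f).
Proof.
elim/last_ind: s k f => [|s i IH] k f fM; first by rewrite subn0.
rewrite size_rcons /partial foldr_rcons; case: k fM => // k fM sk.
by rewrite subSS; apply: IH => //; exact: bnd_derive.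
Qed.

Lemma bsmooth_C_infty f : bsmooth f -> C_infty f.
Proof.
move=> fb k s sk; have [sb sd] := bsmooth_partial fb s; split.
  by have [M] := sb 0%N; exact: bnd_continuous.
by move=> _ i x; exact: sd.
Qed.

Lemma derive_out_supp f v x : ~ supp f x -> 'D_v f x = 0.
Proof.
move=> sx; have : \forall y \near x, f y = (fun=> 0) y.
  have : nbhs x (~` supp f) by apply: open_nbhs_nbhs; split => //; apply: closed_openC; exact: closed_closure.
  apply: filterS => y sy; apply: contra_notP sy => fy0.
  by apply: subset_closure => /=; apply/eqP.
by move=> /near_eq_derive ->; rewrite derive_cst.
Qed.

Lemma supp_out f x : ~ supp f x -> f x = 0.
Proof.
by move=> sx; apply: contra_notP sx => /eqP fx; exact: subset_closure.
Qed.

Lemma supp_derive f v : supp ('D_v f) `<=` supp f.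
Proof.
have h : [set x | 'D_v f x != 0] `<=` supp f.
  move=> x /= Dx; apply: contrapT => sx.
  by rewrite derive_out_supp ?eqxx in Dx.
move=> x /(closure_subset h).
by rewrite -(iffLR (closure_id _))//; exact: closed_closure.
Qed.

Lemma supp_partial f s : supp (partial s f) `<=` supp f.
Proof.
elim: s => [|i s IH] //=.
by apply: subset_trans IH; exact: supp_derive.
Qed.

Lemma compact_continuous_bounded (K : set Rd) f : compact K -> continuous f ->
  exists M, forall x, K x -> `|f x| <= M.
Proof.
move=> cK cf.
have : compact (f @` K) by apply: continuous_compact => //; exact: continuous_subspaceT.
move=> /compact_bounded [M [_ HM]]; exists (M + 1) => x Kx.
by apply: HM; [rewrite ltrDl|exists x].
Qed.

End bounded_derivatives.

Section test_functions_bounded.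
Context {R : realType} {d : nat}.
Local Notation Rd := 'rV[R]_d.
Implicit Types (f g : Rd -> R) (x v : Rd).

Lemma C_infty_continuous f : C_infty f -> continuous f.
Proof. by move=> /(_ 0%N [::] isT)[]. Qed.

Lemma C_infty_derivable f j x : C_infty f -> derivable f x (ei j).
Proof. by move=> /(_ 1%N [::] isT)[_]; apply. Qed.

Lemma C_infty_derive f j : C_infty f -> C_infty ('D_(ei j) f).
Proof.
move=> fC k s sk; have := fC k.+1 (rcons s j).
by rewrite size_rcons ltnS /partial foldr_rcons => /(_ sk)[c D]; split.
Qed.

Lemma test_function_on_derive K f j : closed K -> test_function_on K f ->
  test_function_on K ('D_(ei j) f).
Proof.
move=> cK [fC fK]; split; first exact: C_infty_derive.
by apply: subset_trans fK; exact: supp_derive.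
Qed.

(** Induction on the order for all functions supported in the fixed compact K at once: a partial
    derivative stays in this class. *)
Lemma test_function_on_bsmooth K f : compact K -> test_function_on K f -> bsmooth f.
Proof.
move=> cK; have clK : closed K by apply: compact_closed => //; exact: norm_hausdorff.
have B0 g : test_function_on K g -> exists M, bnd 0 M g.
  move=> [gC gK]; have gc := C_infty_continuous gC.
  have [M HM] := compact_continuous_bounded cK gc.
  exists (Num.max M 0); apply: bnd0 => // x.
  have [Kx|Kx] := pselect (K x); first by rewrite le_max HM.
  rewrite supp_out ?normr0 ?le_max ?lexx ?orbT//.
  by move=> /gK.
move=> fK k; elim: k f fK => [|k IH] f fK; first exact: B0.
have [M0 HM0] := B0 _ fK.
have /choice[M HM] : forall j, exists M, bnd k M ('D_(ei j) f).
  by move=> j; apply: IH; exact: test_function_on_derive.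
have MS j : M j <= M0 + \sum_i M i.
  rewrite (bigD1 j)//= addrCA lerDl addr_ge0//; first exact: bnd_ge0 HM0.
  by apply: sumr_ge0 => i _; exact: bnd_ge0 (HM i).
exists (M0 + \sum_j M j); apply: bndS.
- apply: bnd_le HM0; rewrite lerDl sumr_ge0// => i _; exact: bnd_ge0 (HM i).
- by move=> j x; apply: C_infty_derivable; case: fK.
- by move=> j; exact: bnd_le (MS j) (HM j).
Qed.

Lemma test_function_bsmooth f : test_function f -> bsmooth f.
Proof. by move=> [fC fc]; apply: (test_function_on_bsmooth fc); split. Qed.

Lemma bsmooth_test_function_on K f : bsmooth f -> supp f `<=` K ->
  test_function_on K f.
Proof. by move=> fb fK; split => //; exact: bsmooth_C_infty. Qed.

Lemma test_function_onW K f : compact K -> test_function_on K f -> test_function f.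
Proof.
move=> cK [fC fK]; split => //.
by apply: subclosed_compact cK fK; exact: closed_closure.
Qed.

Lemma supp_subset K f : closed K -> (forall x, ~ K x -> f x = 0) -> supp f `<=` K.
Proof.
move=> clK f0; have h : [set x | f x != 0] `<=` K.
  move=> x /= fx; apply: contrapT => Kx; by move: fx; rewrite f0// eqxx.
by move=> x /(closure_subset h); rewrite -(iffLR (closure_id _)).
Qed.

Lemma bsmooth_ext f g : f =1 g -> bsmooth f -> bsmooth g.
Proof. by move=> /funext ->. Qed.

Lemma bsmooth_cst (c : R) : bsmooth (fun _ : Rd => c).
Proof. by move=> k; exists `|c|; exact: bnd_cst. Qed.

Lemma bsmoothD f g : bsmooth f -> bsmooth g -> bsmooth (fun x => f x + g x).
Proof.
by move=> fb gb k; have [M ?] := fb k; have [N ?] := gb k; exists (M + N); exact: bndD.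
Qed.

Lemma bsmoothM f g : bsmooth f -> bsmooth g -> bsmooth (fun x => f x * g x).
Proof.
move=> fb gb k; have [M ?] := fb k; have [N ?] := gb k.
by exists (2 ^+ k * M * N); exact: bndM.
Qed.

Lemma bsmoothN f : bsmooth f -> bsmooth (fun x => - f x).
Proof. by move=> fb k; have [M ?] := fb k; exists M; exact: bndN. Qed.

Lemma bsmoothB f g : bsmooth f -> bsmooth g -> bsmooth (fun x => f x - g x).
Proof. by move=> fb gb; apply: bsmoothD => //; exact: bsmoothN. Qed.

Lemma bsmooth_derive f j : bsmooth f -> bsmooth ('D_(ei j) f).
Proof. by move=> fb k; have [M ?] := fb k.+1; exists M; exact: bnd_derive. Qed.

Lemma bsmooth_sum (I : Type) (s : seq I) (P : pred I) (F : I -> Rd -> R) :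
  (forall i, bsmooth (F i)) -> bsmooth (fun x => \sum_(i <- s | P i) F i x).
Proof.
move=> Fb k; have /choice[M HM] : forall i, exists M, bnd k M (F i) by move=> i; exact: Fb.
by exists (\sum_(i <- s | P i) M i); exact: bnd_sum.
Qed.

Lemma bsmooth_comp_gen (G : nat -> R -> R) (D : set R) f :
  (forall n y, D y -> is_derive y 1 (G n) (G n.+1 y)) ->
  (forall n, exists B, forall y, D y -> `|G n y| <= B) ->
  (forall x, D (f x)) -> continuous f -> (forall j x, derivable f x (ei j)) ->
  (forall j, bsmooth ('D_(ei j) f)) -> bsmooth (fun x => G 0%N (f x)).
Proof.
move=> dG GB fD fc df Df k.
have /choice[M HM] : forall j, exists M, bnd k.-1 M ('D_(ei j) f) by move=> j; exact: Df.
have [M' HM'] := @bnd_comp R d k G D (\sum_j M j) dG GB.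
exists M'; apply: (HM' f) => // j; apply: (bnd_le _ (HM j)).
rewrite (bigD1 j)//= lerDl; apply: sumr_ge0 => i _; exact: bnd_ge0 (HM i).
Qed.

Lemma bsmooth_comp (G : nat -> R -> R) (D : set R) f :
  (forall n y, D y -> is_derive y 1 (G n) (G n.+1 y)) ->
  (forall n, exists B, forall y, D y -> `|G n y| <= B) ->
  (forall x, D (f x)) -> bsmooth f -> bsmooth (fun x => G 0%N (f x)).
Proof.
move=> dG GB fD fb; apply: (bsmooth_comp_gen dG GB fD) => [|j x|j].
- by have [M] := fb 0%N; exact: bnd_continuous.
- by have [M] := fb 1%N => fM; exact: bnd_derivable fM.
- exact: bsmooth_derive.
Qed.

Lemma bsmooth_continuous f : bsmooth f -> continuous f.
Proof. by move=> /(_ 0%N)[M]; exact: bnd_continuous. Qed.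

Lemma bsmooth_derivable f j x : bsmooth f -> derivable f x (ei j).
Proof. by move=> /(_ 1%N)[M] fM; exact: bnd_derivable fM. Qed.

Lemma bsmooth_bounded f : bsmooth f -> exists M, forall x, `|f x| <= M.
Proof. by move=> /(_ 0%N)[M] fM; exists M => x; exact: bnd_le_norm fM. Qed.

End test_functions_bounded.

(** * Flat functions and smooth truncations of one variable *)

Section flat_functions.
Context {R : realType}.
Implicit Types (p : {poly R}) (t : R).

(** The rate is halved at each degree: half of the exponential controls the extra factor y by y
    exp(- a y / 2) <= 2 / a, the other half goes to the induction hypothesis. *)
Lemma horner_expRN_bounded p (a : R) : 0 < a ->
  exists C, forall y, 0 <= y -> `|p.[y]| * expR (- (a * y)) <= C.
Proof.
elim/poly_ind: p a => [|p c IH] a a0.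
  by exists 0 => y _; rewrite horner0 normr0 mul0r.
have a20 : 0 < a / 2 by rewrite divr_gt0.
have [C HC] := IH _ a20.
exists (C * (2 / a) + `|c|) => y y0; rewrite hornerMXaddC.
rewrite (@le_trans _ _ ((`|p.[y]| * y + `|c|) * expR (- (a * y))))//.
  by rewrite ler_wpM2r ?expR_ge0// (le_trans (ler_normD _ _))// normrM (ger0_norm y0).
rewrite mulrDl lerD//; last first.
  by rewrite ler_piMr// -expR0 ler_expR oppr_le0 mulr_ge0// ltW.
have -> : - (a * y) = - (a / 2 * y) - (a / 2 * y) by field.
rewrite expRD mulrACA ler_pM ?mulr_ge0 ?expR_ge0//; first exact: HC.
rewrite expRN ler_pdivrMr ?expR_gt0// -ler_pdivrMl ?divr_gt0//.
rewrite invf_div; apply: le_trans (expR_ge1Dx _).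
by rewrite lerDr.
Qed.

(** These functions, p(1/t) exp(-1/t) extended by zero, form a class closed under differentiation,
    which replaces p by X^2 (p - p'). All derivatives of exp(-1/t) are thus treated together. *)
Definition flat p t : R := if 0 < t then p.[t^-1] * expR (- t^-1) else 0.

Lemma flat_bounded p : exists C, forall t, `|flat p t| <= C.
Proof.
have [C HC] := horner_expRN_bounded p ltr01.
have C0 : 0 <= C.
  by apply: le_trans (HC 0 (lexx _)); rewrite mulr_ge0// expR_ge0.
exists C => t; rewrite /flat; case: ifPn => [t0|_]; last by rewrite normr0.
rewrite normrM (ger0_norm (expR_ge0 _)) -{2}[t^-1]mul1r.
by apply: HC; rewrite invr_ge0 ltW.
Qed.

Lemma is_derive_flat p t :
  is_derive t 1 (flat p) (flat ('X ^+ 2 * (p - p^`())) t).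
Proof.
have [t0|t0|->] := ltrgt0P t.
- rewrite /flat t0.
  apply: (@near_eq_is_derive _ _ _ (fun t : R => p.[t^-1] * expR (- t^-1))).
    near=> s; rewrite /flat ifT//; near: s; exact: lt_nbhsr.
  have dV : is_derive t 1 (fun s : R => s^-1) (- t ^- 2).
    have tn0 : (id t : R) != 0 by rewrite gt_eqF.
    apply: DeriveDef; first exact: (@derivableV _ _ id).
    by rewrite (@deriveV _ _ id)// derive_id /GRing.scale/= mulr1.
  have dp : is_derive t 1 (fun s : R => p.[s^-1]) (p^`().[t^-1] * (- t ^- 2)).
    exact: (@is_derive1_comp _ (horner p) (fun s : R => s^-1)).
  have de : is_derive t 1 (fun s : R => expR (- s^-1)) (expR (- t^-1) * t ^- 2).
    apply: (@is_derive1_comp _ expR (fun s : R => - s^-1)).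
    by rewrite -[t ^- 2]opprK; exact: is_deriveN.
  apply: is_derive_eq; rewrite !hornerE /GRing.scale /= exprVn.
  by ring.
- have -> : flat ('X ^+ 2 * (p - p^`())) t = 0 by rewrite /flat ltNge ltW.
  apply: (@near_eq_is_derive _ _ _ (fun=> 0)).
  near=> s; rewrite /flat ltNge ltW//; near: s; exact: lt_nbhsl.
- have -> : flat ('X ^+ 2 * (p - p^`())) 0 = 0 by rewrite /flat ltxx.
  (* The difference quotient at 0 is [h * flat ('X ^+ 2 * p) h], so a bound on the second factor
     gives the limit 0. *)
  have [C HC] := flat_bounded ('X ^+ 2 * p).
  suff : (fun h : R => h^-1 *: ((flat p \o shift 0) (h *: 1) - flat p 0)) @ 0^' --> (0 : R).
    move=> H; apply: DeriveDef; first by apply/cvg_ex; exists 0.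
    exact/cvg_lim.
  apply/cvgr0Pnorm_le => e e0; near=> h.
  have h0 : h != 0 by near: h; exact: nbhs_dnbhs_neq.
  rewrite /= addr0 /GRing.scale /= mulr1 {2}/flat ltxx subr0.
  rewrite /flat; case: ifPn => [hp|_]; last by rewrite mulr0 normr0 ltW.
  rewrite mulrA; apply: (@le_trans _ _ (h * C)).
    have := HC h; rewrite /flat hp !hornerE.
    have -> : h^-1 ^+ 2 * p.[h^-1] * expR (- h^-1) =
       h^-1 * (h^-1 * p.[h^-1] * expR (- h^-1)) by ring.
    by rewrite (normrM h^-1) normfV (gtr0_norm hp) ler_pdivrMl.
  have hC : h < e / (C + 1).
    rewrite (le_lt_trans (ler_norm h))//; near: h; apply: dnbhs0_lt.
    by rewrite divr_gt0// ltr_wpDl// (le_trans (normr_ge0 _) (HC 0)).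
  have C0 : 0 <= C by rewrite (le_trans (normr_ge0 _) (HC 0)).
  apply: (@le_trans _ _ (h * (C + 1))).
    by rewrite ler_wpM2l ?ltW// ltrDl.
  by rewrite -ler_pdivlMr ?ltr_wpDl// ltW.
Unshelve. all: by end_near. Qed.

End flat_functions.

Section one_variable.
Context {R : realType}.
Implicit Types (p : {poly R}) (t s : R).

Lemma flat0 p t : t <= 0 -> flat p t = 0.
Proof. by move=> t0; rewrite /flat ltNge t0. Qed.

Lemma flat_gt0 p t : 0 < t -> flat p t = p.[t^-1] * expR (- t^-1).
Proof. by move=> t0; rewrite /flat t0. Qed.

Lemma flat1_ge0 t : 0 <= flat 1 t.
Proof. by rewrite /flat; case: ifP => // _; rewrite hornerC mul1r expR_ge0. Qed.

Lemma flat1_le1 t : flat 1 t <= 1.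
Proof.
rewrite /flat; case: ifP => // t0; rewrite hornerC mul1r -expR0 ler_expR.
by rewrite oppr_le0 invr_ge0 ltW.
Qed.

Lemma le_flat1 s t : s <= t -> flat 1 s <= flat 1 t.
Proof.
move=> st; have [s0|s0] := leP s 0; first by rewrite (flat0 _ s0) flat1_ge0.
have t0 := lt_le_trans s0 st.
by rewrite !flat_gt0// !hornerC !mul1r ler_expR lerN2 lef_pV2.
Qed.

Fixpoint dpoly p n : {poly R} :=
  if n is n'.+1 then 'X ^+ 2 * (dpoly p n' - (dpoly p n')^`()) else p.

Lemma is_derive_dpoly p n t :
  is_derive t 1 (flat (dpoly p n)) (flat (dpoly p n.+1) t).
Proof. exact: is_derive_flat. Qed.

(** A smooth convex substitute for the positive part: its derivative (1 + 1/t) exp(-1/t) lies in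
    [0, 1], and it differs from the positive part by at most 1. *)
Definition eta t := t * flat 1 t.

Lemma is_derive_eta t : is_derive t 1 eta (flat (1 + 'X) t).
Proof.
have df := is_derive_flat 1 t; apply: is_derive_eq.
have [t0|t0] := leP t 0; first by rewrite !flat0// scaler0 scale0r addr0.
rewrite !flat_gt0// !hornerE derivC !hornerE /GRing.scale/=.
by field; rewrite gt_eqF.
Qed.

Lemma eta0 t : t <= 0 -> eta t = 0.
Proof. by move=> t0; rewrite /eta flat0// mulr0. Qed.

Lemma eta_ge0 t : 0 <= eta t.
Proof.
have [t0|t0] := leP t 0; first by rewrite eta0.
by rewrite mulr_ge0 ?flat1_ge0// ltW.
Qed.

Lemma eta_le t : 0 <= t -> eta t <= t.
Proof. by move=> t0; rewrite ler_piMr// flat1_le1. Qed.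

Lemma eta_ge t : t - 1 <= eta t.
Proof.
have [t0|t0] := leP t 0; first by rewrite eta0//; lra.
rewrite /eta flat_gt0// hornerC mul1r.
have := expR_ge1Dx (- t^-1); rewrite -(ler_pM2l t0).
by rewrite mulrDr mulr1 mulrN divff ?gt_eqF.
Qed.

Lemma eta'_ge0 t : 0 <= flat (1 + 'X) t.
Proof.
have [t0|t0] := leP t 0; first by rewrite flat0.
by rewrite flat_gt0// !hornerE mulr_ge0 ?expR_ge0// addr_ge0// invr_ge0 ltW.
Qed.

Lemma eta'_le1 t : flat (1 + 'X) t <= 1.
Proof.
have [t0|t0] := leP t 0; first by rewrite flat0.
rewrite flat_gt0// !hornerE expRN ler_pdivrMr ?expR_gt0// mul1r.
exact: expR_ge1Dx.
Qed.

Lemma eta''_ge0 t : 0 <= flat (dpoly (1 + 'X) 1) t.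
Proof.
have [t0|t0] := leP t 0; first by rewrite flat0.
rewrite flat_gt0// /= derivD derivC derivX !hornerE mulr_ge0 ?expR_ge0//.
by rewrite mulr_ge0 ?exprn_ge0 ?invr_ge0 ?(ltW t0)// addrAC subrr add0r invr_ge0 ltW.
Qed.

(* A smooth concave truncation at height s1, within lam of the identity below. *)
Definition trunc (s1 lam : R) (n : nat) s : R :=
  if n is n'.+1 then (- lam^-1) ^+ n' * flat (dpoly (1 + 'X) n') ((s1 - s) / lam)
  else s1 - lam * eta ((s1 - s) / lam).

Section trunc.
Variables (s1 lam : R).
Hypothesis lam0 : 0 < lam.

Let is_derive_arg s : is_derive s 1 (fun s => (s1 - s) / lam) (- lam^-1).
Proof.
by apply: is_derive_eq; rewrite /GRing.scale /=; ring.
Qed.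

Lemma is_derive_trunc n s : is_derive s 1 (trunc s1 lam n) (trunc s1 lam n.+1 s).
Proof.
have da := is_derive_arg s.
case: n => [|n] /=.
  have de : is_derive s 1 (fun s => eta ((s1 - s) / lam))
      (flat (1 + 'X) ((s1 - s) / lam) * - lam^-1).
    apply: (@is_derive1_comp _ eta (fun s => (s1 - s) / lam)).
    exact: is_derive_eta.
  apply: is_derive_eq; rewrite /GRing.scale/= expr0 mul1r.
  by field; rewrite gt_eqF.
have de : is_derive s 1 (fun s => flat (dpoly (1 + 'X) n) ((s1 - s) / lam))
    (flat (dpoly (1 + 'X) n.+1) ((s1 - s) / lam) * - lam^-1).
  apply: (@is_derive1_comp _ _ (fun s => (s1 - s) / lam)).
  exact: is_derive_dpoly.
apply: is_derive_eq; rewrite /GRing.scale/= [(- lam^-1) ^+ n.+1]exprS.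
by rewrite mulrA mulrAC; congr (_ * _); exact: mulrC.
Qed.

Lemma trunc_le s : trunc s1 lam 0 s <= s1.
Proof. by rewrite /= gerBl mulr_ge0 ?eta_ge0// ltW. Qed.

Lemma trunc_ge s : Num.min s s1 <= trunc s1 lam 0 s.
Proof.
have [ss1|s1s] := leP s s1; last first.
  by rewrite /= eta0 ?mulr0 ?subr0// pmulr_lle0 ?invr_gt0// subr_le0 ltW.
rewrite /= lerBrDr -lerBrDl -ler_pdivlMl// mulrC; apply: eta_le.
by rewrite mulr_ge0 ?subr_ge0 ?invr_ge0// ltW.
Qed.

Lemma trunc_le_id s : trunc s1 lam 0 s <= s + lam.
Proof.
have := eta_ge ((s1 - s) / lam); rewrite -(ler_pM2l lam0) /=.
rewrite mulrBr mulr1 mulrC divfK ?gt_eqF//; lra.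
Qed.

Lemma trunc_eq s : s1 <= s -> trunc s1 lam 0 s = s1.
Proof.
move=> s1s; rewrite /= eta0 ?mulr0 ?subr0//.
by rewrite pmulr_lle0 ?invr_gt0// subr_le0.
Qed.

Lemma trunc'_eq n s : s1 <= s -> trunc s1 lam n.+1 s = 0.
Proof.
by move=> s1s; rewrite /= flat0 ?mulr0// pmulr_lle0 ?invr_gt0// subr_le0.
Qed.

Lemma trunc'_ge0 s : 0 <= trunc s1 lam 1 s.
Proof. by rewrite /= expr0 mul1r eta'_ge0. Qed.

Lemma trunc'_le1 s : trunc s1 lam 1 s <= 1.
Proof. by rewrite /= expr0 mul1r eta'_le1. Qed.

Lemma trunc''_le0 s : trunc s1 lam 2 s <= 0.
Proof.
rewrite /trunc expr1 mulNr oppr_le0 mulr_ge0 ?eta''_ge0// invr_ge0 ltW//.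
Qed.

Lemma trunc'_bounded n : exists B, forall s, `|trunc s1 lam n.+1 s| <= B.
Proof.
have [C HC] := flat_bounded (dpoly (1 + 'X) n : {poly R}).
exists (`|(- lam^-1) ^+ n| * C) => s; rewrite /= normrM ler_wpM2l//.
Qed.

Lemma trunc_bounded m n : exists B, forall s, m <= s -> `|trunc s1 lam n s| <= B.
Proof.
case: n => [|n]; last by have [B HB] := trunc'_bounded n; exists B.
exists (`|s1| + `|m|) => s ms; rewrite ler_norml; apply/andP; split.
  apply: le_trans (trunc_ge s); rewrite le_min; apply/andP; split.
    have := ler_norm (- m); have := normr_ge0 s1; rewrite normrN; lra.
  have := ler_norm (- s1); have := normr_ge0 m; rewrite normrN; lra.
apply: le_trans (trunc_le s) _.
have := ler_norm s1; have := normr_ge0 m; lra.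
Qed.

End trunc.

(** The n-th derivative of 1/t, in the format required by [bsmooth_comp]. *)
Definition inv_seq (n : nat) t : R := (-1) ^+ n * n`!%:R / t ^+ n.+1.

Lemma is_derive_inv_seq n t : 0 < t -> is_derive t 1 (inv_seq n) (inv_seq n.+1 t).
Proof.
move=> t0.
have tn : (fun s : R => s ^+ n.+1) t != 0 by rewrite /= expf_neq0// gt_eqF.
have dX : is_derive t 1 (fun s : R => s ^+ n.+1) (n.+1%:R * t ^+ n).
  apply: DeriveDef; first exact: exprn_derivable.
  by rewrite exp_derive /GRing.scale/= mulr1.
have dV : is_derive t 1 (fun s : R => (s ^+ n.+1)^-1)
    (- (t ^+ n.+1) ^- 2 * (n.+1%:R * t ^+ n)).
  apply: DeriveDef; first exact: (@derivableV _ _ (fun s : R => s ^+ n.+1)).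
  by rewrite (@deriveV _ _ (fun s : R => s ^+ n.+1))// derive_val.
rewrite /inv_seq; apply: is_derive_eq; rewrite /GRing.scale/=.
rewrite factS natrM !exprS.
by field; rewrite ?gt_eqF ?exprn_gt0.
Qed.

Lemma inv_seq_bounded n m : 0 < m -> exists B, forall t, m <= t -> `|inv_seq n t| <= B.
Proof.
move=> m0; exists (n`!%:R / m ^+ n.+1) => t mt.
rewrite /inv_seq !normrM normrX normrN1 expr1n mul1r ger0_norm//.
rewrite ler_wpM2l// normfV ger0_norm ?exprn_ge0 ?(le_trans (ltW m0))//.
rewrite lef_pV2 ?posrE ?exprn_gt0 ?(lt_le_trans m0)//.
by rewrite lerXn2r ?nnegrE// ?(le_trans (ltW m0))// ltW.
Qed.

Definition ln_seq (n : nat) : R -> R := if n is n'.+1 then inv_seq n' else @ln R.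

Lemma is_derive_ln_seq n t : 0 < t -> is_derive t 1 (ln_seq n) (ln_seq n.+1 t).
Proof.
move=> t0; case: n => [|n] /=; last exact: is_derive_inv_seq.
by rewrite /inv_seq expr0 expr1 !mul1r; exact: is_derive1_ln.
Qed.

Lemma ln_seq_bounded n m M : 0 < m ->
  exists B, forall t, m <= t <= M -> `|ln_seq n t| <= B.
Proof.
move=> m0; case: n => [|n] /=; last first.
  by have [B HB] := inv_seq_bounded n m0; exists B => t /andP[mt _]; exact: HB.
exists (`|ln m| + `|ln M|) => t /andP[mt tM]; rewrite ler_norml.
have : ln m <= ln t by rewrite ler_ln ?posrE// (lt_le_trans m0).
have : ln t <= ln M by rewrite ler_ln ?posrE// ?(lt_le_trans m0)// (le_trans mt).
have := ler_norm (- ln m); have := ler_norm (ln M); rewrite normrN => *.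
have := normr_ge0 (ln m); have := normr_ge0 (ln M) => *.
by apply/andP; split; lra.
Qed.

End one_variable.

(** * Compositions and the Lyapunov function *)

Section compositions.
Context {R : realType} {d : nat}.
Local Notation Rd := 'rV[R]_d.
Implicit Types (f g : Rd -> R) (x v : Rd).

Lemma bsmooth_inv m f : 0 < m -> (forall x, m <= f x) -> bsmooth f ->
  bsmooth (fun x => (f x)^-1).
Proof.
move=> m0 mf fb; apply: (@bsmooth_ext _ _ (fun x => inv_seq 0 (f x))).
  by move=> x; rewrite /inv_seq expr0 expr1 !mul1r.
apply: (@bsmooth_comp _ _ inv_seq [set t | m <= t]).
- by move=> n y /= my; apply: is_derive_inv_seq; exact: lt_le_trans my.
- by move=> n; exact: inv_seq_bounded.
- exact: mf.
- exact: fb.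
Qed.

Lemma bsmooth_ln m f : 0 < m -> (forall x, m <= f x) -> bsmooth f ->
  bsmooth (fun x => ln (f x)).
Proof.
move=> m0 mf fb; have [M HM] := bsmooth_bounded fb.
apply: (@bsmooth_comp _ _ ln_seq [set t | m <= t <= M]) => //.
- by move=> n y /andP[my _]; apply: is_derive_ln_seq; exact: lt_le_trans my.
- by move=> n; exact: ln_seq_bounded.
- by move=> x; rewrite /= mf (le_trans (ler_norm _)).
Qed.

Lemma bsmooth_expR f : bsmooth f -> bsmooth (fun x => expR (f x)).
Proof.
move=> fb; have [M HM] := bsmooth_bounded fb.
apply: (@bsmooth_comp _ _ (fun=> expR) [set t | t <= M]) => //.
- by move=> _; exists (expR M) => y /= yM; rewrite ger0_norm ?expR_ge0// ler_expR.
- by move=> x; rewrite /= (le_trans (ler_norm _)).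
Qed.

Lemma is_derive_coord x i j :
  is_derive x (ei j) (fun y : Rd => y ord0 i) ((i == j)%:R : R).
Proof.
apply/is_derive_line.
rewrite (_ : (fun h : R => _) = fun h : R => h * (i == j)%:R + x ord0 i); last first.
  by apply/funext => h; rewrite !mxE eqxx.
by apply: is_derive_eq; rewrite /GRing.scale/= mulr0 addr0 add0r mulr1.
Qed.

Lemma continuous_coord i : continuous (fun y : Rd => y ord0 i).
Proof. by move=> x; exact: coord_continuous. Qed.

Lemma continuous_sumR (T : topologicalType) (I : Type) (r : seq I) (P : pred I)
    (F : I -> T -> R) : (forall i, continuous (F i)) ->
  continuous (fun t => \sum_(i <- r | P i) F i t).
Proof.
move=> Fc; apply: continuous_big => [|i _]; last exact: Fc.
exact: add_continuous.
Qed.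

Lemma norm_coord_le x i : `|x ord0 i| <= `|x|.
Proof.
rewrite [X in _ <= X]mx_normrE.
by apply/bigmax_geP; right; exists (ord0, i).
Qed.

Lemma norm_le_coord x (c : R) : 0 <= c -> (forall i, `|x ord0 i| <= c) -> `|x| <= c.
Proof.
move=> c0 xc; rewrite [X in X <= _]mx_normrE; apply/bigmax_leP; split => // -[i j] _ /=.
by rewrite ord1.
Qed.

Definition U x : R := 1 + dotp x x.

Lemma dotp_ge0 x : 0 <= dotp x x.
Proof. by apply: sumr_ge0 => i _; rewrite -expr2 sqr_ge0. Qed.

Lemma U_ge1 x : 1 <= U x.
Proof. by rewrite /U lerDl dotp_ge0. Qed.

Lemma U_gt0 x : 0 < U x.
Proof. exact: lt_le_trans (U_ge1 x). Qed.

Lemma continuous_U : continuous U.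
Proof.
have H : continuous (fun x : Rd => \sum_(i < d) x ord0 i * x ord0 i).
  by apply: continuous_sumR => i x; apply: continuousM; exact: coord_continuous.
rewrite (_ : U = fun x => 1 + \sum_(i < d) x ord0 i * x ord0 i)// => x.
by apply: continuousD; [exact: cst_continuous|exact: H].
Qed.

Lemma is_derive_U x j : is_derive x (ei j) U (2 * x ord0 j).
Proof.
have dc i := is_derive_coord x i j.
have H : is_derive x (ei j) (\sum_(i < d) (fun y : Rd => y ord0 i * y ord0 i))
    (\sum_(i < d) (x ord0 i * (i == j)%:R + x ord0 i * (i == j)%:R)).
  by apply: is_derive_sum => i; exact: is_deriveM.
rewrite (_ : U = (fun=> 1) \+ \sum_(i < d) (fun y : Rd => y ord0 i * y ord0 i)).
  apply: is_derive_eq; rewrite add0r (bigD1 j)//= eqxx big1 ?addr0.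
    by rewrite !mulr1; ring.
  by move=> i /negPf ->; rewrite !mulr0 addr0.
by apply/funext => y; rewrite /U /dotp /= fct_sumE.
Qed.

Definition rU x : R := (U x)^-1.
Definition qU (i : 'I_d) x : R := x ord0 i / U x.

Lemma is_derive_rU x j : is_derive x (ei j) rU (- 2 * qU j x * rU x).
Proof.
have dU := is_derive_U x j; have U0 : U x != 0 by rewrite gt_eqF// U_gt0.
apply: DeriveDef; first by apply: derivableV => //; case: dU.
rewrite deriveV// derive_val /GRing.scale/= /qU /rU; field; exact: U0.
Qed.

Lemma is_derive_qU x i j :
  is_derive x (ei j) (qU i) ((i == j)%:R * rU x - 2 * qU i x * qU j x).
Proof.
have dr := is_derive_rU x j; have dc := is_derive_coord x i j.
apply: (is_derive_eq (is_deriveM dc dr)); rewrite /GRing.scale/= /qU /rU.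
by field; rewrite gt_eqF// U_gt0.
Qed.

Lemma coord_le_U x i : `|x ord0 i| <= U x.
Proof.
have : x ord0 i ^+ 2 <= dotp x x.
  rewrite /dotp (bigD1 i)//= expr2 lerDl; apply: sumr_ge0 => j _.
  by rewrite -expr2 sqr_ge0.
rewrite /U => xi; rewrite (@le_trans _ _ (1 + x ord0 i ^+ 2))//; last by rewrite lerD2l.
by rewrite -real_normK ?num_real//; have := normr_ge0 (x ord0 i); nra.
Qed.

(** The derivatives of [rU] and [qU i] are polynomials of degree at most two in these same
    functions, so both are bounded at every order by one simultaneous induction. *)
Lemma bsmooth_rqU : bsmooth rU /\ forall i, bsmooth (qU i).
Proof.
have H k : exists M, bnd k M rU /\ forall i, bnd k M (qU i); last first.
  by split=> [k|i k]; have [M []] := H k => *; exists M.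
have rc : continuous rU.
  rewrite (_ : rU = fun x => (U x)^-1)// => x; apply: continuousV; last exact: continuous_U.
  by rewrite gt_eqF// U_gt0.
have qc i : continuous (qU i).
  rewrite (_ : qU i = fun x => x ord0 i * rU x)// => x.
  by apply: continuousM; [exact: coord_continuous|exact: rc].
have r1 x : `|rU x| <= 1.
  by rewrite /rU normfV gtr0_norm ?U_gt0// invf_le1 ?U_gt0// U_ge1.
have q1 i x : `|qU i x| <= 1.
  by rewrite /qU normrM normfV (gtr0_norm (U_gt0 _)) ler_pdivrMr ?U_gt0// mul1r coord_le_U.
elim: k => [|k [M [rM qM]]]; first by exists 1; split=> [|i]; exact: bnd0.
have M0 := bnd_ge0 rM.
have e1 : 0 <= 2 ^+ k * M * M :> R by rewrite !mulr_ge0// exprn_ge0.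
exists (1 + M + 4 * (2 ^+ k * M * M)).
have le1 : 1 <= 1 + M + 4 * (2 ^+ k * M * M) by lra.
split=> [|i]; apply: bndS.
- by apply: (bnd_le le1); exact: bnd0.
- by move=> j x; case: (is_derive_rU x j).
- move=> j; rewrite (_ : 'D_(ei j) rU = fun x => - 2 * (qU j x * rU x)); last first.
    by apply/funext => x; case: (is_derive_rU x j) => _ ->; ring.
  apply: (bnd_le _ (bndZ (-2) (bndM (qM j) rM))); rewrite normrN ger0_norm//; lra.
- by apply: (bnd_le le1); exact: bnd0.
- by move=> j x; case: (is_derive_qU x i j).
- move=> j; rewrite (_ : 'D_(ei j) (qU i) =
    fun x => (i == j)%:R * rU x - 2 * (qU i x * qU j x)); last first.
    by apply/funext => x; case: (is_derive_qU x i j) => _ ->; ring.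
  apply: (bnd_le _ (bndB (bndZ _ rM) (bndZ 2 (bndM (qM i) (qM j))))).
  rewrite !ger0_norm//; case: (i == j); rewrite ?mul1r ?mul0r; lra.
Qed.

(** V is unbounded with compact sublevel sets, yet its gradient [2 * qU j] has bounded derivatives
    of all orders. *)
Definition V x : R := ln (U x).

Lemma V_ge0 x : 0 <= V x.
Proof. by rewrite ln_ge0// U_ge1. Qed.

Lemma is_derive_V x j : is_derive x (ei j) V (2 * qU j x).
Proof.
have := is_derive_comp1 (is_derive_U x j) (is_derive1_ln (U_gt0 x)).
by move=> H; apply: (is_derive_eq H); rewrite /qU mulrC -mulrA.
Qed.

Lemma continuous_V : continuous V.
Proof.
move=> x; apply: (@continuous_comp _ _ _ U (@ln R)); first exact: continuous_U.
exact/continuous_ln/U_gt0.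
Qed.

Lemma bsmooth_derive_V j : bsmooth ('D_(ei j) V).
Proof.
rewrite (_ : 'D_(ei j) V = fun x => 2 * qU j x); last first.
  by apply/funext => x; case: (is_derive_V x j).
apply: bsmoothM; first exact: bsmooth_cst.
exact: (bsmooth_rqU.2 j).
Qed.

Lemma norm_le_U x : `|x| <= U x.
Proof.
apply: norm_le_coord => [|i]; [exact: ltW (U_gt0 _)|exact: coord_le_U].
Qed.

Lemma V_compact (c : R) : compact [set x | V x <= c].
Proof.
apply: bounded_closed_compact.
  exists (expR c); split; first exact: num_real.
  move=> M cM x /= Vx; apply: ltW; apply: le_lt_trans cM.
  rewrite (le_trans (norm_le_U x))// -[U x]lnK ?posrE ?U_gt0//.
  by rewrite ler_expR.
rewrite (_ : [set x | _] = V @^-1` [set y | y <= c])//.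
apply: closed_comp; first by move=> x _; exact: continuous_V.
exact: closed_le.
Qed.

End compositions.

(** * Partitions of unity and smooth approximation *)

Section continuous_real.
Context {R : realType} {T : topologicalType}.
Implicit Types f g : T -> R.

Lemma contD f g : continuous f -> continuous g -> continuous (fun x => f x + g x).
Proof. by move=> fc gc x; apply: (@continuousD _ R); [exact: fc|exact: gc]. Qed.

Lemma contM f g : continuous f -> continuous g -> continuous (fun x => f x * g x).
Proof. by move=> fc gc x; apply: continuousM; [exact: fc|exact: gc]. Qed.

Lemma cont_cst (c : R) : continuous (fun _ : T => c).
Proof. exact: cst_continuous. Qed.

Lemma contN f : continuous f -> continuous (fun x => - f x).
Proof. by move=> fc x; apply: (@continuousN _ R); exact: fc. Qed.

Lemma contB f g : continuous f -> continuous g -> continuous (fun x => f x - g x).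
Proof. by move=> fc gc; apply: contD => //; exact: contN. Qed.

End continuous_real.

Section smooth_step.
Context {R : realType}.
Implicit Types (t s : R).

(** Equal to 0 for t <= 0 and to 1 for t >= 1; the denominator stays above [low] because t or 1 - t
    is at least 1/2. *)
Definition sstep t : R := flat 1 t / (flat 1 t + flat 1 (1 - t)).

Let low : R := flat 1 (2^-1).

Lemma sstep_den_gt0 : 0 < low.
Proof. by rewrite /low flat_gt0// hornerC mul1r expR_gt0. Qed.

Lemma sstep_den t : low <= flat 1 t + flat 1 (1 - t).
Proof.
have [t1|t1] := leP (2^-1) t.
  by rewrite (le_trans (le_flat1 t1))// lerDl flat1_ge0.
rewrite (@le_trans _ _ (flat 1 (1 - t)))//; last by rewrite lerDr flat1_ge0.
by apply: le_flat1; lra.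
Qed.

Let den0 t : 0 < flat 1 t + flat 1 (1 - t).
Proof. exact: lt_le_trans sstep_den_gt0 (sstep_den t). Qed.

Lemma sstep_ge0 t : 0 <= sstep t.
Proof. by rewrite divr_ge0 ?flat1_ge0// ltW. Qed.

Lemma sstep_le1 t : sstep t <= 1.
Proof. by rewrite ler_pdivrMr// mul1r lerDl flat1_ge0. Qed.

Lemma sstep0 t : t <= 0 -> sstep t = 0.
Proof. by move=> t0; rewrite /sstep flat0// mul0r. Qed.

Lemma sstep1 t : 1 <= t -> sstep t = 1.
Proof.
move=> t1; have := den0 t; rewrite /sstep (@flat0 _ _ (1 - t)) ?subr_le0// addr0.
by move=> f0; rewrite divff// gt_eqF.
Qed.

Lemma le_sstep s t : s <= t -> sstep s <= sstep t.
Proof.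
move=> st; rewrite /sstep ler_pdivrMr// mulrAC ler_pdivlMr// !mulrDr mulrC lerD2l.
by rewrite mulrC [leRHS]mulrC ler_pM ?flat1_ge0 ?le_flat1// lerB.
Qed.

(** A difference of two shifted steps is supported in [-1, 1], and its integer translates telescope
    to a partition of unity. *)
Definition beta t : R := sstep (t + 1) - sstep t.

Lemma beta_ge0 t : 0 <= beta t.
Proof. by rewrite subr_ge0 le_sstep// lerDl. Qed.

Lemma beta_neq0 t : beta t != 0 -> `|t| <= 1.
Proof.
apply: contraNle => t1; rewrite /beta; have [t0|t0] := leP 0 t.
  rewrite ger0_norm// in t1.
  by rewrite !sstep1 ?subrr//; lra.
rewrite ltr0_norm// in t1.
by rewrite !sstep0 ?subrr//; lra.
Qed.

Lemma sum_beta n t :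
  \sum_(k < (n.*2).+1) beta (t - (k%:R - n%:R)) =
  sstep (t + n%:R + 1) - sstep (t - n%:R).
Proof.
pose F (k : nat) := - sstep (t + n%:R + 1 - k%:R).
rewrite (eq_bigr (fun k : 'I_ _ => F k.+1 - F k)).
  rewrite -(big_mkord xpredT (fun k => F k.+1 - F k)) telescope_sumr// /F subr0.
  rewrite opprK addrC; congr (_ - sstep _).
  by rewrite -natr1 -addnn natrD; ring.
move=> k _; rewrite /F /beta opprK [RHS]addrC; congr (sstep _ - sstep _); first ring.
by rewrite -natr1; ring.
Qed.

End smooth_step.

Section partition_of_unity.
Context {R : realType} {d : nat}.
Local Notation Rd := 'rV[R]_d.
Implicit Types (f g : Rd -> R) (x v : Rd).

Lemma bsmooth_flat1 (a b : R) i : bsmooth (fun x : Rd => flat 1 (a * x ord0 i + b)).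
Proof.
have D x j : is_derive x (ei j) (fun y : Rd => a * y ord0 i + b) (a * (i == j)%:R).
  have dc := is_derive_coord x i j.
  by apply: (is_derive_eq (is_deriveD (is_deriveZ a dc) (is_derive_cst b x (ei j)))); rewrite addr0.
apply: (@bsmooth_comp_gen _ _ (fun n => flat (dpoly 1 n)) setT).
- by move=> n y _; exact: is_derive_dpoly.
- by move=> n; have [C HC] := flat_bounded (dpoly 1 n : {poly R}); exists C.
- by [].
- apply: contD; last exact: cont_cst.
  by apply: contM; [exact: cont_cst|exact: continuous_coord].
- by move=> j x; case: (D x j).
- move=> j; rewrite (_ : 'D_(ei j) _ = fun=> a * (i == j)%:R); last first.
    by apply/funext => x; case: (D x j).
  exact: bsmooth_cst.
Qed.

Lemma bsmooth_sstep (a b : R) i : bsmooth (fun x : Rd => sstep (a * x ord0 i + b)).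
Proof.
apply: bsmoothM; first exact: bsmooth_flat1.
apply: (bsmooth_inv sstep_den_gt0) => [x|]; first exact: sstep_den.
apply: bsmoothD; first exact: bsmooth_flat1.
apply: (bsmooth_ext _ (bsmooth_flat1 (- a) (1 - b) i)) => x.
by congr flat; ring.
Qed.

Lemma bsmooth_prod (I : Type) (s : seq I) (P : pred I) (F : I -> Rd -> R) :
  (forall i, bsmooth (F i)) -> bsmooth (fun x => \prod_(i <- s | P i) F i x).
Proof.
move=> Fb; elim: s => [|a s IH].
  by apply: (bsmooth_ext _ (bsmooth_cst 1)) => x; rewrite big_nil.
case Pa : (P a); last by apply: bsmooth_ext IH => x; rewrite big_cons Pa.
by apply: (bsmooth_ext _ (bsmoothM (Fb a) IH)) => x; rewrite big_cons Pa.
Qed.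

Section grid.
Variables (n : nat) (h : R).
Hypothesis h0 : 0 < h.
Local Notation idx := {ffun 'I_d -> 'I_(n.*2).+1}.

Definition gpt (k : idx) : Rd := \row_i (((k i)%:R - n%:R) * h).

Definition gw (k : idx) x : R := \prod_(i < d) beta (x ord0 i / h - ((k i)%:R - n%:R)).

Lemma gw_ge0 k x : 0 <= gw k x.
Proof. by apply: prodr_ge0 => i _; exact: beta_ge0. Qed.

Lemma gw_neq0 k x : gw k x != 0 -> `|x - gpt k| <= h.
Proof.
move=> wk; apply: norm_le_coord => [|i]; first exact: ltW.
have : beta (x ord0 i / h - ((k i)%:R - n%:R)) != 0.
  by apply: contra_neq wk => b0; rewrite /gw (bigD1 i)//= b0 mul0r.
move=> /beta_neq0; rewrite !mxE.
have -> : x ord0 i / h - ((k i)%:R - n%:R) = (x ord0 i - ((k i)%:R - n%:R) * h) / h.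
  by field; rewrite gt_eqF.
by rewrite normrM normfV (gtr0_norm h0) ler_pdivrMr// mul1r.
Qed.

Lemma sum_gw x : `|x| <= n%:R * h -> \sum_k gw k x = 1.
Proof.
move=> xn; rewrite /gw -(bigA_distr_bigA (fun i (j : 'I_(n.*2).+1) =>
  beta (x ord0 i / h - (j%:R - n%:R)))) /= big1// => i _.
rewrite sum_beta.
have : `|x ord0 i / h| <= n%:R.
  rewrite normrM normfV (gtr0_norm h0) ler_pdivrMr//.
  exact: le_trans (norm_coord_le _ _) xn.
rewrite ler_norml => /andP[x1 x2].
by rewrite sstep1 ?sstep0 ?subr0//; lra.
Qed.

Lemma bsmooth_gw k : bsmooth (gw k).
Proof.
apply: bsmooth_prod => i; set c := (k i)%:R - n%:R.
apply: (bsmooth_ext _ (bsmoothB (bsmooth_sstep h^-1 (1 - c) i)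
  (bsmooth_sstep h^-1 (- c) i))) => x.
by rewrite /beta; congr (sstep _ - sstep _); ring.
Qed.

(** Wherever the weights sum to 1 this is a convex combination of values of f at grid points within
    h of x, which gives uniform closeness with compact support. *)
Definition ginterp f x : R := \sum_k f (gpt k) * gw k x.

Lemma bsmooth_ginterp f : bsmooth (ginterp f).
Proof.
apply: bsmooth_sum => k; apply: bsmoothM; first exact: bsmooth_cst.
exact: bsmooth_gw.
Qed.

Lemma norm_ball_compact (r : R) : compact [set x : Rd | `|x| <= r].
Proof.
apply: bounded_closed_compact.
  exists r; split; first exact: num_real.
  by move=> M rM x /= xr; rewrite (le_trans xr) ?ltW.
rewrite (_ : [set x | _] = (fun x : Rd => `|x|) @^-1` [set y | y <= r])//.
apply: closed_comp; last exact: closed_le.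
by move=> x _; exact: norm_continuous.
Qed.

Lemma test_function_ginterp f : test_function (ginterp f).
Proof.
apply: (test_function_onW (@norm_ball_compact ((n%:R + 1) * h))).
apply: bsmooth_test_function_on; first exact: bsmooth_ginterp.
apply: supp_subset => [|x /= xn].
  by apply: compact_closed; [exact: norm_hausdorff|exact: norm_ball_compact].
rewrite /ginterp big1// => k _; have [->|w0] := eqVneq (gw k x) 0; first by rewrite mulr0.
exfalso; apply: xn; have := gw_neq0 w0.
have : `|gpt k| <= n%:R * h.
  apply: norm_le_coord => [|i]; first by rewrite mulr_ge0// ltW.
  rewrite mxE normrM (gtr0_norm h0); apply: ler_wpM2r; first exact: ltW.
  have : (k i)%:R <= n%:R + n%:R :> R.
    by rewrite -natrD addnn ler_nat -ltnS ltn_ord.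
  move=> k2.
  by rewrite ler_norml; apply/andP; split; have := ler0n R (k i); lra.
have := ler_normD (x - gpt k) (gpt k); rewrite subrK; lra.
Qed.

Lemma ginterp_close f (e : R) x : `|x| <= n%:R * h ->
  (forall y, `|x - y| <= h -> `|f x - f y| <= e) -> `|ginterp f x - f x| <= e.
Proof.
move=> xn fe; have S1 := sum_gw xn.
have -> : ginterp f x - f x = \sum_k (f (gpt k) - f x) * gw k x.
  rewrite (eq_bigr (fun k => f (gpt k) * gw k x - f x * gw k x)); last first.
    by move=> k _; rewrite mulrBl.
  by rewrite sumrB -mulr_sumr S1 mulr1.
rewrite (le_trans (ler_norm_sum _ _ _))//.
rewrite (@le_trans _ _ (\sum_k e * gw k x))//; last by rewrite -mulr_sumr S1 mulr1.
apply: ler_sum => k _; rewrite normrM (ger0_norm (gw_ge0 _ _)).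
have [->|w0] := eqVneq (gw k x) 0; first by rewrite !mulr0.
by rewrite ler_wpM2r ?gw_ge0// distrC fe// gw_neq0.
Qed.

End grid.

(** Only x is restricted to the ball; y ranges over everything within h of x, since the grid points
    of the interpolation may lie outside. The bound h <= 1 keeps them within one unit. *)
Lemma unif_continuous_ball f (r e : R) : continuous f -> 0 < e ->
  exists2 h : R, 0 < h <= 1 &
    forall x y, `|x| <= r -> `|x - y| <= h -> `|f x - f y| <= e.
Proof.
move=> cf e0; have := @norm_ball_compact r.
move=> /compact_near_coveringP /(_ R (0^'+) (fun h x => forall y, `|x - y| <= h -> `|f x - f y| <= e)) H.
have : \forall h \near 0^'+, [set x : Rd | `|x| <= r] `<=`
    (fun x => forall y, `|x - y| <= h -> `|f x - f y| <= e).
  apply: H => x _.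
  have e20 : 0 < e / 2 by rewrite divr_gt0.
  have /cvgrPdist_le/(_ _ e20) := cf x.
  move=> /nbhs_ballP[dl /= dl0 Hdl].
  have dl20 : 0 < dl / 2 by rewrite divr_gt0.
  exists (ball x (dl / 2), [set h : R | h < dl / 2]) => /=.
    split; first exact: nbhsx_ballx.
    exact: nbhs_right_lt.
  move=> [x' h] /= [bx hdl] y xy.
  move: bx; rewrite -ball_normE /= => bx.
  have b1 : `|x - x'| < dl by rewrite (lt_le_trans bx)// ler_pdivrMr// ler_peMr ?ler1n// ltW.
  have b2 : `|x - y| < dl.
    rewrite (_ : x - y = (x - x') + (x' - y)); last by rewrite addrA subrK.
    rewrite (le_lt_trans (ler_normD _ _))//; lra.
  have h1 := Hdl x' _; have h2 := Hdl y _.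
  rewrite -ball_normE /= in h1 h2.
  have -> : f x' - f y = (f x - f y) - (f x - f x') by ring.
  rewrite (le_trans (ler_normB _ _))//; have := h1 b1; have := h2 b2; lra.
move=> near_h.
have : \forall h \near 0^'+, [/\ 0 < h, h <= 1 & [set x : Rd | `|x| <= r] `<=`
    (fun x => forall y, `|x - y| <= h -> `|f x - f y| <= e)].
  near=> h; split; near: h => //; last exact: nbhs_right_le.
  exact: nbhs_right_gt.
move=> /filter_ex[h [hp h1 hK]]; exists h; first by rewrite hp h1.
by move=> x y xr; apply: hK.
Unshelve. all: by end_near. Qed.

Lemma test_approx_ball f (r e : R) : continuous f -> 0 < e ->
  exists2 g, test_function g & forall x, `|x| <= r -> `|g x - f x| <= e.
Proof.
move=> cf e0; have [h /andP[h0 _] hP] := unif_continuous_ball r cf e0.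
pose n := (Num.truncn (r / h)).+1.
exists (ginterp n h f); first exact: test_function_ginterp.
move=> x xr; apply: ginterp_close => // [|y]; last exact: hP.
rewrite (le_trans xr)// -ler_pdivrMr// ltW//; exact: truncnS_gt.
Qed.

Lemma test_approx f (r e : R) : continuous f -> 0 < e ->
  (forall x, r < `|x| -> f x = 0) ->
  exists2 g, test_function g & forall x, `|g x - f x| <= e.
Proof.
move=> cf e0 fr; have [h /andP[h0 h1] hP] := unif_continuous_ball (r + 1) cf e0.
pose n := (Num.truncn ((r + 1) / h)).+1.
exists (ginterp n h f); first exact: test_function_ginterp.
move=> x; have [xr|xr] := leP `|x| (r + 1).
  apply: ginterp_close => // [|y]; last exact: hP.
  rewrite (le_trans xr)// -ler_pdivrMr// ltW//; exact: truncnS_gt.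
rewrite (fr x) ?subr0; last by rewrite (lt_trans _ xr)// ltrDl.
rewrite /ginterp big1 ?normr0 ?(ltW e0)// => k _.
(* Here |x| > r + 1, and a grid point with nonzero weight is within h <= 1 of x, hence lies beyond
   r, where f vanishes. *)
have [->|w0] := eqVneq (gw h k x) 0; first by rewrite mulr0.
have := gw_neq0 h0 w0 => xk; rewrite fr ?mul0r//.
have := ler_normD (x - gpt h k) (gpt h k); rewrite subrK; lra.
Qed.

End partition_of_unity.

(** * A monotone finite-difference scheme for the backward equation *)

Section taylor.
Context {R : realType}.

(** Mean value theorem between 0 and s; repeated use yields Taylor estimates whose constants are not
    optimized. *)
Lemma le_power_of_derive (f df : R -> R) (c : R) (n : nat) :
  (forall s : R, is_derive s 1 f (df s)) -> f 0 = 0 ->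
  (forall s, `|df s| <= c * `|s| ^+ n) -> forall s, `|f s| <= c * `|s| ^+ n.+1.
Proof.
move=> Df f0 dfc.
have c0 : 0 <= c.
  by have := dfc 1; rewrite normr1 expr1n mulr1; exact: le_trans.
have fc (a b : R) : {within `[a, b], continuous f}.
  apply: continuous_subspaceT => x; apply/differentiable_continuous/derivable1_diffP.
  by case: (Df x).
have K s t : `|t| <= `|s| -> `|df t * s| <= c * `|s| ^+ n.+1.
  move=> ts; rewrite normrM exprS mulrA mulrAC ler_wpM2r//.
  by rewrite (le_trans (dfc _))// ler_wpM2l// lerXn2r ?nnegrE.
move=> s; have [s0|s0|->] := ltrgtP s 0; last first.
- by rewrite f0 normr0 mulr_ge0// exprn_ge0.
- have [t] := MVT s0 (fun x _ => Df x) (fc _ _).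
  rewrite in_itv /= => /andP[t0 ts]; rewrite f0 !subr0 => ->.
  by apply: K; rewrite !gtr0_norm ?ltW.
- have [t] := MVT s0 (fun x _ => Df x) (fc _ _).
  rewrite in_itv /= => /andP[t0 ts]; rewrite f0 sub0r => fs.
  rewrite -normrN fs sub0r mulrN normrN; apply: K.
  by rewrite !ltr0_norm ?lerN2 ?ltW.
Qed.

Lemma taylor3 (f f1 f2 f3 : R -> R) (M : R) :
  (forall s : R, is_derive s 1 f (f1 s)) -> (forall s : R, is_derive s 1 f1 (f2 s)) ->
  (forall s : R, is_derive s 1 f2 (f3 s)) -> (forall s, `|f3 s| <= M) ->
  forall s, `|f s - f 0 - s * f1 0 - s ^+ 2 / 2 * f2 0| <= M * `|s| ^+ 3.
Proof.
move=> D0 D1 D2 f3M.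
have H2 : forall s, `|f2 s - f2 0| <= M * `|s| ^+ 1.
  apply: (@le_power_of_derive _ f3) => [s||s]; last by rewrite expr0 mulr1.
    have := D2 s => ?; by apply: is_derive_eq; rewrite subr0.
  by rewrite subrr.
have H1 : forall s, `|f1 s - f1 0 - s * f2 0| <= M * `|s| ^+ 2.
  apply: (@le_power_of_derive _ (fun s => f2 s - f2 0)) => [s||s]; last exact: H2.
    have := D1 s => ?; apply: is_derive_eq; rewrite /GRing.scale/=; ring.
  by rewrite mul0r !subrr.
apply: (@le_power_of_derive _ (fun s => f1 s - f1 0 - s * f2 0)) => [s||s]; last exact: H1.
  have := D0 s => ?; apply: is_derive_eq; rewrite /GRing.scale/=; by field.
by rewrite !mul0r expr0n/= !mul0r !subrr.
Qed.

End taylor.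

Section scheme.
Context {R : realType} {d : nat}.
Hypothesis hd : (0 < d)%N.
Local Notation Rd := 'rV[R]_d.
Implicit Types (f g w : Rd -> R) (x v : Rd).

Definition gen (b : 'I_d -> Rd -> R) f x : R :=
  laplacian f x + \sum_(i < d) b i x * 'D_(ei i) f x.

Lemma is_derive_shift_line f x i (s df : R) :
  is_derive (x + s *: ei i) (ei i) f df ->
  is_derive s (1 : R) (fun t : R => f (x + t *: ei i)) df.
Proof.
move=> /is_derive_line D; apply/is_derive_line.
rewrite (_ : (fun h : R => _) = fun h : R => f (h *: ei i + (x + s *: ei i)))//.
by apply/funext => h; rewrite scalerDl addrCA [_%:A]mulr1.
Qed.

Lemma bnd_line_diff k M f i (dl : R) : 0 <= dl -> bnd k.+1 M f ->
  bnd k (2 * dl * M) (fun x => f (x + dl *: ei i) - f (x + (- dl) *: ei i)).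
Proof.
move=> dl0; elim: k f => [|k IH] f fM.
  apply: bnd0 => [|x].
    have fc := bnd_continuous fM.
    by apply: contB; apply: bnd_continuous; apply: (bnd_shift _ (bndW fM)).
  have D (s : R) : is_derive s (1 : R) (fun t : R => f (x + t *: ei i)) ('D_(ei i) f (x + s *: ei i)).
    by apply: is_derive_shift_line; apply/derivableP; exact: bnd_derivable fM.
  have dd : - dl <= dl by lra.
  have [|s _ ->] := MVT_segment dd (fun s _ => D s).
    apply: continuous_subspaceT => s; apply/differentiable_continuous/derivable1_diffP.
    by case: (D s).
  rewrite normrM mulrC opprK (ger0_norm (addr_ge0 dl0 dl0)) mulr_natl mulr2n.
  by rewrite ler_wpM2l ?addr_ge0//; exact: bnd_le_norm (bnd_derive _ fM).
have c := IH.
apply: bndS => [|j x|j].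
- by apply: (bnd_weak (k := k)) => //; apply: IH; exact: bndW.
- by apply: derivableB; apply: derivable_shift_arg; exact: bnd_derivable fM.
- apply: (bnd_ext _ (IH _ (bnd_derive j fM))) => x.
  rewrite deriveB; last 2 first.
  + by apply: derivable_shift_arg; exact: bnd_derivable fM.
  + by apply: derivable_shift_arg; exact: bnd_derivable fM.
  by rewrite !derive_shift_arg.
Qed.

Section one_step.
Variables (bt : 'I_d -> Rd -> R) (h : R).
Hypothesis h0 : 0 <= h.
Let dl := Num.sqrt (2 * d%:R * h).

(** The mean of w over the 2d neighbours at distance dl, with weights tilted by [dl / 2 * bt i x].
    Since [dl ^+ 2 = 2 * d%:R * h], the expansion starts with w + h (Laplacian w + bt . grad w). The
    weights are nonnegative as soon as the tilt is at most 1 in absolute value, and then the scheme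
    is monotone. *)
Definition stp (w : Rd -> R) x : R := \sum_(i < d) (2 * d%:R)^-1 *
  ((1 + dl / 2 * bt i x) * w (x + dl *: ei i) +
   (1 - dl / 2 * bt i x) * w (x + (- dl) *: ei i)).

Hypothesis dlb : forall i x, `|dl / 2 * bt i x| <= 1.

Let dl0 : 0 <= dl. Proof. exact: sqrtr_ge0. Qed.

Let dl2 : dl ^+ 2 = 2 * d%:R * h.
Proof. by rewrite sqr_sqrtr// !mulr_ge0. Qed.

Let d0 : (d%:R : R) != 0. Proof. by rewrite pnatr_eq0 -lt0n. Qed.

Let dp : 0 < (d%:R : R). Proof. by rewrite ltr0n. Qed.

Let sumc (c : R) : \sum_(i < d) (2 * d%:R)^-1 * (c *+ 2) = c.
Proof.
rewrite sumr_const card_ord -mulr_natr -[c *+ 2]mulr_natr.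
by field; exact: d0.
Qed.

Lemma stp_cst (c : R) x : stp (fun=> c) x = c.
Proof.
rewrite -[RHS]sumc; apply: eq_bigr => i _; congr (_ * _).
by rewrite -mulrDl mulr2n; ring.
Qed.

Lemma stpD f g x : stp (fun y => f y + g y) x = stp f x + stp g x.
Proof. by rewrite -big_split; apply: eq_bigr => i _ /=; ring. Qed.

Lemma stpZ (c : R) f x : stp (fun y => c * f y) x = c * stp f x.
Proof. by rewrite mulr_sumr; apply: eq_bigr => i _ /=; ring. Qed.

Lemma stp_ge0 f x : (forall y, 0 <= f y) -> 0 <= stp f x.
Proof.
move=> f0; apply: sumr_ge0 => i _; have := dlb i x; rewrite ler_norml => /andP[b1 b2].
apply: mulr_ge0; first by rewrite invr_ge0 mulr_ge0.
by apply: addr_ge0; apply: mulr_ge0 => //; lra.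
Qed.

Lemma le_stp f g x : (forall y, f y <= g y) -> stp f x <= stp g x.
Proof.
move=> fg; rewrite -subr_ge0 (_ : _ - _ = stp (fun y => g y + (-1) * f y) x).
  by apply: stp_ge0 => y; rewrite mulN1r subr_ge0.
by rewrite stpD stpZ mulN1r.
Qed.

Lemma stp_norm f M x : (forall y, `|f y| <= M) -> `|stp f x| <= M.
Proof.
move=> fM; rewrite ler_norml -{1}(stp_cst (- M) x) -{2}(stp_cst M x).
by apply/andP; split; apply: le_stp => y; have := fM y; rewrite ler_norml => /andP[].
Qed.

(** Differentiation commutes with the step except when it hits a weight; this leaves [dl] times a
    centred difference of size [2 * dl * M], and [dl ^+ 2] is proportional to h. The bounds of every
    order thus grow by 1 + O(h), which survives T / h iterations. *)
Lemma bnd_stp k B M f : (forall i, bnd k B (bt i)) -> bnd k M f ->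
  bnd k ((1 + 2 ^+ k * B * d%:R * h) * M) (stp f).
Proof.
move=> btB.
have B0 : 0 <= B by exact: bnd_ge0 (btB (Ordinal hd)).
elim: k f M btB => [|k IH] f M btB fM; have M0 := bnd_ge0 fM.
  apply: bnd0 => [|x].
    apply: continuous_sumR => i.
    have fc := bnd_continuous fM; have bc := bnd_continuous (btB i).
    have cs (v : Rd) : continuous (fun x => f (x + v)).
      by apply: bnd_continuous; exact: (bnd_shift v fM).
    apply: contM; first exact: cont_cst.
    apply: contD; apply: contM => //.
    - by apply: contD; [exact: cont_cst|apply: contM => //; exact: cont_cst].
    - by apply: contB; [exact: cont_cst|apply: contM => //; exact: cont_cst].
  rewrite (@le_trans _ _ M)//; first by apply: stp_norm => y; exact: bnd_le_norm fM.
  by rewrite ler_peMl// lerDl !mulr_ge0.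
have D j x : is_derive x (ei j) (stp f) (stp ('D_(ei j) f) x +
    \sum_(i < d) dl / (4 * d%:R) *
      ('D_(ei j) (bt i) x * (f (x + dl *: ei i) - f (x + (- dl) *: ei i)))).
  have Df v : is_derive x (ei j) (fun y => f (y + v)) ('D_(ei j) f (x + v)).
    rewrite -derive_shift_arg; apply/derivableP/derivable_shift_arg.
    exact: bnd_derivable fM.
  have Db i : is_derive x (ei j) (bt i) ('D_(ei j) (bt i) x).
    by apply/derivableP; exact: bnd_derivable (btB i).
  have H : is_derive x (ei j) (\sum_(i < d) (fun x => (2 * d%:R)^-1 *
     ((1 + dl / 2 * bt i x) * f (x + dl *: ei i) +
      (1 - dl / 2 * bt i x) * f (x + (- dl) *: ei i))))
     (\sum_(i < d) ((2 * d%:R)^-1 *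
     ((1 + dl / 2 * bt i x) * 'D_(ei j) f (x + dl *: ei i) +
      (1 - dl / 2 * bt i x) * 'D_(ei j) f (x + (- dl) *: ei i)) +
      dl / (4 * d%:R) *
      ('D_(ei j) (bt i) x * (f (x + dl *: ei i) - f (x + (- dl) *: ei i))))).
    apply: is_derive_sum => i.
    have := Df (dl *: ei i); have := Df ((- dl) *: ei i); have := Db i => *.
    by apply: is_derive_eq; rewrite /GRing.scale/=; field; exact: d0.
  rewrite (_ : stp f = \sum_(i < d) (fun x => (2 * d%:R)^-1 *
     ((1 + dl / 2 * bt i x) * f (x + dl *: ei i) +
      (1 - dl / 2 * bt i x) * f (x + (- dl) *: ei i)))); last first.
    by apply/funext => y; rewrite fct_sumE.
  by apply: is_derive_eq; rewrite big_split.
have e0 : 0 <= 2 ^+ k * B * d%:R * h by rewrite !mulr_ge0// exprn_ge0.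
have btBW i : bnd k B (bt i) by exact: bndW.
have le1 : (1 + 2 ^+ k * B * d%:R * h) * M <= (1 + 2 ^+ k.+1 * B * d%:R * h) * M.
  rewrite ler_wpM2r// lerD2l exprS -!mulrA mulrA; move: e0; rewrite -!mulrA; lra.
apply: bndS => [|j x|j].
- apply: (bnd_le le1); apply: (@bnd_weak _ _ k) => //; exact/IH/bndW.
- by case: (D j x).
- rewrite (_ : 'D_(ei j) (stp f) = fun x => stp ('D_(ei j) f) x +
      \sum_(i < d) dl / (4 * d%:R) *
      ('D_(ei j) (bt i) x * (f (x + dl *: ei i) - f (x + (- dl) *: ei i)))); last first.
    by apply/funext => x; case: (D j x).
  apply: (@bnd_le _ _ _ ((1 + 2 ^+ k * B * d%:R * h) * M +
    \sum_(i < d) `|dl / (4 * d%:R)| * (2 ^+ k * B * (2 * dl * M)))).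
    rewrite sumr_const card_ord ger0_norm; last by rewrite divr_ge0// mulr_ge0.
    rewrite -[X in _ + X]mulr_natr exprS.
    have -> : dl / (4 * d%:R) * (2 ^+ k * B * (2 * dl * M)) * d%:R =
       2 ^+ k * B * (dl ^+ 2) / 2 * M by field; exact: d0.
    by rewrite dl2 le_eqVlt; apply/orP; left; apply/eqP; field.
  apply: bndD; first by apply: IH => //; exact: bnd_derive.
  apply: bnd_sum => i; apply: bndZ; apply: bndM; first exact: bnd_derive.
  exact: bnd_line_diff.
Qed.

(** Third-order Taylor expansion along each axis: an error of order dl^3, that is h^(3/2), still
    vanishes after summation over T / h steps. *)
Lemma stp_consistent M f x : bnd 3 M f ->
  `|stp f x - f x - h * gen bt f x| <= 2 * M * dl ^+ 3.
Proof.
move=> fM; have M0 := bnd_ge0 fM.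
pose D1 i := 'D_(ei i) f; pose D2 i := 'D_(ei i) (D1 i); pose D3 i := 'D_(ei i) (D2 i).
have D1M i : bnd 2 M (D1 i) by exact: bnd_derive.
have D2M i : bnd 1 M (D2 i) by exact: bnd_derive.
have D3M i : bnd 0 M (D3 i) by exact: bnd_derive.
pose E i (s : R) := f (x + s *: ei i) - f x - s * D1 i x - s ^+ 2 / 2 * D2 i x.
have EM i s : `|E i s| <= M * `|s| ^+ 3.
  have := @taylor3 R (fun t => f (x + t *: ei i)) (fun t => D1 i (x + t *: ei i))
    (fun t => D2 i (x + t *: ei i)) (fun t => D3 i (x + t *: ei i)) M _ _ _ _ s.
  rewrite scale0r addr0; apply => t.
  - by apply: is_derive_shift_line; apply/derivableP; exact: bnd_derivable fM.
  - by apply: is_derive_shift_line; apply/derivableP; exact: bnd_derivable (D1M i).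
  - by apply: is_derive_shift_line; apply/derivableP; exact: bnd_derivable (D2M i).
  - exact: bnd_le_norm (D3M i).
have -> : stp f x - f x - h * gen bt f x = \sum_(i < d) (2 * d%:R)^-1 *
    ((1 + dl / 2 * bt i x) * E i dl + (1 - dl / 2 * bt i x) * E i (- dl)).
  have -> : f x = \sum_(i < d) (2 * d%:R)^-1 * (f x *+ 2) by rewrite sumc.
  have hE : h = dl ^+ 2 / (2 * d%:R) by rewrite dl2; field; exact: d0.
  rewrite /gen /laplacian -big_split/= mulr_sumr -!sumrB; apply: eq_bigr => i _.
  rewrite {1}hE /E /D1 /D2 /D1 mulr2n /partial /= -/(ei i) sqrrN.
  by field; exact: d0.
rewrite (le_trans (ler_norm_sum _ _ _))//.
have -> : 2 * M * dl ^+ 3 = \sum_(i < d) (2 * d%:R)^-1 * ((2 * M * dl ^+ 3) *+ 2).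
  by rewrite sumc.
apply: ler_sum => i _; rewrite normrM ger0_norm ?invr_ge0 ?mulr_ge0//.
rewrite ler_wpM2l ?invr_ge0 ?mulr_ge0// (le_trans (ler_normD _ _))// (mulr2n (2 * M * dl ^+ 3)).
have := dlb i x; rewrite ler_norml => /andP[b1 b2].
rewrite lerD// normrM -[2 * M * _]mulrA ler_pM//.
- by rewrite ler_norml; apply/andP; split; lra.
- by rewrite (le_trans (EM _ _))// (ger0_norm dl0).
- by rewrite ler_norml; apply/andP; split; lra.
- by rewrite (le_trans (EM _ _))// normrN (ger0_norm dl0).
Qed.

End one_step.

End scheme.

(** * Bounded measurable functions and uniformly smooth families *)

Section bounded_integrals.
Context {R : realType} {dT : measure_display} {T : measurableType dT}.
Implicit Types (f g : T -> R) (mu : probability T R).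

(** The class on which real-valued integrals against probability measures are linear and monotone
    without integrability side conditions. *)
Definition mbd f := measurable_fun setT f /\ exists M, forall x, `|f x| <= M.

Lemma mbd_integrable mu f : mbd f -> mu.-integrable setT (EFin \o f).
Proof.
move=> [mf [M fM]]; apply: measurable_bounded_integrable => //.
  exact: (le_lt_trans (probability_le1 mu measurableT) (ltry 1)).
exists M; split; first exact: num_real.
by move=> x Mx y _ /=; rewrite (le_trans (fM y))// ltW.
Qed.

Lemma mbd_cst (c : R) : mbd (fun=> c).
Proof. by split => //; exists `|c|. Qed.

Lemma mbdD f g : mbd f -> mbd g -> mbd (fun x => f x + g x).
Proof.
move=> [mf [M fM]] [mg [N gN]]; split; first exact: measurable_funD.
by exists (M + N) => x; rewrite (le_trans (ler_normD _ _))// lerD.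
Qed.

Lemma mbdM f g : mbd f -> mbd g -> mbd (fun x => f x * g x).
Proof.
move=> [mf [M fM]] [mg [N gN]]; split; first exact: measurable_funM.
by exists (M * N) => x; rewrite normrM ler_pM.
Qed.

Lemma mbdN f : mbd f -> mbd (fun x => - f x).
Proof.
move=> [mf [M fM]]; split; first exact: measurableT_comp.
by exists M => x; rewrite normrN.
Qed.

Lemma mbdB f g : mbd f -> mbd g -> mbd (fun x => f x - g x).
Proof. by move=> mf mg; apply: mbdD => //; exact: mbdN. Qed.

Variable mu : probability T R.

Lemma IntD f g : mbd f -> mbd g ->
  \int[mu]_x (f x + g x) = \int[mu]_x f x + \int[mu]_x g x.
Proof. by move=> *; apply: RintegralD => //; exact: mbd_integrable. Qed.

Lemma IntB f g : mbd f -> mbd g ->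
  \int[mu]_x (f x - g x) = \int[mu]_x f x - \int[mu]_x g x.
Proof. by move=> *; apply: RintegralB => //; exact: mbd_integrable. Qed.

Lemma IntZ c f : mbd f -> \int[mu]_x (c * f x) = c * \int[mu]_x f x.
Proof. by move=> *; apply: RintegralZl => //; exact: mbd_integrable. Qed.

Lemma Int_cst (c : R) : \int[mu]_x c = c.
Proof. rewrite Rintegral_cst// (_ : fine _ = 1) ?mulr1//.
exact: (congr1 fine (probability_setT mu)). Qed.

Lemma le_Int f g : mbd f -> mbd g -> (forall x, f x <= g x) ->
  \int[mu]_x f x <= \int[mu]_x g x.
Proof. by move=> mf mg fg; apply: le_Rintegral => //; exact: mbd_integrable. Qed.

Lemma Int_le_cst f c : mbd f -> (forall x, f x <= c) -> \int[mu]_x f x <= c.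
Proof.
by move=> mf fc; rewrite -[leRHS]Int_cst; apply: le_Int => //; exact: mbd_cst.
Qed.

Lemma Int_ge_cst f c : mbd f -> (forall x, c <= f x) -> c <= \int[mu]_x f x.
Proof.
by move=> mf fc; rewrite -[leLHS]Int_cst; apply: le_Int => //; exact: mbd_cst.
Qed.

Lemma Int_norm f M : mbd f -> (forall x, `|f x| <= M) -> `|\int[mu]_x f x| <= M.
Proof.
move=> mf fM; rewrite ler_norml Int_ge_cst ?Int_le_cst// => x.
  by have := fM x; rewrite ler_norml => /andP[].
by have := fM x; rewrite ler_norml => /andP[].
Qed.

Lemma eq_Int f g : f =1 g -> \int[mu]_x f x = \int[mu]_x g x.
Proof. by move=> /funext ->. Qed.

Lemma Int_close f g e : mbd f -> mbd g -> (forall x, `|f x - g x| <= e) ->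
  `|\int[mu]_x f x - \int[mu]_x g x| <= e.
Proof.
by move=> mf mg fg; rewrite -IntB//; apply: Int_norm => //; exact: mbdB.
Qed.

End bounded_integrals.

Section continuous_integrals.
Context {R : realType} {d : nat}.
Local Notation Rd := 'rV[R]_d.
Implicit Types (f g : Rd -> R).

Lemma continuous_measurable_rV f : continuous f -> measurable_fun setT f.
Proof.
move=> cf; apply: (measurability _ (RGenOpens.measurableE R)).
move=> _ [_ [a [b ->] <-]]; rewrite setTI; apply: sub_sigma_algebra.
apply: open_comp; last exact: interval_open.
by move=> x _; exact: cf.
Qed.

Lemma bsmooth_mbd f : bsmooth f -> mbd f.
Proof.
move=> fb; split; last exact: bsmooth_bounded.
by apply: continuous_measurable_rV; exact: bsmooth_continuous.
Qed.

Lemma test_function_mbd f : test_function f -> mbd f.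
Proof. by move=> tf; exact/bsmooth_mbd/test_function_bsmooth. Qed.

End continuous_integrals.

Section uniform_families.
Context {R : realType} {d : nat} {I : Type} (P : I -> Prop).
Local Notation Rd := 'rV[R]_d.
Implicit Types (F G : I -> Rd -> R).

(** [bsmooth] with constants uniform over the indices in P; later P selects the scheme parameters
    for which the weights are nonnegative. *)
Definition usm F := forall k, exists M, forall i, P i -> bnd k M (F i).

Lemma usm_const f : bsmooth f -> usm (fun=> f).
Proof. by move=> fb k; have [M fM] := fb k; exists M. Qed.

Lemma usmD F G : usm F -> usm G -> usm (fun i x => F i x + G i x).
Proof.
move=> uF uG k; have [M FM] := uF k; have [N GN] := uG k.
by exists (M + N) => i Pi; apply: bndD; [exact: FM|exact: GN].
Qed.

Lemma usmM F G : usm F -> usm G -> usm (fun i x => F i x * G i x).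
Proof.
move=> uF uG k; have [M FM] := uF k; have [N GN] := uG k.
by exists (2 ^+ k * M * N) => i Pi; apply: bndM; [exact: FM|exact: GN].
Qed.

Lemma usm_sum (J : Type) (s : seq J) (F : J -> I -> Rd -> R) :
  (forall j, usm (F j)) -> usm (fun i x => \sum_(j <- s) F j i x).
Proof.
move=> uF; elim: s => [|a s IH].
  move=> k; have [M HM] := usm_const (bsmooth_cst 0) k.
  by exists M => i Pi; apply: (bnd_ext _ (HM i Pi)) => x; rewrite big_nil.
move=> k; have [M HM] := usmD (uF a) IH k.
by exists M => i Pi; apply: (bnd_ext _ (HM i Pi)) => x; rewrite big_cons.
Qed.

Lemma usm_derive F j : usm F -> usm (fun i => 'D_(ei j) (F i)).
Proof.
by move=> uF k; have [M FM] := uF k.+1; exists M => i Pi; apply: bnd_derive; exact: FM.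
Qed.

Lemma usm_bsmooth F i : P i -> usm F -> bsmooth (F i).
Proof. by move=> Pi uF k; have [M FM] := uF k; exists M; exact: FM. Qed.

Lemma usm_comp (G : nat -> R -> R) (D : set R) F :
  (forall n y, D y -> is_derive y 1 (G n) (G n.+1 y)) ->
  (forall n, exists B, forall y, D y -> `|G n y| <= B) ->
  (forall i x, P i -> D (F i x)) -> (forall i, P i -> continuous (F i)) ->
  (forall i j x, P i -> derivable (F i) x (ei j)) ->
  (forall j, usm (fun i => 'D_(ei j) (F i))) -> usm (fun i x => G 0%N (F i x)).
Proof.
move=> dG GB FD Fc dF DF k.
have /choice[M HM] : forall j : 'I_d, exists M, 0 <= M /\
    forall i, P i -> bnd k.-1 M ('D_(ei j) (F i)).
  move=> j; have [M HM] := DF j k.-1.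
  exists (Num.max 0 M); split; first by rewrite le_max lexx.
  by move=> i Pi; apply: (bnd_le _ (HM i Pi)); rewrite le_max lexx orbT.
have [M' HM'] := @bnd_comp R d k G D (\sum_j M j) dG GB.
exists M' => i Pi; apply: HM' => [x||j x|j].
- exact: FD.
- exact: Fc.
- exact: dF.
- apply: (bnd_le _ (proj2 (HM j) i Pi)).
  rewrite (bigD1 j)//= lerDl; apply: sumr_ge0 => l _; exact: (proj1 (HM l)).
Qed.

Lemma usm_inv m F : 0 < m -> (forall i x, P i -> m <= F i x) -> usm F ->
  usm (fun i x => (F i x)^-1).
Proof.
move=> m0 mF uF.
have H : usm (fun i x => inv_seq 0 (F i x)).
  apply: (@usm_comp _ [set t | m <= t]) => //.
  - by move=> n y /= my; apply: is_derive_inv_seq; exact: lt_le_trans my.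
  - by move=> n; exact: inv_seq_bounded.
  - by move=> i Pi; exact/bsmooth_continuous/(usm_bsmooth Pi uF).
  - by move=> i j x Pi; apply: bsmooth_derivable; exact: (usm_bsmooth Pi uF).
  - by move=> j; exact: usm_derive.
move=> k; have [M HM] := H k; exists M => i Pi; apply: (bnd_ext _ (HM i Pi)) => x.
by rewrite /inv_seq expr0 expr1 !mul1r.
Qed.

Lemma usm_gen (b : 'I_d -> Rd -> R) F : (forall i, bsmooth (b i)) -> usm F ->
  usm (fun i => gen b (F i)).
Proof.
move=> bb uF; apply: usmD.
  apply: (@usm_sum _ _ (fun j i => 'D_(ei j) ('D_(ei j) (F i)))) => j.
  by do 2!apply: usm_derive.
apply: (@usm_sum _ _ (fun j i x => b j x * 'D_(ei j) (F i) x)) => j.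
by apply: usmM; [exact: usm_const|exact: usm_derive].
Qed.

End uniform_families.

(** * Iterates of the scheme *)

Section scheme_iterates.
Context {R : realType} {d : nat}.
Hypothesis hd : (0 < d)%N.
Local Notation Rd := 'rV[R]_d.
Variables (bt : 'I_d -> Rd -> R) (T : R).
Hypotheses (btb : forall i, bsmooth (bt i)) (T0 : 0 <= T).

Definition step (N : nat) : R := T / N.+1%:R.

Lemma step_ge0 N : 0 <= step N.
Proof. by rewrite divr_ge0. Qed.

Definition small_step (N : nat) :=
  forall i x, `|Num.sqrt (2 * d%:R * step N) / 2 * bt i x| <= 1.

Lemma step_small e : 0 < e -> exists N0, forall N, (N0 <= N)%N -> step N <= e.
Proof.
move=> e0; exists (Num.truncn (T / e)) => N N0; rewrite /step ler_pdivrMr//.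
rewrite mulrC -ler_pdivrMr// ltW//; apply: lt_le_trans (truncnS_gt _) _.
by rewrite ler_nat.
Qed.

Lemma sqrt_step_small e : 0 < e -> exists N0, forall N, (N0 <= N)%N ->
  Num.sqrt (2 * d%:R * step N) <= e.
Proof.
move=> e0; have dp : 0 < d%:R :> R by rewrite ltr0n.
have [|N0 HN0] := @step_small (e ^+ 2 / (2 * d%:R)).
  by rewrite divr_gt0 ?exprn_gt0 ?mulr_gt0.
exists N0 => N /HN0; rewrite ler_pdivlMr ?mulr_gt0// mulrC => H.
by rewrite -(ger0_norm (ltW e0)) -sqrtr_sqr ler_wsqrtr.
Qed.

Lemma small_step_large : exists N0, forall N, (N0 <= N)%N -> small_step N.
Proof.
have /choice[B HB] : forall i, exists B, forall x, `|bt i x| <= B.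
  by move=> i; exact: bsmooth_bounded.
have B0 i : 0 <= B i by exact: le_trans (HB i 0).
have S0 : 0 <= \sum_i B i by exact: sumr_ge0.
have [|N0 HN0] := @sqrt_step_small (2 / (1 + \sum_i B i)).
  by rewrite divr_gt0// ltr_pwDl.
exists N0 => N /HN0 H i x; rewrite normrM ger0_norm ?divr_ge0 ?sqrtr_ge0//.
rewrite mulrAC ler_pdivrMr// mul1r.
apply: (@le_trans _ _ (2 / (1 + \sum_i B i) * (1 + \sum_i B i))); last first.
  by rewrite divfK// gt_eqF// ltr_pwDl.
apply: ler_pM => //.
rewrite (le_trans (HB i x))// (bigD1 i)//= addrCA lerDl addr_ge0//.
exact: sumr_ge0.
Qed.

Definition iter_stp (w0 : Rd -> R) (p : nat * nat) : Rd -> R :=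
  iter p.2 (stp bt (step p.1)) w0.

Definition good (p : nat * nat) := small_step p.1 /\ (p.2 <= p.1.+1)%N.

(** At most [N.+1] steps of size T / N.+1 turn the factor 1 + C h per step into exp(C T), whatever
    N. *)
Lemma usm_iter_stp w0 : bsmooth w0 -> usm good (iter_stp w0).
Proof.
move=> w0b k; have [M wM] := w0b k.
have /choice[B HB] : forall i, exists B, bnd k B (bt i) by move=> i; exact: btb.
have B0 i : 0 <= B i by exact: bnd_ge0 (HB i).
have btB i : bnd k (\sum_i B i) (bt i).
  by apply: (bnd_le _ (HB i)); rewrite (bigD1 i)//= lerDl sumr_ge0.
set C := 2 ^+ k * (\sum_i B i) * d%:R.
have C0 : 0 <= C by rewrite !mulr_ge0 ?exprn_ge0 ?sumr_ge0.
have M0 := bnd_ge0 wM.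
exists (expR (C * T) * M) => -[N n] [/= sN nN].
have H : bnd k ((1 + C * step N) ^+ n * M) (iter_stp w0 (N, n)).
  elim: n nN => [|n IH] nN; first by rewrite expr0 mul1r.
  rewrite exprS -mulrA /iter_stp iterS.
  by apply: (bnd_stp hd (step_ge0 N) sN btB); apply: IH; exact: ltnW.
apply: (bnd_le _ H); rewrite ler_wpM2r//.
apply: (@le_trans _ _ (expR (C * step N) ^+ n)).
  have Cs : 0 <= C * step N by rewrite (mulr_ge0 C0 (step_ge0 N)).
  by rewrite lerXn2r ?nnegrE ?expR_ge0 ?addr_ge0 ?expR_ge1Dx.
rewrite -expRM_natl ler_expR mulrC -mulrA ler_wpM2l// /step.
by rewrite mulrAC ler_pdivrMr// ler_wpM2l// ler_nat.
Qed.

Lemma iter_stp_range w0 m M p x : good p -> (forall x, m <= w0 x <= M) ->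
  m <= iter_stp w0 p x <= M.
Proof.
case: p => N n [/= sN _] wmM; elim: n x => [|n IH] x; first exact: wmM.
have E : iter_stp w0 (N, n.+1) x = stp bt (step N) (iter_stp w0 (N, n)) x by [].
rewrite E -(stp_cst hd bt (step N) m x) -(stp_cst hd bt (step N) M x).
by apply/andP; split; apply: (le_stp sN) => y; case/andP: (IH y).
Qed.

(** A step is linear and fixes constants. This is what links the two comparisons of [key_inequality]
    through one function w. *)
Lemma iter_stp_affine w0 (c k : R) p x :
  iter_stp (fun x => c + k * w0 x) p x = c + k * iter_stp w0 p x.
Proof.
case: p => N n; elim: n x => [//|n IH] x.
have E w : iter_stp w (N, n.+1) x = stp bt (step N) (iter_stp w (N, n)) x by [].
rewrite !E (_ : iter_stp (fun x => c + k * w0 x) (N, n) =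
    fun x => c + k * iter_stp w0 (N, n) x); last first.
  by apply/funext => y; exact: IH.
by rewrite stpD stpZ stp_cst.
Qed.

End scheme_iterates.

(** * Comparison along curves of measures *)

Section generator.
Context {R : realType} {d : nat}.
Local Notation Rd := 'rV[R]_d.
Implicit Types (f g w v : Rd -> R) (x : Rd) (b : 'I_d -> Rd -> R).

Lemma compact_closed_rV (K : set Rd) : compact K -> closed K.
Proof. by move=> cK; apply: compact_closed => //; exact: norm_hausdorff. Qed.

Definition sqg f x : R := \sum_(i < d) ('D_(ei i) f x) ^+ 2.

Lemma sqg_ge0 f x : 0 <= sqg f x.
Proof. by apply: sumr_ge0 => i _; exact: sqr_ge0. Qed.

Lemma genE b f x :
  gen b f x = \sum_(i < d) ('D_(ei i) ('D_(ei i) f) x + b i x * 'D_(ei i) f x).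
Proof. by rewrite big_split. Qed.

Definition derivable2 f := (forall j x, derivable f x (ei j)) /\
  (forall j x, derivable ('D_(ei j) f) x (ei j)).

Lemma bsmooth_derivable2 f : bsmooth f -> derivable2 f.
Proof.
by move=> fb; split=> j x; apply: bsmooth_derivable => //; exact: bsmooth_derive.
Qed.

Lemma derive_comp f j x (g g1 : R -> R) (D : set R) :
  (forall y, D y -> is_derive y 1 g (g1 y)) -> (forall x, D (f x)) ->
  derivable f x (ei j) ->
  is_derive x (ei j) (fun y => g (f y)) (g1 (f x) * 'D_(ei j) f x).
Proof.
by move=> dg fD df; apply: is_derive_comp1; [exact/derivableP|exact: dg].
Qed.

Lemma gen_comp b f x (g g1 g2 : R -> R) (D : set R) :
  (forall y, D y -> is_derive y 1 g (g1 y)) ->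
  (forall y, D y -> is_derive y 1 g1 (g2 y)) ->
  (forall x, D (f x)) -> derivable2 f ->
  gen b (fun y => g (f y)) x = g1 (f x) * gen b f x + g2 (f x) * sqg f x.
Proof.
move=> dg dg1 fD [df ddf].
have E1 j y : 'D_(ei j) (fun y : Rd => g (f y)) y = g1 (f y) * 'D_(ei j) f y.
  by case: (derive_comp dg fD (df j y)).
have E j := funext (E1 j).
rewrite !genE !mulr_sumr -big_split /=.
apply: eq_bigr => j _; rewrite E E1.
have D1 := derive_comp dg1 fD (df j x); have D2 := derivableP (ddf j x).
have := is_deriveM D1 D2; move/(@derive_val _ _ _ _ _ _ _) => ->.
by rewrite /GRing.scale/=; ring.
Qed.

Lemma genD b f g x : derivable2 f -> derivable2 g ->
  gen b (fun y => f y + g y) x = gen b f x + gen b g x.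
Proof.
move=> [df ddf] [dg ddg].
have E1 j y : 'D_(ei j) (fun y : Rd => f y + g y) y = 'D_(ei j) f y + 'D_(ei j) g y.
  exact: (deriveD (df j y) (dg j y)).
have E j := funext (E1 j).
rewrite !genE -big_split /=; apply: eq_bigr => j _.
have E2 : 'D_(ei j) (fun y : Rd => 'D_(ei j) f y + 'D_(ei j) g y) x =
  'D_(ei j) ('D_(ei j) f) x + 'D_(ei j) ('D_(ei j) g) x := deriveD (ddf j x) (ddg j x).
by rewrite E E1 E2 mulrDr addrACA.
Qed.

Lemma genZ b (c : R) f x : derivable2 f -> gen b (fun y => c * f y) x = c * gen b f x.
Proof.
move=> [df ddf].
have E1 j y : 'D_(ei j) (fun y : Rd => c * f y) y = c * 'D_(ei j) f y.
  exact: (deriveZ c (df j y)).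
have E j := funext (E1 j).
rewrite !genE mulr_sumr /=; apply: eq_bigr => j _.
by rewrite E E1 (deriveZ c (ddf j x)) /GRing.scale/=; ring.
Qed.

Lemma gen_cst b (c : R) x : gen b (fun=> c) x = 0.
Proof.
have E j : 'D_(ei j) (fun _ : Rd => c) = fun=> 0.
  by apply/funext => y; rewrite derive_cst.
by rewrite genE big1// => j _; rewrite E !derive_cst mulr0 addr0.
Qed.

Lemma sqg_addc f (c : R) x : (forall j x, derivable f x (ei j)) ->
  sqg (fun y => f y + c) x = sqg f x.
Proof.
move=> df; apply: eq_bigr => j _; congr (_ ^+ 2).
by rewrite (deriveD (df j x) (derivable_cst _ _ _)) derive_cst addr0.
Qed.

Lemma derivable2_V : derivable2 (V : Rd -> R).
Proof.
split=> j x; first by case: (is_derive_V x j).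
by apply: bsmooth_derivable; exact: bsmooth_derive_V.
Qed.

Lemma derivable2D f g : derivable2 f -> derivable2 g -> derivable2 (fun x => f x + g x).
Proof.
move=> [df ddf] [dg ddg]; split=> j x; first exact: derivableD.
rewrite (_ : 'D_(ei j) _ = fun y => 'D_(ei j) f y + 'D_(ei j) g y).
  exact: derivableD.
by apply/funext => y; exact: (deriveD (df j y) (dg j y)).
Qed.

Lemma derivable2Z (c : R) f : derivable2 f -> derivable2 (fun x => c * f x).
Proof.
move=> [df ddf]; split=> j x; first exact: (@derivableZ _ _ _ f c).
rewrite (_ : 'D_(ei j) _ = fun y => c * 'D_(ei j) f y).
  exact: (@derivableZ _ _ _ ('D_(ei j) f) c).
by apply/funext => y; exact: (deriveZ c (df j y)).
Qed.

Lemma gen_mbd b v : (forall i, continuous (b i)) -> test_function v -> mbd (gen b v).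
Proof.
move=> bc tv; have vb := test_function_bsmooth tv; have [_ cv] := tv.
have gc : continuous (gen b v).
  apply: contD; apply: continuous_sumR => i.
    by apply: bsmooth_continuous; do 2!apply: bsmooth_derive.
  by apply: contM; [exact: bc|apply: bsmooth_continuous; exact: bsmooth_derive].
split; first exact: continuous_measurable_rV.
have [M HM] := compact_continuous_bounded cv gc.
exists (Num.max M 0) => x; have [sx|sx] := pselect (supp v x).
  by rewrite le_max HM.
rewrite /gen /laplacian !big1 ?addr0 ?normr0 ?le_max ?lexx ?orbT// => i _.
  by rewrite (derive_out_supp _ sx) mulr0.
by apply: supp_out => /(supp_partial (s := [:: i; i])).
Qed.

Lemma bsmooth_sqg v : bsmooth v -> bsmooth (sqg v).
Proof.
move=> vb; apply: bsmooth_sum => i; have vi := bsmooth_derive i vb.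
by apply: (bsmooth_ext _ (bsmoothM vi vi)) => x; rewrite expr2.
Qed.

End generator.

Section usm_more.
Context {R : realType} {d : nat} {I : Type} (P : I -> Prop).
Local Notation Rd := 'rV[R]_d.
Implicit Types (F G : I -> Rd -> R).

Lemma usm_ext F G : (forall i, P i -> F i =1 G i) -> usm P F -> usm P G.
Proof.
by move=> FG uF k; have [M HM] := uF k; exists M => i Pi; apply: bnd_ext (HM i Pi); exact: FG.
Qed.

Lemma usm_bounded F : usm P F -> exists2 M, 0 <= M & forall i x, P i -> `|F i x| <= M.
Proof.
move=> /(_ 0%N)[M HM]; exists (Num.max M 0); first by rewrite le_max lexx orbT.
by move=> i x Pi; rewrite le_max (bnd_le_norm x (HM i Pi)).
Qed.

End usm_more.

Lemma taylor2 {R : realType} (f f1 f2 : R -> R) (M : R) :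
  (forall s : R, is_derive s 1 f (f1 s)) -> (forall s : R, is_derive s 1 f1 (f2 s)) ->
  (forall s, `|f2 s| <= M) -> forall a s, `|f (a + s) - f a - s * f1 a| <= M * `|s| ^+ 2.
Proof.
move=> D0 D1 f2M a.
have sh (g g1 : R -> R) s : (forall s : R, is_derive s 1 g (g1 s)) ->
    is_derive s (1 : R) (fun s => g (a + s)) (g1 (a + s)).
  move=> Dg; have Da : is_derive s (1 : R) (fun s => a + s) 1.
    by apply: (is_derive_eq (is_deriveD (is_derive_cst a s 1) (is_derive_id s 1))); rewrite add0r.
  by rewrite -[g1 _]mulr1; apply: (@is_derive1_comp _ g (fun s => a + s)).
have H1 : forall s, `|f1 (a + s) - f1 a| <= M * `|s| ^+ 1.
  apply: (@le_power_of_derive _ _ (fun s => f2 (a + s))) => [s||s].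
  - by have := sh _ _ s D1 => ?; apply: is_derive_eq; rewrite subr0.
  - by rewrite addr0 subrr.
  - by rewrite expr0 mulr1.
apply: (@le_power_of_derive _ _ (fun s => f1 (a + s) - f1 a)) => [s||s].
- have := sh _ _ s D0 => ?; apply: is_derive_eq; rewrite /GRing.scale/=; ring.
- by rewrite addr0 mul0r !subrr.
- exact: H1.
Qed.

(** The bound ln u <= u - 1 at u = 1 / (1 + y), combined with 1 / (1 + y) <= 2 on the range
    considered. *)
Lemma ln_ge_quad {R : realType} (y : R) : - 2^-1 <= y -> y - 2 * y ^+ 2 <= ln (1 + y).
Proof.
move=> y2; have y1 : 0 < 1 + y by lra.
have : ln (1 + y)^-1 <= (1 + y)^-1 - 1.
  have y1' : 0 < (1 + y)^-1 by rewrite invr_gt0.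
  have := @le_ln1Dx R ((1 + y)^-1 - 1).
  by rewrite (_ : 1 + ((1 + y)^-1 - 1) = (1 + y)^-1); [apply; lra|ring].
rewrite lnV ?posrE// => H.
have E : (1 + y)^-1 - 1 = - y + y ^+ 2 * (1 + y)^-1 by field; rewrite gt_eqF.
have : (1 + y)^-1 <= 2 by rewrite invf_ple ?posrE//; lra.
have := sqr_ge0 y; rewrite E in H; nra.
Qed.

Section key.
Context {R : realType} {d : nat}.
Hypothesis hd : (0 < d)%N.
Local Notation Rd := 'rV[R]_d.
Variables (b : 'I_d -> Rd -> R) (CV : R).
Hypotheses (bc : forall i, continuous (b i)) (CV0 : 0 <= CV)
  (bV : forall x, gen b V x <= CV).

Section supersolution.
Variables (m s1 lam dl e1 : R) (bt : 'I_d -> Rd -> R) (w : Rd -> R).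
Hypotheses (m0 : 0 < m) (ms1 : m <= s1) (lam0 : 0 < lam) (dl0 : 0 < dl) (e10 : 0 < e1).
Let K : set Rd := [set x | V x <= (s1 - m) / dl].
Hypotheses (btb : forall i, bsmooth (bt i))
  (bte : forall i x, K x -> `|bt i x - b i x| <= e1)
  (wb : bsmooth w) (wm : forall x, m <= w x <= s1).

(** Adding [dl * V] pushes the function above s1 outside the compact K, where the truncation makes
    it constant. Concavity of the truncation and the upper bound on L V keep it a supersolution up
    to a multiple of dl. *)
Definition zf x : R := trunc s1 lam 0 (w x + dl * V x).
(** Subtracting [ln s1] makes this vanish outside K, hence a test function. *)
Definition vf x : R := ln (zf x) - ln s1.

Let a x : R := w x + dl * V x.

Let ma x : m <= a x.
Proof. by case/andP: (wm x) => mw _; rewrite (le_trans mw)// lerDl mulr_ge0 ?V_ge0 ?ltW. Qed.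

Let a2 : derivable2 a.
Proof.
by apply: derivable2D; [exact: bsmooth_derivable2|apply: derivable2Z; exact: derivable2_V].
Qed.

Let aK x : ~ K x -> s1 <= a x.
Proof.
move=> /negP; rewrite -ltNge ltr_pdivrMr// mulrC => h.
by case/andP: (wm x) => mw _; rewrite /a; lra.
Qed.

Lemma zf_ge_m x : m <= zf x.
Proof. by apply: le_trans (trunc_ge s1 lam0 _); rewrite le_min ms1 ma. Qed.

Lemma zf_le_s1 x : zf x <= s1.
Proof. exact: trunc_le. Qed.

Lemma zf_ge_w x : w x <= zf x.
Proof.
apply: le_trans (trunc_ge s1 lam0 _); case/andP: (wm x) => _ ws1.
by rewrite le_min ws1 andbT lerDl mulr_ge0 ?V_ge0 ?ltW.
Qed.

Let zf_gt0 x : 0 < zf x.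
Proof. exact: lt_le_trans (zf_ge_m x). Qed.

Lemma bsmooth_zf : bsmooth zf.
Proof.
apply: (@bsmooth_comp_gen _ _ (trunc s1 lam) [set t | m <= t] a) => //.
- by move=> n y _; exact: is_derive_trunc.
- by move=> n; exact: trunc_bounded.
- apply: contD; first exact: bsmooth_continuous.
  by apply: contM; [exact: cont_cst|exact: continuous_V].
- by case: a2.
- move=> j; rewrite (_ : 'D_(ei j) a = fun x => 'D_(ei j) w x + dl * 'D_(ei j) V x).
    apply: bsmoothD; first exact: bsmooth_derive.
    by apply: bsmoothM; [exact: bsmooth_cst|exact: bsmooth_derive_V].
  apply/funext => x; have [df _] := bsmooth_derivable2 wb.
  have [dV _] := @derivable2_V R d.
  by rewrite (deriveD (df j x) (@derivableZ _ _ _ V dl _ _ (dV j x))) (deriveZ dl (dV j x)).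
Qed.

Lemma gen_zf b' x : gen b' zf x =
  trunc s1 lam 1 (a x) * (gen b' w x + dl * gen b' V x) + trunc s1 lam 2 (a x) * sqg a x.
Proof.
have -> := gen_comp b' x (D := setT) (fun y _ => is_derive_trunc s1 lam0 0 y)
  (fun y _ => is_derive_trunc s1 lam0 1 y) (fun _ => I) a2.
have -> : gen b' a x = gen b' w x + gen b' (fun y => dl * V y) x.
  by apply: genD; [exact: bsmooth_derivable2|apply: derivable2Z; exact: derivable2_V].
have -> : gen b' (fun y => dl * V y) x = dl * gen b' V x.
  exact: (genZ b' dl x derivable2_V).
by [].
Qed.

Lemma gen_zf_out b' x : ~ K x -> gen b' zf x = 0.
Proof. by move=> Kx; rewrite gen_zf !trunc'_eq ?mul0r ?addr0//; exact: aK. Qed.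

(** The second-order term of the chain rule is nonpositive by concavity and is dropped; e1 accounts
    for the replacement of b by bt in L V, where |D_i V| <= 2. Outside K the derivatives of the
    truncation vanish, so closeness of bt to b on K is enough. *)
Lemma gen_zf_le x : gen bt zf x <=
  trunc s1 lam 1 (a x) * gen bt w x + dl * (CV + 2 * d%:R * e1).
Proof.
have e0 : 0 <= dl * (CV + 2 * d%:R * e1).
  by rewrite mulr_ge0 ?addr_ge0 ?mulr_ge0// ltW.
have [Kx|Kx] := pselect (K x); last first.
  by rewrite gen_zf_out// trunc'_eq ?mul0r ?add0r//; exact: aK.
rewrite gen_zf mulrDr -addrA lerD2l.
have t0 := trunc'_ge0 s1 lam (a x); have t1 := trunc'_le1 s1 lam (a x).
have t2 := trunc''_le0 s1 lam0 (a x); have g0 := sqg_ge0 a x.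
have gV : gen bt V x <= CV + 2 * d%:R * e1.
  have -> : gen bt V x = gen b V x + \sum_(i < d) (bt i x - b i x) * 'D_(ei i) V x.
    rewrite /gen -addrA; congr (_ + _); rewrite -big_split; apply: eq_bigr => i _ /=.
    by ring.
  apply: lerD; first exact: bV.
  rewrite (le_trans (ler_norm _))// (le_trans (ler_norm_sum _ _ _))//.
  have -> : 2 * d%:R * e1 = \sum_(i < d) 2 * e1.
    by rewrite sumr_const card_ord -mulr_natr; ring.
  apply: ler_sum => i _; rewrite normrM mulrC ler_pM//; last exact: bte.
  case: (is_derive_V x i) => _ ->; rewrite normrM ger0_norm// ler_piMr//.
  by rewrite /qU normrM normfV (gtr0_norm (U_gt0 _)) ler_pdivrMr ?U_gt0// mul1r coord_le_U.
have h2 : trunc s1 lam 2 (a x) * sqg a x <= 0 by rewrite mulr_le0_ge0.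
have h3 : 0 <= CV + 2 * d%:R * e1 by rewrite addr_ge0 ?mulr_ge0// ltW.
have h1 : trunc s1 lam 1 (a x) * (dl * gen bt V x) <= dl * (CV + 2 * d%:R * e1).
  rewrite mulrCA; apply: ler_wpM2l; first exact: ltW.
  by apply: le_trans (ler_wpM2l t0 gV) _; rewrite ler_piMl.
by rewrite -[leRHS]addr0 lerD.
Qed.

Lemma gen_vf b' x : gen b' vf x = gen b' zf x / zf x - sqg vf x.
Proof.
have z2 := bsmooth_derivable2 bsmooth_zf.
have L y : [set y : R | 0 < y] y -> is_derive y 1 (@ln R) (inv_seq 0 y).
  by move=> y0; exact: (is_derive_ln_seq 0 y0).
have L1 y : [set y : R | 0 < y] y -> is_derive y 1 (inv_seq 0 : R -> R) (inv_seq 1 y).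
  by move=> y0; exact: (is_derive_ln_seq 1 y0).
have lz : bsmooth (fun y => ln (zf y)).
  by apply: (bsmooth_ln m0) => [y|]; [exact: zf_ge_m|exact: bsmooth_zf].
have -> : gen b' vf x = gen b' (fun y => ln (zf y)) x.
  have := genD b' x (bsmooth_derivable2 lz) (bsmooth_derivable2 (bsmooth_cst (- ln s1))).
  by rewrite gen_cst addr0.
have -> := gen_comp b' x L L1 zf_gt0 z2.
have -> : sqg vf x = sqg zf x / zf x ^+ 2.
  have -> : sqg vf x = sqg (fun y => ln (zf y)) x.
    exact: (sqg_addc (- ln s1) x (bsmooth_derivable2 lz).1).
  rewrite /sqg mulr_suml; apply: eq_bigr => j _.
  case: (derive_comp L zf_gt0 (z2.1 j x)) => _ ->.
  by rewrite /inv_seq/= expr0 expr1 !mul1r; field; rewrite gt_eqF.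
have -> : inv_seq 0 (zf x) = (zf x)^-1 by rewrite /inv_seq expr0 expr1 !mul1r.
have -> : inv_seq 1 (zf x) = - (zf x ^+ 2)^-1.
  by rewrite /inv_seq expr1 (_ : 1`! = 1%N)// mulr1 mulN1r.
by rewrite mulNr [_^-1 * _]mulrC; congr (_ - _); exact: mulrC.
Qed.

Lemma bsmooth_vf : bsmooth vf.
Proof.
apply: bsmoothB; last exact: bsmooth_cst.
by apply: (bsmooth_ln m0) => [y|]; [exact: zf_ge_m|exact: bsmooth_zf].
Qed.

Lemma vf_out x : ~ K x -> vf x = 0.
Proof. by move=> Kx; rewrite /vf /zf trunc_eq ?subrr//; exact: aK. Qed.

(** L ln z = L z / z - |grad ln z|^2, so keeping only q |grad v|^2 leaves -(1 - q) |grad v|^2.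
    Completing the square against (b - bt) . grad v costs e1^2 / (4 (1 - q)) per coordinate,
    independently of the size of the gradient. *)
Lemma gen_vf_le (q : R) x : q < 1 ->
  gen b vf x + q * sqg vf x <= gen bt zf x / zf x + d%:R * (e1 ^+ 2 / (4 * (1 - q))).
Proof.
move=> q1; have q0 : 0 < 1 - q by rewrite subr_gt0.
have -> : gen b vf x + q * sqg vf x = gen bt zf x / zf x +
    \sum_(i < d) ((b i x - bt i x) * 'D_(ei i) vf x - (1 - q) * ('D_(ei i) vf x) ^+ 2).
  have -> : gen bt zf x / zf x = gen bt vf x + sqg vf x by rewrite gen_vf subrK.
  rewrite sumrB -mulr_sumr -/(sqg vf x).
  have -> : gen b vf x = gen bt vf x + \sum_(i < d) (b i x - bt i x) * 'D_(ei i) vf x.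
    rewrite /gen -addrA; congr (_ + _); rewrite -big_split; apply: eq_bigr => i _ /=.
    by ring.
  by ring.
rewrite lerD2l; have -> : d%:R * (e1 ^+ 2 / (4 * (1 - q))) =
    \sum_(i < d) e1 ^+ 2 / (4 * (1 - q)) by rewrite sumr_const card_ord -[RHS]mulr_natl.
apply: ler_sum => i _; set D := 'D_(ei i) vf x.
have [Kx|Kx] := pselect (K x); last first.
  have -> : D = 0.
    rewrite /D derive_out_supp//; move: Kx; apply: contra_not.
    by apply: supp_subset => [|y /vf_out//]; apply: compact_closed_rV; exact: V_compact.
  by rewrite expr0n/= !mulr0 subr0 divr_ge0 ?sqr_ge0// mulr_ge0// ltW.
have := bte i Kx; rewrite distrC; set E := b i x - bt i x => Ee.
have E2 : E ^+ 2 <= e1 ^+ 2.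
  by rewrite -[leLHS]real_normK ?num_real// lerXn2r ?nnegrE// ltW.
rewrite ler_pdivlMr ?mulr_gt0//.
apply: le_trans E2; have := sqr_ge0 (E - 2 * (1 - q) * D); nra.
Qed.

End supersolution.

End key.

Section key_inequality.
Context {R : realType} {d : nat}.
Hypothesis hd : (0 < d)%N.
Local Notation Rd := 'rV[R]_d.
Variables (b : 'I_d -> Rd -> R) (CV : R).
Hypotheses (bc : forall i, continuous (b i)) (CV0 : 0 <= CV)
  (bV : forall x, gen b V x <= CV).
Variables (q T : R).
Hypotheses (q1 : q < 1) (T0 : 0 < T).

(* Integrated form of [d/dt int v dmu <= A' + int (L v + q |grad v|^2) dmu]. *)
Definition curve_ineq (mu : R -> probability Rd R) (A : R -> R) :=
  forall v, test_function v -> forall s t, 0 <= s -> s < t -> t <= T ->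
  forall c, (forall r, s < r < t -> \int[mu r]_x (gen b v x + q * sqg v x) <= c) ->
  \int[mu t]_x v x - \int[mu s]_x v x <= A t - A s + c * (t - s).

(** The test functions produced by the scheme change with the step size, so the modulus of
    continuity is uniform over functions supported in K with derivatives up to order N bounded by M,
    and over the whole family of curves. *)
Definition curve_equicont (J : Type) (mu : J -> R -> probability Rd R) :=
  forall K : set Rd, compact K -> exists N, forall M eta, 0 < eta ->
  exists2 h0, 0 < h0 & forall j psi, test_function_on K psi -> bnd N M psi ->
  forall s t, 0 <= s <= T -> 0 <= t <= T -> `|s - t| <= h0 ->
  `|\int[mu j s]_x psi x - \int[mu j t]_x psi x| <= eta.

Variables (J : Type) (mu : J -> R -> probability Rd R) (A : J -> R -> R).
Hypotheses (muA : forall j, curve_ineq (mu j) (A j)) (muE : curve_equicont mu).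

Section fixed_parameters.
Variables (m s1 lam dl e1 : R) (bt : 'I_d -> Rd -> R).
Hypotheses (m0 : 0 < m) (ms1 : m <= s1) (lam0 : 0 < lam) (dl0 : 0 < dl) (e10 : 0 < e1).
Let K : set Rd := [set x | V x <= (s1 - m) / dl].
Hypotheses (btb : forall i, bsmooth (bt i))
  (bte : forall i x, K x -> `|bt i x - b i x| <= e1).

Let s10 : 0 < s1. Proof. exact: lt_le_trans ms1. Qed.
Let cK : compact K. Proof. exact: V_compact. Qed.
Let clK : closed K. Proof. exact: compact_closed_rV. Qed.

Variable w0 : Rd -> R.
Hypotheses (w0b : bsmooth w0) (w0m : forall x, m <= w0 x <= s1).

Local Notation GOOD := (good bt T).
Let Wf := iter_stp bt T w0.
Let Z p := zf s1 lam dl (Wf p).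
Let Vf p := vf s1 lam dl (Wf p).

Let Wm p : GOOD p -> forall x, m <= Wf p x <= s1.
Proof. by move=> gp x; exact: (iter_stp_range hd). Qed.

Let Wusm : usm GOOD Wf.
Proof. exact: (usm_iter_stp hd btb (ltW T0) w0b). Qed.

Let Wb p : GOOD p -> bsmooth (Wf p).
Proof. by move=> gp; exact: usm_bsmooth gp Wusm. Qed.

Let Zm p x : GOOD p -> m <= Z p x.
Proof. by move=> gp; exact: (zf_ge_m ms1 lam0 dl0 (Wm gp)). Qed.

Let Zb p : GOOD p -> bsmooth (Z p).
Proof. by move=> gp; exact: (bsmooth_zf lam0 dl0 (Wb gp) (Wm gp)). Qed.

Let Vb p : GOOD p -> bsmooth (Vf p).
Proof. by move=> gp; exact: (bsmooth_vf m0 ms1 lam0 dl0 (Wb gp) (Wm gp)). Qed.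

Let Vtest p : GOOD p -> test_function (Vf p).
Proof.
move=> gp; apply: (test_function_onW cK); apply: bsmooth_test_function_on; first exact: Vb.
by apply: supp_subset => // x Kx; exact: (vf_out lam0 dl0 (Wm gp)).
Qed.

Let Zusm : usm GOOD Z.
Proof.
have DW p j x : GOOD p -> 'D_(ei j) (fun y => Wf p y + dl * V y) x =
    'D_(ei j) (Wf p) x + dl * 'D_(ei j) V x.
  move=> gp; have [df _] := bsmooth_derivable2 (Wb gp).
  have [dV _] := @derivable2_V R d.
  have H : 'D_(ei j) (fun y => dl * V y) x = dl * 'D_(ei j) V x by exact: (deriveZ dl (dV j x)).
  by rewrite -H; apply: (deriveD (df j x) (@derivableZ _ _ _ V dl _ _ (dV j x))).
apply: (@usm_comp _ _ _ _ (trunc s1 lam) [set t | m <= t]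
  (fun p x => Wf p x + dl * V x)) => //.
- by move=> n y _; exact: is_derive_trunc.
- by move=> n; exact: trunc_bounded.
- move=> p x gp /=; case/andP: (Wm gp x) => mW _.
  by rewrite (le_trans mW)// lerDl mulr_ge0 ?V_ge0 ?ltW.
- move=> p gp; apply: contD; first exact: bsmooth_continuous (Wb gp).
  by apply: contM; [exact: cont_cst|exact: continuous_V].
- move=> p j x gp.
  have h2 := derivable2D (bsmooth_derivable2 (Wb gp)) (derivable2Z dl (@derivable2_V R d)).
  by case: h2.
- move=> j; apply: (@usm_ext _ _ _ _ (fun p x => 'D_(ei j) (Wf p) x + dl * 'D_(ei j) V x)).
    by move=> p gp x; rewrite DW.
  apply: usmD; first exact: usm_derive.
  apply: (@usmM _ _ _ _ (fun _ _ => dl) (fun _ => 'D_(ei j) V)).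
    exact: usm_const (bsmooth_cst _).
  exact: usm_const (bsmooth_derive_V _).
Qed.

Let psi p x := gen bt (Z p) x * (Z p x)^-1.

Let psi_usm : usm GOOD psi.
Proof.
apply: usmM; first exact: usm_gen.
by apply: (usm_inv m0) => // p x gp; exact: Zm.
Qed.

Let psi_on p : GOOD p -> test_function_on K (psi p).
Proof.
move=> gp; apply: bsmooth_test_function_on; first exact: usm_bsmooth gp psi_usm.
apply: supp_subset => // x Kx; rewrite /psi.
by rewrite (gen_zf_out lam0 dl0 (Wb gp) (Wm gp) bt Kx) mul0r.
Qed.

Let good_succ N n : GOOD (N, n.+1) -> GOOD (N, n).
Proof. by move=> [/= sN nN]; split => //; exact: ltnW. Qed.

Let step_gt0 N : 0 < step T N.
Proof. by rewrite divr_gt0. Qed.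

(** One backward step raises ln Z by at least h [gen bt Z / Z] up to small errors: Taylor for the
    truncation, [ln_ge_quad] for the logarithm, and [gen_zf_le] to compare L z with the derivative
    of the truncation times L w. *)
Lemma key_increment eta : 0 < eta -> exists N0, forall N, (N0 <= N)%N ->
  forall n, GOOD (N, n.+1) -> forall x,
  step T N * (psi (N, n) x - dl * (CV + 2 * d%:R * e1) / m - eta) <=
    Vf (N, n.+1) x - Vf (N, n) x.
Proof.
move=> eta0.
have [M3 W3] := Wusm 3; have [CG CG0 HCG] := usm_bounded (usm_gen btb Wusm).
pose M := Num.max M3 0; have M0 : 0 <= M by rewrite le_max lexx orbT.
have WM p : GOOD p -> bnd 3 M (Wf p).
  by move=> gp; apply: (bnd_le _ (W3 p gp)); rewrite le_max lexx.
have [B2 HB2] := @trunc'_bounded R s1 lam 1.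
have B20 : 0 <= B2 by exact: le_trans (HB2 0).
pose C1 := CG + 4 * d%:R * M.
have C10 : 0 <= C1 by rewrite addr_ge0 ?mulr_ge0.
(* [C1] bounds the change of W divided by h. [D1] collects the consistency error, which is
   proportional to sqrt h; [D2] collects the quadratic remainders of the truncation and of the
   logarithm, proportional to h. *)
pose D1 := 4 * d%:R * M / m; pose D2 := B2 * C1 ^+ 2 / m + 2 * C1 ^+ 2 / m ^+ 2.
have D10 : 0 <= D1 by rewrite divr_ge0 ?mulr_ge0// ltW.
have D20 : 0 <= D2.
  by rewrite addr_ge0 ?divr_ge0 ?mulr_ge0 ?exprn_ge0// ltW.
have [|N1 HN1] := @sqrt_step_small R d hd T (Num.min 1 (eta / 2 / (1 + D1))).
  by rewrite lt_min ltr01 !divr_gt0// ltr_pwDl.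
have [|N2 HN2] := @step_small R T (Num.min (m / (2 * (1 + C1))) (eta / 2 / (1 + D2))).
  by rewrite lt_min !divr_gt0// ?mulr_gt0// ltr_pwDl.
exists (maxn N1 N2) => N; rewrite geq_max => /andP[/HN1 sl /HN2 hl] n gn x.
move: sl hl; rewrite !le_min => /andP[sl1 sl2] /andP[hl1 hl2].
have gn' := good_succ gn; have sN := gn.1.
set h := step T N in hl1 hl2 *; have h0 : 0 < h by exact: step_gt0.
set r := Num.sqrt (2 * d%:R * h) in sl1 sl2.
have r0 : 0 <= r by exact: sqrtr_ge0.
have r2 : r ^+ 2 = 2 * d%:R * h by rewrite sqr_sqrtr// !mulr_ge0// ltW.
set W := Wf (N, n) x; set W' := Wf (N, n.+1) x; set G := gen bt (Wf (N, n)) x.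
have cons : `|W' - W - h * G| <= h * (4 * d%:R * M * r).
  have := stp_consistent hd (ltW h0) sN x (WM _ gn').
  rewrite -/r -/W -/G => H; apply: (le_trans H).
  by rewrite exprSr r2 le_eqVlt; apply/orP; left; apply/eqP; ring.
have GC : `|G| <= CG by exact: HCG.
have dW : `|W' - W| <= h * C1.
  have -> : W' - W = (W' - W - h * G) + h * G by ring.
  rewrite (le_trans (ler_normD _ _))// normrM (gtr0_norm h0) addrC.
  have -> : h * C1 = h * CG + h * (4 * d%:R * M) by rewrite /C1 mulrDr.
  apply: lerD; first exact: (ler_wpM2l (ltW h0) GC).
  apply: le_trans cons _; apply: (ler_wpM2l (ltW h0)).
  by apply: ler_piMr => //; rewrite !mulr_ge0.
pose a := W + dl * V x.
have ZE : Z (N, n) x = trunc s1 lam 0 a by [].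
have Z'E : Z (N, n.+1) x = trunc s1 lam 0 (a + (W' - W)).
  by rewrite /Z /zf -/W'; congr trunc; rewrite /a; ring.
set z := Z (N, n) x; set z' := Z (N, n.+1) x.
have zm : m <= z by exact: Zm.
have z0 : 0 < z by exact: lt_le_trans zm.
have z'0 : 0 < z' by apply: lt_le_trans (Zm x gn).
have T2 : `|z' - z - (W' - W) * trunc s1 lam 1 a| <= B2 * (h * C1) ^+ 2.
  rewrite /z /z' ZE Z'E.
  apply: (le_trans (taylor2 (fun s => is_derive_trunc s1 lam0 0 s)
     (fun s => is_derive_trunc s1 lam0 1 s) HB2 a (W' - W))).
  by rewrite ler_wpM2l// lerXn2r ?nnegrE ?mulr_ge0// ltW.
have T1 : `|z' - z| <= h * C1.
  apply: le_trans dW.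
  have [s [s0 s1']] : exists s, `|trunc s1 lam 1 s| <= 1 /\
      z' - z = trunc s1 lam 1 s * (W' - W).
    rewrite /z /z' ZE Z'E.
    have Dt s := is_derive_trunc s1 lam0 0 s.
    have ct (u w : R) : {within `[u, w], continuous (trunc s1 lam 0)}.
      apply: continuous_subspaceT => y; apply/differentiable_continuous/derivable1_diffP.
      by case: (Dt y).
    have t1 s : `|trunc s1 lam 1 s| <= 1.
      by rewrite ger0_norm ?trunc'_le1// trunc'_ge0.
    have [D0|D0] := leP 0 (W' - W).
      have le1 : a <= a + (W' - W) by rewrite lerDl.
      have [s _ ->] := MVT_segment le1 (fun s _ => Dt s) (ct _ _).
      by exists s; split => //; congr (_ * _); ring.
    have le1 : a + (W' - W) <= a by rewrite gerDl ltW.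
    have [s _ E] := MVT_segment le1 (fun s _ => Dt s) (ct _ _).
    by exists s; split => //; rewrite -opprB E; ring.
  by rewrite s1' normrM ler_piMl.
have Zle := gen_zf_le CV0 bV lam0 dl0 e10 bte (Wb gn') (Wm gn') x.
rewrite -/G -/a in Zle.
set g := gen bt (Z (N, n)) x.
have gle : g <= trunc s1 lam 1 a * G + dl * (CV + 2 * d%:R * e1) by exact: Zle.
have th0 := trunc'_ge0 s1 lam a; have th1 := trunc'_le1 s1 lam a.
set th := trunc s1 lam 1 a in gle th0 th1 T2.
set E0 := dl * (CV + 2 * d%:R * e1) in gle *.
set y := (z' - z) / z.
have yle : `|y| <= h * C1 / m.
  rewrite /y normrM normfV (gtr0_norm z0) ler_pM//; first by rewrite invr_ge0 ltW.
  by rewrite lef_pV2// posrE.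
have hC : h * C1 / m <= 2^-1.
  rewrite ler_pdivrMr//; move: hl1; rewrite ler_pdivlMr ?mulr_gt0 ?ltr_pwDl//; nra.
have y2 : - 2^-1 <= y.
  by have := le_trans yle hC; rewrite ler_norml => /andP[].
have lnE : Vf (N, n.+1) x - Vf (N, n) x = ln (1 + y).
  have -> : 1 + y = z' / z by rewrite /y; field; rewrite gt_eqF.
  by rewrite ln_div ?posrE// /Vf /vf -/z -/z'; ring.
rewrite lnE; apply: le_trans (ln_ge_quad y2).
have ysq : y ^+ 2 <= h ^+ 2 * (C1 ^+ 2 / m ^+ 2).
  rewrite -[leLHS]real_normK ?num_real//.
  have -> : h ^+ 2 * (C1 ^+ 2 / m ^+ 2) = (h * C1 / m) ^+ 2 by field; rewrite gt_eqF.
  by rewrite lerXn2r ?nnegrE// (le_trans _ yle).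
have zlow : h * (g - E0) - h * (4 * d%:R * M * r) - B2 * (h * C1) ^+ 2 <= z' - z.
  move: T2 cons; rewrite !ler_norml => /andP[T2 _] /andP[cons _].
  have c1 : h * G - h * (4 * d%:R * M * r) <= W' - W by lra.
  have c2 : th * (h * G - h * (4 * d%:R * M * r)) <= (W' - W) * th.
    by rewrite mulrC ler_wpM2r.
  have c3 : h * (g - E0) <= h * (th * G) by rewrite ler_wpM2l ?(ltW h0)//; lra.
  have c4 : th * (h * (4 * d%:R * M * r)) <= h * (4 * d%:R * M * r).
    by rewrite ler_piMl ?mulr_ge0// ltW.
  have c5 : th * (h * G) = h * (th * G) by ring.
  have c6 : th * (h * G - h * (4 * d%:R * M * r)) =
    th * (h * G) - th * (h * (4 * d%:R * M * r)) by ring.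
  lra.
have zi : 0 < z^-1 by rewrite invr_gt0.
have zim : z^-1 <= m^-1 by rewrite lef_pV2// posrE.
have E00 : 0 <= E0 by rewrite mulr_ge0 ?addr_ge0 ?mulr_ge0// ltW.
have ylow : h * (g * z^-1) - (h * E0 + h * (4 * d%:R * M * r) + B2 * (h * C1) ^+ 2) / m <= y.
  have : (h * (g - E0) - h * (4 * d%:R * M * r) - B2 * (h * C1) ^+ 2) * z^-1 <= y.
    by rewrite /y ler_wpM2r// ltW.
  have Q0 : 0 <= h * E0 + h * (4 * d%:R * M * r) + B2 * (h * C1) ^+ 2.
    have p1 : 0 <= 4 * d%:R * M * r by rewrite !mulr_ge0.
    have p2 : 0 <= (h * C1) ^+ 2 by exact: sqr_ge0.
    by rewrite !addr_ge0 ?(mulr_ge0 (ltW h0) E00) ?(mulr_ge0 (ltW h0) p1) ?(mulr_ge0 B20 p2).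
  have := ler_wpM2l Q0 zim; rewrite /psi; lra.
have r1 : r * D1 <= eta / 2.
  have h1 : r * (1 + D1) <= eta / 2 by rewrite -ler_pdivlMr// ltr_pwDl.
  by apply: le_trans h1; rewrite ler_wpM2l// lerDr.
have h1 : h * D2 <= eta / 2.
  have h1 : h * (1 + D2) <= eta / 2 by rewrite -ler_pdivlMr// ltr_pwDl.
  by apply: le_trans h1; rewrite ler_wpM2l ?(ltW h0)// lerDr.
have fin : h * (psi (N, n) x - E0 / m - eta) <=
   h * (g * z^-1) - (h * E0 + h * (4 * d%:R * M * r) + B2 * (h * C1) ^+ 2) / m
   - 2 * (h ^+ 2 * (C1 ^+ 2 / m ^+ 2)).
  have -> : h * (g * z^-1) - (h * E0 + h * (4 * d%:R * M * r) + B2 * (h * C1) ^+ 2) / m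
     - 2 * (h ^+ 2 * (C1 ^+ 2 / m ^+ 2)) = h * (psi (N, n) x - E0 / m - r * D1 - h * D2).
    rewrite /psi -/g -/z /D1 /D2; by field; rewrite !gt_eqF.
  by rewrite ler_wpM2l ?(ltW h0)//; lra.
lra.
Qed.

(** Discrete duality on the times T - n h. On each slice, [curve_ineq] and equicontinuity bound the
    change of the integral of [Vf (N, n)] by the increment of A plus h times the integral of psi at
    the lower end, up to errors. By [key_increment], replacing [Vf (N, n)] by [Vf (N, n.+1)] at that
    end gains h times the same integral, up to errors, and the sum telescopes. *)
Lemma key_fixed eta : 0 < eta -> exists N0, forall N, (N0 <= N)%N ->
  GOOD (N, N.+1) /\ forall j,
  \int[mu j T]_x ln (w0 x) <= \int[mu j 0]_x ln (Z (N, N.+1) x) + (A j T - A j 0) +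
    T * (dl * (CV + 2 * d%:R * e1) / m + d%:R * (e1 ^+ 2 / (4 * (1 - q))) + eta).
Proof.
move=> eta0; have eta20 : 0 < eta / 2 by rewrite divr_gt0.
have [N1 HN1] := key_increment eta20.
have [N2 HN2] := small_step_large hd T btb.
have [L HL] := muE cK; have [Mp HMp] := psi_usm L.
have [h0 h00 Hh0] := HL Mp _ eta20.
have [N3 HN3] := @step_small R T h0 h00.
exists (maxn N1 (maxn N2 N3)) => N; rewrite !geq_max => /and3P[/HN1 inc /HN2 sN /HN3 hN].
have gN n : (n <= N.+1)%N -> GOOD (N, n) by [].
split; first exact: gN.
move=> j; set h := step T N in hN inc; have hp : 0 < h by exact: step_gt0.
pose t (n : nat) := T - n%:R * h.
have hT : N.+1%:R * h = T by rewrite /h /step mulrC divfK// pnatr_eq0.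
have tT n : (n <= N.+1)%N -> 0 <= t n <= T.
  move=> nN; rewrite /t subr_ge0 gerBl mulr_ge0 ?(ltW hp)// andbT -[leRHS]hT.
  by rewrite ler_wpM2r ?(ltW hp)// ler_nat.
pose I n := \int[mu j (t n)]_x Vf (N, n) x.
set E1 := dl * (CV + 2 * d%:R * e1) / m; set E2 := d%:R * (e1 ^+ 2 / (4 * (1 - q))).
have stepI n : (n < N.+1)%N -> I n - I n.+1 <=
    (A j (t n) - A j (t n.+1)) + h * (E1 + E2 + eta).
  move=> nN; have gn := gN _ (ltnW nN); have gn1 := gN _ nN.
  have tn1 : t n.+1 = t n - h by rewrite /t -natr1; ring.
  have tlt : t n.+1 < t n by rewrite tn1 gtrBl.
  have /andP[tn0 tnT] := tT _ (ltnW nN); have /andP[tn10 tn1T] := tT _ nN.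
  have mpsi : mbd (psi (N, n)).
    by apply: bsmooth_mbd; exact: usm_bsmooth gn psi_usm.
  have mV k : (k <= N.+1)%N -> mbd (Vf (N, k)).
    by move=> kN; apply: bsmooth_mbd; exact/Vb/gN.
  set c0 := \int[mu j (t n.+1)]_x psi (N, n) x.
  have c : forall r, t n.+1 < r < t n ->
      \int[mu j r]_x (gen b (Vf (N, n)) x + q * sqg (Vf (N, n)) x) <= c0 + eta / 2 + E2.
    move=> r /andP[r1 r2].
    apply: (@le_trans _ _ (\int[mu j r]_x (psi (N, n) x + E2))).
      apply: le_Int => [||x].
      - apply: mbdD; first by apply: gen_mbd => //; exact: Vtest.
        by apply: mbdM; [exact: mbd_cst|apply: bsmooth_mbd; apply: bsmooth_sqg; exact: Vb].
      - by apply: mbdD => //; exact: mbd_cst.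
      - exact: (gen_vf_le m0 ms1 lam0 dl0 e10 bte (Wb gn) (Wm gn) x q1).
    rewrite IntD//; last exact: mbd_cst.
    rewrite Int_cst lerD2r.
    have : `|\int[mu j r]_x psi (N, n) x - c0| <= eta / 2.
      apply: (Hh0 j _ (psi_on gn) (HMp _ gn)).
      - by rewrite (le_trans tn10 (ltW r1)) (le_trans (ltW r2)).
      - by rewrite tn10.
      - by rewrite gtr0_norm ?subr_gt0//; move: r2; rewrite tn1; lra.
    by rewrite ler_norml => /andP[_]; lra.
  have := muA (Vtest gn) tn10 tlt tnT c.
  have -> : t n - t n.+1 = h by rewrite tn1; ring.
  have : h * (c0 - E1 - eta / 2) <= I n.+1 - \int[mu j (t n.+1)]_x Vf (N, n) x.
    rewrite -IntB//; [|exact: mV|exact: mV (ltnW nN)].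
    have -> : h * (c0 - E1 - eta / 2) =
        \int[mu j (t n.+1)]_x (h * (psi (N, n) x + (- E1 - eta / 2))).
      by rewrite IntZ ?IntD ?Int_cst ?addrA//; do ?[exact: mbd_cst|exact: mbdD mpsi (mbd_cst _)].
    apply: le_Int => [||x].
    - by apply: mbdM; [exact: mbd_cst|exact: mbdD mpsi (mbd_cst _)].
    - by apply: mbdB; [exact: mV|exact: mV (ltnW nN)].
    - by rewrite addrA; exact: inc.
  have aux (u u1 u2 dA : R) : h * (c0 - E1 - eta / 2) <= u1 - u2 ->
      u - u2 <= dA + (c0 + eta / 2 + E2) * h -> u - u1 <= dA + h * (E1 + E2 + eta).
    by move: (c0) => c1; lra.
  by move=> hA hB; exact: (aux _ _ _ _ hA hB).
have sumI n : (n <= N.+1)%N -> I 0%N - I n <=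
    (A j T - A j (t n)) + n%:R * h * (E1 + E2 + eta).
  elim: n => [|n IH] nN; first by rewrite /t mul0r subr0 !subrr !mul0r addr0.
  have := IH (ltnW nN); have := stepI _ nN; rewrite -natr1; lra.
have := sumI N.+1 (leqnn _); rewrite hT.
have t0 : t N.+1 = 0 by rewrite /t hT subrr.
have tN : t 0%N = T by rewrite /t mul0r subr0.
rewrite /I t0 tN -/E1 -/E2.
have lz n : (n <= N.+1)%N -> mbd (fun x => ln (Z (N, n) x)).
  by move=> nN; apply: bsmooth_mbd; apply: (bsmooth_ln m0) => [x|]; [exact/Zm/gN|exact/Zb/gN].
have VE n (j' : probability Rd R) : (n <= N.+1)%N -> \int[j']_x Vf (N, n) x = \int[j']_x ln (Z (N, n) x) - ln s1.
  by move=> nN; rewrite /Vf /vf IntB ?Int_cst//; [exact: lz|exact: mbd_cst].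
rewrite !VE//.
have : \int[mu j T]_x ln (w0 x) <= \int[mu j T]_x ln (Z (N, 0%N) x).
  apply: le_Int => [||x].
  - apply: bsmooth_mbd; apply: (bsmooth_ln m0) => // x.
    by case/andP: (w0m x).
  - exact: lz.
  - have wx : 0 < w0 x by case/andP: (w0m x) => mw _; exact: lt_le_trans mw.
    have zx : 0 < Z (N, 0%N) x by apply: lt_le_trans m0 (Zm x (gN _ _)).
    rewrite ler_ln ?posrE//.
    exact: (zf_ge_w lam0 dl0 (Wm (gN 0%N isT))).
lra.
Qed.

End fixed_parameters.

End key_inequality.

(** * Comparison for the drift of a potential *)

Section key_theorem.
Context {R : realType} {d : nat}.
Hypothesis hd : (0 < d)%N.
Local Notation Rd := 'rV[R]_d.
Variables (b : 'I_d -> Rd -> R) (CV : R).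
Hypotheses (bc : forall i, continuous (b i)) (CV0 : 0 <= CV)
  (bV : forall x, gen b V x <= CV).

Lemma V_ball (c : R) (x : Rd) : V x <= c -> `|x| <= expR c.
Proof.
move=> Vc; rewrite (le_trans (norm_le_U x))// -[U x]lnK ?posrE ?U_gt0//.
by rewrite ler_expR.
Qed.

(** The three error terms of [key_fixed] are made at most e / 3 each by the choice of dl, e1 and
    eta; dl also serves as smoothing width of the truncation. Both initial data are run with the
    same N, so that a single w appears in both conclusions. *)
Lemma key_inequality (q T : R) (J : Type) (mu : J -> R -> probability Rd R)
    (A : J -> R -> R) (m s1 e al be : R) (w0 : Rd -> R) :
  q < 1 -> 0 < T -> (forall j, curve_ineq b q T (mu j) (A j)) ->
  curve_equicont T mu -> 0 < m -> m <= s1 -> 0 < e -> bsmooth w0 ->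
  (forall x, m <= w0 x <= s1) -> (forall x, m <= al + be * w0 x <= s1) ->
  exists w z z' : Rd -> R, [/\ [/\ bsmooth w, bsmooth z & bsmooth z'],
    forall x, [/\ m <= w x <= s1, m <= z x <= s1 & m <= z' x <= s1],
    forall x, z x <= w x + e * V x + e /\ z' x <= al + be * w x + e * V x + e &
    forall j,
      \int[mu j T]_x ln (w0 x) <= \int[mu j 0]_x ln (z x) + (A j T - A j 0) + e /\
      \int[mu j T]_x ln (al + be * w0 x) <=
        \int[mu j 0]_x ln (z' x) + (A j T - A j 0) + e].
Proof.
move=> q1 T0 muA muE m0 ms1 e0 w0b w0m w0m'.
have q0 : 0 < 1 - q by rewrite subr_gt0.
pose C := CV + 2 * d%:R; have C0 : 0 <= C by rewrite addr_ge0.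
pose dl := Num.min e (e * m / (3 * T * (C + 1))).
have dl0 : 0 < dl.
  by rewrite lt_min e0 divr_gt0// ?mulr_gt0// ltr_wpDl.
have dle : dl <= e by rewrite ge_min lexx.
have dl1 : T * (dl * C / m) <= e / 3.
  have : dl <= e * m / (3 * T * (C + 1)) by rewrite ge_min lexx orbT.
  rewrite ler_pdivlMr ?mulr_gt0 ?ltr_wpDl// => h.
  rewrite ler_pdivlMr// mulrA -mulrAC ler_pdivrMr//; nra.
pose e1 := Num.min 1 (4 * (1 - q) * e / (3 * T * (d%:R + 1))).
have e10 : 0 < e1.
  by rewrite lt_min ltr01 divr_gt0// ?mulr_gt0// ltr_wpDl.
have e11 : e1 <= 1 by rewrite ge_min lexx.
have e12 : T * (d%:R * (e1 ^+ 2 / (4 * (1 - q)))) <= e / 3.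
  have : e1 <= 4 * (1 - q) * e / (3 * T * (d%:R + 1)) by rewrite ge_min lexx orbT.
  rewrite ler_pdivlMr ?mulr_gt0 ?ltr_wpDl// => h.
  have e2 : e1 ^+ 2 <= e1 by rewrite expr2 ler_piMl// ltW.
  rewrite ler_pdivlMr// !mulrA -mulrAC ler_pdivrMr ?mulr_gt0//.
  have Td : 0 <= T * d%:R by rewrite mulr_ge0// ltW.
  have := ler_wpM2l Td e2; nra.
pose eta := e / (3 * T); have eta0 : 0 < eta by rewrite divr_gt0// mulr_gt0.
have Teta : T * eta <= e / 3 by rewrite /eta le_eqVlt; apply/orP; left; apply/eqP; field; rewrite gt_eqF.
pose c := (s1 - m) / dl.
(* The ball of radius [expR c] contains the set where V <= c, the only place where the smooth drift
   has to be close to b. *)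
have /choice[bt Hbt] : forall i, exists g, test_function g /\
    forall x, `|x| <= expR c -> `|g x - b i x| <= e1.
  by move=> i; have [g tg Hg] := test_approx_ball (expR c) (@bc i) e10; exists g.
have btb i : bsmooth (bt i) by apply: test_function_bsmooth; case: (Hbt i).
have bte i x : [set x | V x <= (s1 - m) / dl] x -> `|bt i x - b i x| <= e1.
  by move=> Kx; have [_] := Hbt i; apply; exact: V_ball.
have w0b' : bsmooth (fun x => al + be * w0 x).
  by apply: bsmoothD; [exact: bsmooth_cst|apply: bsmoothM => //; exact: bsmooth_cst].
have [N1 HN1] := key_fixed hd bc CV0 bV q1 T0 muA muE m0 ms1 dl0 dl0 e10 btb bte w0b w0m eta0.
have [N2 HN2] := key_fixed hd bc CV0 bV q1 T0 muA muE m0 ms1 dl0 dl0 e10 btb bte w0b' w0m' eta0.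
have [gN H1] := HN1 _ (leq_maxl N1 N2); have [gN' H2] := HN2 _ (leq_maxr N1 N2).
set N := maxn N1 N2 in gN H1 gN' H2.
set w := iter_stp bt T w0 (N, N.+1) in H1.
have wm x : m <= w x <= s1 by exact: (iter_stp_range hd).
have wb : bsmooth w by exact: (usm_bsmooth gN (usm_iter_stp hd btb (ltW T0) w0b)).
have w'E : iter_stp bt T (fun x => al + be * w0 x) (N, N.+1) = fun x => al + be * w x.
  by apply/funext => x; exact: iter_stp_affine.
rewrite w'E in H2.
have w'm x : m <= al + be * w x <= s1.
  by rewrite -[al + _]/((fun x => al + be * w x) x) -w'E; exact: (iter_stp_range hd).
have w'b : bsmooth (fun x => al + be * w x).
  by apply: bsmoothD; [exact: bsmooth_cst|apply: bsmoothM => //; exact: bsmooth_cst].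
exists w, (zf s1 dl dl w), (zf s1 dl dl (fun x => al + be * w x)); split.
- by split => //; exact: (bsmooth_zf dl0 dl0 _ wm) || exact: (bsmooth_zf dl0 dl0 _ w'm).
- by move=> x; split => //; rewrite zf_le_s1// andbT;
   [exact: (zf_ge_m ms1 dl0 dl0 wm)|exact: (zf_ge_m ms1 dl0 dl0 w'm)].
- move=> x; have := V_ge0 x => V0.
  have dV : dl * V x <= e * V x by rewrite ler_wpM2r.
  have Zl v : zf s1 dl dl v x <= v x + dl * V x + dl by exact: trunc_le_id.
  split; first by have := Zl w; lra.
  by have := Zl (fun x => al + be * w x); lra.
- have err : T * (dl * (CV + 2 * d%:R * e1) / m + d%:R * (e1 ^+ 2 / (4 * (1 - q))) + eta) <= e.
    have : T * (dl * (CV + 2 * d%:R * e1) / m) <= T * (dl * C / m).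
      rewrite ler_wpM2l ?(ltW T0)// ler_wpM2r ?invr_ge0 ?(ltW m0)//.
      rewrite ler_wpM2l ?(ltW dl0)// lerD2l ler_piMr// mulr_ge0//.
    lra.
  have aux (u v e' : R) : u <= v + e' -> e' <= e -> u <= v + e.
    by move=> h1 h2; apply: le_trans h1 _; rewrite lerD2l.
  by move=> j; split; [exact: aux (H1 j) err|exact: aux (H2 j) err].
Qed.

End key_theorem.

(** * The drift of the potential and its Lyapunov bound *)

Section drift.
Context {R : realType} {d : nat}.
Local Notation Rd := 'rV[R]_d.
Variable Psi : Rd -> R.

Definition drift (i : 'I_d) (x : Rd) : R := - 'D_(ei i) Psi x.

Lemma gen_drift (f : Rd -> R) x :
  laplacian f x - dotp (grad Psi x) (grad f x) = gen drift f x.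
Proof.
rewrite /gen /dotp -sumrN; congr (_ + _); apply: eq_bigr => i _.
by rewrite !mxE mulNr.
Qed.

Lemma sqg_enorm (f : Rd -> R) x : enorm (grad f x) ^+ 2 = sqg f x.
Proof.
rewrite /enorm sqr_sqrtr ?dotp_ge0//; apply: eq_bigr => i _.
by rewrite !mxE -expr2.
Qed.

Lemma U_enorm (x : Rd) : U x = 1 + enorm x ^+ 2.
Proof. by rewrite /enorm sqr_sqrtr ?dotp_ge0. Qed.

(** The Laplacian of V is the sum of the 2 (rU - 2 qU_i^2), at most 2 d; the drift contributes 2 (-
    x . grad Psi) / U. *)
Lemma gen_V_le C : (forall x, - dotp x (grad Psi x) <= C * U x) ->
  forall x, gen drift V x <= 2 * d%:R + 2 * C.
Proof.
move=> HC x; rewrite genE.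
have DV i y : 'D_(ei i) V y = 2 * qU i y by case: (is_derive_V y i).
have DDV i : 'D_(ei i) ('D_(ei i) V) x = 2 * (rU x - 2 * qU i x ^+ 2).
  rewrite (_ : 'D_(ei i) V = fun y => 2 * qU i y); last by apply/funext.
  have Dq := is_derive_qU x i i; rewrite (deriveZ 2 (@ex_derive _ _ _ _ _ _ _ Dq)).
  by rewrite derive_val eqxx mul1r /GRing.scale/=; ring.
have -> : \sum_(i < d) ('D_(ei i) ('D_(ei i) V) x + drift i x * 'D_(ei i) V x) =
    \sum_(i < d) (2 * (rU x - 2 * qU i x ^+ 2)) + 2 * (- dotp x (grad Psi x) * rU x).
  rewrite /dotp -sumrN mulr_suml mulr_sumr -big_split; apply: eq_bigr => i _ /=.
  by rewrite DDV DV /drift /qU /rU !mxE /partial /=; congr (_ + _); rewrite -/(ei i); ring.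
apply: lerD.
  rewrite (@le_trans _ _ (\sum_(i < d) 2))//; last by rewrite sumr_const card_ord -[leLHS]mulr_natr.
  apply: ler_sum => i _; have := sqr_ge0 (qU i x).
  have : rU x <= 1 by rewrite /rU invf_le1 ?U_gt0// U_ge1.
  lra.
rewrite ler_pM2l// ler_pdivrMr ?U_gt0//.
Qed.

Lemma drift_continuous : C_k 2 Psi -> forall i, continuous (drift i).
Proof. by move=> /(_ [:: _] isT) H i; apply: contN; case: (H i). Qed.

End drift.

Section drift_bound.
Context {R : realType} {d : nat}.
Local Notation Rd := 'rV[R]_d.
Implicit Types (f : Rd -> R) (x y v : Rd).

Lemma dotp_CS x y : `|dotp x y| <= enorm x * enorm y.
Proof.
rewrite /enorm -sqrtrM ?dotp_ge0// -sqrtr_sqr; apply: ler_wsqrtr.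
set C := dotp x y; set A := dotp x x; set B := dotp y y.
have A0 : 0 <= A by exact: dotp_ge0.
have B0 : 0 <= B by exact: dotp_ge0.
have H : 0 <= B * (A * B - C ^+ 2).
  have -> : B * (A * B - C ^+ 2) = \sum_(i < d) (B * x ord0 i - C * y ord0 i) ^+ 2.
    rewrite (eq_bigr (fun i => B ^+ 2 * (x ord0 i * x ord0 i) -
      (2 * B * C) * (x ord0 i * y ord0 i) + C ^+ 2 * (y ord0 i * y ord0 i))).
      by rewrite big_split sumrB /= -!mulr_sumr -/(dotp x x) -/(dotp x y) -/(dotp y y)
        -/A -/B -/C; ring.
    by move=> i _; ring.
  by apply: sumr_ge0 => i _; exact: sqr_ge0.
move: B0; rewrite le_eqVlt => /orP[/eqP B0|B0].
  have y0 i : y ord0 i = 0.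
    have /eqP := B0; rewrite eq_sym /B psumr_eq0; last by move=> j _; rewrite -expr2 sqr_ge0.
    by move=> /allP /(_ i); rewrite mem_index_enum => /(_ isT) /=; rewrite mulf_eq0 orbb => /eqP.
  rewrite -B0 mulr0 (_ : C = 0) ?expr0n//.
  by rewrite /C /dotp big1// => i _; rewrite y0 mulr0.
by rewrite -subr_ge0 -(pmulr_rge0 _ B0).
Qed.

(** The increment is split along the path y + w 0, ..., y + w d, which changes one coordinate at a
    time; the mean value theorem on each segment and continuity of the partial derivatives at y give
    the estimate. *)
Lemma C1_differentiable f y : (forall j x, derivable f x (ei j)) ->
  (forall j, continuous ('D_(ei j) f)) -> forall e, 0 < e ->
  exists2 dl, 0 < dl & forall v, `|v| <= dl ->
    `|f (y + v) - f y - \sum_(i < d) v ord0 i * 'D_(ei i) f y| <=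
      e * \sum_(i < d) `|v ord0 i|.
Proof.
move=> df Dc e e0.
have /choice[dl Hdl] : forall i, exists dl, 0 < dl /\
    forall v, `|v| <= dl -> `|'D_(ei i) f (y + v) - 'D_(ei i) f y| <= e.
  move=> i; have := Dc i y => /cvgrPdist_le /(_ _ e0) /nbhs_ballP[dl /= dl0 Hdl].
  exists (dl / 2); split; first by rewrite divr_gt0.
  move=> v vdl; rewrite distrC; apply: Hdl; rewrite -ball_normE /= opprD addrA subrr sub0r.
  by rewrite normrN (le_lt_trans vdl)// ltr_pdivrMr// ltr_pMr// ltr1n.
pose D := \big[Num.min/1]_i dl i.
have D0 : 0 < D by rewrite /D; elim/big_ind: _ => // [a b a0 b0|i _]; [rewrite lt_min a0|case: (Hdl i)].
have Ddl i : D <= dl i by exact: bigmin_le_cond.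
exists D => // v vD.
pose w (k : nat) : Rd := \row_i (if (i < k)%N then v ord0 i else 0).
have w0 : w 0%N = 0 by apply/rowP => i; rewrite !mxE.
have wd : w d = v by apply/rowP => i; rewrite !mxE ltn_ord.
have wS (k : 'I_d) : w k.+1 = w k + v ord0 k *: ei k.
  apply/rowP => i; rewrite !mxE ltnS leq_eqVlt eqxx /=.
  have [->|ik] := eqVneq i k; first by rewrite eqxx ltnn mulr1 add0r.
  have -> : (val i == val k) = false by apply/negbTE; rewrite val_eqE.
  by rewrite mulr0 addr0.
have -> : f (y + v) - f y = \sum_(k < d) (f (y + w k.+1) - f (y + w k)).
  rewrite -(big_mkord xpredT (fun k => f (y + w k.+1) - f (y + w k))).
  by rewrite telescope_sumr// w0 wd addr0.
rewrite -sumrB mulr_sumr (le_trans (ler_norm_sum _ _ _))//; apply: ler_sum => k _.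
rewrite wS addrA; set z := y + w k; set c := v ord0 k.
have Dt (s : R) : is_derive s (1 : R) (fun t : R => f (z + t *: ei k)) ('D_(ei k) f (z + s *: ei k)).
  by apply: is_derive_shift_line; apply/derivableP; exact: df.
have ct (a b : R) : {within `[a, b], continuous (fun t : R => f (z + t *: ei k))}.
  apply: continuous_subspaceT => s; apply/differentiable_continuous/derivable1_diffP.
  by case: (Dt s).
have [s sc ->] : exists2 s, `|s| <= `|c| &
    f (z + c *: ei k) - f z = 'D_(ei k) f (z + s *: ei k) * c.
  have [c0|c0] := leP 0 c.
    have [s] := MVT_segment c0 (fun s _ => Dt s) (ct _ _).
    rewrite in_itv /= scale0r addr0 subr0 => /andP[s0 sc] ->.
    by exists s => //; rewrite !ger0_norm.
  have [s] := MVT_segment (ltW c0) (fun s _ => Dt s) (ct _ _).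
  rewrite in_itv /= scale0r addr0 sub0r => /andP[cs s0] E.
  exists s; first by rewrite ler0_norm// ltr0_norm// lerN2.
  by rewrite -opprB E; ring.
rewrite mulrC -mulrBr normrM mulrC ler_wpM2r//.
have [_] := Hdl k; rewrite /z -addrA; apply; rewrite (le_trans _ (Ddl k))// (le_trans _ vD)//.
apply: norm_le_coord => // i; rewrite !mxE eqxx /=.
have [->|ik] := eqVneq i k.
  by rewrite ltnn add0r mulr1 (le_trans sc)// norm_coord_le.
rewrite mulr0 addr0; case: ifP => _; first exact: norm_coord_le.
by rewrite normr0.
Qed.

Lemma C1_is_derive f y v : (forall j x, derivable f x (ei j)) ->
  (forall j, continuous ('D_(ei j) f)) ->
  is_derive y v f (\sum_(i < d) v ord0 i * 'D_(ei i) f y).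
Proof.
move=> df Dc; set L := \sum_(i < d) _.
suff H : (fun h : R => h^-1 *: ((f \o shift y) (h *: v) - f y)) @ 0^' --> L.
  by apply: DeriveDef; [apply/cvg_ex; exists L|exact: (@cvg_lim R^o)].
apply/cvgrPdist_le => e e0; pose S := \sum_(i < d) `|v ord0 i|.
have S0 : 0 <= S by exact: sumr_ge0.
have e'0 : 0 < e / (1 + S) by rewrite divr_gt0// ltr_pwDl.
have [dl dl0 Hdl] := C1_differentiable y df Dc e'0.
near=> h.
have h0 : h != 0 by near: h; exact: nbhs_dnbhs_neq.
have hv : `|h *: v| <= dl.
  rewrite normrZ (@le_trans _ _ (`|h| * (1 + `|v|)))// ?ler_wpM2l ?lerDr//.
  rewrite -ler_pdivlMr ?ltr_pwDl//; near: h; apply: dnbhs0_le.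
  by rewrite divr_gt0// ltr_pwDl.
have := Hdl _ hv.
have -> : \sum_(i < d) (h *: v) ord0 i * 'D_(ei i) f y = h * L.
  by rewrite mulr_sumr; apply: eq_bigr => i _; rewrite mxE mulrA.
have -> : \sum_(i < d) `|(h *: v) ord0 i| = `|h| * S.
  by rewrite mulr_sumr; apply: eq_bigr => i _; rewrite mxE normrM.
rewrite /= [h *: v + y]addrC => H.
have -> : L - h^-1 *: (f (y + h *: v) - f y) = - (h^-1 * (f (y + h *: v) - f y - h * L)).
  by rewrite /GRing.scale/=; field.
rewrite normrN normrM normfV ler_pdivrMl ?normr_gt0// (le_trans H)//.
rewrite mulrCA ler_wpM2l// mulrAC ler_pdivrMr ?ltr_pwDl// ler_wpM2l ?(ltW e0)//.
by rewrite lerDr.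
Unshelve. all: by end_near. Qed.

Lemma subquadratic_drift (Psi : Rd -> R) : subquadratic Psi ->
  exists2 C, 0 <= C & forall x, - dotp x (grad Psi x) <= C * U x.
Proof.
move=> [_ _ [C [C0 HC]] _ _]; exists C; first exact: ltW.
move=> x; rewrite U_enorm (le_trans _ (HC x))// (le_trans _ (dotp_CS _ _))//.
by rewrite -normrN ler_norm.
Qed.

(** The derivative of s -> x . grad Psi(s x) is x^T D^2 Psi(s x) x, at least lam |x|^2. The mean
    value theorem on [0, 1] compares x . grad Psi(x) with x . grad Psi(0), whose size is at most G0
    U. *)
Lemma semiconvex_drift (Psi : Rd -> R) : C_k 2 Psi -> semiconvex Psi ->
  exists2 C, 0 <= C & forall x, - dotp x (grad Psi x) <= C * U x.
Proof.
move=> CPsi [lam Hlam].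
have dD i j x : derivable ('D_(ei i) Psi) x (ei j) by have [_] := CPsi [:: i] isT; apply.
have cD i j : continuous ('D_(ei j) ('D_(ei i) Psi)) by have [] := CPsi [:: j; i] isT.
pose G0 := \sum_(i < d) `|'D_(ei i) Psi 0|.
have G00 : 0 <= G0 by exact: sumr_ge0.
exists (`|lam| + G0); first by rewrite addr_ge0.
move=> x; pose g (s : R) := \sum_(i < d) x ord0 i * 'D_(ei i) Psi (s *: x).
have Dg (s : R) : is_derive s (1 : R) g (hessian_form Psi (s *: x) x).
  have Di i : is_derive s (1 : R) (fun s : R => 'D_(ei i) Psi (s *: x))
      (\sum_(j < d) x ord0 j * 'D_(ei j) ('D_(ei i) Psi) (s *: x)).
    apply/is_derive_line.
    have := C1_is_derive (s *: x) x (dD i) (cD i) => /is_derive_line.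
    rewrite (_ : (fun h : R => _) = (fun h : R => 'D_(ei i) Psi ((h *: 1 + s) *: x)))//.
    by apply/funext => h; rewrite scalerDl [_%:A]mulr1.
  have H : is_derive s (1 : R) (\sum_(i < d) (fun s : R => x ord0 i * 'D_(ei i) Psi (s *: x)))
     (\sum_(i < d) x ord0 i * \sum_(j < d) x ord0 j * 'D_(ei j) ('D_(ei i) Psi) (s *: x)).
    by apply: is_derive_sum => i; exact: is_deriveZ.
  rewrite (_ : g = \sum_(i < d) (fun s : R => x ord0 i * 'D_(ei i) Psi (s *: x))); last first.
    by apply/funext => t; rewrite fct_sumE.
  apply: (is_derive_eq H); rewrite /hessian_form !mxE; apply: eq_bigr => i _.
  rewrite !mxE mulrC; congr (_ * _); apply: eq_bigr => j _.
  by rewrite !mxE.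
have gc : {within `[0, 1], continuous g}.
  apply: continuous_subspaceT => s; apply/differentiable_continuous/derivable1_diffP.
  by case: (Dg s).
have [s _ E] := MVT_segment ler01 (fun s _ => Dg s) gc.
have g1 : g 1 = dotp x (grad Psi x).
  by apply: eq_bigr => i _; rewrite !mxE scale1r.
have g0 : - (G0 * U x) <= g 0.
  rewrite lerNl (le_trans (ler_norm _))// normrN (le_trans (ler_norm_sum _ _ _))//.
  rewrite mulr_suml; apply: ler_sum => i _; rewrite scale0r normrM mulrC.
  by rewrite ler_wpM2l// coord_le_U.
have H := Hlam (s *: x) x; move: E; rewrite subr0 mulr1 g1 => E; rewrite -E in H.
have en : 0 <= enorm x ^+ 2 by exact: sqr_ge0.
have h1 : - (`|lam| * U x) <= lam * enorm x ^+ 2.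
  rewrite U_enorm; have := ler_norm (- lam); rewrite normrN => ln.
  have := normr_ge0 lam; nra.
lra.
Qed.

Lemma drift_bound (Psi : Rd -> R) : C_k 2 Psi -> subquadratic Psi \/ superquadratic Psi ->
  exists2 C, 0 <= C & forall x, - dotp x (grad Psi x) <= C * U x.
Proof.
by move=> CP [/subquadratic_drift//|[_ [sc _ _ _ _]]]; exact: semiconvex_drift.
Qed.

End drift_bound.

(** * Integration against kernels and bounded convergence *)

Section kernel_probability.
Context d1 d2 (X : measurableType d1) (Y : measurableType d2) (R : realType).
Variable k : R.-pker X ~> Y.

Definition kpr (x : X) : set Y -> \bar R := k x.

HB.instance Definition _ x := Measure.on (kpr x).

HB.instance Definition _ x :=
  Measure_isProbability.Build _ _ _ (kpr x) (prob_kernel x).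

End kernel_probability.

Section mixture.
Context d1 d2 d3 (X : measurableType d1) (Y : measurableType d2)
  (Z : measurableType d3) (R : realType).
Variables (mu : {measure set X -> \bar R}) (kap : R.-pker X ~> Y)
  (nu : {measure set Z -> \bar R}) (e : X * Y -> Z).
Hypothesis me : measurable_fun setT e.
Hypothesis nuE : forall A, measurable A ->
  nu A = (\int[mu]_x kap x [set y | A (e (x, y))])%E.
Local Open Scope ereal_scope.

Let mex x : measurable_fun setT (fun y => e (x, y)).
Proof. exact: measurableT_comp me (measurable_pair1 x). Qed.

Let mixture_indic A : measurable A ->
  \int[nu]_z (\1_A z)%:E = \int[mu]_x \int[kap x]_y (\1_A (e (x, y)))%:E.
Proof.
move=> mA; rewrite integral_indic// setIT nuE//.
apply: eq_integral => x _.
have -> : (fun y => (\1_A (e (x, y)) : R)%:E) =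
    (fun y => (\1_[set y | A (e (x, y))] y)%:E) by [].
by rewrite integral_indic ?setIT// -[X in measurable X]setTI; exact: mex.
Qed.

Lemma measurable_mixture (F : Z -> \bar R) : (forall z, 0 <= F z) ->
  measurable_fun setT F ->
  measurable_fun setT (fun x => \int[kap x]_y F (e (x, y))).
Proof.
move=> F0 mF.
apply: (@measurable_fun_integral_finite_kernel _ _ _ _ _ (F \o e)).
  by move=> z; exact: F0.
exact: measurableT_comp.
Qed.

Import HBNNSimple.

Let mixture_nnsfun (f : {nnsfun Z >-> R}) :
  \int[nu]_z (f z)%:E = \int[mu]_x \int[kap x]_y (f (e (x, y)))%:E.
Proof.
have mI (r : R) x : measurable_fun setT
    (fun y => (\1_(f @^-1` [set r]) (e (x, y)) : R)%:E).
  by apply/measurable_EFinP; apply: measurableT_comp (mex x).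
have m2 (r : R) : measurable_fun setT
    (fun x => \int[kap x]_y (\1_(f @^-1` [set r]) (e (x, y)))%:E).
  apply: (measurable_mixture (F := fun z => (\1_(f @^-1` [set r]) z)%:E)).
    by move=> z; rewrite lee_fin.
  by apply/measurable_EFinP.
have ge (r : R) z : 0 <= (r * \1_(f @^-1` [set r]) z)%:E.
  by rewrite EFinM nnfun_muleindic_ge0.
under [in LHS]eq_integral do rewrite fimfunE -fsumEFin//.
rewrite ge0_integral_fsum//; last first.
  by move=> r; exact/measurable_EFinP/measurableT_comp.
have E x : \int[kap x]_y (f (e (x, y)))%:E = \sum_(r \in range f)
    \int[kap x]_y (r * \1_(f @^-1` [set r]) (e (x, y)))%:E.
  rewrite -ge0_integral_fsum//; last first.
    by move=> r; apply/measurable_EFinP/measurable_funM => //; exact/measurable_EFinP/mI.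
  by apply: eq_integral => y _; rewrite {1}fimfunE -fsumEFin.
under [in RHS]eq_integral do rewrite E.
have Z0 (r : R) z : (r < 0)%R -> (\1_(f @^-1` [set r]) z : R) = 0%R.
  by move=> r0; rewrite preimage_nnfun0// indic0.
have Zl (r : R) x : \int[kap x]_y (r * \1_(f @^-1` [set r]) (e (x, y)))%:E =
    r%:E * \int[kap x]_y (\1_(f @^-1` [set r]) (e (x, y)))%:E.
  have [r0|r0] := leP 0%R r.
    by under eq_integral do rewrite EFinM; rewrite ge0_integralZl// => y _; rewrite lee_fin.
  by rewrite !integral0_eq ?mule0// => y _; rewrite Z0// mulr0.
rewrite ge0_integral_fsum//; last 2 first.
- move=> r; under eq_fun do rewrite Zl; exact: measurable_funeM.
- by move=> r x _; apply: integral_ge0.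
apply: eq_fsbigr => r _.
under [in RHS]eq_integral do rewrite Zl.
have [r0|r0] := leP 0%R r; last first.
  rewrite !integral0_eq// => x _; last by rewrite Z0// mulr0.
  by rewrite integral0_eq ?mule0// => y _; rewrite Z0.
under eq_integral do rewrite EFinM.
rewrite !ge0_integralZl ?lee_fin//; first by rewrite mixture_indic.
- by move=> x _; apply: integral_ge0 => y _; rewrite lee_fin.
- by apply/measurable_EFinP.
Qed.

(** Here nu is the law of e(x, y) when x has law mu and y has law kap x. With [e := id] this is
    Fubini for a semidirect product, with [e := snd] the Chapman-Kolmogorov formula for integrals.
    The proof goes through indicators, simple functions and monotone limits. *)
Lemma mixture_integral (F : Z -> \bar R) : (forall z, 0 <= F z) ->
  measurable_fun setT F ->
  \int[nu]_z F z = \int[mu]_x \int[kap x]_y F (e (x, y)).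
Proof.
move=> F0 mF; pose f_ := nnsfun_approx measurableT mF.
have fF z : (f_ n z)%:E @[n --> \oo] --> F z by exact: cvg_nnsfun_approx.
have mono z a b : (a <= b)%N -> (f_ a z)%:E <= (f_ b z)%:E.
  by move=> ab; rewrite lee_fin; exact/lefP/nd_nnsfun_approx.
have m1 n x : measurable_fun setT (fun y => (f_ n (e (x, y)))%:E).
  by apply/measurable_EFinP; apply: measurableT_comp (mex x).
transitivity (\int[nu]_z limn (fun n => (f_ n z)%:E)).
  by apply: eq_integral => z _; apply/esym/cvg_lim.
rewrite monotone_convergence//; last 3 first.
- by move=> n; exact/measurable_EFinP.
- by move=> n z _; rewrite lee_fin.
- by move=> z _ a b ab; exact: mono.
transitivity (\int[mu]_x limn (fun n => \int[kap x]_y (f_ n (e (x, y)))%:E)).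
  rewrite monotone_convergence//.
  - by apply: congr_lim; apply/funext => n; exact: mixture_nnsfun.
  - move=> n; apply: (measurable_mixture (F := fun z => (f_ n z)%:E)).
      by move=> z; rewrite lee_fin.
    exact/measurable_EFinP.
  - by move=> n x _; apply: integral_ge0 => y _; rewrite lee_fin.
  - move=> x _ a b ab; apply: ge0_le_integral => //.
    + by move=> y _; rewrite lee_fin.
    + by move=> y _; exact: mono.
apply: eq_integral => x _; rewrite -monotone_convergence//.
- by apply: eq_integral => y _; apply/cvg_lim.
- by move=> n y _; rewrite lee_fin.
- by move=> y _ a b ab; exact: mono.
Qed.

End mixture.

Section mixture_bounded.
Context d1 d2 d3 (X : measurableType d1) (Y : measurableType d2)
  (Z : measurableType d3) (R : realType).
Variables (kap : R.-pker X ~> Y) (e : X * Y -> Z).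
Hypothesis me : measurable_fun setT e.

Lemma mbd_comp (f : Z -> R) (x : X) : mbd f -> mbd (fun y => f (e (x, y))).
Proof.
move=> [mf [M fM]]; split; last by exists M.
exact: measurableT_comp mf (measurableT_comp me (measurable_pair1 x)).
Qed.

(* Adding a bound of [f] reduces the bounded case to the nonnegative one. *)
Let shift_int (T : measurableType d2) (P : probability T R) (f : T -> R) M :
  mbd f -> (forall x, `|f x| <= M) ->
  (\int[P]_x (f x + M)%:E = (\int[P]_x f x + M)%:E)%E.
Proof.
move=> mf fM; rewrite -[in RHS](Int_cst P M) -IntD//; last exact: mbd_cst.
rewrite /Rintegral fineK//; apply: (integrable_fin_num measurableT).
by apply: mbd_integrable; apply: mbdD => //; exact: mbd_cst.
Qed.

Lemma mbd_kernel (f : Z -> R) : mbd f ->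
  mbd (fun x => \int[kpr kap x]_y f (e (x, y))).
Proof.
move=> mf; have [_ [M fM]] := mf.
have M0 z : 0 <= f z + M.
  by have := fM z; rewrite ler_norml => /andP[H _]; rewrite -lerBlDr sub0r.
split; last first.
  by exists M => x; apply: Int_norm => //; exact: mbd_comp.
have H : measurable_fun setT (fun x => (\int[kap x]_y (f (e (x, y)) + M)%:E)%E).
  apply: (measurable_mixture kap me (F := fun z => (f z + M)%:E)).
    by move=> z; rewrite lee_fin.
  by apply/measurable_EFinP; apply: measurable_funD => //; case: mf.
have E x : \int[kpr kap x]_y f (e (x, y)) =
    fine (\int[kap x]_y (f (e (x, y)) + M)%:E)%E - M.
  rewrite -[(\int[_]_ _ _)%E]/(\int[kpr kap x]_y (f (e (x, y)) + M)%:E)%E.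
  by rewrite shift_int ?addrK//; exact: mbd_comp.
under eq_fun do rewrite E.
apply: measurable_funB => //; exact: measurableT_comp H.
Qed.

Lemma mixture_Rintegral (mu : probability X R) (nu : probability Z R)
    (f : Z -> R) :
  (forall A, measurable A ->
     nu A = (\int[mu]_x kap x [set y | A (e (x, y))])%E) ->
  mbd f -> \int[nu]_z f z = \int[mu]_x \int[kpr kap x]_y f (e (x, y)).
Proof.
move=> nuE mf; have [_ [M fM]] := mf.
have M0 z : 0 <= f z + M.
  by have := fM z; rewrite ler_norml => /andP[H _]; rewrite -lerBlDr sub0r.
have mc c : mbd (fun=> c : R) by move=> *; exact: mbd_cst.
apply: (addIr M); rewrite -{1}(Int_cst nu M) -{2}(Int_cst mu M).
rewrite -!IntD//; last exact: mbd_kernel.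
rewrite /Rintegral; congr fine.
rewrite (mixture_integral me nuE (F := fun z => (f z + M)%:E)); last 2 first.
- by move=> z; rewrite lee_fin.
- by apply/measurable_EFinP; apply: measurable_funD => //; case: mf.
apply: eq_integral => x _.
rewrite -[(\int[kap x]_ _ _)%E]/(\int[kpr kap x]_y (f (e (x, y)) + M)%:E)%E.
by rewrite shift_int//; exact: mbd_comp.
Qed.

End mixture_bounded.

Section bounded_convergence.
Context {R : realType} {dT : measure_display} {T : measurableType dT}.

Lemma mbd_cvg (f_ : nat -> T -> R) (f : T -> R) M :
  (forall n, measurable_fun setT (f_ n)) -> (forall n x, `|f_ n x| <= M) ->
  (forall x, f_ n x @[n --> \oo] --> f x) -> mbd f.
Proof.
move=> mf fM ff; split.
  by apply: (measurable_fun_cvg (h := f_)) => // x _; exact: ff.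
exists M => x; have h : `|f_ n x| @[n --> \oo] --> `|f x| by exact: cvg_norm.
rewrite -(cvg_lim _ h)//; apply: limr_le; first by apply/cvg_ex; exists `|f x|.
by apply: nearW => n; exact: fM.
Qed.

Lemma Int_cvg (mu : probability T R) (f_ : nat -> T -> R) (f : T -> R) M :
  (forall n, measurable_fun setT (f_ n)) -> (forall n x, `|f_ n x| <= M) ->
  (forall x, f_ n x @[n --> \oo] --> f x) ->
  \int[mu]_x f_ n x @[n --> \oo] --> \int[mu]_x f x.
Proof.
move=> mf fM ff; have mbf := mbd_cvg mf fM ff.
have [] := @dominated_convergence _ _ _ mu setT measurableT
  (fun n x => (f_ n x)%:E) (EFin \o f) (cst M%:E).
- by move=> n; exact/measurable_EFinP.
- by apply/measurable_EFinP; case: mbf.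
- by apply: aeW => x _; apply: cvg_EFin; [exact: nearW|exact: ff].
- by apply: mbd_integrable; exact: mbd_cst.
- by apply: aeW => x n _; rewrite abse_EFin lee_fin.
move=> _ _ h; apply: fine_cvg => //.
rewrite /= fineK; first exact: h.
by apply: (integrable_fin_num measurableT); exact: mbd_integrable.
Qed.

(** The cap C replaces integrability: the errors e (2 V + 3) of the comparison are not known to be
    integrable, but the logarithms they perturb are bounded, so the errors may be capped. *)
Lemma Int_min_vanish (mu : probability T R) (C : R) (f : T -> R) : 0 <= C ->
  measurable_fun setT f -> (forall x, 0 <= f x) ->
  \int[mu]_x Num.min C (n.+1%:R^-1 * f x) @[n --> \oo] --> (0 : R).
Proof.
move=> C0 mf f0; rewrite -[X in _ --> X](Int_cst mu 0).
have h0 n x : 0 <= n.+1%:R^-1 * f x by rewrite mulr_ge0.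
apply: (Int_cvg (M := C)) => [n|n x|x].
- by apply: measurable_minr => //; exact: measurable_funM.
- by rewrite ger0_norm ?ge_min ?lexx// le_min C0 h0.
- have c0 : n.+1%:R^-1 * f x @[n --> \oo] --> 0.
    by rewrite -[X in _ --> X](mul0r (f x)); apply: cvgMl; exact: cvg_harmonic.
  apply: (squeeze_cvgr _ (cvg_cst 0) c0).
  by apply: nearW => n; rewrite ge_min lexx orbT le_min C0 h0.
Qed.

End bounded_convergence.

(** * Test functions determine a probability measure *)

Section test_functions_determine.
Context {R : realType} {d : nat}.
Local Notation Rd := 'rV[R]_d.

Lemma bsmooth_test (f : Rd -> R) r : bsmooth f ->
  (forall x, r < `|x| -> f x = 0) -> test_function f.
Proof.
move=> fb fr; apply: (test_function_onW (@norm_ball_compact _ _ r)).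
apply: bsmooth_test_function_on => //; apply: supp_subset.
  by apply: compact_closed; [exact: norm_hausdorff|exact: norm_ball_compact].
by move=> x /= /negP; rewrite -ltNge; exact: fr.
Qed.

Lemma test_function_outside (f : Rd -> R) : test_function f ->
  exists r, forall x, r < `|x| -> f x = 0.
Proof.
move=> [_ /compact_bounded [r [_ fr]]]; exists (r + 1) => x xr.
apply: supp_out => sx; have := fr (r + 1); rewrite ltrDl => /(_ ltr01 x sx) /=.
by rewrite leNgt xr.
Qed.

Lemma test_functionM (f g : Rd -> R) : test_function f -> bsmooth g ->
  test_function (fun x => f x * g x).
Proof.
move=> tf gb; have [r fr] := test_function_outside tf.
apply: (@bsmooth_test _ r) => [|x /fr ->]; last by rewrite mul0r.
exact/bsmoothM/gb/test_function_bsmooth.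
Qed.

Lemma test_functionZ (c : R) (f : Rd -> R) : test_function f ->
  test_function (fun x => c * f x).
Proof.
move=> tf; have := test_functionM tf (bsmooth_cst c).
by congr test_function; apply/funext => x; rewrite mulrC.
Qed.

Lemma test_functionN (f : Rd -> R) : test_function f ->
  test_function (fun x => - f x).
Proof.
move=> /(test_functionZ (-1)); congr test_function.
by apply/funext => x; rewrite mulN1r.
Qed.

Lemma test_functionD (f g : Rd -> R) : test_function f -> test_function g ->
  test_function (fun x => f x + g x).
Proof.
move=> tf tg; have [r fr] := test_function_outside tf.
have [s gs] := test_function_outside tg.
apply: (@bsmooth_test _ (Num.max r s)).
  exact: (bsmoothD (test_function_bsmooth tf) (test_function_bsmooth tg)).
by move=> x; rewrite gt_max => /andP[/fr -> /gs ->]; rewrite addr0.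
Qed.

Let box (a b : Rd) : set Rd := [set x | forall i, a ord0 i < x ord0 i < b ord0 i].

Let measurable_box a b : measurable (box a b).
Proof.
rewrite (_ : box a b = \bigcap_(i in [set: 'I_d])
    ((fun x : Rd => x ord0 i) @^-1` `](a ord0 i), (b ord0 i)[)).
  apply: fin_bigcap_measurable => // i _; rewrite -[X in measurable X]setTI.
  by apply: measurable_coord_rV => //; exact: measurable_itv.
by apply/seteqP; split => x /= h i; have := h i; rewrite /= in_itv/= => ->.
Qed.

Let bump (a b : Rd) (n : nat) (x : Rd) : R := \prod_(i < d)
  (sstep (n%:R * x ord0 i - n%:R * a ord0 i) *
   sstep (- n%:R * x ord0 i + n%:R * b ord0 i)).

Let bump_test a b n : test_function (bump a b n).
Proof.
apply: (@bsmooth_test _ (Num.max `|a| `|b|)).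
  apply: bsmooth_prod => i; apply: bsmoothM; last exact: bsmooth_sstep.
  exact: bsmooth_sstep.
move=> x mx; have [i mi] : exists i, Num.max `|a| `|b| < `|x ord0 i|.
  apply: contrapT => /forallNP h; move: mx; rewrite ltNge => /negP; apply.
  apply: norm_le_coord; first by rewrite le_max normr_ge0.
  by move=> i; rewrite leNgt; exact/negP.
move: mi; rewrite gt_max => /andP[ax bx]; rewrite /bump (bigD1 i)//=.
have := le_lt_trans (norm_coord_le a i) ax; rewrite ltr_norml => /andP[a1 a2].
have := le_lt_trans (norm_coord_le b i) bx; rewrite ltr_norml => /andP[b1 b2].
have [x0|x0] := leP 0 (x ord0 i).
  rewrite [X in _ * X * _]sstep0 ?mulr0 ?mul0r// mulNr addrC subr_le0.
  by apply: ler_wpM2l => //; rewrite ltW// -[ltRHS](ger0_norm x0).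
rewrite [X in X * _ * _]sstep0 ?mul0r// subr_le0.
by apply: ler_wpM2l => //; apply: ltW; move: a1; rewrite (ltr0_norm x0) opprK.
Qed.

Let bump01 a b n x : 0 <= bump a b n x <= 1.
Proof.
have h i : 0 <= sstep (n%:R * x ord0 i - n%:R * a ord0 i) *
   sstep (- n%:R * x ord0 i + n%:R * b ord0 i) <= 1.
  by rewrite mulr_ge0 ?sstep_ge0// mulr_ile1 ?sstep_ge0 ?sstep_le1.
apply/andP; split; first by apply: prodr_ge0 => i _; case/andP: (h i).
apply: (@le_trans _ _ (\prod_(i < d) 1)); last by rewrite big1.
by apply: ler_prod => i _; exact: h.
Qed.

Let natr_large (c e : R) : 0 < c -> \forall n \near \oo, e <= n%:R * c.
Proof.
move=> c0; near=> n; rewrite -ler_pdivrMr//; near: n; exact: nbhs_infty_ger.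
Unshelve. all: by end_near. Qed.

Let bump_cvg a b x : bump a b n x @[n --> \oo] --> (\1_(box a b) x : R).
Proof.
have [bx|nbx] := pselect (box a b x).
  have -> : (\1_(box a b) x : R) = 1 by rewrite indicE mem_set.
  apply: cvg_near_cst.
  have h (i : 'I_d) : \forall n \near \oo, 1 <= n%:R * (x ord0 i - a ord0 i) /\
      1 <= n%:R * (b ord0 i - x ord0 i).
    have /andP[ax xb] := bx i.
    near=> n; split; near: n; apply: natr_large; rewrite subr_gt0//.
  have : \forall n \near \oo, forall i, 1 <= n%:R * (x ord0 i - a ord0 i) /\
      1 <= n%:R * (b ord0 i - x ord0 i).
    apply: filter_forall => i; exact: h.
  apply: filterS => n H; rewrite /bump big1// => i _; have [h1 h2] := H i.
  by rewrite !sstep1 ?mulr1//; [rewrite mulNr addrC -mulrBr|rewrite -mulrBr].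
have -> : (\1_(box a b) x : R) = 0 by rewrite indicE memNset.
apply: cvg_near_cst.
have [i /negP xi] : exists i, ~ a ord0 i < x ord0 i < b ord0 i.
  by apply: contrapT => /forallNP h; apply: nbx => i; apply: contrapT; exact: h.
apply: nearW => n; rewrite /bump (bigD1 i)//=.
move: xi; rewrite negb_and -!leNgt => /orP[xi|xi].
  by rewrite [X in X * _ * _]sstep0 ?mul0r// -mulrBr mulr_ge0_le0// subr_le0.
rewrite [X in _ * X * _]sstep0 ?mulr0 ?mul0r// mulNr addrC -mulrBr.
by rewrite mulr_ge0_le0// subr_le0.
Unshelve. all: by end_near. Qed.

(** The products of smooth steps [bump a b n] converge boundedly to the indicator of an open box,
    and open boxes form a class stable under intersection that generates the Borel sets. *)
Lemma test_functions_determine (mu nu : probability Rd R) :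
  (forall f, test_function f -> \int[mu]_x f x = \int[nu]_x f x) ->
  forall A, measurable A -> mu A = nu A.
Proof.
move=> mnE; pose G := [set box a b | a in [set: Rd] & b in [set: Rd]].
have IE (P : probability Rd R) a b :
    \int[P]_x bump a b n x @[n --> \oo] --> fine (P (box a b)).
  have -> : fine (P (box a b)) = \int[P]_x \1_(box a b) x.
    by rewrite /Rintegral integral_indic// setIT.
  apply: (Int_cvg (f_ := bump a b) (M := 1)) => [n|n x|x]; last exact: bump_cvg.
    by have [] := test_function_mbd (bump_test a b n).
  by have /andP[h1 h2] := bump01 a b n x; rewrite ger0_norm.
have gE (n : nat) : G (box (\row_i (- n%:R)) (\row_i n%:R)).
  by eexists => //; eexists.
move=> A mA; apply: (@g_sigma_algebra_measure_unique _ R Rd G _ _ gE) => //.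
- by move=> _ [a _ [b _ <-]]; exact: measurable_box.
- apply/seteqP; split => // x _.
  exists (Num.bound `|x|) => // i; rewrite !mxE -ltr_norml.
  exact: le_lt_trans (norm_coord_le _ _) (archi_boundP (normr_ge0 x)).
- move=> _ _ [a _ [b _ <-]] [a' _ [b' _ <-]].
  exists (\row_i Num.max (a ord0 i) (a' ord0 i)) => //.
  exists (\row_i Num.min (b ord0 i) (b' ord0 i)) => //.
  apply/seteqP; split => [x /= h|x [/= h1 h2] i]; last first.
    by rewrite !mxE gt_max lt_min; have /andP[-> ->] := h1 i; exact: h2.
  by split => i; have := h i; rewrite !mxE gt_max lt_min => /andP[/andP[h1 h2] /andP[h3 h4]]; apply/andP.
- move=> _ [a _ [b _ <-]]; rewrite -[LHS]fineK ?fin_num_measure//.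
  rewrite -[RHS]fineK ?fin_num_measure//; congr EFin.
  rewrite -(cvg_lim _ (IE mu a b))// -(cvg_lim _ (IE nu a b))//.
  by congr (limn _); apply/funext => n; exact: mnE.
- by move=> k; apply: (le_lt_trans (probability_le1 _ _)) (ltry 1); exact: measurable_box.
- apply: (smallest_sub _ _ mA) => [|U oU]; first exact: smallest_sigma_algebra.
  rewrite (open_boxE oU) bigcup_mkcond.
  rewrite -[<<s _ >>]/(@measurable _ (g_sigma_algebraType G)).
  apply: (@countable_bigcupT_measurable _ (g_sigma_algebraType G)) => // -[a b].
  case: ifPn => // _; apply: sub_sigma_algebra.
  exists (\row_i ratr (a ord0 i)) => //; exists (\row_i ratr (b ord0 i)) => //.
  by apply/seteqP; split => x /= h i; have := h i; rewrite !mxE.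
Qed.

End test_functions_determine.

Section law.
Context d1 d2 (T1 : measurableType d1) (T2 : measurableType d2) (R : realType).
Variables (mu : probability T1 R) (f : T1 -> T2) (mf : measurable_fun setT f).

(** The measurability proof is an argument so that the probability structure can be attached to the
    term [law mf]. *)
Definition law of measurable_fun setT f := pushforward mu f.

Let law0 : law mf set0 = 0%E.
Proof. by rewrite /law /pushforward preimage_set0 measure0. Qed.

Let law_ge0 A : (0 <= law mf A)%E. Proof. exact: measure_ge0. Qed.

Let law_sigma_additive : semi_sigma_additive (law mf).
Proof.
move=> F mF tF mUF; rewrite /law /pushforward preimage_bigcup.
have mp A : measurable A -> measurable (f @^-1` A).
  by move=> mA; rewrite -[X in measurable X]setTI; exact: mf.
apply: (measure_semi_sigma_additive (s := mu)) => [n||].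
- exact: mp.
- apply/trivIsetP => /= i j _ _ ij; rewrite -preimage_setI.
  by move/trivIsetP : tF => /(_ _ _ _ _ ij) ->//; rewrite preimage_set0.
- by rewrite -preimage_bigcup; exact: mp.
Qed.

HB.instance Definition _ := isMeasure.Build _ _ _ (law mf)
  law0 law_ge0 law_sigma_additive.

Let law_setT : law mf setT = 1%E.
Proof. by rewrite /law /pushforward preimage_setT; exact: probability_setT. Qed.

HB.instance Definition _ := Measure_isProbability.Build _ _ _ (law mf) law_setT.

End law.

(** * The transition semigroup *)

Lemma ln_le_sub1 {R : realType} (y : R) : 0 < y -> ln y <= y - 1.
Proof.
move=> y0; have := @le_ln1Dx R (y - 1).
by rewrite (_ : 1 + (y - 1) = y); [apply; lra|ring].
Qed.

Section generator_bound.
Context {R : realType} {d : nat}.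
Local Notation Rd := 'rV[R]_d.
Variable b : 'I_d -> Rd -> R.
Hypothesis bc : forall i, continuous (b i).

Lemma gen_bnd (K : set Rd) : compact K -> exists2 B, 0 <= B &
  forall M psi, test_function_on K psi -> bnd 2 M psi ->
  forall x, `|gen b psi x| <= B * M.
Proof.
move=> cK; have H i : exists B, forall x, K x -> `|b i x| <= B.
  exact: compact_continuous_bounded.
have {H} [B HB] := choice H.
have B0 : 0 <= \sum_(i < d) `|B i| by apply: sumr_ge0.
exists (d%:R + \sum_(i < d) `|B i|); first by rewrite addr_ge0.
move=> M psi [_ psiK] psib x; rewrite mulrDl /gen.
have M0 := bnd_ge0 psib.
rewrite (le_trans (ler_normD _ _))//; apply: lerD.
  rewrite (le_trans (ler_norm_sum _ _ _))//.
  rewrite (_ : d%:R * M = \sum_(i < d) M); last by rewrite sumr_const card_ord mulr_natl.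
  by apply: ler_sum => i _; apply: (@bnd_le_norm _ _ 0); do 2!apply: bnd_derive.
rewrite (le_trans (ler_norm_sum _ _ _))// mulr_suml; apply: ler_sum => i _.
rewrite normrM; have [Kx|Kx] := pselect (K x).
  apply: ler_pM => //; first exact: (le_trans (HB i x Kx) (ler_norm _)).
  by apply: (@bnd_le_norm _ _ 1 M ('D_(ei i) psi)); exact: bnd_derive.
by rewrite derive_out_supp ?normr0 ?mulr0 ?mulr_ge0// => /psiK.
Qed.

End generator_bound.

Section semigroup.
Context {R : realType} {d : nat}.
Hypothesis hd : (0 < d)%N.
Local Notation Rd := 'rV[R]_d.
Variables (b : 'I_d -> Rd -> R) (CV : R).
Hypotheses (bc : forall i, continuous (b i)) (CV0 : 0 <= CV)
  (bV : forall x, gen b V x <= CV).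
Implicit Types (x y : Rd) (f : Rd -> R) (s t r c M B k e : R).
Variable p : R -> R.-pker Rd ~> Rd.
Hypothesis pb : forall x f, test_function f ->
  (forall t : R, 0 < t -> is_derive t (1 : R) (fun s => \int[p s x]_y f y)
     (\int[p t x]_y gen b f y)) /\
  (\int[p t x]_y f y) @[t --> 0^'+] --> f x.

(** [fundamental_solution] constrains p at positive times only; the kernel at t <= 0 is set to the
    Dirac mass, so that time 0 can serve as an endpoint. *)
Definition Pk (t : R) : R.-pker Rd ~> Rd :=
  if t <= 0 as _ return R.-pker Rd ~> Rd then kdirac (@measurable_id _ Rd setT) else p t.

Definition Pr (t : R) (x : Rd) : probability Rd R := kpr (Pk t) x.

Lemma PkE t : 0 < t -> Pk t = p t.
Proof. by rewrite /Pk leNgt => ->. Qed.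

Lemma Pr0_int t (f : Rd -> R) x : t <= 0 -> measurable_fun setT f ->
  \int[Pr t x]_y f y = f x.
Proof.
move=> t0 mf; rewrite /Pr /kpr /Pk t0 /Rintegral /kdirac/=.
by rewrite integral_dirac ?diracT ?mul1e//; exact/measurable_EFinP.
Qed.

Lemma is_derive_Pr x f t : test_function f -> 0 < t ->
  is_derive t (1 : R) (fun s => \int[Pr s x]_y f y) (\int[Pr t x]_y gen b f y).
Proof.
move=> tf t0; have [/(_ t t0) Df _] := pb x tf.
rewrite /Pr /kpr PkE//; apply: near_eq_is_derive Df.
near=> s; rewrite PkE//; near: s; exact: lt_nbhsr.
Unshelve. all: by end_near. Qed.

Lemma Pr_right0 x f : test_function f ->
  (\int[Pr t x]_y f y) @[t --> 0^'+] --> \int[Pr 0 x]_y f y.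
Proof.
move=> tf; rewrite Pr0_int//; last by case: (test_function_mbd tf).
have [_ H] := pb x tf; apply: cvg_trans H; apply: near_eq_cvg.
by near=> t; rewrite /Pr /kpr PkE.
Unshelve. all: by end_near. Qed.

(** Mean value theorem in time; the limit at 0+ in the definition of a fundamental solution gives
    continuity at the left end when s = 0. *)
Lemma Pr_increment x f s t c : test_function f -> 0 <= s -> s < t ->
  (forall r, s < r < t -> \int[Pr r x]_y gen b f y <= c) ->
  \int[Pr t x]_y f y - \int[Pr s x]_y f y <= c * (t - s).
Proof.
move=> tf s0 st H; have D r : 0 < r -> is_derive r (1 : R)
    (fun s => \int[Pr s x]_y f y) (\int[Pr r x]_y gen b f y).
  exact: is_derive_Pr.
have Cn r : 0 < r -> {for r, continuous (fun s => \int[Pr s x]_y f y)}.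
  move=> /D Dr; apply: differentiable_continuous; apply/derivable1_diffP.
  exact: ex_derive.
have [||r + ->] := @MVT R (fun s => \int[Pr s x]_y f y)
    (fun r => \int[Pr r x]_y gen b f y) s t st.
- by move=> r /[!in_itv]/= /andP[sr _]; apply: D; exact: le_lt_trans sr.
- apply/continuous_within_itvP => //; split.
  + by move=> r /[!in_itv]/= /andP[sr _]; apply: Cn; exact: le_lt_trans sr.
  + move: s0; rewrite le_eqVlt => /predU1P[<-|s0]; first exact: Pr_right0.
    exact/cvg_at_right_filter/Cn.
  + exact/cvg_at_left_filter/Cn/(le_lt_trans s0 st).
- by rewrite in_itv/= => /H h; apply: ler_wpM2r => //; rewrite subr_ge0 ltW.
Qed.

Lemma Pr_lipschitz x f s t M : test_function f -> 0 <= s -> 0 <= t ->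
  (forall y, `|gen b f y| <= M) ->
  `|\int[Pr s x]_y f y - \int[Pr t x]_y f y| <= M * `|s - t|.
Proof.
move=> tf; wlog st : s t / s <= t.
  move=> H s0 t0 fM; have [st|/ltW st] := leP s t; first exact: H.
  by rewrite distrC (distrC s); apply: H.
move=> s0 t0 fM; have gm := gen_mbd bc tf.
have M0 : 0 <= M by exact: le_trans (fM 0).
move: st; rewrite le_eqVlt => /predU1P[->|st]; first by rewrite !subrr normr0 mulr0.
rewrite distrC (distrC s) (gtr0_norm (_ : 0 < t - s)) ?subr_gt0// ler_norml.
have fM' y : - M <= gen b f y <= M by rewrite -ler_norml.
apply/andP; split; last first.
  by apply: Pr_increment => // r _; apply: Int_le_cst => // y; case/andP: (fM' y).
have tN := test_functionN tf.
have := @Pr_increment x (fun y => - f y) s t M tN s0 st.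
have fb := test_function_bsmooth tf.
have NE (P : probability Rd R) : \int[P]_y (- f y) = - \int[P]_y f y.
  have := IntZ P (-1) (test_function_mbd tf); rewrite mulN1r => <-.
  by apply: eq_Int => y; rewrite mulN1r.
rewrite !NE => H; rewrite lerNl (le_trans _ (H _))//; first by rewrite opprB opprK addrC.
move=> r _; apply: Int_le_cst; first exact: gen_mbd.
move=> y; have -> : gen b (fun y => - f y) y = - gen b f y.
  rewrite -mulN1r -(genZ b (-1) _ (bsmooth_derivable2 fb)); congr (gen b _ y).
  by apply/funext => z; rewrite mulN1r.
by rewrite lerNl; case/andP: (fM' y).
Qed.

Lemma Pr_curve_ineq T x s0 : 0 <= s0 ->
  curve_ineq b 0 T (fun s => Pr (s0 + s) x) (fun=> 0).
Proof.
move=> s00 v tv s t s1 st _ c H; rewrite subrr add0r.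
have -> : c * (t - s) = c * (s0 + t - (s0 + s)) by congr (_ * _); ring.
apply: Pr_increment => //; [exact: addr_ge0|by rewrite ltrD2l|].
move=> r /andP[r1 r2]; have := H (r - s0).
rewrite ltrBrDl r1 ltrBlDl r2 => /(_ isT); rewrite addrC subrK.
by under eq_Int do rewrite mul0r addr0.
Qed.

(** The index carries the starting point and a time shift, and the Lipschitz constant [B * M]
    depends on neither: the comparison is used for all starting points at once. *)
Lemma Pr_curve_equicont T : 
  curve_equicont T (fun (j : Rd * {s : R | 0 <= s}) s => Pr (sval j.2 + s) j.1).
Proof.
move=> K cK; exists 2%N => M eta eta0; have [B B0 HB] := gen_bnd bc cK.
exists (eta / (B * `|M| + 1)); first by rewrite divr_gt0// ltr_wpDl// mulr_ge0.
move=> [x [s0 s00]] psi psiK psib s t /andP[s1 _] /andP[t1 _] st /=.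
have tpsi := test_function_onW cK psiK.
have M0 := bnd_ge0 psib.
rewrite (le_trans (Pr_lipschitz x tpsi (addr_ge0 s00 s1) (addr_ge0 s00 t1) (HB _ _ psiK psib)))//.
have -> : s0 + s - (s0 + t) = s - t by ring.
move: st; rewrite (ger0_norm M0) ler_pdivlMr ?ltr_wpDl ?mulr_ge0// => st.
by rewrite (le_trans _ st)// mulrC; apply: ler_wpM2l => //; rewrite lerDl.
Qed.

Lemma mbd_Pr t f : mbd f -> mbd (fun x => \int[Pr t x]_y f y).
Proof. exact: (@mbd_kernel _ _ _ _ _ _ _ (Pk t) snd measurable_snd). Qed.

(* [w >= 1 + kappa P_t phi - O(kappa^2)] for the approximate subsolution [w]
   given by [key_inequality], tested on the curves started at Dirac masses. *)
Let chapman_eps x f s t B k e : test_function f -> 0 <= s -> 0 < t ->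
  (forall y, `|f y| <= B) -> 0 < k -> k * B <= 2^-1 -> 0 < e ->
  k * \int[Pr (s + t) x]_y f y <= k * (\int[Pr s x]_z \int[Pr t z]_y f y) +
    4 * (k * B) ^+ 2 + e +
    \int[Pr s x]_z Num.min 2 (e * (2 * V z + 3)).
Proof.
move=> tf s0 t0 fB k0 kB e0; have fb := test_function_bsmooth tf.
have fm := test_function_mbd tf.
have kf y : - 2^-1 <= k * f y <= 2^-1.
  rewrite -ler_norml normrM (gtr0_norm k0) (le_trans _ kB)//.
  by apply: ler_wpM2l => //; exact: ltW.
have kf2 y : (k * f y) ^+ 2 <= (k * B) ^+ 2.
  have : `|k * f y| <= k * B.
    by rewrite normrM (gtr0_norm k0); apply: ler_wpM2l => //; exact: ltW.
  by rewrite ler_norml => /andP[h1 h2]; nra.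
have w0b : bsmooth (fun y => 1 + k * f y).
  by apply: bsmoothD; [exact: bsmooth_cst|apply: bsmoothM => //; exact: bsmooth_cst].
have half0 : (0 : R) < 2^-1 by rewrite invr_gt0.
have half1 : (2^-1 : R) <= 3 / 2 by lra.
have w0m y : 2^-1 <= 1 + k * f y <= 3 / 2 by have := kf y; lra.
have w0m' y : 2^-1 <= 2 + (- 1) * (1 + k * f y) <= 3 / 2 by have := kf y; lra.
have [w [z [z' [[wb zb z'b] wm zw H]]]] := @key_inequality R d hd b CV bc CV0 bV 0 t
  (Rd * {s : R | 0 <= s})%type (fun j r => Pr (sval j.2 + r) j.1) (fun _ _ => 0)
  2^-1 (3 / 2) e 2 (- 1) (fun y => 1 + k * f y) ltr01 t0
  (fun j => @Pr_curve_ineq t j.1 _ (svalP j.2)) (@Pr_curve_equicont t)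
  half0 half1 e0 w0b w0m w0m'.
have [H1 _] := H (x, exist _ s s0).
rewrite /= addr0 subrr addr0 in H1.
have mz h : bsmooth h -> (forall y, 2^-1 <= h y <= 3 / 2) -> mbd (fun y => ln (h y)).
  by move=> hb hm; apply: bsmooth_mbd; by apply: (bsmooth_ln half0 _ hb) => y; case/andP: (hm y).
pose g y := \int[Pr t y]_u f u; have mg : mbd g by exact: mbd_Pr.
(* The second datum is 1 - k f. On the curve started at y with shift 0 its comparison reads - k P_t
   f(y) <= ln z' + errors; with ln z' <= z' - 1 this bounds w(y) from above by 1 + k P_t f(y) +
   errors. *)
have H2 y : - k * g y - 2 * (k * B) ^+ 2 <= ln (z' y) + e.
  have [_] := H (y, exist _ 0 (lexx 0)); rewrite /= !(add0r, oppr0, addr0).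
  have mz' : mbd (fun u => ln (z' u)) by apply: mz => // u; case: (wm u).
  rewrite (Pr0_int _ (lexx _)); last by case: mz'.
  apply: le_trans; rewrite -[2 * _](Int_cst (Pr t y)) -(IntZ _ (- k) fm).
  have mkf : mbd (fun u => - k * f u) by apply: mbdM => //; exact: mbd_cst.
  rewrite -IntB//; last exact: mbd_cst.
  apply: le_Int; first by apply: mbdB => //; exact: mbd_cst.
    apply: mz; last by move=> u; have := kf u; lra.
    apply: bsmoothD; first exact: bsmooth_cst.
    by apply: bsmoothM => //; exact: bsmooth_cst.
  move=> u; have -> : 2 + (- 1) * (1 + k * f u) = 1 + - k * f u by lra.
  apply: le_trans (ln_ge_quad _); last by have := kf u; lra.
  rewrite mulNr sqrrN; have := kf2 u; lra.
have V0 y : 0 <= e * (2 * V y + 3) by rewrite mulr_ge0 ?(ltW e0)//; have := V_ge0 y; lra.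
have mmin : mbd (fun y => Num.min 2 (e * (2 * V y + 3))).
  split.
    apply: measurable_minr => //; apply: measurable_funM => //.
    apply: measurable_funD => //; apply: measurable_funM => //.
    apply: continuous_measurable_rV; exact: continuous_V.
  by exists 2 => y; rewrite ger0_norm ?ge_min ?lexx// le_min V0 ler0n.
have H3 y : ln (z y) <= k * g y + 2 * (k * B) ^+ 2 + Num.min 2 (e * (2 * V y + 3)).
  have [/andP[w1 w2] /andP[z1 z2] /andP[z3 z4]] := wm y; have [zle z'le] := zw y.
  have h1 : ln (z y) <= z y - 1 by apply: ln_le_sub1; lra.
  have h2 : ln (z' y) <= z' y - 1 by apply: ln_le_sub1; lra.
  have h3 := H2 y.
  have h4 : - 2^-1 <= k * g y.
    rewrite -(IntZ _ k fm); apply: Int_ge_cst; last by move=> u; case/andP: (kf u).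
    by apply: mbdM => //; exact: mbd_cst.
  have kB2 : 0 <= (k * B) ^+ 2 by exact: sqr_ge0.
  by rewrite /Num.min; case: ifP => _; lra.
have H4 : k * \int[Pr (s + t) x]_y f y - 2 * (k * B) ^+ 2 <=
    \int[Pr (s + t) x]_y ln (1 + k * f y).
  rewrite -[2 * _](Int_cst (Pr (s + t) x)) -(IntZ _ k fm).
  have mkf : mbd (fun u => k * f u) by apply: mbdM => //; exact: mbd_cst.
  rewrite -IntB//; last exact: mbd_cst.
  apply: le_Int; [by apply: mbdB => //; exact: mbd_cst|exact: mz|].
  move=> u; apply: le_trans (ln_ge_quad _); last by case/andP: (kf u).
  have := kf2 u; lra.
have mkg : mbd (fun u => k * g u) by apply: mbdM => //; exact: mbd_cst.
have H5 : \int[Pr s x]_y ln (z y) <= k * (\int[Pr s x]_z g z) + 2 * (k * B) ^+ 2 +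
    \int[Pr s x]_y Num.min 2 (e * (2 * V y + 3)).
  rewrite -[2 * (k * B) ^+ 2](Int_cst (Pr s x)) -(IntZ _ k mg).
  have mc : mbd (fun _ : Rd => 2 * (k * B) ^+ 2) by exact: mbd_cst.
  rewrite -IntD// -IntD//; last exact: mbdD.
  apply: le_Int => //; last by apply: mbdD => //; exact: mbdD.
  by apply: mz => // u; case: (wm u).
rewrite -/g; lra.
Qed.

(** First e -> 0 for fixed k, where the capped error integrates to zero. What remains is k a <= k c
    + O(k^2), and a small k contradicts a > c. *)
Lemma chapman_le x f s t : test_function f -> 0 <= s -> 0 < t ->
  \int[Pr (s + t) x]_y f y <= \int[Pr s x]_z \int[Pr t z]_y f y.
Proof.
move=> tf s0 t0; have [_ [B' fB']] := test_function_mbd tf.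
pose B := `|B'| + 1; have B0 : 0 < B by rewrite ltr_wpDl.
have fB y : `|f y| <= B.
  by rewrite (le_trans (fB' y))// (le_trans (ler_norm _))// lerDl.
set a := \int[_]_y _; set c := \int[_]_z _.
have H1 k : 0 < k -> k * B <= 2^-1 -> k * a <= k * c + 4 * (k * B) ^+ 2.
  move=> k0 kB; rewrite -lerBlDl.
  pose h (n : nat) y := Num.min 2 (n.+1%:R^-1 * (2 * V y + 3)).
  have Ih : \int[Pr s x]_y h n y @[n --> \oo] --> (0 : R).
    apply: Int_min_vanish => // [|y]; last by have := V_ge0 y; lra.
    apply: measurable_funD => //; apply: measurable_funM => //.
    by apply: continuous_measurable_rV; exact: continuous_V.
  have Ih' : n.+1%:R^-1 * 1 + \int[Pr s x]_y h n y @[n --> \oo] --> (0 : R).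
    rewrite -[X in _ --> X]addr0; apply: cvgD => //.
    by rewrite -[X in _ --> X](mul0r 1); apply: cvgMl; exact: cvg_harmonic.
  rewrite -subr_le0; apply: (cvgr_to_ge Ih'); apply: nearW => n.
  have n0 : 0 < n.+1%:R^-1 :> R by [].
  have H : k * a <= k * c + 4 * (k * B) ^+ 2 + n.+1%:R^-1 + \int[Pr s x]_y h n y.
    exact: (@chapman_eps x f s t B k n.+1%:R^-1 tf s0 t0 fB k0 kB n0).
  by move: H; rewrite mulr1 -addrA -lerBlDl opprD addrA.
rewrite leNgt; apply/negP => ca.
pose k := Num.min (2 * B)^-1 ((a - c) / (8 * B ^+ 2)).
have B2 : 0 < B ^+ 2 by rewrite exprn_gt0.
have k0 : 0 < k by rewrite lt_min invr_gt0 mulr_gt0//= divr_gt0 ?subr_gt0 ?mulr_gt0.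
have kB : k * B <= 2^-1.
  rewrite -ler_pdivlMr//; have : k <= (2 * B)^-1 by rewrite ge_min lexx.
  by rewrite invfM.
have kac : k * (8 * B ^+ 2) <= a - c.
  by rewrite -ler_pdivlMr ?mulr_gt0// ge_min lexx orbT.
move: (k) k0 kB kac (H1 k) => {}k k0 kB kac /(_ k0 kB); rewrite exprMn.
have -> : 4 * (k ^+ 2 * B ^+ 2) = k * (k * (8 * B ^+ 2)) / 2 by move: (B) => B1; lra.
have : k * (k * (8 * B ^+ 2)) <= k * (a - c) by apply: ler_wpM2l => //; exact: ltW.
have : 0 < k * (a - c) by rewrite mulr_gt0// subr_gt0.
rewrite !mulrBr; lra.
Qed.

Lemma chapman_test x f s t : test_function f -> 0 <= s -> 0 <= t ->
  \int[Pr (s + t) x]_y f y = \int[Pr s x]_z \int[Pr t z]_y f y.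
Proof.
move=> tf s0; have fm := test_function_mbd tf.
rewrite le_eqVlt => /predU1P[<-|t0].
  by rewrite addr0; apply: eq_Int => z; rewrite Pr0_int//; case: fm.
apply/eqP; rewrite eq_le chapman_le//=.
have := chapman_le x (test_functionN tf) s0 t0.
have NE (P : probability Rd R) h : mbd h -> \int[P]_y (- h y) = - \int[P]_y h y.
  move=> mh; have := IntZ P (-1) mh; rewrite mulN1r => <-.
  by apply: eq_Int => y; rewrite mulN1r.
rewrite NE//; under [X in _ <= X -> _]eq_Int do rewrite NE//.
by rewrite NE ?lerN2//; exact: mbd_Pr.
Qed.

Lemma chapman x s t A : 0 <= s -> 0 <= t -> measurable A ->
  Pr (s + t) x A = (\int[Pr s x]_z Pr t z A)%E.
Proof.
move=> s0 t0 mA.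
pose nu := semidirect (Pr s x) (Pk t).
have m2 : measurable_fun setT (snd : Rd * Rd -> Rd) by exact: measurable_snd.
transitivity (law nu m2 A); last first.
  rewrite /law /pushforward /= /semidirect; apply: eq_integral => z _.
  by congr (Pk t z _); apply/seteqP; split => y; rewrite /xsection/= inE.
apply: test_functions_determine => // f tf; rewrite chapman_test//.
apply/esym/(@mixture_Rintegral _ _ _ _ _ _ _ (Pk t) snd m2) => [B mB|].
  rewrite /law /pushforward /= /semidirect; apply: eq_integral => z _.
  by congr (Pk t z _); apply/seteqP; split => y; rewrite /xsection/= inE.
exact: test_function_mbd.
Qed.

Lemma chapman_ge0 x s t (F : Rd -> \bar R) : 0 <= s -> 0 <= t ->
  (forall y, (0 <= F y)%E) -> measurable_fun setT F ->
  (\int[Pr (s + t) x]_y F y = \int[Pr s x]_z \int[Pr t z]_y F y)%E.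
Proof.
move=> s0 t0 F0 mF.
apply: (@mixture_integral _ _ _ _ _ _ _ (Pr s x) (Pk t) (Pr (s + t) x) snd) => //.
by move=> A mA; exact: chapman.
Qed.

End semigroup.

(** * Absolutely continuous functions of time *)

Section absolute_continuity.
Context {R : realType}.
Implicit Types (F : R -> R) (e dl : R).

Definition small_on (I : finType) dl (a b : I -> R) :=
  [/\ forall i, 0 <= a i /\ a i <= b i /\ b i <= 1,
      trivIset setT (fun i => `]a i, b i[%classic) &
      \sum_i (b i - a i) < dl].

(** Arbitrary finite index types allow the intervals of a family of partitions to be indexed by
    dependent pairs. *)
Lemma AC_fin F e : absolutely_continuous01 F -> 0 < e ->
  exists2 dl, 0 < dl & forall (I : finType) (a b : I -> R), small_on dl a b ->
    \sum_i `|F (b i) - F (a i)| < e.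
Proof.
move=> acF /acF [dl dl0 H]; exists dl => // I a b [ab tI S].
have bij : {on [pred _ | true], bijective (@enum_val I I)} := onW_bij _ (@enum_val_bij I).
rewrite (reindex _ bij)/=; apply: (H #|I| (a \o enum_val) (b \o enum_val)) => /=.
- by move=> i; exact: ab.
- by move=> i j _ _ /tI => /(_ Logic.I Logic.I) /enum_val_inj.
- by move: S; rewrite (reindex _ bij).
Qed.

(** Cutting each interval along a partition keeps the family disjoint and of the same total length,
    so the same threshold controls the variations. *)
Lemma AC_variation F e : absolutely_continuous01 F -> 0 < e ->
  exists2 dl, 0 < dl & forall n (a b : 'I_n -> R) (s : 'I_n -> seq R),
    small_on dl a b -> (forall i, itv_partition (a i) (b i) (s i)) ->
    \sum_i variation (a i) (b i) F (s i) < e.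
Proof.
move=> acF e0; have [dl dl0 H] := AC_fin acF e0; exists dl => // n a b s [ab tI S] sP.
pose x i k := nth (b i) (a i :: s i) k.
have x_le i j k : (j <= k)%N -> (k <= size (s i))%N -> x i j <= x i k.
  move=> jk ks; have [+ _] := sP i.
  rewrite -[path _ _ _]/(sorted _ (a i :: s i)) => /(sorted_ltn_nth lt_trans) h.
  move: jk; rewrite leq_eqVlt => /predU1P[->//|jk]; apply/ltW/h => //.
    by rewrite inE/= ltnS (leq_trans (ltnW jk)).
have x_a i k : (k <= size (s i))%N -> a i <= x i k.
  by move=> ks; exact: (x_le i 0%N).
have x_b i k : (k <= size (s i))%N -> x i k <= b i.
  by move=> ks; rewrite /x; apply: itv_partition_nth_le.
have := H {i : 'I_n & 'I_(size (s i))} (fun p => x (tag p) (tagged p))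
  (fun p => x (tag p) (tagged p).+1).
rewrite -(@sig_big_dep _ _ _ _ _ xpredT (fun _ => xpredT)
  (fun i (k : 'I_(size (s i))) => `|F (x i k.+1) - F (x i k)|))/=.
rewrite -(eq_bigr _ (fun i _ => big_mkord xpredT
  (fun k => `|F (x i k.+1) - F (x i k)|))); apply; split.
- move=> [i k] /=; have ki := ltn_ord k; have [a0 [_ b1]] := ab i; split.
    by rewrite (le_trans a0)// x_a// ltnW.
  by split; [exact: x_le|rewrite (le_trans _ b1)// x_b].
- move=> [i j] [i' j'] _ _ /= [z [/= z1 z2]].
  have ii : i = i'.
    apply: tI => //; exists z; move: z1 z2; rewrite /= !in_itv/=.
    move=> /andP[z1 z2] /andP[z3 z4]; split; apply/andP; split.
    + exact: le_lt_trans (x_a _ _ (ltnW (ltn_ord j))) z1.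
    + exact: lt_le_trans z2 (x_b _ _ (ltn_ord j)).
    + exact: le_lt_trans (x_a _ _ (ltnW (ltn_ord j'))) z3.
    + exact: lt_le_trans z4 (x_b _ _ (ltn_ord j')).
  subst i'; congr existT; apply/val_inj/eqP.
  move: z1 z2; rewrite /= !in_itv/= => /andP[z1 z2] /andP[z3 z4].
  rewrite eqn_leq; apply/andP; split; rewrite leqNgt; apply/negP => jj.
    have := x_le i _ _ jj (ltnW (ltn_ord j)).
    by rewrite leNgt (lt_trans z1 z4).
  have := x_le i _ _ jj (ltnW (ltn_ord j')).
  by rewrite leNgt (lt_trans z3 z2).
- rewrite -(@sig_big_dep _ _ _ _ _ xpredT (fun _ => xpredT)
    (fun i (k : 'I_(size (s i))) => x i k.+1 - x i k))/=.
  rewrite (le_lt_trans _ S)//; apply: ler_sum => i _.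
  rewrite -(big_mkord xpredT (fun k => x i k.+1 - x i k)) telescope_sumr//.
  by rewrite /x /= (itv_partition_nth_size _ (sP i)).
Qed.

Lemma AC_TV F e : absolutely_continuous01 F -> 0 < e ->
  exists2 dl, 0 < dl & forall n (a b : 'I_n -> R), small_on dl a b ->
    (forall i, total_variation (a i) (b i) F \is a fin_num) ->
    \sum_i fine (total_variation (a i) (b i) F) <= e.
Proof.
move=> acF e0; have e20 : 0 < e / 2 by rewrite divr_gt0.
have [dl dl0 H] := AC_variation acF e20.
exists dl => // n a b ab fTV; pose h := e / 2 / n.+1%:R.
have h0 : 0 < h by rewrite divr_gt0.
have sE i : exists s, itv_partition (a i) (b i) s /\
    fine (total_variation (a i) (b i) F) <= variation (a i) (b i) F s + h.
  have [_ [_ [s sP <-] <-]] := ub_ereal_sup_adherent h0 (fTV i).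
  rewrite -/(total_variation _ _ _) -[X in (X - _ < _)%E -> _]fineK// => hs.
  exists s; split => //; rewrite -lerBlDr ltW//.
have {sE} [s sP] := choice sE.
apply: (@le_trans _ _ (\sum_i (variation (a i) (b i) F (s i) + h))).
  by apply: ler_sum => i _; case: (sP i).
rewrite big_split/= sumr_const card_ord [leRHS]splitr lerD//.
  by apply/ltW/H => // i; case: (sP i).
rewrite (_ : e / 2 = h * n.+1%:R); last by rewrite /h divfK.
by rewrite -[leLHS]mulr_natr; apply: ler_wpM2l; [exact: ltW|rewrite ler_nat].
Qed.

Lemma AC_single F e : absolutely_continuous01 F -> 0 < e ->
  exists2 dl, 0 < dl & forall x y, 0 <= x <= 1 -> 0 <= y <= 1 ->
    `|x - y| < dl -> `|F x - F y| < e.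
Proof.
move=> acF e0; have [dl dl0 H] := AC_fin acF e0; exists dl => // x y.
wlog xy : x y / x <= y.
  move=> W x1 y1 xy; have [|/ltW yx] := leP x y; first by move=> /W; apply.
  by rewrite distrC; apply: W => //; rewrite distrC.
move=> /andP[x0 x1] /andP[y0 y1]; rewrite distrC ger0_norm ?subr_ge0// => xyd.
have := H 'I_1 (fun=> x) (fun=> y); rewrite !big_ord1 distrC; apply.
by split => //; [move=> i j; rewrite !ord1|rewrite big_ord1].
Qed.

Lemma AC_bounded_variation F : absolutely_continuous01 F -> bounded_variation 0 1 F.
Proof.
move=> acF; have [dl dl0 H] := AC_variation acF (@ltr01 R).
pose N := (Num.bound dl^-1).+1; have N0 : (0 : R) < N%:R by rewrite ltr0n.
have Ndl : N%:R^-1 < dl.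
  rewrite invf_plt ?posrE// (lt_le_trans (archi_boundP _))// ?invr_ge0 ?(ltW dl0)//.
  by rewrite ler_nat.
suff K k : (k <= N)%N -> (total_variation 0 (k%:R / N%:R) F <= k%:R%:E)%E.
  apply/bounded_variationP => //; have := K N (leqnn _).
  rewrite divff ?gt_eqF// => h; rewrite ge0_fin_numE ?total_variation_ge0//.
  exact: le_lt_trans h (ltry _).
elim: k => [_|k IH kN]; first by rewrite mul0r total_variationxx.
have k0 : 0 <= k%:R / N%:R :> R by rewrite divr_ge0.
have k1 : k%:R / N%:R <= k.+1%:R / N%:R :> R by rewrite ler_pM2r ?invr_gt0// ler_nat.
have k2 : k.+1%:R / N%:R <= 1 :> R by rewrite ler_pdivrMr// mul1r ler_nat.
rewrite (total_variationD _ k0 k1) -[in leRHS]natr1 EFinD; apply: leeD; first exact/IH/ltnW.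
apply: ub_ereal_sup => _ [_ [s sP <-] <-]; rewrite lee_fin ltW//.
have := H 1%N (fun=> k%:R / N%:R) (fun=> k.+1%:R / N%:R) (fun=> s).
rewrite [X in _ -> _ -> X < _]big_ord1; apply => //; split => //; first by move=> i j; rewrite !ord1.
by rewrite big_ord1 -mulrBl -natrB// subSnn mul1r.
Qed.

End absolute_continuity.

(** * Densities of absolutely continuous functions *)

Section finite_restriction.
Context d (T : measurableType d) (R : realType) (mu : {measure set T -> \bar R}).
Variables (D : set T) (mD : measurable D) (fD : (mu D < +oo)%E).

Definition frestr of (mu D < +oo)%E : set T -> \bar R := mrestr mu mD.

HB.instance Definition _ := Measure.copy (frestr fD) (mrestr mu mD).

Let frestr_fin : fin_num_fun (frestr fD).
Proof.
move=> A mA; rewrite ge0_fin_numE//; apply: le_lt_trans fD.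
have -> : frestr fD A = mu (A `&` D) by [].
by apply: le_measure; rewrite ?inE//; exact: measurableI.
Qed.

HB.instance Definition _ := Measure_isFinite.Build _ _ _ (frestr fD) frestr_fin.

End finite_restriction.

Definition cumulative_of {R : realType} (H : R -> R) (_ : nondecreasing_fun H)
  (_ : right_continuous H) := H.

HB.instance Definition _ {R : realType} (H : R -> R) (Hnd : nondecreasing_fun H)
    (Hrc : right_continuous H) :=
  isCumulative.Build R _ R (cumulative_of Hnd Hrc) Hnd Hrc.

Section monotone_density.
Context {R : realType}.
Let leb : {measure set (measurableTypeR R) -> \bar R} := @lebesgue_measure R.

(** Extends functions on [0, 1] to the line by constants, so that their Stieltjes measures can be
    formed there. *)
Definition clamp (x : R) := Num.max 0 (Num.min 1 x).

Lemma clamp_itv x : 0 <= clamp x <= 1.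
Proof. by rewrite /clamp le_max lexx/= ge_max ler01 ge_min lexx. Qed.

Lemma clamp_id x : 0 <= x <= 1 -> clamp x = x.
Proof. by move=> /andP[x0 x1]; rewrite /clamp min_r// max_r. Qed.

Lemma le_clamp x y : x <= y -> clamp x <= clamp y.
Proof.
by move=> xy; rewrite /clamp /Num.max /Num.min; repeat case: ifP; lra.
Qed.

Lemma clamp_between x y z : clamp x < z -> z < clamp y -> x < z /\ z < y.
Proof. by rewrite /clamp /Num.max /Num.min; repeat case: ifP; lra. Qed.

Lemma clamp_lipschitz x y : x <= y -> clamp y - clamp x <= y - x.
Proof. by move=> xy; rewrite /clamp /Num.max /Num.min; repeat case: ifP; lra. Qed.

Variable H : R -> R.
Hypotheses (Hnd : nondecreasing_fun H) (Hcl : forall x, H (clamp x) = H x)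
  (acH : absolutely_continuous01 H).

Let Hrc : right_continuous H.
Proof.
move=> x; apply/cvgrPdist_lt => e e0; have [dl dl0 Hdl] := AC_single acH e0.
near=> y; rewrite -(Hcl x) -(Hcl y); apply: Hdl; rewrite ?clamp_itv//.
have xy : x <= y by near: y; exact: nbhs_right_ge.
rewrite distrC ger0_norm ?subr_ge0 ?le_clamp// (le_lt_trans (clamp_lipschitz xy))//.
by rewrite ltrBlDl; near: y; apply: nbhs_right_lt; rewrite ltrDl.
Unshelve. all: by end_near. Qed.

Let mu : {measure set (measurableTypeR R) -> \bar R} :=
  lebesgue_stieltjes_measure (cumulative_of Hnd Hrc).

Let mu_itv x y : x <= y -> mu `]x, y]%classic = (H y - H x)%:E.
Proof.
move=> xy; rewrite -[LHS]/(lebesgue_stieltjes_measure (cumulative_of Hnd Hrc) `]x, y]%classic).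
rewrite /lebesgue_stieltjes_measure /measure_extension/=.
rewrite measurable_mu_extE/=; last by exists (x, y).
by rewrite wlength_itv_bnd.
Qed.

Let mD : measurable (`]0%R, 1%R]%classic : set R). Proof. exact: measurable_itv. Qed.

(** An open bounded interval J lies in ]inf J, sup J], whose Stieltjes mass is an increment of H. *)
Let hull (J : set R) : open J -> is_interval J -> J `<=` `]-1, 2[%classic ->
  exists ab : R * R, [/\ ab.1 <= ab.2, `]ab.1, ab.2[%classic `<=` J &
    (mu J <= (H ab.2 - H ab.1)%:E)%E].
Proof.
move=> oJ iJ J12; have [->|/set0P[x0 Jx0]] := eqVneq J set0.
  by exists (0, 0); split => //=; [by rewrite set_itvoo0|rewrite measure0 subrr].
have hJ x : J x -> -1 < x < 2 by move=> /J12; rewrite /= in_itv.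
have lbJ : has_inf J.
  by split; [exists x0|exists (-1) => x /hJ /andP[/ltW]].
have ubJ : has_sup J by split; [exists x0|exists 2 => x /hJ /andP[_ /ltW]].
have leI x : J x -> inf J <= x by move=> Jx; apply: ge_inf => //; case: lbJ.
have leS x : J x -> x <= sup J by move=> Jx; apply: ub_le_sup => //; case: ubJ.
exists (inf J, sup J); split => /=; first exact: le_trans (leI _ Jx0) (leS _ Jx0).
- move=> z; rewrite /= in_itv/= => /andP[z1 z2].
  rewrite -subr_gt0 in z1; rewrite -subr_gt0 in z2.
  have [x Jx xz] := inf_adherent z1 lbJ; have [y Jy yz] := sup_adherent z2 ubJ.
  apply: (iJ x y) => //.
  by move: xz yz; rewrite addrC subrK opprB addrC subrK => /ltW -> /ltW ->.
- rewrite -mu_itv; last exact: le_trans (leI _ Jx0) (leS _ Jx0).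
  apply: le_measure; rewrite ?inE.
  + by apply: open_measurable.
  + exact: measurable_itv.
  + move=> x Jx; rewrite /= in_itv/= leS// andbT.
    have /nbhs_ballP[e /= e0 eJ] : nbhs x J by exact: open_nbhs_nbhs.
    have Jy : J (x - e / 2).
      apply: eJ; rewrite /ball/= opprB addrC subrK gtr0_norm ?divr_gt0//.
      by rewrite ltr_pdivrMr// ltr_pMr// ltr1n.
    by apply: le_lt_trans (leI _ Jy) _; rewrite ltrBlDr ltrDl divr_gt0.
Qed.

(** Outer regularity puts the null set in an open set of small Lebesgue measure. Absolute continuity
    of H bounds the Stieltjes mass of finitely many of its disjoint components, uniformly in their
    number. *)
Lemma stieltjes_null (N : set R) : measurable N -> leb N = 0 ->
  mu (N `&` `]0%R, 1%R]) = 0%E.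
Proof.
move=> mN N0; set N' := N `&` _; have mN' : measurable N' by exact: measurableI.
have N'0 : leb N' = 0.
  apply/eqP; rewrite -measure_le0 -N0; apply: le_measure; rewrite ?inE//.
  exact: subIsetl.
apply/eqP; rewrite -measure_le0; apply/lee_addgt0Pr => e e0; rewrite add0e.
have [dl dl0 HAC] := AC_fin acH e0.
have N'oo : (leb N' < +oo)%E by rewrite N'0 ltry.
have [U0 [oU0 NU0 Udl0]] := lebesgue_regularity_outer mN' N'oo dl0.
(* Intersection with a bounded interval keeps the components bounded, as [hull] requires. *)
pose U := U0 `&` `]-1, 2[%classic.
have oU : open U by apply: openI => //; exact: interval_open.
have NU : N' `<=` U.
  move=> x N'x; split; first exact: NU0.
  by have [_] := N'x; rewrite /= !in_itv/= => /andP[]; lra.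
have mU0 : measurable U0 by exact: open_measurable.
have mU : measurable U by exact: open_measurable.
have lebU : (leb U < dl%:E)%E.
  apply: le_lt_trans (_ : (leb U0 < dl%:E)%E).
    by apply: le_measure; rewrite ?inE//; exact: subIsetl.
  by rewrite (measureDI leb mU0 mN') setIidr// [X in (_ + X)%E]N'0 adde0.
pose J := open_disjoint_itv oU.
have mJ q : measurable (J q) by apply: open_measurable; exact: open_disjoint_itv_open.
have UJ : U = \bigcup_q J q by exact: open_disjoint_itv_bigcup.
have tJ : trivIset setT J by exact: open_disjoint_itv_trivIset.
have hJ q : exists ab : R * R, [/\ ab.1 <= ab.2, `]ab.1, ab.2[%classic `<=` J q &
    (mu (J q) <= (H ab.2 - H ab.1)%:E)%E].
  apply: hull; first exact: open_disjoint_itv_open.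
    exact: open_disjoint_itv_is_interval.
  by move=> x Jx; have [] : U x by rewrite UJ; exists q.
have {hJ} [ab HJ] := choice hJ.
apply: (@le_trans _ _ (mu U)); first by apply: le_measure; rewrite ?inE.
rewrite UJ measure_semi_bigcup// -?UJ//.
apply: lime_le; first by apply: is_cvg_nneseries.
apply: nearW => n; rewrite big_mkord.
apply: (@le_trans _ _ (\sum_(q < n) (H (ab q).2 - H (ab q).1)%:E)%E).
  by apply: lee_sum => q _; case: (HJ q).
rewrite sumEFin lee_fin ltW//.
rewrite (eq_bigr (fun q : 'I_n => `|H (clamp (ab q).2) - H (clamp (ab q).1)|)); last first.
  by move=> q _; rewrite !Hcl ger0_norm// subr_ge0; apply: Hnd; case: (HJ q).
apply: (HAC 'I_n (fun q => clamp (ab q).1) (fun q => clamp (ab q).2)); split.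
- move=> q; have [h _ _] := HJ q; have /andP[-> _] := clamp_itv (ab q).1.
  by have /andP[_ ->] := clamp_itv (ab q).2; rewrite le_clamp.
- move=> q q' _ _ [z [/= zq zq']]; apply/val_inj/(tJ q q') => //; exists z.
  have cl r : z \in `]clamp (ab r).1, clamp (ab r).2[ -> J r z.
    have [h JJ _] := HJ r; rewrite in_itv => /= /andP[h1 h2]; apply: JJ.
    have [c1 c2] := clamp_between h1 h2.
    by rewrite /= in_itv/= ?c1 ?c2 ?(ltW c1) ?(ltW c2).
  by split; exact: cl.
- rewrite -lte_fin -sumEFin; apply: le_lt_trans lebU.
  apply: (@le_trans _ _ (\sum_(q < n) leb (J q))%E).
    apply: lee_sum => q _; have [h JJ _] := HJ q.
    apply: (@le_trans _ _ (leb `](ab q).1, (ab q).2[%classic)); last first.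
      by apply: le_measure; rewrite ?inE; [exact: measurable_itv|exact: mJ|exact: JJ].
    rewrite [X in (_ <= X)%E](lebesgue_measure_itv `](ab q).1, (ab q).2[)/=; case: ifPn => [_|].
      by rewrite lee_fin clamp_lipschitz.
    rewrite lte_fin -leNgt => h'; have -> : (ab q).1 = (ab q).2 by apply/eqP; rewrite eq_le h h'.
    by rewrite subrr.
  rewrite -measure_bigsetU_ord//; last by move=> q q' _ _ /tJ => /(_ I I) /val_inj.
  apply: le_measure; rewrite ?inE; last by rewrite UJ; exact: bigsetU_bigcup.
    by apply: bigsetU_measurable => q _; exact: mJ.
  exact: mU.
by move=> q; exact: mJ.
Qed.

Let restr_fin : (mu `]0%R, 1%R]%classic < +oo)%E.
Proof. by rewrite mu_itv// ltry. Qed.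

(** Radon-Nikodym for the Stieltjes measure of H restricted to ]0, 1], absolutely continuous by
    [stieltjes_null]. *)
Lemma monotone_density : exists g : R -> R, leb.-integrable setT (EFin \o g) /\
  forall s t, 0 <= s -> s <= t -> t <= 1 ->
  (H t - H s)%:E = (\int[leb]_(x in `]s, t]) (g x)%:E)%E.
Proof.
pose nu := charge_of_finite_measure
  (@frestr _ (measurableTypeR R) R mu `]0%R, 1%R]%classic mD restr_fin).
have nul : nu `<< leb.
  apply/null_content_dominatesP => A mA A0; exact: stieltjes_null.
pose g := Radon_Nikodym nu leb.
have gE : EFin \o (fine \o g) = g.
  by apply/funext => x /=; rewrite fineK//; exact: Radon_Nikodym_fin_num.
exists (fine \o g); rewrite gE; split; first exact: Radon_Nikodym_integrable.
move=> s t s0 st t1; rewrite -mu_itv//.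
transitivity (nu `]s, t]%classic).
  transitivity (mu (`]s, t]%classic `&` `]0%R, 1%R]%classic)); last by [].
  congr (mu _); rewrite setIidl//.
  by move=> x /=; rewrite !in_itv/= => /andP[h1 h2]; rewrite (le_lt_trans s0)//= (le_trans h2).
apply: (etrans (Radon_Nikodym_integral nul (measurable_itv _))).
by apply: eq_integral => x _; rewrite -[(fine \o g) x]/(fine (g x)) fineK//; exact: Radon_Nikodym_fin_num.
Qed.

End monotone_density.

Section fundamental_theorem.
Context {R : realType}.
Let leb : {measure set (measurableTypeR R) -> \bar R} := @lebesgue_measure R.
Variable F : R -> R.
Hypothesis acF : absolutely_continuous01 F.

Let TVfin s t : 0 <= s -> s <= t -> t <= 1 -> total_variation s t F \is a fin_num.
Proof.
move=> s0 st t1; apply/bounded_variationP => //.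
have BV := AC_bounded_variation acF.
apply: (bounded_variationr s0 st); exact: (bounded_variationl (le_trans s0 st) t1).
Qed.

Let H x := fine (total_variation 0 (clamp x) F).

Let HB s t : 0 <= s -> s <= t -> t <= 1 -> H t - H s = fine (total_variation s t F).
Proof.
move=> s0 st t1; rewrite /H !clamp_id ?s0 ?(le_trans s0)//= ?(le_trans st)//.
rewrite (total_variationD _ s0 st) fineD ?TVfin//; first by rewrite addrAC subrr add0r.
exact: le_trans t1.
Qed.

Let dF s t : 0 <= s -> s <= t -> t <= 1 -> `|F t - F s| <= H t - H s.
Proof.
by move=> s0 st t1; rewrite HB// -lee_fin fineK ?TVfin// total_variation_ge.
Qed.

Let H1 x := H x + F (clamp x).

Let clampK (x : R) : clamp (clamp x) = clamp x.
Proof. by rewrite clamp_id// clamp_itv. Qed.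

Let Hcl x : H (clamp x) = H x. Proof. by rewrite /H clampK. Qed.

Let H1cl x : H1 (clamp x) = H1 x. Proof. by rewrite /H1 Hcl clampK. Qed.

Let clamp_step x y : x <= y -> `|F (clamp y) - F (clamp x)| <= H y - H x.
Proof.
move=> xy; rewrite -(Hcl x) -(Hcl y); apply: dF; last by case/andP: (clamp_itv y).
  by case/andP: (clamp_itv x).
exact: le_clamp.
Qed.

Let Hnd : nondecreasing_fun H.
Proof. by move=> x y /clamp_step h; rewrite -subr_ge0 (le_trans _ h). Qed.

Let H1nd : nondecreasing_fun H1.
Proof.
move=> x y /clamp_step; rewrite ler_norml /H1 => /andP[h _]; lra.
Qed.

Let acH : absolutely_continuous01 H.
Proof.
move=> e e0; have e20 : 0 < e / 2 by rewrite divr_gt0.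
have [dl dl0 HTV] := AC_TV acF e20; exists dl => // n a b ab tI S.
rewrite (le_lt_trans _ (_ : e / 2 < e))//; last by rewrite ltr_pdivrMr// ltr_pMr// ltr1n.
rewrite (eq_bigr (fun i => fine (total_variation (a i) (b i) F))).
  by apply: HTV => [|i]; [split|apply: TVfin; have [? []] := ab i].
move=> i _; have [h1 [h2 h3]] := ab i.
by rewrite ger0_norm ?subr_ge0 ?HB//; exact: Hnd.
Qed.

Let acH1 : absolutely_continuous01 H1.
Proof.
move=> e e0; have e20 : 0 < e / 2 by rewrite divr_gt0.
have [dl1 dl10 D1] := acH e20; have [dl2 dl20 D2] := acF e20.
exists (Num.min dl1 dl2); first by rewrite lt_min dl10.
move=> n a b ab tI; rewrite lt_min => /andP[S1 S2].
rewrite [ltRHS]splitr; apply: le_lt_trans (ltrD (D1 n a b ab tI S1) (D2 n a b ab tI S2)).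
rewrite -big_split; apply: ler_sum => i _; have [h1 [h2 h3]] := ab i.
rewrite /H1 !clamp_id ?h1 ?(le_trans h2) ?(le_trans h1)//=.
by rewrite opprD addrACA ler_normD.
Qed.

(** F is the difference of H + F and H, with H the total variation from 0; both are nondecreasing
    and absolutely continuous, so both have densities. The derivative almost everywhere is then
    Lebesgue differentiation of the primitive. *)
Lemma AC_FTC : exists g : R -> R, [/\ leb.-integrable setT (EFin \o g),
  forall s t, 0 <= s -> s <= t -> t <= 1 ->
    (F t - F s)%:E = (\int[leb]_(x in `]s, t]) (g x)%:E)%E &
  {ae leb, forall x : R, 0 < x < 1 -> is_derive x (1 : R) F (g x)}].
Proof.
have [g1 [ig1 g1E]] := monotone_density H1nd H1cl acH1.
have [g2 [ig2 g2E]] := monotone_density Hnd Hcl acH.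
pose g x := g1 x - g2 x.
have gE : EFin \o g = (fun x => (EFin \o g1) x - (EFin \o g2) x)%E by [].
have ig : leb.-integrable setT (EFin \o g) by rewrite gE; exact: integrableB.
have FE s t : 0 <= s -> s <= t -> t <= 1 ->
    (F t - F s)%:E = (\int[leb]_(x in `]s, t]) (g x)%:E)%E.
  move=> s0 st t1; have mI : measurable (`]s, t]%classic : set R) by exact: measurable_itv.
  transitivity (\int[leb]_(x in `]s, t]) ((g1 x)%:E - (g2 x)%:E))%E; last by [].
  rewrite integralB//; last 2 first.
  - by apply: integrableS ig1.
  - by apply: integrableS ig2.
  rewrite -g1E// -g2E// -EFinB /H1 !clamp_id ?s0 ?(le_trans s0)//= ?(le_trans st)//.
  by congr EFin; ring.
exists g; split => //.
have igS y : leb.-integrable [set` Interval (BRight 0) (BRight y)] (EFin \o g).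
  by apply: integrableS ig => //; exact: measurable_itv.
have lg : locally_integrable [set: R] g by apply: open_integrable_locally => //; exact: openT.
have := FTC1 igS lg; apply: filterS; first exact: (ae_filter_ringOfSetsType leb).
move=> x Hx /andP[x0 x1].
have [//|D E] := Hx.
have nearF : \forall y \near x,
    (\int[leb]_(t in [set` Interval (BRight 0) (BRight y)]) g t)%R + F 0 = F y.
  near=> y; have y0 : 0 < y by near: y; exact: lt_nbhsr.
  have y1 : y < 1 by near: y; exact: lt_nbhsl.
  by rewrite /Rintegral -FE ?(ltW y0) ?(ltW y1)//= subrK.
apply: (near_eq_is_derive nearF).
rewrite -[g x]addr0; apply: is_deriveD.
exact: (DeriveDef D (etrans (esym (derive1E _ x)) E)).
Unshelve. all: by end_near. Qed.

End fundamental_theorem.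

(** * Lower integrals and transport costs *)

Section lower_integral.
Context d (T : measurableType d) (R : realType) (mu : {measure set T -> \bar R}).
Local Open Scope ereal_scope.
Implicit Types (f u h : T -> \bar R) (A B C D : set T).

(* No measurability is needed: the integral of a nonnegative function is a
   supremum over simple functions below it. *)
Lemma le_lower_integral D u f : (forall x, 0 <= u x) -> (forall x, 0 <= f x) ->
  (forall x, D x -> u x <= f x) -> \int[mu]_(x in D) u x <= \int[mu]_(x in D) f x.
Proof.
move=> u0 f0 uf; rewrite !ge0_integralE//.
apply: ereal_sup_le => _ [g gu <-]; exists g => // x.
apply: le_trans (gu x) _; rewrite !patchE; case: ifPn => // /set_mem; exact: uf.
Qed.

Import HBNNSimple.

(** The norm of the defect is not known to be measurable in time, so its integral is only a supremum
    over simple functions below it. Superadditivity still holds when f has an integrable minorant h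
    on one of the two pieces. *)
Lemma lower_integral_superadditive A B C f h : measurable A -> measurable B ->
  A `<=` C -> B `<=` C -> A `&` B = set0 -> (forall x, 0 <= f x) ->
  (forall x, 0 <= h x) -> measurable_fun B h -> (forall x, B x -> h x <= f x) ->
  \int[mu]_(x in B) h x \is a fin_num ->
  \int[mu]_(x in A) f x + \int[mu]_(x in B) h x <= \int[mu]_(x in C) f x.
Proof.
move=> mA mB AC BC AB f0 h0 mh hf hfin; rewrite -leeBrDr//.
rewrite [leLHS]ge0_integralE//; apply: ge_ereal_sup => _ [g gf <-].
rewrite leeBrDr// -integralT_nnsfun [X in _ + X <= _]integral_mkcond.
have mhB : measurable_fun setT (h \_ B) by apply/(measurable_restrictT _ _).1.
have hB0 x : 0 <= (h \_ B) x by rewrite patchE; case: ifP.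
rewrite -ge0_integralD//; last 2 first.
- by move=> x _; rewrite lee_fin.
- exact/measurable_EFinP.
rewrite [leRHS]integral_mkcond; apply: le_lower_integral => //.
- by move=> x; rewrite adde_ge0// lee_fin.
- by move=> x; rewrite patchE; case: ifP.
move=> x _; have := gf x; rewrite !patchE.
case: ifPn => xA; case: ifPn => xB; case: ifPn => xC; rewrite ?adde0//.
- by exfalso; have : set0 x by rewrite -AB; split; exact/set_mem.
- by exfalso; have : set0 x by rewrite -AB; split; exact/set_mem.
- by move: xC; rewrite mem_set//; exact/AC/set_mem.
- move=> g0; rewrite -[leRHS]add0e; apply: leeD => //.
  exact/hf/set_mem.
- by move: xC; rewrite mem_set//; exact/BC/set_mem.
- by move=> /le_trans; apply.
Qed.

End lower_integral.

Section laws.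
Context d1 d2 (T1 : measurableType d1) (T2 : measurableType d2) (R : realType).

Lemma Int_law (mu : probability T1 R) (m : T1 -> T2) (mm : measurable_fun setT m)
  (f : T2 -> R) : mbd f -> \int[law mu mm]_x f x = \int[mu]_x f (m x).
Proof.
move=> mf; rewrite /Rintegral; congr fine.
rewrite -[LHS]/(\int[pushforward mu m]_x (EFin \o f) x)%E integral_pushforward//.
- by case: mf => mf _; exact/measurable_EFinP.
- have mfm : mbd (fun x => f (m x)).
    by case: mf => mf [M fM]; split; [exact: measurableT_comp|exists M].
  by rewrite preimage_setT; exact: (mbd_integrable mu mfm).
Qed.

Lemma Int_eq_measure (mu nu : probability T1 R) (f : T1 -> R) :
  (forall A, measurable A -> mu A = nu A) -> \int[mu]_x f x = \int[nu]_x f x.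
Proof.
move=> E; rewrite /Rintegral; congr fine.
by apply: eq_measure_integral => A mA _; exact: E.
Qed.

End laws.

Section transport_cost.
Context {R : realType} {d : nat}.
Local Notation Rd := 'rV[R]_d.
Implicit Types (f : Rd -> R) (mu nu : probability Rd R).

Lemma measurable_sqenorm : measurable_fun setT (fun x : Rd => enorm x ^+ 2).
Proof.
rewrite (_ : (fun x => _) = fun x : Rd => \sum_(i < d) x ord0 i * x ord0 i); last first.
  by apply/funext => x; rewrite /enorm sqr_sqrtr// dotp_ge0.
apply: measurable_sum => i; apply: measurable_funM; exact: measurable_coord_rV.
Qed.

Lemma measurable_cost :
  measurable_fun setT (fun xy : Rd * Rd => enorm (xy.1 - xy.2) ^+ 2).
Proof.
apply: (measurableT_comp measurable_sqenorm).
apply: measurable_fun_rV => i; under eq_fun do rewrite !mxE.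
apply: measurable_funB.
  exact: measurableT_comp (measurable_coord_rV i) measurable_fst.
exact: measurableT_comp (measurable_coord_rV i) measurable_snd.
Qed.

Lemma bnd1_lipschitz M f x y : bnd 1 M f -> `|f x - f y| <= d%:R * M * enorm (x - y).
Proof.
move=> fM; have M0 := bnd_ge0 fM; set v := x - y.
have Dc j : continuous ('D_(ei j) f) by apply: (bnd_continuous (bnd_derive j fM)).
have D (s : R) : is_derive s (1 : R) (fun s : R => f (y + s *: v))
    (\sum_(i < d) v ord0 i * 'D_(ei i) f (y + s *: v)).
  have /is_derive_line H := C1_is_derive (y + s *: v) v (fun j x => @bnd_derivable _ _ 0 M f j x fM) Dc.
  apply/is_derive_line; rewrite (_ : (fun h : R => _) = fun h : R => f (h *: v + (y + s *: v)))//.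
  apply/funext => h; have -> : h%:A = h :> R by exact: mulr1.
  by rewrite scalerDl addrCA.
have cL : {within `[0, 1], continuous (fun s : R => f (y + s *: v))}.
  apply: continuous_subspaceT => s; apply: differentiable_continuous.
  by apply/derivable1_diffP; exact: ex_derive.
have [z _ E] := MVT ltr01 (fun s _ => D s) cL.
have yv : y + v = x by rewrite /v addrC subrK.
move: E; rewrite scale1r scale0r addr0 yv subr0 mulr1 => ->.
rewrite (le_trans (ler_norm_sum _ _ _))//.
have -> : d%:R * M * enorm (x - y) = \sum_(i < d) enorm (x - y) * M.
  by rewrite sumr_const card_ord -mulr_natl; ring.
apply: ler_sum => i _; rewrite normrM; apply: ler_pM => //.
  rewrite /enorm -sqrtr_sqr; apply: ler_wsqrtr.
  by rewrite /dotp (bigD1 i)//= expr2 lerDl sumr_ge0// => j _; exact: sqr_ge0.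
exact: (bnd_le_norm (y + z *: v) (bnd_derive i fM)).
Qed.

(* AM-GM: L |x - y| <= dl + L^2 |x - y|^2 / (4 dl). *)
Lemma coupling_test M f mu nu g dl k : coupling mu nu g -> bnd 1 M f -> 0 < dl ->
  (\int[g]_xy (enorm (xy.1 - xy.2) ^+ 2)%:E <= k%:E)%E ->
  `|\int[mu]_x f x - \int[nu]_x f x| <= dl + (d%:R * M) ^+ 2 / (4 * dl) * k.
Proof.
move=> gc fM dl0 gk.
have mf : mbd f.
  split; first by apply: continuous_measurable_rV; exact: bnd_continuous fM.
  by exists M => x; exact: bnd_le_norm fM.
have m1 : measurable_fun setT (fst : Rd * Rd -> Rd) by exact: measurable_fst.
have m2 : measurable_fun setT (snd : Rd * Rd -> Rd) by exact: measurable_snd.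
have E1 : \int[mu]_x f x = \int[g]_x f x.1.
  rewrite -(Int_law g m1 mf); apply: Int_eq_measure => A mA.
  by rewrite -(gc A mA).1 /law /pushforward; congr (g _); apply/seteqP; split => x //= [].
have E2 : \int[nu]_x f x = \int[g]_x f x.2.
  rewrite -(Int_law g m2 mf); apply: Int_eq_measure => A mA.
  by rewrite -(gc A mA).2 /law /pushforward; congr (g _); apply/seteqP; split => x //= [].
have mfc m : measurable_fun setT m -> mbd (fun x : Rd * Rd => f (m x)).
  by move=> mm; case: mf => mf [N fN]; split; [exact: measurableT_comp mf mm|exists N].
have mF : mbd (fun x : Rd * Rd => f x.1 - f x.2) by apply: mbdB; exact: mfc.
rewrite E1 E2 -IntB; [|exact: mfc|exact: mfc].
set K := _ / _; have K0 : 0 <= K by rewrite divr_ge0 ?sqr_ge0// mulr_ge0// ltW.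
rewrite -lee_fin.
have -> : (`|\int[g]_x (f x.1 - f x.2)|%:E = `|\int[g]_x (f x.1 - f x.2)%:E|)%E.
  by rewrite /Rintegral -abse_EFin fineK//; exact: integrable_fin_num (mbd_integrable g mF).
apply: (le_trans (le_abse_integral _ _ _)) => //; first by apply/measurable_EFinP; case: mF.
have mcost : measurable_fun setT (fun x : Rd * Rd => (enorm (x.1 - x.2) ^+ 2)%:E).
  by apply/measurable_EFinP; exact: measurable_cost.
apply: (@le_trans _ _ (\int[g]_x (dl%:E + K%:E * (enorm (x.1 - x.2) ^+ 2)%:E))%E).
  apply: ge0_le_integral => //.
  - by apply: measurableT_comp => //; apply/measurable_EFinP; case: mF.
  - by apply: emeasurable_funD => //; exact: measurable_funeM.
  - move=> [x y] _ /=; rewrite -EFinM -EFinD lee_fin.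
    apply: le_trans (bnd1_lipschitz x y fM) _; rewrite /K.
    set L := d%:R * M; set e := enorm _.
    have -> : dl + L ^+ 2 / (4 * dl) * e ^+ 2 = L * e + (2 * dl - L * e) ^+ 2 / (4 * dl).
      by field; rewrite gt_eqF.
    by rewrite lerDl divr_ge0 ?sqr_ge0// mulr_ge0// ltW.
rewrite ge0_integralD//; last 3 first.
- by move=> x _; rewrite lee_fin ltW.
- by move=> x _; rewrite mule_ge0// lee_fin ?sqr_ge0.
- exact: measurable_funeM.
rewrite integral_cst// [X in (_ * X)%E](probability_setT g) mule1 EFinD leeD2l//.
rewrite ge0_integralZl//; last by move=> x _; rewrite lee_fin sqr_ge0.
have K0' : (0 <= K%:E)%E by rewrite lee_fin.
by rewrite EFinM; exact: (lee_wpmul2l K0' gk).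
Qed.

Lemma W2_coupling mu nu (k : R) : 0 < k -> (W2 mu nu < k%:E)%E ->
  exists2 g, coupling mu nu g &
    (\int[g]_xy (enorm (xy.1 - xy.2) ^+ 2)%:E <= (k ^+ 2)%:E)%E.
Proof.
move=> k0; rewrite /W2; set I := ereal_inf _ => Ik.
have I0 : (0 <= I)%E.
  apply: le_ereal_inf_tmp => _ [g _ <-]; apply: integral_ge0 => x _; rewrite lee_fin; exact: sqr_ge0.
suff : (I < (k ^+ 2)%:E)%E.
  by move=> /ereal_inf_lt[_ [g gc <-] /ltW gk]; exists g.
rewrite ltNge; apply/negP => kI.
have : (k%:E <= I `^ 2^-1)%E; last by rewrite leNgt Ik.
case: I I0 kI {Ik} => [r| |]// r0; last by rewrite poweRyr ?leey.
rewrite poweR_EFin !lee_fin => kr; rewrite powR12_sqrt//.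
by rewrite -(ger0_norm (ltW k0)) -sqrtr_sqr; apply: ler_wsqrtr.
Qed.

End transport_cost.

(** * Time regularity of an admissible curve *)

Section curve_regularity.
Context {R : realType} {d : nat}.
Local Notation Rd := 'rV[R]_d.
Variables (rho0 rho1 : probability Rd R) (c : R -> probability Rd R).
Hypotheses (cW : W2_curve rho0 rho1 c) (cAC : distr_abs_continuous c).

Let Fc (f : Rd -> R) (t : R) : R := \int[c t]_x f x.

Lemma curve_continuous (f : Rd -> R) (t e : R) : test_function f -> 0 <= t <= 1 -> 0 < e ->
  exists2 dl : R, 0 < dl & forall s, 0 <= s <= 1 -> `|s - t| < dl -> `|Fc f s - Fc f t| <= e.
Proof.
move=> tf t01 e0; have [M fM] := test_function_bsmooth tf 1%N.
have e20 : 0 < e / 2 by rewrite divr_gt0.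
pose K := (d%:R * M) ^+ 2 / (4 * (e / 2)).
have K0 : 0 <= K by rewrite divr_ge0 ?sqr_ge0// mulr_ge0// ltW.
(* By [coupling_test] a coupling of cost at most k^2 changes the integral of f by at most e / 2 + K
   k^2, hence by at most e. *)
pose k := Num.sqrt (e / 2 / (K + 1)).
have k2 : k ^+ 2 = e / 2 / (K + 1).
  by rewrite /k sqr_sqrtr// divr_ge0 ?(ltW e20)// addr_ge0.
have k0 : 0 < k by rewrite sqrtr_gt0 divr_gt0// ltr_wpDl.
have [_ cont _ _] := cW; have t01' : `[0%R, 1%R]%classic t by rewrite /= in_itv.
have k0e : (0 < k%:E)%E by rewrite lte_fin.
have nk : nbhs (0%E : \bar R) [set y : \bar R | (y < k%:E)%E] by exact: lt_nbhsl.
have /nbhs_ballP[dl /= dl0 H] := cont t t01' _ nk.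
exists dl => // s s01 st.
have Ws : (W2 (c s) (c t) < k%:E)%E.
  by apply: H; [rewrite /ball/= distrC|rewrite /= in_itv].
have [g gc gk] := W2_coupling k0 Ws.
rewrite /Fc (le_trans (coupling_test gc fM e20 gk))// -/K k2 [leRHS]splitr lerD2l.
by rewrite mulrA ler_pdivrMr ?ltr_wpDl// mulrC ler_wpM2l ?(ltW e20)// lerDl.
Qed.

(** U contains a ball of finitely many seminorms, so every psi with [bnd N M psi] enters U after
    multiplication by e / (M + 1). The definition of absolute continuity concerns times in ]0, 1[;
    the closed interval is reached by continuity. *)
Lemma curve_AC (K : set Rd) : compact K -> exists N G, absolutely_continuous01 G /\
  forall M, exists2 C, 0 <= C & forall psi, test_function_on K psi -> bnd N M psi ->
  forall s t, 0 <= s <= 1 -> 0 <= t <= 1 -> `|Fc psi s - Fc psi t| <= C * `|G s - G t|.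
Proof.
move=> cK; have [U [G [[UK [N [e [e0 HU]]]] acG HG]]] := cAC cK.
exists N, G; split => // M; exists ((`|M| + 1) / e).
  by rewrite divr_ge0 ?(ltW e0)// addr_ge0.
move=> psi psiK psib; have tpsi := test_function_onW cK psiK.
have M0 := bnd_ge0 psib.
pose a := e / (M + 1); have a0 : 0 < a by rewrite divr_gt0// ltr_wpDl.
have Upsi : U (fun x => a * psi x).
  apply: HU; split.
    apply: bsmooth_test_function_on.
      by apply: bsmoothM; [exact: bsmooth_cst|exact: test_function_bsmooth].
    have [_ sK] := psiK; apply: subset_trans sK; apply: closure_subset => x /=.
    by apply: contraNN => /eqP ->; rewrite mulr0.
  move=> s x sN; have aM : bnd N (a * M) (fun x => a * psi x).
    by have := bndZ a psib; rewrite (gtr0_norm a0).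
  rewrite (le_lt_trans (bnd_le_norm x (bnd_partial aM sN)))//.
  by rewrite /a mulrAC ltr_pdivrMr ?ltr_wpDl// ltr_pM2l// ltrDl.
have inner s t : 0 < s < 1 -> 0 < t < 1 ->
    `|Fc psi s - Fc psi t| <= (M + 1) / e * `|G s - G t|.
  move=> s01 t01; have := HG t s _ t01 s01 Upsi.
  rewrite /= !IntZ; [|exact: test_function_mbd|exact: test_function_mbd].
  rewrite -mulrBr normrM (gtr0_norm a0) -/(Fc psi s) -/(Fc psi t) /a => h.
  by rewrite -ler_pdivrMl ?divr_gt0// ?ltr_wpDl// invf_div.
move=> s t s01 t01; rewrite (ger0_norm M0); set C := (M + 1) / e.
have C0 : 0 <= C by rewrite divr_ge0 ?(ltW e0)// addr_ge0.
apply/ler_addgt0Pr => eta eta0; pose h := eta / (2 * (C + 1)).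
have h0 : 0 < h by rewrite divr_gt0// mulr_gt0// ltr_wpDl.
have [g1 g10 HG1] := AC_single acG h0.
have app u : 0 <= u <= 1 -> exists v, [/\ 0 < v < 1, `|Fc psi u - Fc psi v| <= h &
    `|G u - G v| <= h].
  move=> u01; have [dl dl0 Hdl] := curve_continuous tpsi u01 h0.
  pose th := Num.min 1 (Num.min dl g1).
  have th0 : 0 < th by rewrite !lt_min ltr01 dl0.
  have [th1 th2 th3] : [/\ th <= 1, th <= dl & th <= g1].
    by rewrite !ge_min !lexx !orbT.
  (* This point lies in ]0, 1[ and within th of u, also when u is 0 or 1. *)
  have v01 : 0 < (1 - th / 2) * u + th / 4 < 1 by nra.
  have uv : `|(1 - th / 2) * u + th / 4 - u| < th.
    by rewrite ltr_norml; nra.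
  exists ((1 - th / 2) * u + th / 4); split => //.
    rewrite distrC; apply: Hdl; first by case/andP: v01 => /ltW -> /ltW ->.
    exact: lt_le_trans uv th2.
  apply/ltW/HG1 => //; first by case/andP: v01 => /ltW -> /ltW ->.
  by rewrite distrC (lt_le_trans uv).
have [s' [s'01 Fs Gs]] := app s s01; have [t' [t'01 Ft Gt]] := app t t01.
have Fst := inner s' t' s'01 t'01; rewrite -/C in Fst.
have e1 : (C + 1) * h * 2 = eta.
  by rewrite /h; field; rewrite gt_eqF// ltr_wpDl.
have G' : `|G s' - G t'| <= `|G s - G t| + 2 * h.
  have -> : G s' - G t' = (G s - G t) - (G s - G s') + (G t - G t') by ring.
  rewrite (le_trans (ler_normD _ _))// (le_trans (lerD (ler_normB _ _) (lexx _)))//; lra.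
have -> : Fc psi s - Fc psi t = (Fc psi s - Fc psi s') + (Fc psi s' - Fc psi t') -
    (Fc psi t - Fc psi t') by ring.
rewrite (le_trans (ler_normB _ _))// (le_trans (lerD (ler_normD _ _) (lexx _)))//.
have CG := ler_wpM2l C0 G'; rewrite mulrDr in CG; lra.
Qed.

Lemma curve_test_AC (f : Rd -> R) : test_function f -> absolutely_continuous01 (Fc f).
Proof.
move=> tf; have [_ cK] := tf; have [N [G [acG HG]]] := curve_AC cK.
have [M fM] := test_function_bsmooth tf N; have [C C0 HC] := HG M.
have fK : test_function_on (supp f) f by split => //; case: tf.
move=> e e0; have e'0 : 0 < e / (C + 1) by rewrite divr_gt0// ltr_wpDl.
have [dl dl0 H] := acG _ e'0; exists dl => // n a b ab tI S.
have := H n a b ab tI S; rewrite ltr_pdivlMr ?ltr_wpDl// => /(le_lt_trans _); apply.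
rewrite mulr_suml; apply: ler_sum => i _; have [a0 [aib b1]] := ab i.
rewrite (le_trans (HC f fK fM (b i) (a i) _ _))//.
- by rewrite b1 (le_trans a0).
- by rewrite a0 (le_trans aib).
- by rewrite mulrC ler_wpM2l// lerDl.
Qed.

End curve_regularity.

(** * The action bounds the dual functional *)

Section action_bound.
Context {R : realType} {d : nat}.
Local Notation Rd := 'rV[R]_d.
Local Notation leb := (@lebesgue_measure R).
Variables (Psi : Rd -> R) (tau : R).
Hypotheses (tau0 : 0 < tau) (bc : forall i, continuous (drift Psi i)).
Variables (rho0 rho1 : probability Rd R) (c : R -> probability Rd R).
Hypotheses (cW : W2_curve rho0 rho1 c) (cAC : distr_abs_continuous c).

Let b := drift Psi.
Let Fc (f : Rd -> R) (t : R) : R := \int[c t]_x f x.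
Let sq (t : R) : \bar R := sqnorm_m1 (continuity_defect Psi tau c t) (c t).

Let sq_ge f t : test_function f ->
  ((2 * (derive1 (Fc f) t - tau * \int[c t]_x gen b f x) -
    \int[c t]_x sqg f x)%:E <= sq t)%E.
Proof.
move=> tf; apply: ereal_sup_ubound; exists f => //.
rewrite /continuity_defect; congr (_%:E); congr (2 * (_ - tau * _) - _).
  by apply: eq_Int => x; rewrite gen_drift.
by apply: eq_Int => x; rewrite sqg_enorm.
Qed.

Let test0 : test_function (fun _ : Rd => 0 : R).
Proof. by apply: (@bsmooth_test _ _ _ 0) => //; exact: bsmooth_cst. Qed.

Lemma sqnorm_ge0 t : (0 <= sq t)%E.
Proof.
apply: le_trans (sq_ge t test0); rewrite lee_fin.
have -> : Fc (fun=> 0) = cst 0 by apply/funext => s; rewrite /Fc Int_cst.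
rewrite derive1_cst.
under eq_Int do rewrite gen_cst; rewrite Int_cst.
have S x : sqg (fun _ : Rd => 0 : R) x = 0.
  by rewrite /sqg big1// => i _; rewrite derive_cst expr0n.
by under eq_Int do rewrite S; rewrite Int_cst mulr0 subrr mulr0 subrr.
Qed.

Definition lact (t : R) : \bar R := (\int[leb]_(r in `[0%R, t]) sq r)%E.

Hypothesis fin : (lact 1 < +oo)%E.

Let lact_fin t : t <= 1 -> lact t \is a fin_num.
Proof.
move=> t1; rewrite ge0_fin_numE; last by apply: integral_ge0 => r _; exact: sqnorm_ge0.
apply: le_lt_trans fin; rewrite /lact [leLHS]integral_mkcond [leRHS]integral_mkcond.
apply: le_lower_integral => [r|r|r _]; rewrite ?patchE.
- by case: ifP => // _; exact: sqnorm_ge0.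
- by case: ifP => // _; exact: sqnorm_ge0.
- case: ifPn => [|_]; last by case: ifP => // _; exact: sqnorm_ge0.
  rewrite inE/= in_itv/= => /andP[r0 rt]; rewrite mem_set//= in_itv/= r0.
  exact: le_trans t1.
Qed.

(** Tested with 2 q tau v, the norm is at least 4 q tau (d/dt int v - tau int (L v + q |grad v|^2));
    this multiple puts the factor q in front of the gradient. The derivative exists almost
    everywhere, and the positive part h of G is a measurable minorant of the norm there. *)
Lemma action_increment v q s t cc : test_function v -> 0 < q -> 0 <= s -> s < t -> t <= 1 ->
  (forall r, s < r < t -> \int[c r]_x (gen b v x + q * sqg v x) <= cc) ->
  4 * q * tau * (Fc v t - Fc v s - tau * cc * (t - s)) <= fine (lact t) - fine (lact s).
Proof.
move=> tv q0 s0 st t1 Hcc; set k := 4 * q * tau.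
have k0 : 0 < k by rewrite !mulr_gt0.
have [g [ig FE [N [mN N0 NE]]]] := AC_FTC (curve_test_AC cW cAC tv).
have mst : measurable (`]s, t]%classic : set R) by exact: measurable_itv.
pose G r := k * (g r - tau * cc); pose h r := Num.max 0 (G r).
have leb_st : (leb `]s, t]%classic = (t - s)%:E)%E.
  by rewrite lebesgue_measure_itv/= lte_fin st.
have icst a : leb.-integrable `]s, t]%classic (fun=> a%:E).
  apply: measurable_bounded_integrable => //; first by rewrite [X in (X < _)%E]leb_st ltry.
  exists `|a|; split; first exact: num_real.
  by move=> x ax y _ /=; exact: ltW.
have igst : leb.-integrable `]s, t]%classic (EFin \o g) by exact: integrableS ig.
have iG : leb.-integrable `]s, t]%classic (EFin \o G).
  have -> : EFin \o G = (fun r => k%:E * ((EFin \o g) r - (tau * cc)%:E))%E by [].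
  by apply: integrableZl => //; apply: integrableB.
have IG : (\int[leb]_(r in `]s, t]) (G r)%:E = (k * (Fc v t - Fc v s - tau * cc * (t - s)))%:E)%E.
  transitivity (\int[leb]_(r in `]s, t]) (k%:E * ((EFin \o g) r - (tau * cc)%:E)))%E; last first.
    rewrite integralZl//; last exact: integrableB.
    rewrite integralB// -FE ?(ltW st)// integral_cst// [X in (_ - _ * X)%E]leb_st.
    exact: erefl.
  by [].
have ih : leb.-integrable `]s, t]%classic (EFin \o h).
  have -> : EFin \o h = ((EFin \o G)^\+)%E.
    by apply/funext => r; rewrite funeposE /= -EFin_max maxC.
  exact: integrable_funepos.
(* The end t is removed together with the exceptional set, because the bound by [cc] is available at
   interior times. *)
pose N1 := N `|` [set t]; pose B := `]s, t]%classic `\` N1.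
have mN1 : measurable N1 by exact: measurableU.
have N10 : leb N1 = 0%E.
  apply/eqP; rewrite -measure_le0 (le_trans (measureU2 _ _ _))//.
  by rewrite [X in (X + _)%E]N0 [X in (_ + X)%E]lebesgue_measure_set1 adde0.
have mB : measurable B by exact: measurableD.
have BE : (\int[leb]_(r in B) (h r)%:E = \int[leb]_(r in `]s, t]) (h r)%:E)%E.
  by rewrite -negligible_integral.
have dq r : B r -> ((h r)%:E <= sq r)%E.
  move=> [/= + /not_orP[Nr /eqP rt]]; rewrite in_itv/= => /andP[sr]; rewrite le_eqVlt (negbTE rt)/= => rt'.
  have r01 : 0 < r < 1 by rewrite (le_lt_trans s0 sr) (lt_le_trans rt' t1).
  have D : is_derive r (1 : R) (Fc v) (g r).
    by apply: contrapT => nD; apply: Nr; apply: NE => /= H; apply: nD; exact: H.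
  rewrite /h EFin_max ge_max sqnorm_ge0/=.
  have tav := test_functionZ (2 * q * tau) tv.
  apply: le_trans (sq_ge r tav); rewrite lee_fin.
  have -> : derive1 (Fc (fun x => 2 * q * tau * v x)) r = 2 * q * tau * g r.
    have -> : Fc (fun x => 2 * q * tau * v x) = (fun u => 2 * q * tau * Fc v u).
      by apply/funext => u; rewrite /Fc IntZ//; exact: test_function_mbd.
    rewrite derive1E; have := is_deriveZ (2 * q * tau) D => DZ.
    exact: derive_val.
  have vb := test_function_bsmooth tv.
  under eq_Int do rewrite (genZ b (2 * q * tau) _ (bsmooth_derivable2 vb)).
  have S x : sqg (fun x => 2 * q * tau * v x) x = (2 * q * tau) ^+ 2 * sqg v x.
    rewrite /sqg mulr_sumr; apply: eq_bigr => i _.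
    by rewrite (deriveZ (2 * q * tau) ((bsmooth_derivable2 vb).1 i x)) exprMn.
  under [X in _ - X]eq_Int do rewrite S.
  have mg : mbd (gen b v) by exact: gen_mbd.
  have ms : mbd (sqg v) by apply: bsmooth_mbd; exact: bsmooth_sqg.
  rewrite !IntZ//.
  have := Hcc r; rewrite sr rt' => /(_ isT).
  rewrite IntD ?IntZ//; last by apply: mbdM => //; exact: mbd_cst.
  rewrite /G /k; move: (\int[c r]_x gen b v x) (\int[c r]_x sqg v x) => a1 a2 H.
  have -> : 2 * (2 * q * tau * g r - tau * (2 * q * tau * a1)) - (2 * q * tau) ^+ 2 * a2 =
    4 * q * tau * (g r - tau * (a1 + q * a2)) by ring.
  apply: ler_wpM2l; first by rewrite !mulr_ge0 ?ltW.
  by rewrite lerD2l lerN2 ler_pM2l.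
have LL : (lact s + \int[leb]_(r in B) (h r)%:E <= lact t)%E.
  apply: lower_integral_superadditive => //.
  - by move=> r; rewrite /= !in_itv/= => /andP[-> /le_trans]; apply; exact: ltW.
  - move=> r [/=]; rewrite !in_itv/= => /andP[sr ->] _.
    by rewrite (le_trans s0)// ltW.
  - apply/seteqP; split => // r [/= + [/=]]; rewrite !in_itv/= => /andP[_ rs] /andP[sr].
    by move: sr; rewrite ltNge rs.
  - exact: sqnorm_ge0.
  - by move=> r; rewrite lee_fin /h le_max lexx.
  - by apply: measurable_funS (measurable_int _ ih) => //; exact: subDsetl.
  - by apply: integrable_fin_num => //; apply: integrableS ih => //; exact: subDsetl.
have Gh : (\int[leb]_(r in `]s, t]) (G r)%:E <= \int[leb]_(r in `]s, t]) (h r)%:E)%E.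
  by apply: le_integral => // r _; rewrite lee_fin /h le_max lexx orbT.
rewrite -lee_fin -IG EFinB !fineK ?lact_fin//; last by rewrite (le_trans (ltW st)).
rewrite leeBrDl ?lact_fin//; last by rewrite (le_trans (ltW st)).
apply: le_trans LL; apply: leeD2l; apply: (le_trans Gh).
by rewrite le_eqVlt; apply/orP; left; apply/eqP; exact: esym BE.
Qed.

End action_bound.

(** * The duality bound from a curve of finite action *)

Section dual_bound.
Context {R : realType} {d : nat}.
Hypothesis hd : (0 < d)%N.
Local Notation Rd := 'rV[R]_d.
Variables (Psi : Rd -> R) (tau CV : R) (p : R -> R.-pker Rd ~> Rd).
Hypotheses (tau0 : 0 < tau) (bc : forall i, continuous (drift Psi i)) (CV0 : 0 <= CV)
  (bV : forall x, gen (drift Psi) V x <= CV).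
Hypothesis pb : forall x f, test_function f ->
  (forall t : R, 0 < t -> is_derive t (1 : R) (fun s => \int[p s x]_y f y)
     (\int[p t x]_y gen (drift Psi) f y)) /\
  (\int[p t x]_y f y) @[t --> 0^'+] --> f x.
Variables (rho0 rho1 : probability Rd R) (c : R -> probability Rd R).
Hypotheses (cW : W2_curve rho0 rho1 c) (cAC : distr_abs_continuous c).
Let b := drift Psi.
Let L := lact Psi tau c.
Hypothesis fin : (L 1 < +oo)%E.

Let scaled t : 0 <= t <= tau -> 0 <= t / tau <= 1.
Proof. by move=> /andP[t0 t1]; rewrite divr_ge0 ?(ltW tau0)//= ler_pdivrMr ?mul1r. Qed.

Let curve q : 0 < q ->
  curve_ineq b q tau (fun s => c (s / tau)) (fun s => (4 * q * tau)^-1 * fine (L (s / tau))).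
Proof.
move=> q0 v tv s t s0 st tT cc H.
have k0 : 0 < 4 * q * tau by rewrite !mulr_gt0.
have := action_increment tau0 bc cW cAC fin tv q0 (_ : 0 <= s / tau) (_ : s / tau < t / tau)
  (_ : t / tau <= 1) (cc := cc).
rewrite divr_ge0 ?(ltW tau0)// ltr_pM2r ?invr_gt0// st ler_pdivrMr// mul1r tT.
move=> /(_ isT isT isT) h.
have {}h : 4 * q * tau * (\int[c (t / tau)]_x v x - \int[c (s / tau)]_x v x -
     tau * cc * (t / tau - s / tau)) <= fine (L (t / tau)) - fine (L (s / tau)).
  apply: h => r /andP[r1 r2]; have := H (r * tau).
  rewrite -ltr_pdivrMr// r1 -ltr_pdivlMr// r2 => /(_ isT).
  by rewrite mulfK// gt_eqF.
rewrite -mulrBr -lerBlDr ler_pdivlMl//; apply: le_trans h.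
rewrite ler_pM2l// lerD2l lerN2 -mulrBl le_eqVlt; apply/orP; left; apply/eqP.
by field; rewrite gt_eqF.
Qed.

Let curve_Pr q x : 0 < q -> curve_ineq b q tau (fun s => Pr p s x) (fun=> 0).
Proof.
move=> q0 v tv s t s0 st tT cc H.
have := Pr_curve_ineq pb (T := tau) (x := x) (lexx 0) tv s0 st tT (c := cc).
rewrite !add0r; apply => r rst; rewrite add0r; apply: le_trans (H r rst).
have mg : mbd (gen b v) by exact: gen_mbd.
have ms : mbd (sqg v) by apply: bsmooth_mbd; apply: bsmooth_sqg; exact: test_function_bsmooth.
apply: le_Int; [by apply: mbdD => //; apply: mbdM => //; exact: mbd_cst| |].
  by apply: mbdD => //; apply: mbdM => //; exact: mbd_cst.
by move=> y; rewrite lerD2l mul0r mulr_ge0 ?(ltW q0) ?sqg_ge0.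
Qed.

(** [None] is the given curve, [Some x] the transition probabilities started at x. One index type
    makes [key_inequality] return the same w for both, so that the bound on w obtained from the
    kernels can be used along the curve. *)
Let J : Type := option Rd.
Let mu (j : J) (s : R) : probability Rd R := if j is Some x then Pr p s x else c (s / tau).
Let A q (j : J) (s : R) : R :=
  if j is Some _ then 0 else (4 * q * tau)^-1 * fine (L (s / tau)).

Let mu_equicont : curve_equicont tau mu.
Proof.
move=> K cK; have [N1 H1] := Pr_curve_equicont bc pb tau cK.
have [N2 [G [acG H2]]] := curve_AC cW cAC cK.
exists (maxn N1 N2) => M eta eta0.
have [h1 h10 HH1] := H1 M eta eta0; have [C C0 HC] := H2 M.
have eC0 : 0 < eta / (C + 1) by rewrite divr_gt0// ltr_wpDl.
have [dl dl0 Hdl] := AC_single acG eC0.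
exists (Num.min h1 (tau * dl / 2)); first by rewrite lt_min h10 divr_gt0// mulr_gt0.
move=> j psi psiK psib s t s01 t01; rewrite le_min => /andP[st1 st2].
case: j => [x|]; rewrite /mu.
  have := HH1 (x, exist _ 0 (lexx 0)) psi psiK (bnd_weak (leq_maxl N1 N2) psib) s t s01 t01 st1.
  by rewrite /= !add0r.
apply: (le_trans (HC psi psiK (bnd_weak (leq_maxr N1 N2) psib) _ _ (scaled s01) (scaled t01))).
have : `|G (s / tau) - G (t / tau)| < eta / (C + 1).
  apply: Hdl; [exact: scaled|exact: scaled|].
  rewrite -mulrBl normrM (gtr0_norm (_ : 0 < tau^-1)) ?invr_gt0// ltr_pdivrMr//.
  have : 0 < tau * dl by rewrite mulr_gt0.
  by move: st2; lra.
rewrite ltr_pdivlMr ?ltr_wpDl// => /ltW; apply: le_trans; rewrite mulrC ler_wpM2l// lerDl//.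
Qed.

Let mu_ineq q : 0 < q -> forall j, curve_ineq b q tau (mu j) (A q j).
Proof. by move=> q0 [x|]; [exact: curve_Pr|exact: curve]. Qed.

Let cE0 f : \int[c 0]_x f x = \int[rho0]_x f x.
Proof. by case: cW => _ _ H _; exact: Int_eq_measure. Qed.

Let cE1 f : \int[c 1]_x f x = \int[rho1]_x f x.
Proof. by case: cW => _ _ _ H; exact: Int_eq_measure. Qed.

Variables (phi : Rd -> R) (B : R).
Hypotheses (tphi : test_function phi) (B1 : 1 <= B) (phiB : forall x, `|phi x| <= B).

Let u y := \int[Pr p tau y]_x expR (phi x).

Let phi_bs : bsmooth phi. Proof. exact: test_function_bsmooth. Qed.

Let eb x : expR (- B) <= expR (phi x) <= expR B.
Proof. by rewrite !ler_expR -ler_norml. Qed.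

Let mexp : mbd (fun x => expR (phi x)).
Proof. exact/bsmooth_mbd/bsmooth_expR. Qed.

Let mu_u : mbd u. Proof. exact: mbd_Pr. Qed.

Let ub y : expR (- B) <= u y <= expR B.
Proof.
by rewrite Int_ge_cst ?Int_le_cst// => x; case/andP: (eb x).
Qed.

Let u0 y : 0 < u y.
Proof. by case/andP: (ub y) => h _; apply: lt_le_trans h; exact: expR_gt0. Qed.

Let mlnu : mbd (fun y => ln (u y)).
Proof.
split; first by apply: measurableT_comp => //; case: mu_u.
exists B => y; rewrite ler_norml -{1}(expRK (- B)) -{2}(expRK B).
by rewrite !ler_ln ?posrE ?expR_gt0.
Qed.

(** The coefficient of e in the upper bound of [z - u], apart from the term [2 * k * E ^+ 2]. *)
Let W (k : R) (y : Rd) : R := k^-1 * (V y + 2) + (V y + 1).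

Let WV (k : R) (y : Rd) : 0 < k -> 0 <= W k y.
Proof.
move=> k0; have V0 := V_ge0 y; rewrite addr_ge0 ?mulr_ge0 ?invr_ge0 ?(ltW k0)//; lra.
Qed.

Let dual_eps q k e : 0 < q < 1 -> 0 < k -> k * expR B <= 2^-1 -> 0 < e ->
  \int[rho1]_x phi x <= \int[rho0]_x ln (u x) + 2 * k * expR B ^+ 3 +
    \int[rho0]_x Num.min (2 * B) (e * (expR B * W k x)) +
    (4 * q * tau)^-1 * fine (L 1) + e.
Proof.
move=> /andP[q0 q1] k0 kB e0.
pose m := Num.min (expR (- B)) 2^-1; pose s1 := Num.max (expR B) 1.
have m0 : 0 < m by rewrite lt_min expR_gt0 invr_gt0 ltr0n.
have eB1 : 1 <= expR B by rewrite -[leLHS]expR0 ler_expR (le_trans ler01).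
have s1E : s1 = expR B by rewrite /s1 max_l.
have ms1 : m <= s1 by rewrite s1E ge_min ler_expR ge0_cp ?(le_trans ler01).
have w0b : bsmooth (fun x => expR (phi x)) by exact: bsmooth_expR.
have w0m x : m <= expR (phi x) <= s1.
  by have /andP[h1 h2] := eb x; rewrite s1E h2 ge_min h1.
have ke x : 0 <= k * expR (phi x) <= 2^-1.
  rewrite mulr_ge0 ?(ltW k0) ?expR_ge0//= (le_trans _ kB)//.
  by rewrite ler_pM2l//; case/andP: (eb x).
have w0m' x : m <= 1 + - k * expR (phi x) <= s1.
  have := ke x; have : m <= 2^-1 by rewrite ge_min lexx orbT.
  rewrite s1E mulNr; lra.
have [w [z [z' [[wb zb z'b] wm zw H]]]] := @key_inequality R d hd b CV bc CV0 bV q tau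
  J mu (A q) m s1 e 1 (- k) (fun x => expR (phi x)) q1 tau0 (mu_ineq q0) mu_equicont
  m0 ms1 e0 w0b w0m w0m'.
have [H1 _] := H None.
rewrite /mu /A divff ?gt_eqF// mul0r cE0 cE1 in H1.
have EK : \int[rho1]_x ln (expR (phi x)) = \int[rho1]_x phi x.
  by apply: eq_Int => x; rewrite expRK.
rewrite EK in H1.
have L00 : 0 <= (4 * q * tau)^-1 * fine (L 0).
  rewrite mulr_ge0 ?invr_ge0 ?mulr_ge0 ?(ltW q0) ?(ltW tau0)// fine_ge0//.
  by apply: integral_ge0 => r _; exact: sqnorm_ge0.
have E2 x : (k * expR (phi x)) ^+ 2 <= (k * expR B) ^+ 2.
  rewrite lerXn2r ?nnegrE ?mulr_ge0 ?expR_ge0 ?(ltW k0)//.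
  by rewrite ler_pM2l//; case/andP: (eb x).
have mz h : bsmooth h -> (forall y, m <= h y <= s1) -> mbd (fun y => ln (h y)).
  move=> hb hm; apply: bsmooth_mbd; apply: (bsmooth_ln m0 _ hb) => y.
  by case/andP: (hm y).
(* The second datum is 1 - k exp(phi), whose logarithm is at least - k exp(phi) - 2 (k E)^2. The
   comparison on the curve started at y then bounds k w(y) from above by k u(y) up to errors. *)
have H2 y : - k * u y - 2 * (k * expR B) ^+ 2 <= ln (z' y) + e.
  have [_] := H (Some y); rewrite /mu /A subrr addr0.
  have mz' : mbd (fun v => ln (z' v)) by apply: mz => // v; case: (wm v).
  rewrite (Pr0_int _ _ (lexx _)); last by case: mz'.
  apply: le_trans; rewrite -[2 * _](Int_cst (Pr p tau y)) -(IntZ _ (- k) mexp).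
  have mkf : mbd (fun v => - k * expR (phi v)) by apply: mbdM => //; exact: mbd_cst.
  rewrite -IntB//; last exact: mbd_cst.
  apply: le_Int; first by apply: mbdB => //; exact: mbd_cst.
    apply: mz w0m'; apply: bsmoothD; first exact: bsmooth_cst.
    by apply: bsmoothM => //; exact: bsmooth_cst.
  move=> v; apply: le_trans (ln_ge_quad _); last by have := ke v; rewrite mulNr; lra.
  by rewrite mulNr sqrrN lerD2l lerN2 ler_pM2l.
have ubE := ub; set E := expR B in kB ubE s1E eB1 E2 H2 *.
have E0 : 0 < E by exact: expR_gt0.
have H3 y : w y <= u y + 2 * k * E ^+ 2 + k^-1 * (e * V y + 2 * e).
  have [_ _ /andP[z3 _]] := wm y; have [_ z'le] := zw y.
  have h2 : ln (z' y) <= z' y - 1 by apply: ln_le_sub1; exact: lt_le_trans m0 z3.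
  have h3 := H2 y.
  have : k * w y <= k * u y + 2 * (k * E) ^+ 2 + (e * V y + 2 * e) by move: z'le h3; lra.
  rewrite -ler_pdivlMl// => /le_trans; apply.
  rewrite le_eqVlt; apply/orP; left; apply/eqP; field; rewrite gt_eqF//.
have H4 y : ln (z y) <= ln (u y) + 2 * k * E ^+ 3 + Num.min (2 * B) (e * (E * W k y)).
  have [_ /andP[z1 z2] _] := wm y; have [zle _] := zw y.
  have z0 : 0 < z y by exact: lt_le_trans m0 z1.
  have /andP[u1 u2] := ubE y; have uy0 := u0 y.
  pose dl := 2 * k * E ^+ 2 + e * W k y.
  have dl0 : 0 <= dl.
    by rewrite addr_ge0 ?mulr_ge0 ?exprn_ge0 ?(ltW E0) ?(ltW k0) ?(ltW e0) ?WV.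
  have zu : z y <= u y + dl.
    have h3 := H3 y; rewrite /dl /W !mulrDr; move: h3 zle; rewrite !mulrDr.
    rewrite (mulrCA e) (mulrCA e k^-1) (mulrC 2 e); lra.
  have lz : ln (z y) - ln (u y) <= E * dl.
    rewrite -ln_div ?posrE// (le_trans (ln_le_sub1 _))// ?divr_gt0//.
    apply: (@le_trans _ _ (dl / u y)).
      by rewrite lerBlDr ler_pdivrMr// mulrDl divfK ?gt_eqF// mul1r addrC.
    rewrite mulrC; apply: ler_wpM2r => //.
    by rewrite -[E]invrK lef_pV2 ?posrE ?invr_gt0// -expRN.
  have Edl : E * dl = 2 * k * E ^+ 3 + e * (E * W k y) by rewrite /dl; ring.
  have k3 : 0 <= 2 * k * E ^+ 3.
    by rewrite !mulr_ge0 ?exprn_ge0 ?(ltW E0) ?(ltW k0).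
  have lz2 : ln (z y) <= B by rewrite -[leRHS]expRK ler_ln ?posrE ?expR_gt0// -/E -s1E.
  have lu : - B <= ln (u y) by rewrite -[leLHS]expRK ler_ln ?posrE ?expR_gt0.
  by rewrite /Num.min; case: ifP => _; lra.
have mW : measurable_fun setT (fun x => E * W k x).
  have mV : measurable_fun setT (V : Rd -> R).
    by apply: continuous_measurable_rV; exact: continuous_V.
  apply: measurable_funM => //; apply: measurable_funD; last exact: measurable_funD.
  by apply: measurable_funM => //; exact: measurable_funD.
have EW0 x : 0 <= e * (E * W k x).
  by rewrite !mulr_ge0 ?(ltW e0) ?(ltW E0) ?WV.
have mmin : mbd (fun x => Num.min (2 * B) (e * (E * W k x))).
  split; first by apply: measurable_minr => //; exact: measurable_funM.
  exists (2 * B) => x; rewrite ger0_norm ?ge_min ?lexx// le_min EW0 andbT mulr_ge0//.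
  exact: le_trans B1.
have H5 : \int[rho0]_x ln (z x) <= \int[rho0]_x ln (u x) + 2 * k * E ^+ 3 +
    \int[rho0]_x Num.min (2 * B) (e * (E * W k x)).
  rewrite -[2 * k * E ^+ 3](Int_cst rho0).
  have mc : mbd (fun _ : Rd => 2 * k * E ^+ 3) by exact: mbd_cst.
  rewrite -IntD// -IntD//; last exact: mbdD.
  apply: le_Int => //; last by apply: mbdD => //; exact: mbdD.
  by apply: mz => // v; case: (wm v).
move: H1 H5 L00; set a1 := \int[rho1]_x _; set a2 := \int[rho0]_x ln (z x).
set a3 := \int[rho0]_x ln (u x); set a4 := \int[rho0]_x Num.min _ _.
lra.
Qed.

(** e -> 0 comes first, with k and q fixed, because the errors carry a factor 1 / k; then k -> 0
    removes the quadratic term and q -> 1 turns (4 q tau)^-1 into (4 tau)^-1. *)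
Lemma dual_bound : \int[rho1]_x phi x - \int[rho0]_x ln (\int[Pr p tau x]_y expR (phi y)) <=
  (4 * tau)^-1 * fine (L 1).
Proof.
rewrite -/u; set E := expR B; have E0 : 0 < E by exact: expR_gt0.
set X := (4 * tau)^-1 * _; set a := \int[rho1]_x _; set I := \int[rho0]_x _.
have X0 : 0 <= X.
  rewrite mulr_ge0 ?invr_ge0 ?mulr_ge0 ?(ltW tau0)// fine_ge0//.
  by apply: integral_ge0 => r _; exact: sqnorm_ge0.
have aux (a' I' x y i e : R) : a' <= I' + x + i + y + e -> a' - (I' + x + y) <= i + e.
  by lra.
have qk (q k : R) : 0 < q < 1 -> 0 < k -> k * E <= 2^-1 -> a <= I + 2 * k * E ^+ 3 + q^-1 * X.
  move=> q01 k0 kE; have /andP[q0 q1] := q01; rewrite -subr_ge0 -lerN2 oppr0 opprB.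
  have mW : measurable_fun setT (fun x => E * W k x).
    have mV : measurable_fun setT (V : Rd -> R).
      by apply: continuous_measurable_rV; exact: continuous_V.
    apply: measurable_funM => //; apply: measurable_funD; last exact: measurable_funD.
    by apply: measurable_funM => //; exact: measurable_funD.
  have EW0 x : 0 <= E * W k x by rewrite !mulr_ge0 ?(ltW E0) ?WV.
  have B0 : 0 <= 2 * B by rewrite mulr_ge0//; exact: le_trans B1.
  have cv : \int[rho0]_x Num.min (2 * B) (n.+1%:R^-1 * (E * W k x)) + n.+1%:R^-1 @[n --> \oo] --> (0 : R).
    rewrite -[X in _ --> X]addr0; apply: cvgD; first exact: Int_min_vanish.
    exact: cvg_harmonic.
  apply: (cvgr_to_ge cv); apply: nearW => n.
  have n0 : 0 < n.+1%:R^-1 :> R by [].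
  have := dual_eps q01 k0 kE n0; rewrite -/a -/I -/E.
  have -> : (4 * q * tau)^-1 * fine (L 1) = q^-1 * X.
    by rewrite /X; field; rewrite !gt_eqF.
  exact: aux.
apply/ler_addgt0Pr => eta eta0.
pose k := Num.min (2 * E)^-1 (eta / (4 * E ^+ 3)).
have E3 : 0 < E ^+ 3 by rewrite exprn_gt0.
have k0 : 0 < k by rewrite lt_min invr_gt0 mulr_gt0//= divr_gt0// mulr_gt0.
have kE : k * E <= 2^-1.
  rewrite -ler_pdivlMr//; have : k <= (2 * E)^-1 by rewrite ge_min lexx.
  by rewrite invfM.
have kE3 : 2 * k * E ^+ 3 <= eta / 2.
  have : k <= eta / (4 * E ^+ 3) by rewrite ge_min lexx orbT.
  by rewrite ler_pdivlMr ?mulr_gt0//; lra.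
pose y := eta / (2 * (X + 1)); have y0 : 0 < y by rewrite divr_gt0// mulr_gt0// ltr_wpDl.
have q01 : 0 < (1 + y)^-1 < 1.
  by rewrite invr_gt0 addr_gt0//= invf_lt1 ?addr_gt0// ltrDl.
have := qk _ _ q01 k0 kE; rewrite invrK mulrDl mul1r.
have : y * X <= eta / 2.
  by rewrite /y mulrAC ler_pdivrMr ?mulr_gt0 ?ltr_wpDl//; nra.
move: kE3; lra.
Qed.

End dual_bound.

(** * Entropy duality *)

Section power_limits.
Context {R : realType}.
Implicit Types u t y : R.

Lemma expR_le_quad u : u <= 2^-1 -> expR u <= 1 + u + 2 * u ^+ 2.
Proof.
move=> u1; have h := @expR_ge1Dx R (- u); rewrite expRN in h.
have u2 : 0 < 1 - u by lra.
have : expR u <= (1 - u)^-1.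
  by rewrite -[expR u]invrK lef_pV2 ?posrE ?invr_gt0 ?expR_gt0.
move=> /le_trans; apply; rewrite -div1r ler_pdivrMr//.
have : 0 <= u ^+ 2 * (1 - 2 * u) by rewrite mulr_ge0 ?sqr_ge0//; lra.
lra.
Qed.

(** Both y = y^t exp((1 - t) ln y) and 1 = y^t exp(- t ln y) are bounded below by the tangent of the
    exponential; the two bounds are averaged with weights t and 1 - t, and the logarithms cancel. *)
Lemma powR_young t y : 0 < t < 1 -> 0 <= y -> y `^ t <= t * y + 1 - t.
Proof.
move=> /andP[t0 t1]; rewrite le_eqVlt => /predU1P[<-|y0].
  by rewrite powR0 ?gt_eqF//; lra.
rewrite /powR gt_eqF//; set q := expR _.
have q0 : 0 < q by exact: expR_gt0.
have h1 : q * (1 + (1 - t) * ln y) <= y.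
  have E : y = q * expR ((1 - t) * ln y).
    by rewrite -expRD -mulrDl addrC subrK mul1r lnK.
  by rewrite [leRHS]E ler_pM2l// expR_ge1Dx.
have h2 : q * (1 - t * ln y) <= 1.
  have E : 1 = q * expR (- (t * ln y)) by rewrite -expRD subrr expR0.
  by rewrite [leRHS]E ler_pM2l// expR_ge1Dx.
have : t * (q * (1 + (1 - t) * ln y)) <= t * y by rewrite ler_wpM2l// ltW.
have : (1 - t) * (q * (1 - t * ln y)) <= (1 - t) * 1 by rewrite ler_wpM2l// subr_ge0 ltW.
move: (ln y) => v; nra.
Qed.

Lemma cvg_powR (a_ : nat -> R) a t : 0 < t -> (forall n, 0 < a_ n) ->
  a_ n @[n --> \oo] --> a -> a_ n `^ t @[n --> \oo] --> a `^ t.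
Proof.
move=> t0 a0 aa; have : 0 <= a.
  by rewrite -(cvg_lim _ aa)//; apply: limr_ge; [apply/cvg_ex; exists a|apply: nearW => n; exact: ltW].
rewrite le_eqVlt => /predU1P[aE|apos].
  rewrite -aE powR0 ?gt_eqF//; apply/cvgr0Pnorm_lt => e e0.
  have d0 : 0 < e `^ t^-1 by exact: powR_gt0.
  rewrite -aE in aa; move/cvgr0Pnorm_lt : aa => /(_ _ d0); apply: filterS => n.
  rewrite !ger0_norm ?powR_ge0 ?(ltW (a0 n))// => h.
  have -> : e = (e `^ t^-1) `^ t by rewrite -powRrM mulVf ?gt_eqF// powRr1// ltW.
  by apply: gt0_ltr_powR => //; rewrite nnegrE ltW.
have -> : a `^ t = expR (t * ln a) by rewrite /powR gt_eqF.
have -> : (fun n => a_ n `^ t) = (fun n => expR (t * ln (a_ n))).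
  by apply/funext => n; rewrite /powR gt_eqF.
apply: continuous_cvg; first exact: continuous_expR.
by apply: cvgMr; apply: continuous_cvg => //; exact: continuous_ln.
Qed.

(** The derivative of s -> y^s at s = 1, taken along the exponents 1 - u_n. *)
Lemma cvg_powR_ln (u_ : nat -> R) y : 0 <= y -> (forall n, 0 < u_ n < 1) ->
  u_ n @[n --> \oo] --> 0 ->
  (u_ n)^-1 * (y - y `^ (1 - u_ n)) @[n --> \oo] --> y * ln y.
Proof.
move=> y0 u01 cu; move: y0; rewrite le_eqVlt => /predU1P[<-|y0].
  rewrite mul0r; apply: cvg_near_cst; apply: nearW => n.
  by rewrite powR0 ?subrr ?mulr0// subr_eq0 gt_eqF//; case/andP: (u01 n).
pose C := 2 * y * ln y ^+ 2.
have cC : C * u_ n @[n --> \oo] --> 0 by rewrite -(mulr0 C); exact: cvgMr.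
have cN : - (C * u_ n) @[n --> \oo] --> 0 by rewrite -oppr0; exact: cvgN.
apply/subr_cvg0; apply: (squeeze_cvgr _ cN cC).
pose e := (2 * (`|ln y| + 1))^-1.
have e0 : 0 < e by rewrite invr_gt0 mulr_gt0// ltr_wpDl.
have : \forall n \near \oo, u_ n <= e by exact: (cvgr_le 0 cu).
apply: filterS => n une; have /andP[u0 u1] := u01 n.
move: (u_ n) une u0 u1 => v ve v0 v1; rewrite -ler_norml.
have vL : v * `|ln y| <= 2^-1.
  have : v * (2 * (`|ln y| + 1)) <= 1.
    by rewrite -ler_pdivlMr ?div1r// mulr_gt0// ltr_wpDl.
  by lra.
have -> : y `^ (1 - v) = y * expR (- v * ln y).
  rewrite /powR gt_eqF// -[X in _ = X * _](lnK y0) -expRD; congr expR; ring.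
pose z := - v * ln y.
have zv : `|z| <= 2^-1 by rewrite /z normrM normrN (gtr0_norm v0).
have -> : v^-1 * (y - y * expR (- v * ln y)) - y * ln y = - (y / v) * (expR z - 1 - z).
  by rewrite /z; field; rewrite gt_eqF.
have z2 : 0 <= expR z - 1 - z <= 2 * z ^+ 2.
  have := @expR_ge1Dx R z; have : z <= 2^-1 by exact: le_trans (ler_norm _) zv.
  by move=> /expR_le_quad; lra.
case/andP: z2 => z2 z3; rewrite normrM normrN (ger0_norm z2) (@ger0_norm _ (y / v)); last by rewrite divr_ge0// ltW.
apply: (@le_trans _ _ (y / v * (2 * z ^+ 2))).
  by rewrite ler_wpM2l// divr_ge0// ltW.
rewrite le_eqVlt; apply/orP; left; apply/eqP; rewrite /C /z; field; rewrite gt_eqF//.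
Qed.

End power_limits.

Section limits_in_mean.
Context {dT : measure_display} {T : measurableType dT} {R : realType}.
Variable mu : {measure set T -> \bar R}.

Lemma fatou_le (f_ : nat -> T -> R) (f : T -> R) (c_ : nat -> R) (c : R) :
  (forall n, measurable_fun setT (f_ n)) -> (forall n x, 0 <= f_ n x) ->
  measurable_fun setT f ->
  {ae mu, forall x, f_ n x @[n --> \oo] --> f x} ->
  (forall n, (\int[mu]_x (f_ n x)%:E <= (c_ n)%:E)%E) ->
  c_ n @[n --> \oo] --> c -> (\int[mu]_x (f x)%:E <= c%:E)%E.
Proof.
move=> mf_ f0 mf ff fc cc.
have mEf n : measurable_fun setT (fun x => (f_ n x)%:E) by exact/measurable_EFinP.
have -> : (\int[mu]_x (f x)%:E = \int[mu]_x limn_einf (fun n => (f_ n x)%:E))%E.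
  apply: ae_eq_integral => //; first exact/measurable_EFinP.
    have -> : (fun x => limn_einf (fun n => (f_ n x)%:E)) =
        (fun x => - limn_esup (fun n => (- f_ n x)%:E))%E by [].
    apply: measurableT_comp => //; apply: measurable_fun_limn_esup => n.
    by apply/measurable_EFinP; exact: measurableT_comp.
  apply: filterS ff => x fx _; rewrite (cvg_limn_einf_sup (l := (f x)%:E))//.
  by apply: cvg_EFin; [exact: nearW|exact: fx].
apply: (le_trans (@fatou _ _ _ mu setT measurableT _ mEf _)); first by move=> n x _; rewrite lee_fin.
apply/lee_addgt0Pr => e e0; rewrite limn_einf_lim -EFinD.
have : \forall n \near \oo, c_ n <= c + e.
  by apply: (cvgr_le c cc); rewrite ltrDl.
move=> [N _ HN]; apply: lime_le; first exact: is_cvg_einfs.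
apply: nearW => n; apply: (@le_trans _ _ (\int[mu]_x (f_ (maxn n N) x)%:E)%E).
  by apply: ereal_inf_lbound; exists (maxn n N) => //=; exact: leq_maxl.
by apply: (le_trans (fc _)); rewrite lee_fin HN//=; exact: leq_maxr.
Qed.

(* The limit of a sequence that converges fast in mean; the domination is what
   the limit theorems need. *)
Lemma fast_L1_limit (g_ : nat -> T -> R) (K : R) : 0 <= K ->
  (forall n, measurable_fun setT (g_ n)) -> (forall n x, 0 <= g_ n x) ->
  mu.-integrable setT (EFin \o g_ 0%N) ->
  (forall n, (\int[mu]_x (`|g_ n.+1 x - g_ n x|)%:E <= (K / (2 ^ n.+1)%:R)%:E)%E) ->
  exists (g : T -> R) (G : T -> \bar R),
  [/\ measurable_fun setT g, forall x, 0 <= g x,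
      {ae mu, forall x, g_ n x @[n --> \oo] --> g x},
      mu.-integrable setT G &
      forall n x, ((g_ n x)%:E <= G x)%E].
Proof.
move=> K0 mg g0 ig0 gK.
pose D n x : \bar R := (`|g_ n.+1 x - g_ n x|)%:E.
have mD n : measurable_fun setT (D n).
  apply/measurable_EFinP; apply: measurableT_comp => //; exact: measurable_funB.
have D0 n x : (0 <= D n x)%E by rewrite lee_fin.
pose S x := (\sum_(0 <= n <oo) D n x)%E.
pose g x := fine (limn_esup (fun n => (g_ n x)%:E)).
have mg' : measurable_fun setT g.
  apply: measurableT_comp; first exact: fine_measurable.
  by apply: measurable_fun_limn_esup => n; exact/measurable_EFinP.
have mS : measurable_fun setT S by apply: ge0_emeasurable_sum => // n x _ _.
have iS : mu.-integrable setT S.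
  apply/integrableP; split => //.
  under eq_integral do rewrite gee0_abs ?nneseries_ge0//.
  rewrite integral_nneseries//; apply: (@le_lt_trans _ _ K%:E); last exact: ltry.
  apply: (le_trans _ (epsilon_trick0 xpredT K0)); apply: lee_nneseries => [n _ _|n _]; last exact: gK.
  exact: integral_ge0.
have gS n x : ((g_ n x)%:E <= (g_ 0%N x)%:E + S x)%E.
  apply: (@le_trans _ _ ((g_ 0%N x)%:E + \sum_(0 <= i < n) D i x)%E); last first.
    by rewrite leeD2l//; apply: nneseries_lim_ge => i _ _.
  elim: n => [|n IH]; first by rewrite big_geq// adde0.
  rewrite big_nat_recr//= addeA; apply: le_trans (leeD IH (lexx _)).
  by rewrite -EFinD lee_fin -lerBlDl ler_norm.
exists (fun x => Num.max 0 (g x)), (fun x => (g_ 0%N x)%:E + S x)%E; split => //.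
- exact: measurable_maxr.
- by move=> x; rewrite le_max lexx.
- have := integrable_ae measurableT iS; apply: filterS => x /(_ I) Sx.
  have cv : cvgn (g_^~ x).
    have : cvgn [normed series (telescope (g_^~ x))].
      apply: nondecreasing_is_cvgn.
        by apply: nondecreasing_series => i _ _; exact: normr_ge0.
      exists (fine (S x)) => _ [n _ <-]; rewrite -lee_fin fineK//.
      rewrite /series /= -sumEFin; apply: nneseries_lim_ge => i _ _; exact: D0.
    move=> /normed_cvg; rewrite telescopeK => H.
    have -> : (g_^~ x) = (fun n => (g_ n x - g_ 0%N x) + g_ 0%N x).
      by apply/funext => n; rewrite subrK.
    by apply: is_cvgD => //; exact: is_cvg_cst.
  have ge : 0 <= limn (g_^~ x) by apply: limr_ge => //; apply: nearW => n.
  have -> : g x = limn (g_^~ x).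
    rewrite /g (cvg_limn_einf_sup (l := (limn (g_^~ x))%:E))//.
    by apply: cvg_EFin; [exact: nearW|exact: cv].
  by rewrite max_r.
- exact: integrableD.
Qed.

End limits_in_mean.

Section entropy_dual.
Context {dT : measure_display} {T : measurableType dT} {R : realType}.
Variable mu : probability T R.
Variables (I : Type) (P : set I) (k : I -> T -> R) (l : I -> R) (A : R).
Hypothesis km : forall i, P i -> mbd (k i).
Hypothesis lin : forall (a b : R) i j, P i -> P j -> exists2 m, P m &
  k m = (fun x => a * k i x + b * k j x) /\ l m = a * l i + b * l j.
Hypothesis one : exists2 i, P i & k i = cst 1 /\ l i = 1.
Hypothesis lA : forall i, P i -> l i + 1 - \int[mu]_x expR (k i x) <= A.

Let D i := l i + 1 - \int[mu]_x expR (k i x).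
Let S := sup [set D i | i in P].

Let hasS : has_sup [set D i | i in P].
Proof.
split; first by have [i Pi _] := one; exists (D i), i.
by exists A => _ [i Pi <-]; exact: lA.
Qed.

Let DS i : P i -> D i <= S.
Proof. by move=> Pi; apply: sup_upper_bound => //; exists i. Qed.

Let SA : S <= A.
Proof. by apply: ge_sup; [case: hasS|move=> _ [i Pi <-]; exact: lA]. Qed.

(** This is 4^-(n+1): its square root is summable, which makes the maximizing sequence converge fast
    in mean. *)
Let eps (n : nat) : R := (2 ^ n.+1)%:R ^- 2.

Let eps0 n : 0 < eps n.
Proof. by rewrite invr_gt0 exprn_gt0// ltr0n expn_gt0. Qed.

Let ex_seq : {i_ : nat -> I | forall n, P (i_ n) /\ S - eps n <= D (i_ n)}.
Proof.
apply: cid.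
suff /choice [f Hf] : forall n, exists i, P i /\ S - eps n <= D i by exists f.
move=> n; have [_ [i Pi <-] H] := sup_adherent (eps0 n) hasS.
by exists i; split => //; exact: ltW.
Qed.

Let i_ := sval ex_seq.
Let Pi n : P (i_ n). Proof. by case: (svalP ex_seq n). Qed.
Let Di n : S - eps n <= D (i_ n). Proof. by case: (svalP ex_seq n). Qed.

Let mexp (f : T -> R) : mbd f -> mbd (fun x => expR (f x)).
Proof.
move=> [mf [M fM]]; split; first exact: measurableT_comp.
by exists (expR M) => x; rewrite ger0_norm ?expR_ge0// ler_expR (le_trans (ler_norm _)).
Qed.

Let g n x := expR (k (i_ n) x).
Let gm n : mbd (g n). Proof. exact/mexp/km. Qed.

(* The n-th maximizer is optimal up to [eps n] when perturbed in the direction [k j]. *)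
Let pert n j (s : R) : P j ->
  s * l j <= eps n + \int[mu]_x ((expR (s * k j x) - 1) * g n x).
Proof.
move=> Pj; have [m Pm [kE lE]] := lin 1 s (Pi n) Pj.
have h1 := DS Pm; have h2 := Di n.
have sk : mbd (fun x => s * k j x) by apply: mbdM; [exact: mbd_cst|exact: km].
have me : mbd (fun x => expR (s * k j x) * g n x) by apply: mbdM => //; exact: mexp.
have -> : \int[mu]_x ((expR (s * k j x) - 1) * g n x) =
    \int[mu]_x expR (k m x) - \int[mu]_x g n x.
  have -> : \int[mu]_x expR (k m x) = \int[mu]_x (expR (s * k j x) * g n x).
    by apply: eq_Int => x; rewrite kE /= mul1r expRD mulrC.
  rewrite -IntB//; apply: eq_Int => x; ring.
move: h1 h2; rewrite /D -/(g n) lE; set a := \int[mu]_x expR (k m x).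
by set b := \int[mu]_x expR _; set c := \int[mu]_x g n x; rewrite -/c; lra.
Qed.

(** Perturbation by the constant - ln 2, which halves the exponential. *)
Let mass n : \int[mu]_x g n x <= 4.
Proof.
have [j Pj [kE lE]] := one; have := pert n (- ln 2) Pj; rewrite lE kE.
have -> : \int[mu]_x ((expR (- ln 2 * cst 1 x) - 1) * g n x) = - 2^-1 * \int[mu]_x g n x.
  rewrite -IntZ//; apply: eq_Int => x; congr (_ * _).
  by rewrite /= mulr1 expRN lnK ?posrE//; lra.
have e1 : eps n <= 1.
  by rewrite invf_le1 ?exprn_gt0 ?ltr0n ?expn_gt0// exprn_ege1// ler1n expn_gt0.
have : ln (2 : R) <= 1.
  by apply: (le_trans (ln_le_sub1 _)) => //; lra.
set c := \int[mu]_x _; lra.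
Qed.

Let r n x := expR (2^-1 * k (i_ n) x).
Let rm n : mbd (r n).
Proof. by apply: mexp; apply: mbdM; [exact: mbd_cst|exact: km]. Qed.

Let r2 n x : r n x ^+ 2 = g n x.
Proof. by rewrite /r -expRM_natl /g; congr expR; field. Qed.

(** The average of two near maximizers has value at most S. The gap between the arithmetic and the
    geometric mean of their exponentials is half the squared difference of the roots r, so the roots
    are Cauchy in L^2. *)
Let midpoint n : \int[mu]_x (r n.+1 x - r n x) ^+ 2 <= 2 * eps n.
Proof.
have [m Pm [kE lE]] := lin 2^-1 2^-1 (Pi n.+1) (Pi n).
have h1 := DS Pm; have h2 := Di n; have h3 := Di n.+1.
have E : \int[mu]_x expR (k m x) = \int[mu]_x (r n.+1 x * r n x).
  by apply: eq_Int => x; rewrite kE /= expRD.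
have -> : \int[mu]_x (r n.+1 x - r n x) ^+ 2 =
    \int[mu]_x g n.+1 x + \int[mu]_x g n x - 2 * \int[mu]_x (r n.+1 x * r n x).
  have rr : mbd (fun x => r n.+1 x * r n x) by exact: mbdM.
  rewrite -IntD// -IntZ// -IntB//; [|exact: mbdD|by apply: mbdM => //; exact: mbd_cst].
  by apply: eq_Int => x; rewrite -!r2; ring.
have e1 : eps n.+1 <= eps n.
  rewrite lef_pV2 ?posrE ?exprn_gt0 ?ltr0n ?expn_gt0//.
  by rewrite lerXn2r ?nnegrE// ler_nat leq_exp2l.
move: h1 h2 h3; rewrite /D lE E.
have -> : \int[mu]_x expR (k (i_ n) x) = \int[mu]_x g n x by [].
have -> : \int[mu]_x expR (k (i_ n.+1) x) = \int[mu]_x g n.+1 x by [].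
set a := \int[mu]_x g n x; set b := \int[mu]_x g n.+1 x.
by set c := \int[mu]_x (_ * _); lra.
Qed.

(** |a^2 - b^2| <= q (a - b)^2 + 2 (a^2 + b^2) / q with q = 2^(n+1); by [midpoint] and [mass] the
    two integrals are at most 2 / q and 16 / q. *)
Let L1 n : (\int[mu]_x (`|g n.+1 x - g n x|)%:E <= (20 / (2 ^ n.+1)%:R)%:E)%E.
Proof.
have mn : mbd (fun x => `|g n.+1 x - g n x|).
  have [h1 [M h2]] := mbdB (gm n.+1) (gm n); split; first exact: measurableT_comp.
  by exists M => x; rewrite normr_id.
rewrite -(@fineK _ (\int[mu]_x _)%E); last first.
  by apply: (integrable_fin_num measurableT); exact: mbd_integrable.
rewrite lee_fin -/(Rintegral mu setT _).
pose q : R := (2 ^ n.+1)%:R; have q0 : 0 < q by rewrite ltr0n expn_gt0.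
have rr : mbd (fun x => (r n.+1 x - r n x) ^+ 2).
  have h := mbdB (rm n.+1) (rm n); have := mbdM h h.
  by congr mbd; apply/funext => x; rewrite expr2.
have qr : mbd (fun x => q * (r n.+1 x - r n x) ^+ 2).
  by apply: mbdM => //; exact: mbd_cst.
have gg : mbd (fun x => g n.+1 x + g n x) by exact: mbdD.
have qg : mbd (fun x => 2 * q^-1 * (g n.+1 x + g n x)).
  by apply: mbdM => //; exact: mbd_cst.
apply: (@le_trans _ _ (\int[mu]_x (q * (r n.+1 x - r n x) ^+ 2 +
    2 * q^-1 * (g n.+1 x + g n x)))).
  apply: le_Int => //; first exact: mbdD.
  move=> x; rewrite -!r2; move: (r n.+1 x) (r n x) => a b.
  have H (u v : R) : `|u * v| <= q * u ^+ 2 + q^-1 * v ^+ 2.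
    have -> : q * u ^+ 2 + q^-1 * v ^+ 2 = q^-1 * ((q * u) ^+ 2 + v ^+ 2).
      by field; rewrite gt_eqF.
    have -> : u * v = q^-1 * (q * u * v) by field; rewrite gt_eqF.
    rewrite normrM gtr0_norm ?invr_gt0// ler_pM2l ?invr_gt0// ler_norml.
    by move: (q * u) => w; apply/andP; split; nra.
  have -> : a ^+ 2 - b ^+ 2 = (a - b) * (a + b) by ring.
  apply: (le_trans (H _ _)); rewrite lerD2l [2 * _]mulrC -mulrA.
  rewrite ler_wpM2l ?invr_ge0 ?(ltW q0)//; have := sqr_ge0 (a - b); nra.
rewrite IntD// !IntZ// IntD//.
have h1 := mass n; have h2 := mass n.+1; have h3 := midpoint n.
have : q * \int[mu]_x (r n.+1 x - r n x) ^+ 2 <= q * (2 * eps n).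
  by rewrite ler_wpM2l// ltW.
have -> : q * (2 * eps n) = 2 / q by rewrite /eps -/q; field; rewrite gt_eqF.
have : 2 * q^-1 * (\int[mu]_x g n.+1 x + \int[mu]_x g n x) <= 2 * q^-1 * 8.
  rewrite ler_wpM2l ?mulr_ge0 ?invr_ge0 ?(ltW q0)//; lra.
have : 0 < q^-1 by rewrite invr_gt0.
rewrite /= -/q; move: (q^-1) => q' q'0.
set a := q * _; set b := 2 * q' * _; move: a b => a b; lra.
Qed.

Let limit : exists (h : T -> R) (G : T -> \bar R),
  [/\ measurable_fun setT h, forall x, 0 <= h x,
      {ae mu, forall x, g n x @[n --> \oo] --> h x},
      mu.-integrable setT G &
      forall n x, ((g n x)%:E <= G x)%E].
Proof.
apply: (@fast_L1_limit _ _ _ mu g 20) => //.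
- by move=> n; case: (gm n).
- by move=> n x; exact: expR_ge0.
- exact: mbd_integrable.
Qed.

Let eps_cvg : eps n @[n --> \oo] --> 0.
Proof.
apply: (squeeze_cvgr _ (cvg_cst 0) cvg_harmonic); apply: nearW => n.
rewrite ltW//= /eps lef_pV2 ?posrE ?exprn_gt0 ?ltr0n ?expn_gt0//.
rewrite -natrX ler_nat -expnM (leq_trans (ltnW (ltn_expl n.+1 (ltnSn 1))))//.
by rewrite leq_exp2l// muln2 -addnn leq_addr.
Qed.

(** The exponentials of near maximizers converge in mean to h, and optimality under perturbation in
    the direction k j gives the linear constraints in the limit. For the entropy, a near maximizer
    is compared with its multiple by t < 1; the resulting bound passes to the limit by Fatou at
    fixed t, and division by 1 - t followed by t -> 1 turns h - h^t into h ln h. *)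
Lemma entropy_dual : exists h : T -> R,
  [/\ measurable_fun setT h, forall x, 0 <= h x,
      forall i, P i -> (\int[mu]_x (k i x * h x)%:E = (l i)%:E)%E,
      (\int[mu]_x (h x)%:E = 1)%E &
      (\int[mu]_x (h x * ln (h x) - h x + 1)%:E <= A%:E)%E].
Proof.
have [h [G [mh h0 gh iG gG]]] := limit.
have ih : mu.-integrable setT (EFin \o h).
  have [] := @dominated_convergence _ _ _ mu setT measurableT
    (fun n x => (g n x)%:E) (EFin \o h) G => //.
  - by move=> n; apply/measurable_EFinP; case: (gm n).
  - exact/measurable_EFinP.
  - by apply: filterS gh => x H _; apply: cvg_EFin; [exact: nearW|exact: H].
  - by apply: aeW => x n _; rewrite gee0_abs// lee_fin expR_ge0.
have lim f : mbd f -> \int[mu]_x (f x * g n x) @[n --> \oo] --> \int[mu]_x (f x * h x).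
  move=> [mf [M fM]].
  have M0 : 0 <= M by exact: le_trans (fM point).
  have [] := @dominated_convergence _ _ _ mu setT measurableT
    (fun n x => (f x * g n x)%:E) (fun x => (f x * h x)%:E) (fun x => M%:E * G x)%E.
  - by move=> n; apply/measurable_EFinP/measurable_funM => //; case: (gm n).
  - exact/measurable_EFinP/measurable_funM.
  - apply: filterS gh => x H _; apply: cvg_EFin; first exact: nearW.
    by apply: cvgMr; exact: H.
  - exact: integrableZl.
  - apply: aeW => x n _; rewrite abse_EFin normrM EFinM.
    apply: lee_pmul => //; rewrite ?lee_fin//.
    by rewrite ger0_norm ?expR_ge0.
  move=> i1 _ H; apply: fine_cvg => //; rewrite fineK; first exact: H.
  exact: (integrable_fin_num measurableT).
have iB f : mbd f -> mu.-integrable setT (fun x => (f x * h x)%:E).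
  move=> [mf [M fM]]; apply: (le_integrable measurableT _ _ (integrableZl measurableT M ih)).
    exact/measurable_EFinP/measurable_funM.
  by move=> x _; rewrite /= lee_fin !normrM ler_wpM2r// (le_trans (fM x))// ler_norm.
have lk1 j : P j -> l j <= \int[mu]_x (k j x * h x).
  move=> Pj; have [mk [M kM]] := km Pj.
  pose C := (2 * M ^+ 2) * \int[mu]_x h x; apply/ler_addgt0Pr => e e0.
  have M0 : 0 <= M by exact: le_trans (kM point).
  have Ih0 : 0 <= \int[mu]_x h x.
    by apply: fine_ge0; apply: integral_ge0 => x _; rewrite lee_fin.
  have C0 : 0 <= C by rewrite !mulr_ge0.
  pose s := Num.min (2 * (M + 1))^-1 (e / (C + 1)).
  have s0 : 0 < s by rewrite lt_min invr_gt0 mulr_gt0 ?divr_gt0 ?ltr_wpDl.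
  have sM x : `|s * k j x| <= 2^-1.
    have : s <= (2 * (M + 1))^-1 by rewrite ge_min lexx.
    rewrite normrM gtr0_norm// -div1r ler_pdivlMr ?mulr_gt0 ?ltr_wpDl// => h1.
    have : s * `|k j x| <= s * (M + 1).
      by rewrite ler_wpM2l ?(ltW s0)// (le_trans (kM x))// lerDl.
    by lra.
  have sC : s * C <= e.
    have : s <= e / (C + 1) by rewrite ge_min lexx orbT.
    rewrite ler_pdivlMr ?ltr_wpDl//; have := s0; nra.
  have me : mbd (fun x => expR (s * k j x) - 1).
    apply: mbdB; last exact: mbd_cst.
    by apply: mexp; apply: mbdM; [exact: mbd_cst|exact: km].
  have H1 : s * l j <= \int[mu]_x ((expR (s * k j x) - 1) * h x).
    have cv : eps n + \int[mu]_x ((expR (s * k j x) - 1) * g n x) @[n --> \oo] -->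
        0 + \int[mu]_x ((expR (s * k j x) - 1) * h x) by apply: cvgD => //; exact: lim.
    rewrite add0r in cv; rewrite -(cvg_lim _ cv)//; apply: limr_ge; first by apply/cvg_ex; eexists; exact: cv.
    by apply: nearW => n; exact: pert.
  have H2 : \int[mu]_x ((expR (s * k j x) - 1) * h x) <=
      s * \int[mu]_x (k j x * h x) + s ^+ 2 * C.
    have -> : s ^+ 2 * C = (2 * (s ^+ 2 * M ^+ 2)) * \int[mu]_x h x by rewrite /C; ring.
    have ikh := iB _ (km Pj).
    have ia : mu.-integrable setT (fun x => (s * (k j x * h x))%:E) by exact: (integrableZl measurableT s ikh).
    have ib : mu.-integrable setT (fun x => (2 * (s ^+ 2 * M ^+ 2) * h x)%:E).
      exact: (integrableZl measurableT (2 * (s ^+ 2 * M ^+ 2)) ih).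
    rewrite -(RintegralZl s measurableT ikh) -(RintegralZl (2 * (s ^+ 2 * M ^+ 2)) measurableT ih).
    rewrite -RintegralD//.
    apply: le_Rintegral => //; first exact: iB.
      exact: (integrableD measurableT ia ib).
    move=> x _; rewrite mulrA -mulrDl ler_wpM2r//.
    have := sM x; have -> : s ^+ 2 * M ^+ 2 = (s * M) ^+ 2 by rewrite exprMn.
    have h1 : `|s * k j x| <= s * M by rewrite normrM gtr0_norm// ler_wpM2l// ltW.
    have h2 : (s * k j x) ^+ 2 <= (s * M) ^+ 2.
      by rewrite -[leLHS]real_normK ?num_real// lerXn2r ?nnegrE// mulr_ge0// ltW.
    rewrite ler_norml; move: (s * k j x) h2 => u h2 /andP[u1 u2].
    by have := expR_le_quad u2; lra.
  have : s * l j <= s * (\int[mu]_x (k j x * h x) + s * C).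
    apply: (le_trans H1 (le_trans H2 _)).
    by rewrite mulrDr mulrA -expr2.
  by rewrite ler_pM2l//; move/le_trans; apply; rewrite lerD2l.
(* The reverse inequality is [lk1] for - k j, which belongs to the family. *)
have lk j : P j -> \int[mu]_x (k j x * h x) = l j.
  move=> Pj; apply/eqP; rewrite eq_le lk1// andbT.
  have [m Pm [kE lE]] := lin (-1) 0 Pj Pj.
  have := lk1 _ Pm; rewrite lE mul0r addr0 mulN1r.
  have -> : \int[mu]_x (k m x * h x) = - \int[mu]_x (k j x * h x).
    rewrite -mulN1r -RintegralZl//; last by apply: iB; exact: km.
    by apply: eq_Rintegral => x _; rewrite kE; ring.
  by rewrite lerN2.
have lkE j : P j -> (\int[mu]_x (k j x * h x)%:E = (l j)%:E)%E.
  move=> Pj; rewrite -lk// /Rintegral fineK//.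
  by apply: (integrable_fin_num measurableT); apply: iB; exact: km.
have h1 : (\int[mu]_x (h x)%:E = 1)%E.
  have [j Pj [kE lE]] := one; rewrite -[RHS]/(1%:E) -lE -lkE// kE.
  by apply: eq_integral => x _; rewrite /= mul1r.
have young (t y : R) : 0 < t < 1 -> 0 <= y -> 0 <= t * y - y `^ t + 1 - t.
  by move=> t01 y0; have := powR_young t01 y0; lra.
exists h; split => //.
apply: (@le_trans _ _ S%:E); last by rewrite lee_fin.
have step (t : R) : 0 < t < 1 ->
  (\int[mu]_x (t * h x - h x `^ t + 1 - t)%:E <= ((1 - t) * S)%:E)%E.
  move=> /andP[t0 t1].
  apply: (@fatou_le _ _ _ mu (fun n x => t * g n x - g n x `^ t + 1 - t) _
    (fun n => (1 - t) * S + eps n)) => //.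
  - move=> n; have [mg _] := gm n; apply: measurable_funB => //.
    apply: measurable_funD => //; apply: measurable_funB.
      exact: measurable_funM.
    exact: (measurableT_comp (measurable_powR _)).
  - by move=> n x; apply: young; rewrite ?t0 ?expR_ge0.
  - apply: measurable_funB => //.
    apply: measurable_funD => //; apply: measurable_funB.
      exact: measurable_funM.
    exact: (measurableT_comp (measurable_powR _)).
  - apply: filterS gh => x gx; apply: cvgB; last exact: cvg_cst.
    apply: cvgD; last exact: cvg_cst.
    apply: cvgB; first by apply: cvgMr; exact: gx.
    by apply: cvg_powR => // n; exact: expR_gt0.
  - move=> n; have [m Pm [kE lE]] := lin t 0 (Pi n) (Pi n).
    have ek x : expR (k m x) = g n x `^ t.
      by rewrite kE mul0r addr0 /powR gt_eqF ?expR_gt0// expRK.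
    have mp : mbd (fun x => g n x `^ t).
      have := mexp (km Pm); congr mbd; apply/funext => x; exact: ek.
    have tg : mbd (fun x => t * g n x) by apply: mbdM => //; exact: mbd_cst.
    have m1 : mbd (fun x => t * g n x - g n x `^ t) by exact: mbdB.
    have m2 : mbd (fun x => t * g n x - g n x `^ t + 1) by apply: mbdD => //; exact: mbd_cst.
    have m3 : mbd (fun x => t * g n x - g n x `^ t + 1 - t) by apply: mbdB => //; exact: mbd_cst.
    rewrite -(@fineK _ (\int[mu]_x _)%E); last first.
      by apply: (integrable_fin_num measurableT); exact: mbd_integrable.
    rewrite lee_fin -/(Rintegral mu setT _).
    rewrite IntB//; last exact: mbd_cst.
    rewrite IntD//; last exact: mbd_cst.
    rewrite IntB// IntZ// !Int_cst.
    have h2 := DS Pm; have h3 := Di n; move: h2 h3; rewrite /D lE (eq_Int _ ek) mul0r addr0.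
    have -> : \int[mu]_x expR (k (i_ n) x) = \int[mu]_x g n x by [].
    set a := \int[mu]_x g n x; set b := \int[mu]_x _ => h2 h3.
    have : t * (S - eps n) <= t * (l (i_ n) + 1 - a) by rewrite ler_wpM2l// ltW.
    have : t * eps n <= eps n by rewrite ger_pMl// ltW.
    move: (l (i_ n)) h2 h3 (eps n) => y h2 h3 e; lra.
  - rewrite -[X in _ --> X]addr0; apply: cvgD => //; exact: cvg_cst.
pose u n : R := n.+2%:R^-1.
have u0 n : 0 < u n by rewrite invr_gt0.
have u1 n : u n < 1 by rewrite invf_lt1// ltr1n.
have cu : u n @[n --> \oo] --> 0.
  have := @cvg_harmonic R; rewrite -cvg_shiftS; apply.
have T01 n : 0 < 1 - u n < 1 by rewrite subr_gt0 u1 gtrBl u0.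
apply: (@fatou_le _ _ _ mu (fun n x =>
   (u n)^-1 * ((1 - u n) * h x - h x `^ (1 - u n) + 1 - (1 - u n))) _ (fun=> S)) => //.
- move=> n; apply: measurable_funM => //; apply: measurable_funB => //.
  apply: measurable_funD => //; apply: measurable_funB.
    exact: measurable_funM.
  exact: (measurableT_comp (measurable_powR _)).
- by move=> n x; rewrite mulr_ge0 ?invr_ge0 ?(ltW (u0 n))// young.
- apply: measurable_funD => //; apply: measurable_funB => //; apply: measurable_funM => //.
  exact: measurableT_comp.
- apply: aeW => x.
  have E n : (u n)^-1 * ((1 - u n) * h x - h x `^ (1 - u n) + 1 - (1 - u n)) =
     (u n)^-1 * (h x - h x `^ (1 - u n)) - h x + 1.
    by field; rewrite gt_eqF.
  under eq_fun do rewrite E.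
  apply: cvgD; last exact: cvg_cst.
  apply: cvgB; last exact: cvg_cst.
  by apply: cvg_powR_ln => // n; rewrite u0 u1.
- move=> n; under eq_integral do rewrite EFinM.
  rewrite ge0_integralZl//; last 3 first.
  - apply/measurable_EFinP; apply: measurable_funB => //.
    apply: measurable_funD => //; apply: measurable_funB.
      exact: measurable_funM.
    exact: (measurableT_comp (measurable_powR _)).
  - by move=> x _; rewrite lee_fin young.
  - by rewrite lee_fin invr_ge0 ltW.
  have := step _ (T01 n).
  have -> : (1 - (1 - u n)) * S = u n * S by ring.
  move=> H; apply: (@le_trans _ _ ((u n)^-1%:E * (u n * S)%:E)%E).
    by apply: lee_wpmul2l => //; rewrite lee_fin invr_ge0 ltW.
  by rewrite -EFinM lee_fin mulKf// gt_eqF.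
- exact: cvg_cst.
Qed.

End entropy_dual.

(** * Densities and relative entropy *)

Section has_density.
Context {dT : measure_display} {T : measurableType dT} {R : realType}.
Variables (g nu : probability T R) (h : T -> R).
Hypotheses (mh : measurable_fun setT h) (h0 : forall x, 0 <= h x)
  (gh : forall A, measurable A -> g A = (\int[nu]_(x in A) (h x)%:E)%E).

Let mEh : measurable_fun setT (EFin \o h). Proof. exact/measurable_EFinP. Qed.

Lemma density_dominates : g `<< nu.
Proof.
apply/null_content_dominatesP => A mA nA; rewrite gh//.
apply: null_set_integral => //; exact: measurable_funTS.
Qed.

Lemma density_mass : (\int[nu]_x (h x)%:E = 1)%E.
Proof. by rewrite -gh// probability_setT. Qed.

Lemma integrable_density : nu.-integrable setT (EFin \o h).
Proof.
apply/integrableP; split => //; under eq_integral do rewrite gee0_abs ?lee_fin//.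
by rewrite density_mass ltry.
Qed.

Let SF_h : ae_eq nu setT (Radon_Nikodym_SigmaFinite.f g nu) (EFin \o h).
Proof.
apply: integral_ae_eq => //; first exact/Radon_Nikodym_SigmaFinite.f_integrable/density_dominates.
move=> A _ mA; rewrite -Radon_Nikodym_SigmaFinite.f_integral//; last exact: density_dominates.
exact: gh.
Qed.

Lemma integral_density (F : T -> \bar R) : (forall x, 0 <= F x)%E ->
  measurable_fun setT F -> (\int[g]_x F x = \int[nu]_x (F x * (h x)%:E))%E.
Proof.
move=> F0 mF.
rewrite -(Radon_Nikodym_SigmaFinite.change_of_variables density_dominates)//.
apply: ae_eq_integral => //.
- apply: emeasurable_funM => //.
  exact: measurable_int (Radon_Nikodym_SigmaFinite.f_integrable density_dominates).
- exact: emeasurable_funM.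
- by apply: filterS SF_h => x H /H ->.
Qed.

Lemma Rintegral_density (F : T -> R) : mbd F ->
  \int[g]_x F x = \int[nu]_x (F x * h x).
Proof.
move=> mF; have [mF1 [M FM]] := mF; have M0 : 0 <= M by apply: le_trans (FM point).
have FM0 x : 0 <= F x + M by have := FM x; rewrite ler_norml => /andP[? _]; lra.
have iF : nu.-integrable setT (fun x => (F x * h x)%:E).
  apply: (le_integrable measurableT _ _ (integrableZl measurableT M integrable_density)).
    exact/measurable_EFinP/measurable_funM.
  by move=> x _; rewrite /= lee_fin !normrM ler_wpM2r// (le_trans (FM x))// ler_norm.
apply: (addIr M); rewrite -{1}(Int_cst g M) -IntD//; last exact: mbd_cst.
have -> : \int[nu]_x (F x * h x) + M = \int[nu]_x (F x * h x + M * h x).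
  rewrite RintegralD//; last exact: (integrableZl measurableT M integrable_density).
  congr (_ + _); rewrite (RintegralZl M measurableT integrable_density).
  by rewrite /Rintegral density_mass mulr1.
rewrite /Rintegral; congr fine; rewrite integral_density//.
- by apply: eq_integral => x _; rewrite -EFinM mulrDl.
- by apply/measurable_EFinP/measurable_funD.
Qed.

(** As h has integral 1, adding - h + 1 leaves the integral unchanged and makes the integrand
    nonnegative. The signed integral is treated through its positive and negative parts; the latter
    is at most 1 because h ln h >= h - 1. *)
Lemma relative_entropy_density : relative_entropy g nu =
  (\int[nu]_x (h x * ln (h x) - h x + 1)%:E)%E.
Proof.
have gnu := density_dominates.
have mln : measurable_fun setT (fun x => ln (h x)) by exact: measurableT_comp.
have mhl : measurable_fun setT (fun x => h x * ln (h x)) by exact: measurable_funM.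
rewrite /relative_entropy; case: asboolP => // _.
have RNh : ae_eq g setT (fun x => (ln (fine (Radon_Nikodym (charge_of_finite_measure g) nu x)))%:E)
    (fun x => (ln (h x))%:E).
  have : ae_eq nu setT (Radon_Nikodym (charge_of_finite_measure g) nu) (EFin \o h).
    apply: ae_eq_trans SF_h; apply: ae_eq_sym.
    exact: ae_eq_Radon_Nikodym_SigmaFinite.
  move=> [A [mA A0 HA]]; exists A; split => //.
    by move/null_content_dominatesP : gnu; apply.
  by apply: subset_trans HA; apply: subsetC => x H /H ->.
have mRN : measurable_fun setT (fun x => fine (Radon_Nikodym (charge_of_finite_measure g) nu x)).
  apply: measurableT_comp; first exact: fine_measurable.
  by apply: measurable_int; exact: Radon_Nikodym_integrable.
rewrite (ae_eq_integral _ _ _ _ _ RNh)//; last 2 first.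
- by apply/measurable_EFinP; exact: measurableT_comp.
- exact/measurable_EFinP.
pose u x := (h x * ln (h x))%:E : \bar R.
pose v x := (h x * ln (h x) - h x + 1)%:E : \bar R.
have v0 x : (0 <= v x)%E.
  rewrite lee_fin; have := h0 x; rewrite le_eqVlt => /predU1P[<-|hx].
    by rewrite mul0r; lra.
  have hi : 0 < (h x)^-1 by rewrite invr_gt0.
  have := ln_le_sub1 hi; rewrite lnV ?posrE// => H.
  have : h x * (- ln (h x)) <= h x * ((h x)^-1 - 1) by rewrite ler_pM2l.
  by rewrite mulrBr divff ?gt_eqF//; lra.
have mu_ : measurable_fun setT u by exact/measurable_EFinP.
have mv : measurable_fun setT v.
  by apply/measurable_EFinP/measurable_funD => //; exact: measurable_funB.
have Ep : (\int[g]_x (EFin \o (fun x => ln (h x)))^\+ x = \int[nu]_x u^\+ x)%E.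
  rewrite integral_density//; last exact/measurable_funepos/measurable_EFinP.
  apply: eq_integral => x _; rewrite !funeposE /u /= EFinM.
  rewrite -!EFin_max -!EFinM; congr EFin.
  by rewrite mulrC maxr_pMr// mulr0.
have En : (\int[g]_x (EFin \o (fun x => ln (h x)))^\- x = \int[nu]_x u^\- x)%E.
  rewrite integral_density//; last exact/measurable_funeneg/measurable_EFinP.
  have E (a b : R) : 0 <= b -> (maxe (- a%:E) 0 * b%:E = maxe (- (b * a)%:E) 0)%E.
    move=> b0; rewrite -!EFinN -!EFin_max -EFinM; congr EFin.
    by rewrite mulrC maxr_pMr// mulr0 mulrN.
  by apply: eq_integral => x _; rewrite !funenegE; exact: E.
rewrite [LHS]integralE Ep En.
have int1 : (\int[nu]_x 1%:E = 1)%E.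
  etransitivity; first exact: (integral_cst nu measurableT 1%E).
  by rewrite mul1e; exact: probability_setT.
have mp : measurable_fun setT (u^\+)%E by exact/measurable_funepos.
have mn : measurable_fun setT (u^\-)%E by exact/measurable_funeneg.
have fn : (\int[nu]_x u^\- x <= 1)%E.
  rewrite -int1; apply: ge0_le_integral => // x _.
  rewrite funenegE ge_max; apply/andP; split; last by rewrite lee_fin.
  rewrite /u -EFinN lee_fin.
  by have := v0 x; have := h0 x; rewrite lee_fin; lra.
have fnf : (\int[nu]_x u^\- x)%E \is a fin_num.
  by rewrite ge0_fin_numE ?(le_lt_trans fn) ?ltry// integral_ge0.
have A1 : (\int[nu]_x (u^\+ x + 1%:E) = \int[nu]_x u^\+ x + 1)%E.
  by rewrite ge0_integralD ?int1// => x _; rewrite lee_fin.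
have A2 : (\int[nu]_x (u^\- x + (h x)%:E) = \int[nu]_x u^\- x + 1)%E.
  by rewrite ge0_integralD ?density_mass// => x _; rewrite lee_fin.
have A3 : (\int[nu]_x (v x + (u^\- x + (h x)%:E)) = \int[nu]_x v x + (\int[nu]_x u^\- x + 1))%E.
  rewrite ge0_integralD ?A2//; last exact: emeasurable_funD.
  by move=> x _; rewrite adde_ge0 ?lee_fin.
have H : (\int[nu]_x u^\+ x + 1 = \int[nu]_x v x + (\int[nu]_x u^\- x + 1))%E.
  rewrite -A1 -A3; apply: eq_integral => x _.
  rewrite funeposE funenegE /u /v -EFinN -!EFin_max -!EFinD; congr EFin.
  by rewrite /Order.max; case: ifP => /idP h2; case: ifP => /idP h3; lra.
have E : (\int[nu]_x u^\+ x = \int[nu]_x v x + \int[nu]_x u^\- x)%E.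
  have one : (1 : \bar R)%E \is a fin_num by [].
  by rewrite -(addeK (\int[nu]_x u^\+ x)%E one) H addeA addeK.
by rewrite E addeK.
Qed.

End has_density.

Section density_measure.
Context {dT : measure_display} {T : measurableType dT} {R : realType}.
Variables (nu : probability T R) (h : T -> R).
Hypotheses (mh : measurable_fun setT h) (h0 : forall x, 0 <= h x)
  (h1 : (\int[nu]_x (h x)%:E = 1)%E).

Definition density_measure of measurable_fun setT h & (forall x, 0 <= h x) &
  (\int[nu]_x (h x)%:E = 1)%E :=
  fun A : set T => (\int[nu]_(x in A) (h x)%:E)%E.

Let dm := density_measure mh h0 h1.

Let dm0 : dm set0 = 0%E. Proof. exact: integral_set0. Qed.

Let dm_ge0 A : (0 <= dm A)%E.
Proof. by apply: integral_ge0 => x _; rewrite lee_fin. Qed.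

Let dm_sigma_additive : semi_sigma_additive dm.
Proof. by apply: semi_sigma_additive_nng_induced => //; exact/measurable_EFinP. Qed.

HB.instance Definition _ := isMeasure.Build _ _ _ dm dm0 dm_ge0 dm_sigma_additive.

Let dm_setT : dm setT = 1%E. Proof. exact: h1. Qed.

HB.instance Definition _ := Measure_isProbability.Build _ _ _ dm dm_setT.

Definition density_probability : probability T R := dm.

End density_measure.

(** * From the dual functional to a coupling *)

Section duality.
Context {R : realType} {d : nat}.
Local Notation Rd := 'rV[R]_d.
Variables (kap : R.-pker Rd ~> Rd) (rho0 rho : probability Rd R) (A : R).
Hypothesis dual : forall phi, test_function phi ->
  \int[rho]_x phi x - \int[rho0]_x ln (\int[kpr kap x]_y expR (phi y)) <= A.

Let nu := semidirect rho0 kap.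

Let nuE B : measurable B -> nu B = (\int[rho0]_x kap x [set y | B (x, y)])%E.
Proof.
move=> mB; apply: eq_integral => x _; congr (kap x _).
by apply/seteqP; split => y; rewrite /xsection/= inE.
Qed.

Let mid : measurable_fun setT (@id (Rd * Rd)). Proof. exact: measurable_id. Qed.

Let nu_int (f : Rd * Rd -> R) : mbd f ->
  \int[nu]_z f z = \int[rho0]_x \int[kpr kap x]_y f (x, y).
Proof. by move=> mf; exact: (mixture_Rintegral mid nuE mf). Qed.

Let m1 : measurable_fun setT (fst : Rd * Rd -> Rd). Proof. exact: measurable_fst. Qed.
Let m2 : measurable_fun setT (snd : Rd * Rd -> Rd). Proof. exact: measurable_snd. Qed.

Let I : Type := (Rd -> R) * (Rd -> R).
(** A pair (phi, psi) stands for phi(y) - psi(x). Leaving psi free makes the family linear;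
    optimizing over psi gives back the logarithm in [dual]. *)
Let P : set I := [set i | test_function i.1 /\ mbd i.2].
Let k (i : I) (z : Rd * Rd) : R := i.1 z.2 - i.2 z.1.
Let l (i : I) : R := \int[rho]_x i.1 x - \int[rho0]_x i.2 x.

Let mbd_fst (f : Rd -> R) : mbd f -> mbd (fun z : Rd * Rd => f z.1).
Proof. by move=> [mf [M fM]]; split; [exact: measurableT_comp mf m1|exists M]. Qed.

Let mbd_snd (f : Rd -> R) : mbd f -> mbd (fun z : Rd * Rd => f z.2).
Proof. by move=> [mf [M fM]]; split; [exact: measurableT_comp mf m2|exists M]. Qed.

Let km i : P i -> mbd (k i).
Proof.
by move=> [t1 t2]; apply: mbdB; [apply/mbd_snd/test_function_mbd|exact: mbd_fst].
Qed.

Let test0 : test_function (fun _ : Rd => 0 : R).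
Proof. by apply: (@bsmooth_test _ _ _ 0) => //; exact: bsmooth_cst. Qed.

Let lin (a b : R) i j : P i -> P j -> exists2 m, P m &
  k m = (fun z => a * k i z + b * k j z) /\ l m = a * l i + b * l j.
Proof.
move=> [i1 i2] [j1 j2].
have ti := test_functionZ a i1; have tj := test_functionZ b j1.
have mi : mbd (fun x => a * i.2 x) by apply: mbdM => //; exact: mbd_cst.
have mj : mbd (fun x => b * j.2 x) by apply: mbdM => //; exact: mbd_cst.
exists (fun x => a * i.1 x + b * j.1 x, fun x => a * i.2 x + b * j.2 x).
  by split; [exact: test_functionD|exact: mbdD].
split; first by apply/funext => z; rewrite /k /=; ring.
rewrite /l /= !IntD//; try exact: test_function_mbd.
rewrite !IntZ//; try exact: test_function_mbd.
ring.
Qed.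

Let one : exists2 i, P i & k i = cst 1 /\ l i = 1.
Proof.
exists (fun=> 0, fun=> -1); first by split => //; exact: mbd_cst.
by split; [apply/funext => z; rewrite /k /= opprK add0r|rewrite /l /= !Int_cst opprK add0r].
Qed.

(** With u the kernel mean of exp(phi), ln u <= psi - 1 + exp(- psi) u for every psi, with equality
    at psi = ln u. *)
Let lA i : P i -> l i + 1 - \int[nu]_z expR (k i z) <= A.
Proof.
move=> Pi; have [ti mi] := Pi; have ma := test_function_mbd ti.
have mexp (f : Rd -> R) : mbd f -> mbd (fun x => expR (f x)).
  move=> [mf [M fM]]; split; first exact: measurableT_comp.
  by exists (expR M) => x; rewrite ger0_norm ?expR_ge0// ler_expR (le_trans (ler_norm _)).
pose u x := \int[kpr kap x]_y expR (i.1 y).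
have mu_ : mbd u by exact: (@mbd_kernel _ _ _ _ _ _ _ kap snd m2 _ (mexp _ ma)).
have [_ [M aM]] := ma.
have u0 x : expR (- M) <= u x.
  apply: Int_ge_cst; first exact: mexp.
  by move=> y; rewrite ler_expR; have := aM y; rewrite ler_norml => /andP[].
have up x : 0 < u x by apply: lt_le_trans (u0 x); exact: expR_gt0.
have u1 x : u x <= expR M.
  apply: Int_le_cst; first exact: mexp.
  by move=> y; rewrite ler_expR; exact: le_trans (ler_norm _) (aM y).
have mlnu : mbd (fun x => ln (u x)).
  split; first by apply: measurableT_comp => //; case: mu_.
  exists M => x; rewrite ler_norml -{1}(expRK (- M)) -{2}(expRK M).
  by rewrite !ler_ln ?posrE ?expR_gt0// u0 u1.
have eE z : expR (k i z) = expR (- i.2 z.1) * expR (i.1 z.2) by rewrite -expRD addrC.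
have mN := mexp _ (mbdN mi).
rewrite (eq_Int _ eE) nu_int; last first.
  by apply: mbdM; [exact: (mbd_fst mN)|exact: (mbd_snd (mexp _ ma))].
have -> : \int[rho0]_x \int[kpr kap x]_y (expR (- i.2 (x, y).1) * expR (i.1 (x, y).2)) =
    \int[rho0]_x (expR (- i.2 x) * u x).
  by apply: eq_Int => x; exact: (IntZ (kpr kap x) (expR (- i.2 x)) (mexp _ ma)).
apply: le_trans (dual ti); rewrite -/u /l -addrA -addrA lerD2l.
have mM : mbd (fun x => expR (- i.2 x) * u x) by exact: mbdM.
have mc : mbd (fun _ : Rd => 1 : R) by exact: mbd_cst.
have mD : mbd (fun x => i.2 x - 1) by exact: mbdB.
have mE : mbd (fun x => i.2 x - 1 + expR (- i.2 x) * u x) by exact: mbdD.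
have : \int[rho0]_x ln (u x) <= \int[rho0]_x (i.2 x - 1 + expR (- i.2 x) * u x).
  apply: le_Int => // x.
  have h : 0 < expR (- i.2 x) * u x by rewrite mulr_gt0// expR_gt0.
  by have := ln_le_sub1 h; rewrite lnM ?posrE ?expR_gt0// expRK; lra.
rewrite IntD// IntB// Int_cst; set a := \int[rho0]_x ln _; set b := \int[rho0]_x i.2 x.
by set e := \int[rho0]_x _; lra.
Qed.

(** The linear constraints are the marginals: phi = 0 with psi = - 1_B gives the first one, psi = 0
    gives the second one on test functions, which determine it. *)
Lemma dual_entropy : exists2 g, coupling rho0 rho g & (relative_entropy g nu <= A%:E)%E.
Proof.
have [h [mh h0 hk h1 hA]] := entropy_dual km lin one lA.
pose g := density_probability mh h0 h1.
have gh B : measurable B -> g B = (\int[nu]_(x in B) (h x)%:E)%E by [].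
exists g; last by rewrite (relative_entropy_density mh h0 gh).
have hkR i : P i -> \int[nu]_x (k i x * h x) = l i.
  by move=> Pi; rewrite /Rintegral hk.
move=> B mB; split.
  have mI : mbd (fun x : Rd => \1_B x : R).
    split; first exact: measurable_indic.
    by exists 1 => x; rewrite indicE; case: (x \in B); rewrite ?normr1 ?normr0.
  pose i : I := (fun=> 0, fun x => - \1_B x).
  have Pi : P i by split => //; exact: mbdN.
  have Ek : g (B `*` setT) = (\int[nu]_z (k i z * h z)%:E)%E.
    rewrite gh; last exact: measurableX.
    rewrite integral_mkcond; apply: eq_integral => z _.
    rewrite /k /= add0r opprK patchE indicE.
    have -> : (z \in B `*` [set: Rd]) = (z.1 \in B).
      by apply/idP/idP; rewrite !inE/= => // -[].
    by case: (_ \in _); rewrite ?mul1r ?mul0r.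
  rewrite Ek hk// /l /= Int_cst add0r.
  have -> : - (\int[rho0]_x (- (\1_B x : R))) = \int[rho0]_x (\1_B x : R).
    have := IntZ rho0 (-1) mI; rewrite mulN1r => H; rewrite -[RHS]opprK -H; congr (- _).
    by apply: eq_Int => x; rewrite mulN1r.
  rewrite /Rintegral fineK; first by rewrite integral_indic// setIT.
  by apply: (integrable_fin_num measurableT); exact: (mbd_integrable _ mI).
have -> : g (setT `*` B) = law g m2 B.
  by congr (g _); apply/seteqP; split => z /=; rewrite /setX/=; tauto.
apply: test_functions_determine => // f tf; have mf := test_function_mbd tf.
rewrite Int_law// ?(Rintegral_density mh h0 gh)//; last exact: mbd_snd.
have Pi : P (f, fun=> 0) by split => //; exact: mbd_cst.
have := hkR _ Pi; rewrite /l /= Int_cst subr0 => <-.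
by apply: eq_Int => z; rewrite /k /= subr0.
Qed.

End duality.

(** * Entropic bridges *)

Section entropy_function.
Context {R : realType}.
Implicit Types v w : R.

Definition ent w : R := w * ln w - w + 1.

Lemma ent_tangent v w : 0 < v -> 0 <= w -> ent v + (w - v) * ln v <= ent w.
Proof.
move=> v0; rewrite /ent le_eqVlt => /predU1P[<-|w0].
  by rewrite mul0r; lra.
have vw : 0 < v / w by rewrite divr_gt0.
have := ln_le_sub1 vw; rewrite ln_div ?posrE// => H.
have : w * (ln v - ln w) <= w * (v / w - 1) by rewrite ler_pM2l.
by rewrite mulrBr mulrBr mulrCA divff ?gt_eqF// !mulr1; lra.
Qed.

Lemma ent_ge0 w : 0 <= w -> 0 <= ent w.
Proof. by move=> w0; have := ent_tangent ltr01 w0; rewrite ln1 /ent ln1; lra. Qed.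

(** Truncation towards 1, the minimum of [ent]: it keeps the logarithm bounded and does not increase
    [ent]. *)
Definition clampN (n : nat) w : R := Num.max n.+1%:R^-1 (Num.min n.+1%:R w).

Lemma clampN_ge n w : n.+1%:R^-1 <= clampN n w.
Proof. by rewrite le_max lexx. Qed.

Lemma clampN_gt0 n w : 0 < clampN n w.
Proof. by apply: lt_le_trans (clampN_ge n w); rewrite invr_gt0. Qed.

Lemma clampN_le n w : clampN n w <= n.+1%:R.
Proof.
by rewrite ge_max ge_min lexx andbT (@le_trans _ _ 1)// ?invf_le1// ler1n.
Qed.

Lemma clampN_le1 n w : 0 <= w -> clampN n w <= w + 1.
Proof.
move=> w0; rewrite ge_max (@le_trans _ _ 1) ?lerDr// ?invf_le1 ?ler1n//=.
by rewrite ge_min lerDl ler01 orbT.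
Qed.

Lemma ent_clampN n w : 0 <= w -> ent (clampN n w) <= ent w.
Proof.
move=> w0; apply: le_trans (ent_tangent (clampN_gt0 n w) w0).
rewrite lerDl.
have n1 : n.+1%:R^-1 <= 1 :> R by rewrite invf_le1// ler1n.
have n2 : 1 <= n.+1%:R :> R by rewrite ler1n.
have [w1|w1] := leP w 1.
  have cE : clampN n w = Num.max n.+1%:R^-1 w by rewrite /clampN min_r// (le_trans w1).
  rewrite mulr_le0 ?subr_le0//; first by rewrite cE le_max lexx orbT.
  by rewrite ln_le0// cE ge_max n1.
have c1 : 1 <= clampN n w by rewrite le_max le_min n2 (ltW w1) orbT.
rewrite mulr_ge0 ?ln_ge0// subr_ge0 ge_max ge_min lexx orbT andbT.
exact: le_trans n1 (ltW w1).
Qed.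

Lemma cvg_clampN w : 0 <= w -> clampN n w @[n --> \oo] --> w.
Proof.
move=> w0; have c1 : w + n.+1%:R^-1 @[n --> \oo] --> w.
  by rewrite -[X in _ --> X]addr0; apply: cvgD; [exact: cvg_cst|exact: cvg_harmonic].
apply: (squeeze_cvgr _ (cvg_cst w) c1).
have : \forall n \near \oo, w <= n%:R by exact: nbhs_infty_ger.
apply: filterS => n wn; have wN : w <= n.+1%:R by rewrite (le_trans wn)// ler_nat.
rewrite /clampN min_r// le_max lexx orbT ge_max lerDr w0/= lerDl.
by rewrite invr_ge0.
Qed.

End entropy_function.

Section kernel_snd.
Context d1 d2 d3 (X : measurableType d1) (Y : measurableType d2)
  (Z : measurableType d3) (R : realType).
Variable k : R.-pker Y ~> Z.

(** Forgets the first argument: iterating [semidirect] with such kernels builds the joint law of a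
    Markov process at successive times. *)
Definition ksnd (xy : X * Y) : {measure set Z -> \bar R} := k xy.2.

Let measurable_ksnd U : measurable U -> measurable_fun setT (ksnd ^~ U).
Proof.
move=> mU; apply: (measurableT_comp (measurable_kernel k U mU)).
exact: measurable_snd.
Qed.

HB.instance Definition _ := isKernel.Build _ _ _ _ _ ksnd measurable_ksnd.

Let ksnd_prob xy : ksnd xy setT = 1%E. Proof. exact: prob_kernel. Qed.

HB.instance Definition _ := Kernel_isProbability.Build _ _ _ _ _ ksnd ksnd_prob.

End kernel_snd.

Section semidirect_integral.
Context d1 d2 (X : measurableType d1) (Y : measurableType d2) (R : realType).
Variables (mu : probability X R) (k : R.-pker X ~> Y).

Let E (A : set (X * Y)) : measurable A ->
  semidirect mu k A = (\int[mu]_x k x [set y | A (x, y)])%E.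
Proof.
move=> mB; apply: eq_integral => x _; congr (k x _).
by apply/seteqP; split => y; rewrite /xsection/= inE.
Qed.

Lemma semidirect_integral (F : X * Y -> \bar R) : (forall z, 0 <= F z)%E ->
  measurable_fun setT F ->
  (\int[semidirect mu k]_z F z = \int[mu]_x \int[k x]_y F (x, y))%E.
Proof. exact: (mixture_integral (@measurable_id _ (X * Y)%type setT) E). Qed.

Lemma semidirect_Rintegral (f : X * Y -> R) : mbd f ->
  \int[semidirect mu k]_z f z = \int[mu]_x \int[kpr k x]_y f (x, y).
Proof. exact: (mixture_Rintegral (@measurable_id _ (X * Y)%type setT) E). Qed.

Lemma measurable_kernel_integral (F : X * Y -> \bar R) : (forall z, 0 <= F z)%E ->
  measurable_fun setT F -> measurable_fun setT (fun x => \int[k x]_y F (x, y))%E.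
Proof. exact: (measurable_mixture k (@measurable_id _ (X * Y)%type setT)). Qed.

Lemma mbd_kernel_integral (f : X * Y -> R) : mbd f ->
  mbd (fun x => \int[kpr k x]_y f (x, y)).
Proof. exact: (mbd_kernel k (@measurable_id _ (X * Y)%type setT)). Qed.

End semidirect_integral.

Lemma mbd_map d1 d2 (X : measurableType d1) (Y : measurableType d2) (R : realType)
  (f : Y -> R) (g : X -> Y) : measurable_fun setT g -> mbd f -> mbd (fun x => f (g x)).
Proof. by move=> mg [mf [M fM]]; split; [exact: measurableT_comp|exists M]. Qed.

Section bridge.
Context {R : realType} {d : nat}.
Hypothesis hd : (0 < d)%N.
Local Notation Rd := 'rV[R]_d.
Variables (b : 'I_d -> Rd -> R) (CV : R).
Hypotheses (bc : forall i, continuous (b i)) (CV0 : 0 <= CV)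
  (bV : forall x, gen b V x <= CV).
Variable p : R -> R.-pker Rd ~> Rd.
Hypothesis pb : forall x f, test_function f ->
  (forall t : R, 0 < t -> is_derive t (1 : R) (fun s => \int[p s x]_y f y)
     (\int[p t x]_y gen b f y)) /\
  (\int[p t x]_y f y) @[t --> 0^'+] --> f x.
Variables (tau : R) (rho0 rho1 : probability Rd R).
Hypothesis tau0 : 0 < tau.
Let nu := semidirect rho0 (Pk p tau).
Variables (g : probability (Rd * Rd)%type R) (h : Rd * Rd -> R) (H : R).
Hypotheses (cg : coupling rho0 rho1 g) (mh : measurable_fun setT h)
  (h0 : forall x, 0 <= h x)
  (gh : forall A, measurable A -> g A = (\int[nu]_(x in A) (h x)%:E)%E)
  (hH : (\int[nu]_x (ent (h x))%:E <= H%:E)%E).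

Let chapman_mbd x s t f : 0 <= s -> 0 <= t -> mbd f ->
  \int[Pr p (s + t) x]_y f y = \int[Pr p s x]_z \int[Pr p t z]_y f y.
Proof.
move=> s0 t0 mf.
apply: (@mixture_Rintegral _ _ _ _ _ _ _ (Pk p t) snd measurable_snd _ _ _ _ mf).
by move=> A mA; exact: (chapman hd bc CV0 bV pb).
Qed.

(** In units of tau: [nu2], [nu3] and [nu4] are the joint laws of the diffusion started from rho0 at
    the times 0 and s, then also t, then also 1. *)
Let P (r : R) : R.-pker Rd ~> Rd := Pk p (tau * r).
Let nu2 s := semidirect rho0 (P s).
Let nu3 s t := semidirect (nu2 s) (@ksnd _ _ _ Rd Rd Rd R (P (t - s))).
Let nu4 s t := semidirect (nu3 s t) (@ksnd _ _ _ (Rd * Rd)%type Rd Rd R (P (1 - t))).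

Let chap_ge0 x s t (F : Rd -> \bar R) : 0 <= s -> 0 <= t -> (forall y, 0 <= F y)%E ->
  measurable_fun setT F ->
  (\int[P s x]_z \int[P t z]_y F y = \int[P (s + t) x]_y F y)%E.
Proof.
move=> s0 t0 F0 mF; rewrite /P mulrDr.
by have := chapman_ge0 hd bc CV0 bV pb x (mulr_ge0 (ltW tau0) s0) (mulr_ge0 (ltW tau0) t0) F0 mF => ->.
Qed.

Let nest s t (F : Rd -> Rd -> Rd -> Rd -> \bar R) :
  (forall x z z' y, 0 <= F x z z' y)%E ->
  measurable_fun setT (fun w : ((Rd * Rd) * Rd) * Rd => F w.1.1.1 w.1.1.2 w.1.2 w.2) ->
  (\int[nu4 s t]_w F w.1.1.1 w.1.1.2 w.1.2 w.2 =
   \int[rho0]_x \int[P s x]_z \int[P (t - s) z]_z' \int[P (1 - t) z']_y F x z z' y)%E.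
Proof.
move=> F0 mF; rewrite /nu4 semidirect_integral//.
have m3 := measurable_kernel_integral (@ksnd _ _ _ (Rd * Rd)%type Rd Rd R (P (1 - t))) (fun z => F0 _ _ _ _) mF.
rewrite /nu3 semidirect_integral//; last by move=> z; exact: integral_ge0.
have m2 := measurable_kernel_integral (@ksnd _ _ _ Rd Rd Rd R (P (t - s))) _ m3.
rewrite /nu2 semidirect_integral//.
  by move=> z; apply: integral_ge0 => z' _; exact: integral_ge0.
by apply: m2 => z; exact: integral_ge0.
Qed.

(** The integral of F(X_s) under the path law with density h(X_0, X_1), in rescaled time. *)
Let mm s (F : Rd -> R) : \bar R :=
  (\int[rho0]_x \int[P s x]_z \int[P (1 - s) z]_y (F z * h (x, y))%:E)%E.

Let m1 : measurable_fun setT (fun w : ((Rd * Rd) * Rd) * Rd => w.1.1.1).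
Proof. by do 2!apply: measurableT_comp measurable_fst _; exact: measurable_fst. Qed.

Let h4 (w : ((Rd * Rd) * Rd) * Rd) : R := h (w.1.1.1, w.2).

Let mh4 : measurable_fun setT h4.
Proof.
apply: measurableT_comp mh _; apply/measurable_fun_pairP; split => //.
exact: measurable_snd.
Qed.

Let e34 (w : ((Rd * Rd) * Rd) * Rd) : Rd * Rd := (w.1.1.2, w.1.2).

Let me34 : measurable_fun setT e34.
Proof.
apply/measurable_fun_pairP; split; last exact: (measurableT_comp measurable_snd measurable_fst).
exact: (measurableT_comp measurable_snd (measurableT_comp measurable_fst measurable_fst)).
Qed.

Let meas_z (F : Rd -> R) x : measurable_fun setT F -> (forall z, 0 <= F z) -> forall t,
  measurable_fun setT (fun z => \int[P (1 - t) z]_y (F z * h (x, y))%:E)%E.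
Proof.
move=> mF F0 t.
apply: (measurable_kernel_integral (P (1 - t)) (F := fun q => (F q.1 * h (x, q.2))%:E)).
  by move=> z; rewrite lee_fin mulr_ge0.
apply/measurable_EFinP/measurable_funM; first exact: measurableT_comp mF measurable_fst.
exact: (measurableT_comp (measurableT_comp mh (measurable_pair1 x)) measurable_snd).
Qed.

Let mFh (F : Rd -> R) x z : measurable_fun setT (fun y => (F z * h (x, y))%:E).
Proof. by apply/measurable_EFinP/measurable_funM => //; exact: measurableT_comp mh (measurable_pair1 x). Qed.

(** The time that neither F nor h sees is integrated out by Chapman-Kolmogorov. *)
Let marg1 (s t : R) (F : Rd -> R) : 0 <= s -> s <= t -> t <= 1 -> (forall z, 0 <= F z) ->
  measurable_fun setT F ->
  (\int[nu4 s t]_w (F w.1.1.2 * h4 w)%:E = mm s F)%E.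
Proof.
move=> s0 st t1 F0 mF.
rewrite (nest s t (F := fun x z z' y => (F z * h (x, y))%:E)); last 2 first.
- by move=> x z z' y; rewrite lee_fin mulr_ge0.
- apply/measurable_EFinP/measurable_funM => //; apply: measurableT_comp mF _.
  exact: measurableT_comp measurable_fst me34.
rewrite /mm; apply: eq_integral => x _; apply: eq_integral => z _.
rewrite chap_ge0 ?subr_ge0//; last by move=> y; rewrite lee_fin mulr_ge0.
by have -> : t - s + (1 - t) = 1 - s by ring.
Qed.

Let marg2 (s t : R) (F : Rd -> R) : 0 <= s -> s <= t -> t <= 1 -> (forall z, 0 <= F z) ->
  measurable_fun setT F ->
  (\int[nu4 s t]_w (F w.1.2 * h4 w)%:E = mm t F)%E.
Proof.
move=> s0 st t1 F0 mF.
rewrite (nest s t (F := fun x z z' y => (F z' * h (x, y))%:E)); last 2 first.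
- by move=> x z z' y; rewrite lee_fin mulr_ge0.
- apply/measurable_EFinP/measurable_funM => //; apply: measurableT_comp mF _.
  exact: measurableT_comp measurable_snd me34.
rewrite /mm; apply: eq_integral => x _.
rewrite (chap_ge0 x s0 (F := fun z' => \int[P (1 - t) z']_y (F z' * h (x, y))%:E)%E) ?subr_ge0//.
- by have -> : s + (t - s) = t by ring.
- by move=> y; apply: integral_ge0 => z _; rewrite lee_fin mulr_ge0.
- exact: meas_z.
Qed.

Let P0 x (F : Rd -> \bar R) : measurable_fun setT F -> (\int[P 0 x]_y F y = F x)%E.
Proof.
move=> mF; rewrite /P mulr0 /Pk lexx /kdirac/=.
by rewrite integral_dirac ?diracT ?mul1e.
Qed.

Let mm0 (F : Rd -> R) : (forall z, 0 <= F z) -> measurable_fun setT F ->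
  (mm 0 F = \int[nu]_w (F w.1 * h w)%:E)%E.
Proof.
move=> F0 mF; rewrite /nu semidirect_integral; last 2 first.
- by move=> z; rewrite lee_fin mulr_ge0.
- by apply/measurable_EFinP/measurable_funM => //; exact: measurableT_comp mF measurable_fst.
apply: eq_integral => x _; rewrite P0; last exact: meas_z.
by rewrite /P subr0 mulr1.
Qed.

Let mm1 (F : Rd -> R) : (forall z, 0 <= F z) -> measurable_fun setT F ->
  (mm 1 F = \int[nu]_w (F w.2 * h w)%:E)%E.
Proof.
move=> F0 mF; rewrite /nu semidirect_integral; last 2 first.
- by move=> z; rewrite lee_fin mulr_ge0.
- by apply/measurable_EFinP/measurable_funM => //; exact: measurableT_comp mF measurable_snd.
apply: eq_integral => x _; rewrite {1}/P mulr1; apply: eq_integral => z _.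
by rewrite subrr P0.
Qed.

Let nuI (F : Rd * Rd -> R) : (forall z, 0 <= F z) -> measurable_fun setT F ->
  (\int[nu]_w (F w * h w)%:E = \int[g]_w (F w)%:E)%E.
Proof.
move=> F0 mF; by rewrite (integral_density mh gh)//; exact/measurable_EFinP.
Qed.

Let mass4 (s t : R) : 0 <= s -> s <= t -> t <= 1 -> (\int[nu4 s t]_w (h4 w)%:E = 1)%E.
Proof.
move=> s0 st t1.
transitivity (\int[nu4 0 1]_w (1 * h4 w)%:E)%E; last first.
  rewrite (marg1 (F := fun=> 1))// mm0// (nuI (F := fun=> 1))//.
  etransitivity; first exact: (integral_cst g measurableT 1%E).
  by rewrite mul1e; exact: probability_setT.
transitivity (\int[nu4 s t]_w (1 * h4 w)%:E)%E.
  by apply: eq_integral => w _; rewrite mul1r.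
have t0 : 0 <= t by exact: le_trans st.
have one0 (z : Rd) : 0 <= (1 : R) by [].
have mone : measurable_fun setT (fun _ : Rd => 1 : R) by [].
transitivity (mm t (fun=> 1)); first exact: (marg2 s0 st t1 one0 mone).
transitivity (\int[nu4 t 1]_w (1 * h4 w)%:E)%E.
  symmetry; exact: (marg1 t0 t1 (lexx 1) one0 mone).
transitivity (mm 1 (fun=> 1)); first exact: (marg2 t0 t1 (lexx 1) one0 mone).
symmetry; exact: (marg2 (lexx 0) ler01 (lexx 1) one0 mone).
Qed.

Let h40 w : 0 <= h4 w. Proof. exact: h0. Qed.

Let preim (s t : R) (f : ((Rd * Rd) * Rd) * Rd -> Rd) A : measurable A ->
  (\int[nu4 s t]_(w in f @^-1` A) (h4 w)%:E = \int[nu4 s t]_w (\1_A (f w) * h4 w)%:E)%E.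
Proof.
move=> mA; rewrite integral_mkcond; apply: eq_integral => w _.
rewrite patchE indicE; have -> : (w \in f @^-1` A) = (f w \in A) by apply/idP/idP; rewrite !inE.
by case: (_ \in _); rewrite ?mul1r ?mul0r.
Qed.

Let indic_ge0 (A : set Rd) z : 0 <= (\1_A z : R). Proof. by rewrite indicE. Qed.

(** The law of X_s under the density h(X_0, X_1) makes sense for s in [0, 1]; elsewhere rho0 is a
    default value. *)
Let ex_c : {c : R -> probability Rd R | forall s, 0 <= s <= 1 ->
  forall A, measurable A -> c s A = mm s \1_A}.
Proof.
apply: cid; suff /choice [c Hc] : forall s, exists m : probability Rd R,
    0 <= s <= 1 -> forall A, measurable A -> m A = mm s \1_A by exists c.
move=> s; have [/andP[s0 s1]|ns] := boolP (0 <= s <= 1); last by exists rho0.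
pose G := density_probability mh4 h40 (mass4 s0 s1 (lexx 1)).
have mz : measurable_fun setT (fun w : ((Rd * Rd) * Rd) * Rd => w.1.1.2).
  exact: (measurableT_comp measurable_fst me34).
exists (law G mz) => _ A mA.
rewrite -(marg1 s0 s1 (lexx 1) (indic_ge0 A) (measurable_indic mA)).
exact: preim.
Qed.

Let c := sval ex_c.
Let cE s A : 0 <= s <= 1 -> measurable A -> c s A = mm s \1_A.
Proof. by move=> s01; exact: (svalP ex_c s s01). Qed.

Let c0 A : measurable A -> c 0 A = rho0 A.
Proof.
move=> mA; rewrite cE ?lexx ?ler01// (mm0 (indic_ge0 A) (measurable_indic mA)).
have m : measurable_fun setT (fun w : Rd * Rd => \1_A w.1 : R).
  by apply: measurableT_comp (measurable_indic mA) _; exact: measurable_fst.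
rewrite (nuI (F := fun w => \1_A w.1))//.
have [<- _] := cg mA.
transitivity (\int[g]_w (\1_(A `*` setT) w)%:E)%E; last by rewrite integral_indic ?setIT//; exact: measurableX.
apply: eq_integral => w _; rewrite !indicE; congr ((nat_of_bool _)%:R%:E).
by apply/idP/idP; rewrite !inE /setX/= => // -[].
Qed.

Let c1 A : measurable A -> c 1 A = rho1 A.
Proof.
move=> mA; rewrite cE ?lexx ?ler01// (mm1 (indic_ge0 A) (measurable_indic mA)).
have m : measurable_fun setT (fun w : Rd * Rd => \1_A w.2 : R).
  by apply: measurableT_comp (measurable_indic mA) _; exact: measurable_snd.
rewrite (nuI (F := fun w => \1_A w.2))//.
have [_ <-] := cg mA.
transitivity (\int[g]_w (\1_(setT `*` A) w)%:E)%E; last by rewrite integral_indic ?setIT//; exact: measurableX.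
apply: eq_integral => w _; rewrite !indicE; congr ((nat_of_bool _)%:R%:E).
by apply/idP/idP; rewrite !inE /setX/= => // -[].
Qed.

Let hN n w := clampN n (h w).

Let mhN n : mbd (hN n).
Proof.
split; last first.
  by exists n.+1%:R => w; rewrite ger0_norm ?clampN_le// ltW// clampN_gt0.
by apply: measurable_maxr => //; apply: measurable_minr.
Qed.

Let k2 (r : R) := @ksnd _ _ _ Rd Rd Rd R (P r).
(** The conditional expectation of the truncated density given X_0 and X_t. *)
Let W n t (q : Rd * Rd) : R := \int[kpr (k2 (1 - t)) q]_y hN n (q.1, y).

Let mp13 : measurable_fun setT (fun w : (Rd * Rd) * Rd => (w.1.1, w.2)).
Proof.
apply/measurable_fun_pairP; split; last exact: measurable_snd.
exact: (measurableT_comp measurable_fst measurable_fst).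
Qed.

Let mW n t : mbd (W n t).
Proof. exact: (mbd_kernel_integral (k2 (1 - t)) (mbd_map mp13 (mhN n))). Qed.

Let hNx n x : mbd (fun y => hN n (x, y)).
Proof. exact: (mbd_map (measurable_pair1 x) (mhN n)). Qed.

Let Wge n t q : n.+1%:R^-1 <= W n t q.
Proof. by apply: Int_ge_cst => [|y]; [exact: hNx|exact: clampN_ge]. Qed.

Let W0 n t q : 0 < W n t q.
Proof. by apply: lt_le_trans (Wge n t q); rewrite invr_gt0. Qed.

Let Wle n t q : W n t q <= n.+1%:R.
Proof. by apply: Int_le_cst => [|y]; [exact: hNx|exact: clampN_le]. Qed.

Let mlnW n t : mbd (fun q => ln (W n t q)).
Proof.
split; first by apply: measurableT_comp => //; case: (mW n t).
exists (ln n.+1%:R) => q; rewrite ler_norml -lnV ?posrE//.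
by rewrite !ler_ln ?posrE ?invr_gt0// Wge Wle.
Qed.

Let mentW n t : mbd (fun q => ent (W n t q)).
Proof.
by apply: mbdD; [apply: mbdB => //; exact: mbdM|exact: mbd_cst].
Qed.

Let EN n t := \int[nu2 t]_q ent (W n t q).

Let chapW n (s t : R) q : 0 <= s -> s <= t -> t <= 1 ->
  \int[kpr (k2 (t - s)) q]_z W n t (q.1, z) = W n s q.
Proof.
move=> s0 st t1.
have a1 : 0 <= tau * (t - s) by rewrite mulr_ge0 ?(ltW tau0)// subr_ge0.
have a2 : 0 <= tau * (1 - t) by rewrite mulr_ge0 ?(ltW tau0)// subr_ge0.
have := chapman_mbd q.2 a1 a2 (hNx n q.1).
have -> : tau * (t - s) + tau * (1 - t) = tau * (1 - s) by ring.
by move=> E; rewrite [RHS]E.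
Qed.

Let nu32 (s t : R) (k : Rd * Rd -> R) : 0 <= s -> s <= t -> mbd k ->
  \int[nu3 s t]_w k (w.1.1, w.2) = \int[nu2 t]_q k q.
Proof.
move=> s0 st mk.
rewrite /nu3 (semidirect_Rintegral (nu2 s) (k2 (t - s)) (mbd_map mp13 mk)).
have m2 := mbd_kernel_integral (k2 (t - s)) (mbd_map mp13 mk).
rewrite /nu2 (semidirect_Rintegral rho0 (P s) m2) (semidirect_Rintegral rho0 (P t) mk).
apply: eq_Int => x.
have a1 : 0 <= tau * s by rewrite mulr_ge0 ?(ltW tau0).
have a2 : 0 <= tau * (t - s) by rewrite mulr_ge0 ?(ltW tau0)// subr_ge0.
have := chapman_mbd x a1 a2 (mbd_map (measurable_pair1 x) mk).
have -> : tau * s + tau * (t - s) = tau * t by ring.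
by move=> E; rewrite [RHS]E.
Qed.

Section increment.
Variables (s t : R) (a : Rd * Rd -> R).
Hypotheses (s0 : 0 <= s) (st : s <= t) (t1 : t <= 1) (ma : mbd a).

Let K z := kpr (P (t - s)) z.
Let Z z := \int[K z]_u expR (a (z, u)).
(** Normalized so that exp(G) has mean 1 under [K z]. *)
Let G q := a q - ln (Z q.1).

Let mea : mbd (fun q => expR (a q)).
Proof.
have [h1 [M h2]] := ma; split; first exact: measurableT_comp.
by exists (expR M) => x; rewrite ger0_norm ?expR_ge0// ler_expR (le_trans (ler_norm _)).
Qed.

Let max_ z : mbd (fun u => expR (a (z, u))).
Proof. exact: (mbd_map (measurable_pair1 z) mea). Qed.

Let Zb : exists M, forall z, expR (- M) <= Z z <= expR M.
Proof.
have [_ [M aM]] := ma; exists M => z.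
have aM' q : - M <= a q <= M by rewrite -ler_norml.
by rewrite Int_ge_cst ?Int_le_cst// => u; rewrite ler_expR; case/andP: (aM' (z, u)).
Qed.

Let Z0 z : 0 < Z z.
Proof. by have [M /(_ z) /andP[+ _]] := Zb; apply: lt_le_trans; exact: expR_gt0. Qed.

Let mlnZ : mbd (fun z => ln (Z z)).
Proof.
have mZ : mbd Z by exact: (mbd_kernel_integral (P (t - s)) mea).
split; first by apply: measurableT_comp => //; case: mZ.
have [M ZM] := Zb; exists M => z; have /andP[z1 z2] := ZM z.
by rewrite ler_norml -{1}(expRK (- M)) -{2}(expRK M) !ler_ln ?posrE ?expR_gt0// z1 z2.
Qed.

Let mG : mbd G.
Proof. by apply: mbdB => //; exact: (mbd_map measurable_fst mlnZ). Qed.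

(* The tangent inequality for [ent] at [W_s e^G], whose [K]-mean is [W_s]. *)
Let gibbs n q : ent (W n s q) + \int[K q.2]_z (W n t (q.1, z) * G (q.2, z)) <=
  \int[K q.2]_z ent (W n t (q.1, z)).
Proof.
pose v := W n s q; have v0 : 0 < v by exact: W0.
have mw : mbd (fun z => W n t (q.1, z)) by exact: (mbd_map (measurable_pair1 q.1)).
have mGq : mbd (fun z => G (q.2, z)) by exact: (mbd_map (measurable_pair1 q.2)).
have me : mbd (fun z => ent (W n t (q.1, z))).
  exact: (mbd_map (measurable_pair1 q.1) (mentW n t)).
have mc (r : R) : mbd (fun _ : Rd => r) by exact: mbd_cst.
have meG : mbd (fun z => expR (G (q.2, z))).
  have [h1 [M h2]] := mGq; split; first exact: measurableT_comp.
  by exists (expR M) => x; rewrite ger0_norm ?expR_ge0// ler_expR (le_trans (ler_norm _)).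
have IG : \int[K q.2]_z expR (G (q.2, z)) = 1.
  transitivity ((Z q.2)^-1 * \int[K q.2]_z expR (a (q.2, z))).
    rewrite -IntZ//; apply: eq_Int => z.
    by rewrite /G expRD expRN lnK ?posrE// mulrC.
  by rewrite mulVf// gt_eqF.
have cw : \int[K q.2]_z W n t (q.1, z) = v by exact: chapW.
have m1' : mbd (fun z => W n t (q.1, z) * G (q.2, z)) by exact: mbdM.
have m2' : mbd (fun z => ln v * W n t (q.1, z)) by exact: mbdM.
have m3' : mbd (fun z => ln v * W n t (q.1, z) + W n t (q.1, z) * G (q.2, z)) by exact: mbdD.
have m4' : mbd (fun z => v * expR (G (q.2, z))) by exact: mbdM.
have m5' : mbd (fun z => ln v * W n t (q.1, z) + W n t (q.1, z) * G (q.2, z) -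
  v * expR (G (q.2, z))) by exact: mbdB.
apply: (@le_trans _ _ (\int[K q.2]_z (ln v * W n t (q.1, z) +
    W n t (q.1, z) * G (q.2, z) - v * expR (G (q.2, z)) + 1))).
  rewrite IntD// IntB// IntD// !IntZ// IG cw Int_cst /ent -/v.
  by set i := \int[_]_z _; lra.
apply: le_Int => //; first exact: mbdD.
move=> z; have vG : 0 < v * expR (G (q.2, z)) by rewrite mulr_gt0// expR_gt0.
have := ent_tangent vG (ltW (W0 n t (q.1, z))).
by rewrite lnM ?posrE ?expR_gt0// expRK /ent lnM ?posrE ?expR_gt0// expRK; lra.
Qed.

Let mhN4 n : mbd (fun w : ((Rd * Rd) * Rd) * Rd => hN n (w.1.1.1, w.2)).
Proof.
apply: (mbd_map (g := fun w : ((Rd * Rd) * Rd) * Rd => (w.1.1.1, w.2)) _ (mhN n)).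
apply/measurable_fun_pairP; split => //; exact: measurable_snd.
Qed.

(** [gibbs] integrated over (X_0, X_s); conditioning on (X_0, X_s, X_t) allows the truncated density
    to be replaced by [W n t]. *)
Lemma EN_step n : EN n s + \int[nu4 s t]_w (G (e34 w) * hN n (w.1.1.1, w.2)) <= EN n t.
Proof.
have mG4 : mbd (fun w => G (e34 w)) by exact: (mbd_map me34 mG).
have m4 : mbd (fun w => G (e34 w) * hN n (w.1.1.1, w.2)) by exact: mbdM.
have mp23 : measurable_fun setT (fun w : (Rd * Rd) * Rd => (w.1.2, w.2)).
  apply/measurable_fun_pairP; split; last exact: measurable_snd.
  exact: (measurableT_comp measurable_snd measurable_fst).
have mG3 : mbd (fun w : (Rd * Rd) * Rd => G (w.1.2, w.2)) by exact: (mbd_map mp23 mG).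
have mW3 : mbd (fun w : (Rd * Rd) * Rd => W n t (w.1.1, w.2)) by exact: (mbd_map mp13).
have mWG : mbd (fun w : (Rd * Rd) * Rd => W n t (w.1.1, w.2) * G (w.1.2, w.2)) by exact: mbdM.
have mE3 : mbd (fun w : (Rd * Rd) * Rd => ent (W n t (w.1.1, w.2))).
  exact: (mbd_map mp13 (mentW n t)).
have -> : \int[nu4 s t]_w (G (e34 w) * hN n (w.1.1.1, w.2)) =
    \int[nu3 s t]_w (W n t (w.1.1, w.2) * G (w.1.2, w.2)).
  rewrite /nu4 semidirect_Rintegral//; apply: eq_Int => w.
  rewrite [RHS]mulrC; exact: (IntZ (kpr (P (1 - t)) w.2) (G (w.1.2, w.2)) (hNx n w.1.1)).
have -> : EN n t = \int[nu3 s t]_w ent (W n t (w.1.1, w.2)) by rewrite (nu32 s0 st (mentW n t)).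
rewrite /nu3 (semidirect_Rintegral (nu2 s) _ mWG) (semidirect_Rintegral (nu2 s) _ mE3).
have mWI := mbd_kernel_integral (k2 (t - s)) mWG.
rewrite -(IntD (nu2 s) (mentW n s) mWI).
apply: le_Int => [||q].
- exact: (mbdD (mentW n s) mWI).
- exact: (mbd_kernel_integral (k2 (t - s)) mE3).
- exact: gibbs.
Qed.

Lemma law34_coupling : coupling (c s) (c t) (law (density_probability mh4 h40 (mass4 s0 st t1)) me34).
Proof.
have s1 : 0 <= s <= 1 by rewrite s0 (le_trans st).
have t01 : 0 <= t <= 1 by rewrite (le_trans s0).
move=> A mA; split.
- rewrite cE// -(marg1 s0 st t1 (indic_ge0 A) (measurable_indic mA)).
  rewrite -(@preim s t (fun w => w.1.1.2) A mA).
  by rewrite [LHS]/(integral _ _ _); congr (integral _ _ _); apply/seteqP; split => w /=; rewrite /setX/=; tauto.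
- rewrite cE// -(marg2 s0 st t1 (indic_ge0 A) (measurable_indic mA)).
  rewrite -(@preim s t (fun w => w.1.2) A mA).
  by rewrite [LHS]/(integral _ _ _); congr (integral _ _ _); apply/seteqP; split => w /=; rewrite /setX/=; tauto.
Qed.

Lemma lim34 : \int[nu4 s t]_w (G (e34 w) * hN n (w.1.1.1, w.2)) @[n --> \oo] -->
  \int[law (density_probability mh4 h40 (mass4 s0 st t1)) me34]_q G q.
Proof.
have mG4 : mbd (fun w => G (e34 w)) by exact: (mbd_map me34 mG).
have [mG1 [M GM]] := mG4; have M0 : 0 <= M by apply: le_trans (GM point).
have gd : forall A, measurable A -> density_probability mh4 h40 (mass4 s0 st t1) A =
  (\int[nu4 s t]_(w in A) (h4 w)%:E)%E by [].
have -> : \int[law (density_probability mh4 h40 (mass4 s0 st t1)) me34]_q G q = \int[nu4 s t]_w (G (e34 w) * h4 w).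
  by rewrite Int_law// (Rintegral_density mh4 h40 gd).
have ih := integrable_density mh4 h40 gd.
have [] := @dominated_convergence _ _ _ (nu4 s t) setT measurableT
  (fun n w => (G (e34 w) * hN n (w.1.1.1, w.2))%:E) (fun w => (G (e34 w) * h4 w)%:E)
  (fun w => M%:E * ((h4 w)%:E + 1%:E))%E.
- move=> n; have [mn _] := mhN4 n; apply/measurable_EFinP; exact: (measurable_funM mG1 mn).
- apply/measurable_EFinP; exact: (measurable_funM mG1 mh4).
- apply: aeW => w _; apply: cvg_EFin; first exact: nearW.
  by apply: cvgMr; apply: cvg_clampN.
- apply: integrableZl => //; apply: integrableD => //.
  by apply: mbd_integrable; exact: mbd_cst.
- apply: aeW => w n _; rewrite -EFinD -EFinM abse_EFin lee_fin normrM.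
  apply: ler_pM => //; rewrite ger0_norm; last exact/ltW/clampN_gt0.
  exact: clampN_le1.
move=> i1 _ cv; apply: fine_cvg => //; rewrite fineK; first exact: cv.
exact: (integrable_fin_num measurableT).
Qed.

End increment.

Let EN_ge0 n t : 0 <= EN n t.
Proof. by apply: Int_ge_cst => // q; apply: ent_ge0; exact: ltW. Qed.

Let EN1 n : EN n 1 <= H.
Proof.
have mw : mbd (fun w => ent (hN n w)).
  have ml : mbd (fun w => ln (hN n w)).
    split; first by apply: measurableT_comp => //; case: (mhN n).
    exists (ln n.+1%:R) => q; rewrite ler_norml -lnV ?posrE//.
    by rewrite !ler_ln ?posrE ?invr_gt0 ?clampN_gt0// clampN_ge clampN_le.
  by apply: mbdD; [apply: mbdB => //; exact: mbdM|exact: mbd_cst].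
have -> : EN n 1 = \int[nu]_w ent (hN n w).
  rewrite /EN /nu2 /nu /P mulr1; apply: eq_Int => -[x z]; congr ent.
  rewrite /W /k2 subrr.
  have t00 : tau * 0 <= 0 by rewrite mulr0.
  have [mx _] := hNx n x; exact: (Pr0_int p z t00 mx).
have iw := mbd_integrable nu mw.
rewrite -lee_fin /Rintegral fineK; last exact: (integrable_fin_num measurableT).
apply: le_trans hH; apply: ge0_le_integral => //.
- by move=> w _; rewrite lee_fin ent_ge0// ltW// clampN_gt0.
- by apply/measurable_EFinP; case: mw.
- apply/measurable_EFinP; apply: measurable_funD => //; apply: measurable_funB => //.
  by apply: measurable_funM => //; exact: measurableT_comp.
- by move=> w _; rewrite lee_fin ent_clampN.
Qed.

Let mono n (s t : R) : 0 <= s -> s <= t -> t <= 1 -> EN n s <= EN n t.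
Proof.
move=> s0 st t1; have mc : mbd (fun _ : Rd * Rd => 0 : R) by exact: mbd_cst.
have := @EN_step s t _ s0 st t1 mc n; apply: le_trans; rewrite lerDl le_eqVlt.
apply/orP; left; apply/eqP/esym.
transitivity (\int[nu4 s t]_w (0 : R)); last exact: Int_cst.
apply: eq_Int => w; rewrite (eq_Int _ (g := fun=> 1)) => [|u]; last exact: expR0.
by rewrite Int_cst ln1 subrr mul0r.
Qed.

(* The upper limit of the entropies of the truncated densities. *)
Let Eset t : set R := [set v | forall N, exists2 n, (N <= n)%N & v <= EN n t].
Let E t : R := sup (Eset t).

Let EsetH t : 0 <= t <= 1 -> has_sup (Eset t).
Proof.
move=> /andP[t0 t1]; split; first by exists 0 => N; exists N.
exists H => v /(_ 0%N) [n _ vn]; apply: (le_trans vn); apply: le_trans (EN1 n).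
exact: mono.
Qed.

(** The inequality holds for the truncated densities, and its left side passes to the limit by
    dominated convergence. On the right E is an upper limit: if v is at most [EN n s] for
    arbitrarily large n, then v + X - e is at most [EN n t] for arbitrarily large n. *)
Lemma bridge : exists (c : R -> probability Rd R) (E : R -> R),
  [/\ forall A, measurable A -> c 0 A = rho0 A,
      forall A, measurable A -> c 1 A = rho1 A,
      forall t, 0 <= t <= 1 -> 0 <= E t <= H &
      forall s t : R, 0 <= s -> s <= t -> t <= 1 -> exists2 pi, coupling (c s) (c t) pi &
        forall a : Rd * Rd -> R, mbd a ->
        \int[pi]_q (a q - ln (\int[Pr p (tau * (t - s)) q.1]_u expR (a (q.1, u)))) <= E t - E s].
Proof.
exists c, E; split => // [t t01|s t s0 st t1].
  apply/andP; split; first by apply: sup_upper_bound; [exact: EsetH|move=> N; exists N].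
  apply: ge_sup; first by case: (EsetH t01).
  have /andP[t0 t1] := t01.
  move=> v /(_ 0%N) [n _ vn]; apply: (le_trans vn); apply: le_trans (EN1 n); exact: mono.
have s01 : 0 <= s <= 1 by rewrite s0 (le_trans st).
have t01 : 0 <= t <= 1 by rewrite (le_trans s0).
exists (law (density_probability mh4 h40 (mass4 s0 st t1)) me34); first exact: law34_coupling.
move=> a ma; have Hs := @EN_step s t a s0 st t1 ma; have Hl := @lim34 s t a s0 st t1 ma.
set X := \int[_]_q _; rewrite lerBrDl -lerBrDr.
apply: ge_sup; first by case: (EsetH s01).
move=> v vs; rewrite lerBrDr; apply/ler_addgt0Pr => e e0; rewrite -lerBlDr.
apply: sup_upper_bound; first exact: EsetH.
have Xe : X - e < X by rewrite ltrBlDr ltrDl.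
have [N _ HN] := cvgr_gt X Hl (X - e) Xe.
move=> M; have [n Mn vn] := vs (maxn M N); exists n; first exact: leq_trans (leq_maxl _ _) Mn.
apply: le_trans (Hs n); rewrite -addrA lerD//.
by apply: ltW; apply: HN => /=; exact: leq_trans (leq_maxr _ _) Mn.
Qed.

End bridge.

(** * Short-time estimates for the semigroup *)

Section semigroup_estimates.
Context {R : realType} {d : nat}.
Local Notation Rd := 'rV[R]_d.
Variables (b : 'I_d -> Rd -> R).
Hypothesis bc : forall i, continuous (b i).
Variable p : R -> R.-pker Rd ~> Rd.
Hypothesis pb : forall x f, test_function f ->
  (forall t : R, 0 < t -> is_derive t (1 : R) (fun s => \int[p s x]_y f y)
     (\int[p t x]_y gen b f y)) /\
  (\int[p t x]_y f y) @[t --> 0^'+] --> f x.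

Lemma continuous_gen v : test_function v -> continuous (gen b v).
Proof.
move=> tv; have vb := test_function_bsmooth tv.
apply: contD; apply: continuous_sumR => i.
  by apply: bsmooth_continuous; do 2!apply: bsmooth_derive.
by apply: contM; [exact: bc|apply: bsmooth_continuous; exact: bsmooth_derive].
Qed.

Lemma gen_outside v : test_function v -> exists r, forall x, r < `|x| -> gen b v x = 0.
Proof.
move=> [_ /compact_bounded [r [_ vr]]]; exists (r + 1) => x xr.
have nx : ~ supp v x.
  move=> sx; have := vr (r + 1); rewrite ltrDl => /(_ ltr01 x sx) /=.
  by rewrite leNgt xr.
rewrite genE big1// => i _; rewrite !derive_out_supp ?mulr0 ?addr0//.
by move=> /supp_derive.
Qed.

Lemma gen_expm1 f x : bsmooth f ->
  gen b (fun y => expR (f y) - 1) x = expR (f x) * (gen b f x + sqg f x).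
Proof.
move=> fb.
have D2 (y : R) : setT y -> is_derive y (1 : R) expR (expR y).
  by move=> _; exact: is_derive_expR.
have := genD b x (bsmooth_derivable2 (bsmooth_expR fb)) (bsmooth_derivable2 (bsmooth_cst (- 1))).
rewrite gen_cst addr0 => ->.
have := gen_comp b x D2 D2 (fun=> I) (bsmooth_derivable2 fb).
move=> h; apply: (etrans h); ring.
Qed.

Lemma test_function_expm1 (f : Rd -> R) : test_function f -> test_function (fun y => expR (f y) - 1).
Proof.
move=> tf; have [r fr] := test_function_outside tf.
apply: (@bsmooth_test _ _ _ r).
  apply: bsmoothB; last exact: bsmooth_cst.
  by apply: bsmooth_expR; exact: test_function_bsmooth.
by move=> x /fr ->; rewrite expR0 subrr.
Qed.

(** L v is continuous with compact support but need not be a test function; a test function within e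
    / 3 of it has a mean that moves by at most M q in time q, whatever the starting point. *)
Lemma Pr_gen_uniform v e : test_function v -> 0 < e -> exists2 r0, 0 < r0 &
  forall q x, 0 <= q <= r0 -> \int[Pr p q x]_y gen b v y <= gen b v x + e.
Proof.
move=> tv e0; have [r vr] := gen_outside tv.
have e3 : 0 < e / 3 by rewrite divr_gt0.
have [k tk kv] := test_approx (continuous_gen tv) e3 vr.
have [_ [M kM]] := gen_mbd bc tk.
have M0 : 0 <= M by exact: le_trans (kM 0).
exists (e / (3 * (M + 1))); first by rewrite divr_gt0// mulr_gt0// ltr_wpDl.
move=> q x /andP[q0 qr]; have mk := test_function_mbd tk.
have mg := gen_mbd bc tv; have mc : mbd (fun _ : Rd => e / 3) by exact: mbd_cst.
have h1 : \int[Pr p q x]_y gen b v y <= \int[Pr p q x]_y k y + e / 3.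
  rewrite -[X in _ + X](Int_cst (Pr p q x)) -IntD//; apply: le_Int => //; first exact: mbdD.
  by move=> y; have := kv y; rewrite ler_norml; lra.
have h2 : \int[Pr p q x]_y k y <= k x + M * q.
  have := Pr_lipschitz bc pb x tk q0 (lexx 0) kM.
  rewrite subr0 (ger0_norm q0) (Pr0_int _ _ (lexx 0)); last by case: mk.
  by rewrite ler_norml; lra.
have h3 : M * q <= e / 3.
  move: qr; rewrite ler_pdivlMr ?mulr_gt0 ?ltr_wpDl//; nra.
have := kv x; rewrite ler_norml; lra.
Qed.

(** exp(f) - 1 is a test function and exp(- f) L exp(f) = L f + |grad f|^2. The factor [expR (- B)]
    in the tolerance compensates exp(- f). *)
Lemma ln_exp_increment f e : test_function f -> 0 < e -> exists2 r0, 0 < r0 &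
  forall r z, 0 < r <= r0 ->
  ln (\int[Pr p r z]_u expR (f u - f z)) <= r * (gen b f z + sqg f z + e).
Proof.
move=> tf e0; have [mf [B fB]] := test_function_mbd tf.
have fb := test_function_bsmooth tf; have tg := test_function_expm1 tf.
have e1 : 0 < e * expR (- B) by rewrite mulr_gt0// expR_gt0.
have [r0 r00 Hr] := Pr_gen_uniform tg e1; exists r0 => // r z /andP[r1 r2].
pose g y := expR (f y) - 1; have mg : mbd g by exact: test_function_mbd.
have m1 : mbd (fun _ : Rd => 1 : R) by exact: mbd_cst.
have E : \int[Pr p r z]_u expR (f u - f z) = 1 + expR (- f z) * (\int[Pr p r z]_u g u - g z).
  rewrite (@eq_Int _ _ _ _ _ (fun u => expR (- f z) * (g u + 1))); last first.
    by move=> u; rewrite /g subrK -expRD addrC.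
  rewrite IntZ//; last exact: mbdD.
  rewrite IntD// Int_cst /g mulrDr mulrBr mulr1 mulrBr -expRD addNr expR0; ring.
have inc : \int[Pr p r z]_u g u - g z <= (gen b g z + e * expR (- B)) * r.
  have := Pr_increment pb (x := z) (f := g) (s := 0) (t := r) (c := gen b g z + e * expR (- B)) tg (lexx 0) r1.
  rewrite (Pr0_int _ _ (lexx 0)) ?subr0; last by case: mg.
  apply => q /andP[q0 q1]; apply: Hr; rewrite ltW//=.
  by apply: le_trans r2; exact: ltW.
have pos : 0 < \int[Pr p r z]_u expR (f u - f z).
  apply: (@lt_le_trans _ _ (expR (- B - f z))); first exact: expR_gt0.
  apply: Int_ge_cst; last by move=> u; rewrite ler_expR lerD2r; have := fB u; rewrite ler_norml => /andP[].
  have := mbdM (mbdD mg m1) (mbd_cst (expR (- f z))); congr mbd; apply/funext => u.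
  by rewrite /g subrK -expRD.
apply: (le_trans (ln_le_sub1 pos)); rewrite E addrAC subrr add0r.
apply: (@le_trans _ _ (expR (- f z) * ((gen b g z + e * expR (- B)) * r))).
  by rewrite ler_pM2l// expR_gt0.
rewrite /g gen_expm1// mulrA mulrC ler_pM2l// mulrDr mulrA -expRD addNr expR0 mul1r.
rewrite lerD2l mulrCA ger_pMr// -expRD -[leRHS]expR0 ler_expR.
by have := fB z; rewrite ler_norml; lra.
Qed.

(** The square is f(u)^2 - f(z)^2 - 2 f(z) (f(u) - f(z)), and the means of f^2 and of f are
    Lipschitz in time. *)
Lemma Pr_square_increment f A1 A2 B r z : test_function f -> 0 <= r ->
  (forall x, `|f x| <= B) -> (forall x, `|gen b f x| <= A1) ->
  (forall x, `|gen b (fun y => f y * f y) x| <= A2) ->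
  \int[Pr p r z]_u (f u - f z) ^+ 2 <= (A2 + 2 * B * A1) * r.
Proof.
move=> tf r0 fB fA1 fA2; have mf := test_function_mbd tf.
have tf2 := test_functionM tf (test_function_bsmooth tf).
have mf2 := test_function_mbd tf2.
have Z0 (h : Rd -> R) : mbd h -> \int[Pr p 0 z]_u h u = h z.
  by move=> [mh _]; rewrite (Pr0_int _ _ (lexx 0)).
have h1 := Pr_lipschitz bc pb z tf r0 (lexx 0) fA1.
have h2 := Pr_lipschitz bc pb z tf2 r0 (lexx 0) fA2.
move: h1 h2; rewrite !Z0// subr0 (ger0_norm r0) => h1 h2.
have mz : mbd (fun u => 2 * f z * f u) by apply: mbdM => //; exact: mbd_cst.
have mc : mbd (fun _ : Rd => f z * f z) by exact: mbd_cst.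
have -> : \int[Pr p r z]_u (f u - f z) ^+ 2 =
    \int[Pr p r z]_u (f u * f u) - f z * f z - 2 * f z * (\int[Pr p r z]_u f u - f z).
  rewrite (@eq_Int _ _ _ _ _ (fun u => f u * f u - 2 * f z * f u + f z * f z)); last first.
    by move=> u; ring.
  rewrite IntD//; last exact: mbdB.
  rewrite IntB// IntZ// Int_cst; ring.
set I2 := \int[_]_u (f u * f u) in h2 *; set I1 := \int[_]_u f u in h1 *.
have h3 : - (2 * f z * (I1 - f z)) <= 2 * (B * (A1 * r)).
  have : `|f z| * `|I1 - f z| <= B * (A1 * r) by apply: ler_pM.
  by rewrite -normrM ler_norml => /andP[h _]; lra.
by move: h2; rewrite ler_norml => /andP[_ h2]; lra.
Qed.

End semigroup_estimates.

Section coupling_marginals.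
Context {R : realType} {d : nat}.
Local Notation Rd := 'rV[R]_d.
Variables (mu nu : probability Rd R) (g : probability (Rd * Rd)%type R).
Hypothesis gc : coupling mu nu g.
Let m1 : measurable_fun setT (fst : Rd * Rd -> Rd). Proof. exact: measurable_fst. Qed.
Let m2 : measurable_fun setT (snd : Rd * Rd -> Rd). Proof. exact: measurable_snd. Qed.

Lemma coupling_fst f : mbd f -> \int[g]_q f q.1 = \int[mu]_x f x.
Proof.
move=> mf; rewrite -(Int_law g m1 mf); apply/esym/Int_eq_measure => A mA.
by rewrite -(gc mA).1 /law /pushforward; congr (g _); apply/seteqP; split => x //= [].
Qed.

Lemma coupling_snd f : mbd f -> \int[g]_q f q.2 = \int[nu]_x f x.
Proof.
move=> mf; rewrite -(Int_law g m2 mf); apply/esym/Int_eq_measure => A mA.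
by rewrite -(gc mA).2 /law /pushforward; congr (g _); apply/seteqP; split => x //= [].
Qed.

End coupling_marginals.

Section exp_remainder.
Context {R : realType}.
Implicit Types x : R.

Lemma expRm1_le x : expR x - 1 <= x * expR x.
Proof.
have := @expR_ge1Dx R (- x); rewrite expRN => h.
have e0 := expR_gt0 x.
have : expR x * (1 - x) <= expR x * (expR x)^-1 by rewrite ler_pM2l.
by rewrite mulfV ?gt_eqF//; lra.
Qed.

Lemma expR_remainder x : expR x - 1 - x <= x ^+ 2 * expR `|x|.
Proof.
have h := expRm1_le x; have h2 := @expR_ge1Dx R x.
have [x0|x0] := leP 0 x.
  rewrite ger0_norm//; have : x * (expR x - 1) <= x * (x * expR x) by rewrite ler_wpM2l.
  by rewrite expr2; lra.
rewrite ltr0_norm//; have e1 : 1 <= expR (- x) by rewrite -expR0 ler_expR oppr_ge0 ltW.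
have : x * (expR x - 1) <= x * x by rewrite ler_wnM2l ?(ltW x0)//; lra.
have : x ^+ 2 <= x ^+ 2 * expR (- x) by rewrite ler_peMr ?sqr_ge0.
by rewrite !expr2; lra.
Qed.

End exp_remainder.

(** * The action of a bridge *)

Section monotone_increments.
Context {R : realType}.
Variable E : R -> R.
Hypothesis mono : forall s t : R, 0 <= s -> s <= t -> t <= 1 -> E s <= E t.

(** Induction on the number of intervals, removing one with the largest left end: unless it is
    degenerate, the others lie to its left. *)
Lemma sum_disjoint_increments n (a b : 'I_n -> R) :
  (forall i, 0 <= a i /\ a i <= b i /\ b i <= 1) ->
  trivIset setT (fun i => `]a i, b i[%classic) ->
  \sum_(i < n) (E (b i) - E (a i)) <= E 1 - E 0.
Proof.
move=> ab tI.
have ab1 i : 0 <= a i /\ a i <= b i by have [? [? _]] := ab i.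
suff H m (S : {set 'I_n}) (T : R) : #|S| = m -> 0 <= T <= 1 ->
    (forall i, i \in S -> b i <= T) -> \sum_(i in S) (E (b i) - E (a i)) <= E T - E 0.
  have := H _ finset.setT 1 erefl; rewrite lexx ler01 => /(_ isT).
  rewrite (eq_bigl xpredT) => [|i]; last by rewrite inE.
  by apply=> i _; have [_ [_]] := ab i.
elim: m S T => [|m IH] S T Sm /andP[T0 T1] ST.
  by rewrite (cards0_eq Sm) big_set0 subr_ge0 mono.
have [i0 i0S] : exists i, i \in S by apply/set0Pn; rewrite -card_gt0 Sm.
pose i := [arg max_(i > i0 in S) a i]%O.
have [iS imax] : i \in S /\ forall j, j \in S -> a j <= a i.
  by rewrite /i; case: arg_maxP.
have [a0 aib] := ab1 i.
rewrite (big_setD1 i)//=.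
have Sm' : #|S :\ i| = m by apply/eqP; rewrite -eqSS -Sm (cardsD1 i S) iS.
move: (aib); rewrite le_eqVlt => /predU1P[->|ablt].
  rewrite subrr add0r; apply: IH => //; first by rewrite T0.
  by move=> j; rewrite 2!inE => /andP[_ /ST].
have bT := ST i iS.
have ai1 : 0 <= a i <= 1 by rewrite a0 (le_trans _ T1)// (le_trans _ bT)// ltW.
have h := IH (S :\ i)%SET (a i) Sm' ai1.
have : \sum_(i1 in S :\ i) (E (b i1) - E (a i1)) <= E (a i) - E 0.
  apply: h => j; rewrite 2!inE => /andP[ji jS]; rewrite leNgt; apply/negP => bj.
  move/negP : ji; apply; apply/eqP; apply: tI => //.
  pose m0 := Num.min (b i) (b j); have am : a i < m0 by rewrite lt_min ablt bj.
  have m1 : m0 <= b i by rewrite ge_min lexx.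
  have m2 : m0 <= b j by rewrite ge_min lexx orbT.
  have := imax j jS; exists ((a i + m0) / 2).
  by split; rewrite /= in_itv/=; apply/andP; split; lra.
have := mono (le_trans a0 aib) bT T1; lra.
Qed.

End monotone_increments.

Section borel_line.
Context {R : realType}.

(* Keeps unification from comparing the two presentations of the Borel
   sigma-algebra of the line. *)
Lemma measurable_EFin_line (D : set R) (k : R -> R) : measurable_fun D k ->
  measurable_fun D (fun x => (k x)%:E).
Proof. by move=> mk; exact/measurable_EFinP. Qed.

End borel_line.

(** * Primitives and the upper density of a monotone function *)

Section integral_absolutely_continuous.
Context {R : realType}.
Local Notation leb := (@lebesgue_measure R).
Implicit Types k : R -> R.

Let Q k t := fine (\int[leb]_(x in `]0%R, t]) (k x)%:E)%E.

Let mI (s t : R) : measurable (`]s, t]%classic : set R).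
Proof. exact: measurable_itv. Qed.

Lemma integral_increment k (s t : R) : leb.-integrable setT (EFin \o k) -> 0 <= s -> s <= t ->
  ((Q k t - Q k s)%:E = \int[leb]_(x in `]s, t]) (k x)%:E)%E.
Proof.
move=> ik s0 st.
have iS (A : set R) : measurable A -> leb.-integrable A (EFin \o k).
  by move=> mA; apply: integrableS ik.
have fS (A : set R) : measurable A -> (\int[leb]_(x in A) (k x)%:E)%E \is a fin_num.
  by move=> mA; have iA := iS A mA; exact: (@integrable_fin_num _ _ _ leb A mA (EFin \o k) iA).
have U : (`]0, t]%classic : set R) = `]0, s] `|` `]s, t].
  apply/seteqP; split => x /=; rewrite !in_itv/=.
    by move=> /andP[x0 xt]; have [xs|xs] := leP x s; [left|right]; rewrite ?x0 ?xs.
  by case=> /andP[x0 xt]; rewrite ?x0 ?xt ?(le_trans xt st)//= (le_lt_trans s0 x0).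
have E : (\int[leb]_(x in `]0%R, t]) (k x)%:E = \int[leb]_(x in `]0%R, s]) (k x)%:E +
    \int[leb]_(x in `]s, t]) (k x)%:E)%E.
  rewrite {1}U integral_setU_EFin//.
  - by rewrite -U; have i0t := iS _ (mI 0 t); apply/measurable_EFinP; exact: measurable_int i0t.
  - rewrite disj_set2E; apply/eqP/seteqP; split => x //= [].
    by rewrite !in_itv/= => /andP[_ xs] /andP[sx _]; move: (lt_le_trans sx xs); rewrite ltxx.
rewrite /Q E fineD ?fS// addrAC subrr add0r fineK// fS//.
Qed.

(** The part of k above the level n has small integral for n large, and the part below n contributes
    at most n times the total length. *)
Lemma integral_AC k : leb.-integrable setT (EFin \o k) -> (forall x, 0 <= k x) ->
  absolutely_continuous01 (Q k).
Proof.
move=> ik k0 e e0.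
have mk : measurable_fun setT k by apply/measurable_EFinP; exact: measurable_int ik.
pose kn (n : nat) x := Num.max 0 (k x - n%:R).
have mkn n : measurable_fun setT (kn n).
  by apply: measurable_maxr => //; exact: measurable_funB.
have kn0 n x : 0 <= kn n x by rewrite le_max lexx.
have knk n x : kn n x <= k x by rewrite ge_max k0 lerBlDr lerDl ler0n.
have ikn n : leb.-integrable setT (EFin \o kn n).
  apply: (le_integrable measurableT _ _ ik); first exact: measurable_EFin_line.
  by move=> x _ /=; rewrite lee_fin !ger0_norm.
have [] := @dominated_convergence _ _ _ leb setT measurableT
  (fun n x => (kn n x)%:E) (cst 0%E) (EFin \o k).
- by move=> n; exact: measurable_EFin_line.
- exact: measurable_cst.
- apply: aeW => x _; apply: cvg_EFin; first exact: nearW.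
  apply: cvg_near_cst; have : \forall n \near \oo, k x <= n%:R by exact: nbhs_infty_ger.
  by apply: filterS => n kxn /=; rewrite /kn max_l// subr_le0.
- exact: ik.
- by apply: aeW => x n _; rewrite /= lee_fin ger0_norm.
move=> _ _; rewrite integral0 => cv.
have [n Hn] : exists n, (\int[leb]_x (kn n x)%:E < (e / 2)%:E)%E.
  have e2 : 0 < e / 2 by rewrite divr_gt0.
  have /fine_cvgP[_ /cvgr0Pnorm_lt /(_ _ e2) [N _ HN]] := cv; exists N.
  have := HN N (leqnn N); move=> /(le_lt_trans (ler_norm _)) /= h.
  by rewrite -(fineK (integrable_fin_num measurableT (ikn N))) lte_fin.
exists (e / (2 * (n%:R + 1))); first by rewrite divr_gt0// mulr_gt0// ltr_wpDl.
move=> m a b ab tI S.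
have ab' i : [/\ 0 <= a i, a i <= b i & b i <= 1] by have [? [? ?]] := ab i.
have kE x : k x <= n%:R + kn n x by rewrite -lerBlDl le_max lexx orbT.
have inc i : `|Q k (b i) - Q k (a i)| <= n%:R * (b i - a i) + (Q (kn n) (b i) - Q (kn n) (a i)).
  have [a0 aib _] := ab' i; rewrite ger0_norm; last first.
    by rewrite -lee_fin integral_increment//; apply: integral_ge0 => x _; rewrite lee_fin.
  rewrite -lee_fin [leRHS]EFinD (integral_increment ik)// (integral_increment (ikn n))//.
  have -> : ((n%:R * (b i - a i))%:E = \int[leb]_(x in `]a i, b i]) n%:R%:E)%E.
    have lE : leb `]a i, b i]%classic = (b i - a i)%:E.
      rewrite lebesgue_measure_itv/= lte_fin -EFinB.
      by move: aib; rewrite le_eqVlt => /predU1P[->|->//]; rewrite ltxx subrr.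
    by rewrite integral_cst// [X in (_ * X)%E]lE -EFinM.
  rewrite -ge0_integralD//; last 2 first.
  - by move=> x _; rewrite lee_fin.
  - by apply: measurable_EFin_line; exact: measurable_funTS.
  apply: ge0_le_integral => //.
  - by move=> x _; rewrite lee_fin.
  - by apply: measurable_EFin_line; exact: measurable_funTS.
  - apply: measurable_EFin_line; apply: measurable_funD => //; exact: measurable_funTS.
  - by move=> x _; rewrite -EFinD lee_fin.
have mono s t : 0 <= s -> s <= t -> t <= 1 -> Q (kn n) s <= Q (kn n) t.
  move=> s0 st _; rewrite -subr_ge0 -lee_fin integral_increment//.
  by apply: integral_ge0 => x _; rewrite lee_fin.
have H1 : Q (kn n) 1 - Q (kn n) 0 < e / 2.
  rewrite -lte_fin integral_increment//; apply: le_lt_trans Hn.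
  rewrite [leLHS]integral_mkcond; apply: ge0_le_integral => //.
  - by move=> x _; rewrite patchE; case: ifP => // _; rewrite lee_fin.
  - by apply/(measurable_restrictT _ _).1 => //; apply: measurable_EFin_line; exact: measurable_funTS.
  - exact: measurable_EFin_line.
  - by move=> x _; rewrite patchE; case: ifP => // _; rewrite lee_fin.
apply: (le_lt_trans (ler_sum _ (fun i _ => inc i))); rewrite big_split/= -mulr_sumr.
have h2 := sum_disjoint_increments mono ab tI.
have h3 : n%:R * \sum_(i < m) (b i - a i) <= e / 2.
  have S0 : 0 <= \sum_(i < m) (b i - a i).
    by apply: sumr_ge0 => i _; rewrite subr_ge0; case: (ab' i).
  move: S; rewrite ltr_pdivlMr ?mulr_gt0 ?ltr_wpDl//.
  have : 0 <= n%:R :> R by [].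
  by move: (\sum_(i < m) _) (n%:R) S0 => w v; nra.
lra.
Qed.

End integral_absolutely_continuous.

Section straddle.
Context {R : realType}.

(** Intervals merely containing x are allowed, since the grid cells of [upper_density] need not
    start at x. *)
Lemma straddle (F : R -> R) (x l e : R) : is_derive x (1 : R) F l -> 0 < e ->
  exists2 dl, 0 < dl & forall a b, a <= x -> x < b -> b - a < dl ->
    `|F b - F a - l * (b - a)| <= e * (b - a).
Proof.
move=> [D E] e0.
have cv : h^-1 *: (F (h *: (1 : R) + x) - F x) @[h --> (0 : R)^'] --> l by rewrite -E; exact: D.
move/cvgrPdist_le : cv => /(_ e e0)[dl /= dl0 Hdl].
have H y : `|y - x| < dl -> `|F y - F x - l * (y - x)| <= e * `|y - x|.
  have [->|yx] := eqVneq y x; first by rewrite !subrr mulr0 subrr normr0 mulr0.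
  move=> ydl; have yx0 : y - x != 0 by rewrite subr_eq0.
  have := Hdl (y - x); rewrite /ball_/= sub0r normrN => /(_ ydl yx0).
  rewrite [_ *: 1]mulr1 subrK => h.
  have -> : F y - F x - l * (y - x) = - (l - (y - x)^-1 *: (F y - F x)) * (y - x).
    by rewrite /GRing.scale/=; field.
  by rewrite normrM normrN ler_wpM2r.
exists dl => // a b ax xb ab.
have h1 := H a; have h2 := H b.
rewrite ler0_norm ?subr_le0// in h1; rewrite ger0_norm ?subr_ge0 ?(ltW xb)// in h2.
have {}h1 := h1 ltac:(lra); have {}h2 := h2 ltac:(lra).
move: h1 h2; rewrite !ler_norml; lra.
Qed.

End straddle.

Section upper_density.
Context {R : realType}.
Local Notation leb := (@lebesgue_measure R).
Variables (E : R -> R) (H : R).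
Hypothesis mono : forall s t : R, 0 <= s -> s <= t -> t <= 1 -> E s <= E t.
Hypothesis EH : forall t : R, 0 <= t <= 1 -> 0 <= E t <= H.

Let N (n : nat) : R := n.+1%:R.
Let N0 n : 0 < N n. Proof. by rewrite ltr0n. Qed.
Let pt n (k : nat) : R := k%:R / N n.

Let pt_le n k l : (k <= l)%N -> pt n k <= pt n l.
Proof. by move=> kl; rewrite ler_pM2r ?invr_gt0// ler_nat. Qed.

Let pt0 n k : 0 <= pt n k. Proof. by rewrite divr_ge0// ltW. Qed.
Let pt1 n : pt n n.+1 = 1. Proof. by rewrite /pt divff// gt_eqF. Qed.
Let ptS n k : pt n k.+1 - pt n k = (N n)^-1.
Proof. by rewrite /pt -mulrBl -natrB// subSnn mul1r. Qed.

Let sl n k := N n * (E (pt n k.+1) - E (pt n k)).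

Let sl0 n k : (k < n.+1)%N -> 0 <= sl n k.
Proof.
move=> kn; rewrite mulr_ge0 ?(ltW (N0 n))// subr_ge0 mono ?pt_le//.
by rewrite -(pt1 n) pt_le.
Qed.

Let Ik n k : set R := `[pt n k, pt n k.+1[%classic.
Let e_ n x : R := \sum_(k < n.+1) sl n k * \1_(Ik n k) x.

Let mIk n k : measurable (Ik n k). Proof. exact: measurable_itv. Qed.

Let me n : measurable_fun setT (e_ n).
Proof. by apply: measurable_sum => k; apply: measurable_funM => //; exact: measurable_indic. Qed.

Let e0 n x : 0 <= e_ n x.
Proof. by apply: sumr_ge0 => k _; rewrite mulr_ge0 ?sl0// indicE. Qed.

Let ie n : (\int[leb]_x (e_ n x)%:E = (E 1 - E 0)%:E)%E.
Proof.
under eq_integral do rewrite /e_ -sumEFin.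
rewrite ge0_integral_sum//; last 2 first.
- by move=> k; apply: measurable_EFin_line; apply: measurable_funM => //; exact: measurable_indic.
- by move=> k x _; rewrite lee_fin mulr_ge0 ?sl0// indicE.
have E1 (k : 'I_n.+1) : (\int[leb]_x (sl n k * \1_(Ik n k) x)%:E =
    (E (pt n k.+1) - E (pt n k))%:E)%E.
  under eq_integral do rewrite EFinM.
  rewrite ge0_integralZl//; last 2 first.
  - by apply: measurable_EFin_line; exact: measurable_indic.
  - by rewrite lee_fin sl0.
  have -> : (\int[leb]_x (\1_(Ik n k) x)%:E = leb (Ik n k))%E.
    by rewrite integral_indic ?setIT//; exact: mIk.
  rewrite /Ik lebesgue_measure_itv/= lte_fin -EFinB ptS.
  have -> : pt n k < pt n k.+1 by rewrite -subr_gt0 ptS invr_gt0.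
  by rewrite -EFinM /sl mulrAC divff ?gt_eqF// mul1r.
under eq_bigr do rewrite E1.
rewrite sumEFin -(big_mkord xpredT (fun k => E (pt n k.+1) - E (pt n k))).
by rewrite telescope_sumr// pt1 /pt mul0r.
Qed.

Let e_val n x : 0 <= x < 1 -> exists k, [/\ (k < n.+1)%N, pt n k <= x, x < pt n k.+1 & e_ n x = sl n k].
Proof.
move=> /andP[x0 x1]; pose y := x * N n.
have y0 : 0 <= y by rewrite mulr_ge0// ltW.
have /andP[k1 k2] := truncn_itv y0; set k := Num.truncn y in k1 k2.
have kn : (k < n.+1)%N.
  by rewrite -(ltr_nat R) (le_lt_trans k1)// -[ltRHS]mul1r ltr_pM2r.
exists k; rewrite ler_pdivrMr// ltr_pdivlMr//; split => //.
rewrite /e_ (bigD1 (Ordinal kn))//= big1 ?addr0 => [|j jk].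
  rewrite indicE mem_set ?mulr1//= /Ik/= in_itv/= ler_pdivrMr// ltr_pdivlMr// k1 k2.
  by [].
rewrite indicE memNset ?mulr0//= /Ik/= in_itv/= ler_pdivrMr// ltr_pdivlMr// => /andP[j1 j2].
move/negP : jk; apply; apply/eqP/val_inj => /=; apply/eqP; rewrite eqn_leq.
have jk : j%:R < k.+1%:R :> R by exact: le_lt_trans j1 k2.
have kj : k%:R < j.+1%:R :> R by exact: le_lt_trans k1 j2.
by move: jk kj; rewrite !ltr_nat !ltnS => -> ->.
Qed.

(** The slopes of E on the grid of mesh 1/(n+1) have integral E 1 - E 0, so by Fatou their lower
    limit has integral at most H. A number that is asymptotically below the slope on every interval
    of that length around x is below this lower limit, which replaces a derivative of E. *)
Lemma upper_density : exists er : R -> R, [/\ leb.-integrable setT (EFin \o er),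
  forall x, 0 <= er x, (\int[leb]_x (er x)%:E <= H%:E)%E &
  {ae leb, forall x : R, 0 < x < 1 -> forall u,
    (forall e, 0 < e -> \forall n \near \oo, forall a b, 0 <= a -> a <= x -> x < b -> b <= 1 ->
      b - a = n.+1%:R^-1 -> u <= n.+1%:R * (E b - E a) + e) -> u <= er x}].
Proof.
pose el x := limn_einf (fun n => (e_ n x)%:E).
have mel : measurable_fun setT el.
  have -> : el = (fun x => - limn_esup (fun n => (- e_ n x)%:E))%E by [].
  apply: measurableT_comp => //; apply: measurable_fun_limn_esup => n.
  by apply: measurable_EFin_line; exact: measurableT_comp.
have el0 x : (0 <= el x)%E.
  rewrite /el limn_einf_lim; apply: lime_ge; first exact: is_cvg_einfs.
  apply: nearW => n; apply: le_ereal_inf_tmp => _ [m _ <-]; by rewrite lee_fin.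
have E10 : E 1 - E 0 <= H.
  have := EH (t := 0); have := EH (t := 1); rewrite !lexx !ler01 => /(_ isT) h1 /(_ isT); lra.
have iel : (\int[leb]_x el x <= H%:E)%E.
  have mEe n : measurable_fun setT (fun x => (e_ n x)%:E) by exact: measurable_EFin_line.
  apply: (le_trans (@fatou _ _ _ leb setT measurableT _ mEe _)).
    by move=> n x _; rewrite lee_fin.
  rewrite limn_einf_lim; apply: lime_le; first exact: is_cvg_einfs.
  apply: nearW => n; apply: (@le_trans _ _ (\int[leb]_x (e_ n x)%:E)%E).
    by apply: ereal_inf_lbound; exists n => /=.
  by rewrite ie lee_fin.
have intel : leb.-integrable setT el.
  apply/integrableP; split => //; under eq_integral do rewrite gee0_abs//.
  exact: le_lt_trans iel (ltry _).
have aefin := integrable_ae measurableT intel.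
pose er x := fine (el x).
have mer : measurable_fun setT er by apply: measurableT_comp => //; exact: fine_measurable.
have er0 x : 0 <= er x by exact: fine_ge0.
have erle x : ((er x)%:E <= el x)%E.
  by rewrite /er; have := el0 x; case: (el x) => [r|_|]//=; rewrite ?leey.
have ier : leb.-integrable setT (EFin \o er).
  apply: (le_integrable measurableT _ _ intel); first exact: measurable_EFin_line.
  by move=> x _ /=; rewrite ger0_norm// gee0_abs.
exists er; split => //.
  apply: le_trans iel; apply: ge0_le_integral => //.
  - by move=> x _; rewrite lee_fin.
  - exact: measurable_EFin_line.
apply: filterS aefin => x /(_ I) xfin /andP[x0 x1] u Hu; apply/ler_addgt0Pr => e ep.
rewrite -lerBlDr -lee_fin /er fineK// /el limn_einf_lim; apply: lime_ge; first exact: is_cvg_einfs.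
have [M _ HM] := Hu e ep; exists M => // n Mn; apply: le_ereal_inf_tmp => _ [m /= nm <-].
have x01 : 0 <= x < 1 by rewrite (ltW x0).
have [k [kn k1 k2 ->]] := e_val m x01.
rewrite lee_fin lerBlDr; apply: (HM m _ (pt m k) (pt m k.+1)) => //.
- exact: leq_trans Mn nm.
- by rewrite -(pt1 m) pt_le.
Qed.

End upper_density.

(** * A countable dense family of test functions *)

Section countable_dense.
Context {R : realType} {d : nat}.
Local Notation Rd := 'rV[R]_d.
Implicit Types (f g : Rd -> R).

Lemma bnd_of_partial k M f : C_infty f ->
  (forall s x, (size s <= k)%N -> `|partial s f x| <= M) -> bnd k M f.
Proof.
elim: k f => [|k IH] f Cf H.
  by apply: bnd0; [exact: C_infty_continuous|move=> x; exact: (H [::])].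
apply: bndS.
- by apply: bnd0; [exact: C_infty_continuous|move=> x; exact: (H [::])].
- by move=> j x; exact: C_infty_derivable.
- move=> j; apply: IH; first exact: C_infty_derive.
  move=> s x sk; have := H (rcons s j) x; rewrite size_rcons /partial foldr_rcons.
  exact.
Qed.

Let idx : seq (seq 'I_d) := [::] :: [seq [:: i] | i <- enum 'I_d] ++
  [seq [:: p.1; p.2] | p <- enum (predT : pred ('I_d * 'I_d))].

Let idxP s : (size s <= 2)%N -> s \in idx.
Proof.
case: s => [|i [|j [|//]]] _; rewrite inE// mem_cat; apply/orP; right; apply/orP.
  by left; apply: map_f; rewrite mem_enum.
by right; apply/mapP; exists (i, j); rewrite ?mem_enum.
Qed.

Let gridT (r m : nat) := {ffun 'I_d -> 'I_(2 * r * m.+1).+1}.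
Let pt (r m : nat) (z : gridT r m) : Rd :=
  \row_i ((z i : nat)%:R / m.+1%:R - r%:R).

(** Integer parts of the derivatives of order at most 2, scaled by m + 1, at the grid points:
    functions with equal codes have derivatives within 1/(m+1) there. *)
Let code r m f : seq (seq int) :=
  [seq [seq Num.floor (m.+1%:R * partial s f (pt z)) | s <- idx] | z <- enum (@predT (gridT r m))].

Let codeP r m f g s (z : gridT r m) : (size s <= 2)%N -> code r m f = code r m g ->
  `|partial s f (pt z) - partial s g (pt z)| <= m.+1%:R^-1.
Proof.
move=> s2 /eq_in_map /(_ z); rewrite mem_enum => /(_ isT) /eq_in_map /(_ s (idxP s2)) E.
have m0 : (0 : R) < m.+1%:R by [].
have /andP[a1 a2] := Num.Theory.floor_itv (m.+1%:R * partial s f (pt z)).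
have /andP[b1 b2] := Num.Theory.floor_itv (m.+1%:R * partial s g (pt z)).
rewrite E in a1 a2; rewrite -div1r ler_pdivlMr// -[X in _ * X <= _](gtr0_norm m0) -normrM mulrC mulrBr.
move: a1 a2 b1 b2; rewrite !intrD /=.
move: (_ * partial s f _) (_ * partial s g _) => u v; rewrite ler_norml; lra.
Qed.

Let near_pt r m (x : Rd) : `|x| <= r%:R -> exists z : gridT r m, forall i,
  `|x ord0 i - pt z ord0 i| <= m.+1%:R^-1.
Proof.
move=> xr; have m0 : (0 : R) < m.+1%:R by [].
have y0 i : 0 <= (x ord0 i + r%:R) * m.+1%:R.
  rewrite mulr_ge0//; have := le_trans (norm_coord_le x i) xr.
  by rewrite ler_norml; lra.
have yb i : (Num.truncn ((x ord0 i + r%:R) * m.+1%:R) < (2 * r * m.+1).+1)%N.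
  rewrite ltnS -(ler_nat R); have /andP[h _] := truncn_itv (y0 i); apply: (le_trans h).
  rewrite !natrM ler_pM2r//; have := le_trans (norm_coord_le x i) xr.
  by rewrite ler_norml; lra.
exists [ffun i => Ordinal (yb i)] => i; rewrite mxE ffunE/=.
have /andP[h1 h2] := truncn_itv (y0 i); set k := Num.truncn _ in h1 h2 *.
have {}h2 : (x ord0 i + r%:R) * m.+1%:R < k%:R + 1 by rewrite natr1.
move: h1 h2; set q : R := k%:R => h1 h2.
have E : x ord0 i - (q / m.+1%:R - r%:R) = ((x ord0 i + r%:R) * m.+1%:R - q) / m.+1%:R.
  by field; rewrite gt_eqF.
rewrite E normrM normfV (gtr0_norm m0) ler_pdivrMr// mulVf ?gt_eqF//.
by rewrite ler_norml; lra.
Qed.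

Let adm (r M : nat) f := [/\ test_function f, forall x : Rd, r%:R < `|x| -> f x = 0 &
  bnd 3 M%:R f].

Let J : Type := (nat * nat * nat) * seq (seq int).

(** One admissible function per code; the zero function is the default when there is none. *)
Let pick_f (j : J) : Rd -> R :=
  if pselect (exists f, adm j.1.1.1 j.1.1.2 f /\ code j.1.1.1 j.1.2 f = j.2) is left P
  then sval (cid P) else fun=> 0.

(** Codes are countable, and two admissible functions with equal codes are close in C^2 on the whole
    ball, because their third derivatives are bounded by M and the grid has mesh 1/(m+1). *)
Lemma countable_dense_test : exists f_ : nat -> Rd -> R, (forall n, test_function (f_ n)) /\
  forall f, test_function f -> exists K, compact K /\ forall e, 0 < e ->
  exists n, test_function_on K (fun x => f x - f_ n x) /\ bnd 2 e (fun x => f x - f_ n x).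
Proof.
have t0 : test_function (fun _ : Rd => 0 : R).
  by apply: (@bsmooth_test _ _ _ 0) => //; exact: bsmooth_cst.
exists (fun n => if (unpickle n : option ((nat * nat * nat) * seq (seq int))) is Some j then pick_f j else fun=> 0).
split.
  move=> n; case: (unpickle n) => // j; rewrite /pick_f; case: pselect => // Pj.
  by case: (cid Pj) => f [[]].
move=> f tf; have [r0 fr0] := test_function_outside tf.
have [M0 fM0] := test_function_bsmooth tf 3.
pose r := (Num.bound r0).+1; pose M := Num.bound M0.
have r0r : r0 <= r%:R.
  rewrite (le_trans (ler_norm _))// ltW// (lt_le_trans (archi_boundP (normr_ge0 _)))//.
  by rewrite /r /Num.bound normr_id ler_nat leqnSn.
have M0M : M0 <= M%:R.
  by rewrite ltW// (le_lt_trans (ler_norm _))// (lt_le_trans (archi_boundP (normr_ge0 _)))// /M /Num.bound normr_id.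
have admf : adm r M f.
  split => //; first by move=> x rx; apply: fr0; exact: le_lt_trans rx.
  exact: bnd_le fM0.
exists [set x : Rd | `|x| <= r%:R]; split; first exact: norm_ball_compact.
move=> e e0; pose C := 1 + d%:R * (2 * M%:R) * d%:R : R.
have C0 : 0 <= C by rewrite addr_ge0// !mulr_ge0.
pose m := Num.bound (C / e).
have Cm : C / m.+1%:R <= e.
  rewrite ler_pdivrMr// mulrC -ler_pdivrMr// ltW// (lt_le_trans (archi_boundP _))//.
    by rewrite divr_ge0// ltW.
  by rewrite ler_nat.
pose j : (nat * nat * nat) * seq (seq int) := ((r, M, m), code r m f).
exists (pickle j); rewrite pickleK /pick_f; case: pselect; last by case; exists f.
move=> Pj; have [[tg gr gM] cg] := svalP (cid Pj); move: tg gr gM cg.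
set g := sval (cid Pj) => tg gr gM cg.
have th : test_function (fun x => f x - g x).
  by apply: test_functionD => //; exact: test_functionN.
have h3 : bnd 3 (2 * M%:R) (fun x => f x - g x).
  have -> : 2 * M%:R = M%:R + M%:R :> R by rewrite mulr_natl mulr2n.
  by case: admf => _ _ fM3; exact: (bndB fM3 gM).
have hr x : r%:R < `|x| -> f x - g x = 0.
  by move=> rx; rewrite gr// subr0; case: admf => _ -> //.
have hb := test_function_bsmooth th.
have hK : test_function_on [set x : Rd | `|x| <= r%:R] (fun x => f x - g x).
  apply: bsmooth_test_function_on => //; apply: supp_subset.
    by apply: compact_closed_rV; exact: norm_ball_compact.
  by move=> x /= /negP; rewrite -ltNge; exact: hr.
split; first exact: hK.
apply: bnd_of_partial; first by case: th.
move=> s x s2; have [xr|xr] := leP `|x| r%:R; last first.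
  rewrite supp_out ?normr0 ?ltW// => /supp_partial /(hK.2) /=.
  by rewrite leNgt xr.
have [z Hz] := near_pt m xr.
have fg y : partial s (fun x => f x - g x) y = partial s f y - partial s g y.
  have fb := test_function_bsmooth tf; have gb := test_function_bsmooth tg.
  elim: s {s2} y => [//|i s IH] y /=; rewrite (funext IH).
  have [_ df] := bsmooth_partial fb s; have [_ dg] := bsmooth_partial gb s.
  exact: (deriveB (df i y) (dg i y)).
have lip : bnd 1 (2 * M%:R) (partial s (fun x => f x - g x)).
  have := bnd_partial h3 (leq_trans s2 (leqnSn 2)); apply: bnd_weak.
  by rewrite -[1%N]/(3 - 2)%N leq_sub2l.
have := bnd1_lipschitz x (pt z) lip.
have en : enorm (x - pt z) <= d%:R * m.+1%:R^-1.
  have v0 : 0 <= d%:R * m.+1%:R^-1 :> R by rewrite mulr_ge0.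
  rewrite /enorm -[leRHS](ger0_norm v0) -sqrtr_sqr; apply: ler_wsqrtr.
  rewrite exprMn expr2 -mulrA; apply: (@le_trans _ _ (\sum_(i < d) m.+1%:R^-1 ^+ 2)).
    apply: ler_sum => i _; rewrite -expr2 -[leLHS]real_normK ?num_real// lerXn2r ?nnegrE//.
    by have := Hz i; rewrite !mxE.
  rewrite sumr_const card_ord -[leLHS]mulr_natl; case: (d) => [|d']; first by rewrite !mul0r.
  by rewrite ler_wpM2l// ler_peMl ?exprn_ge0// ler1n.
have k0 : 0 <= d%:R * (2 * M%:R) :> R by rewrite !mulr_ge0.
move=> h1; have h2 := ler_wpM2l k0 en.
have h4 := codeP z s2 (esym cg).
rewrite -fg in h4; apply: le_trans Cm.
rewrite -[X in `|X|](subrK (partial s (fun x => f x - g x) (pt z))) (le_trans (ler_normD _ _))//.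
have -> : C / m.+1%:R = d%:R * (2 * M%:R) * (d%:R * m.+1%:R^-1) + m.+1%:R^-1.
  by rewrite /C; ring.
by apply: lerD => //; exact: le_trans h1 h2.
Qed.

End countable_dense.

(** * Integrals of test functions along a bridge *)

Section curve_of_bridge.
Context {R : realType} {d : nat}.
Local Notation Rd := 'rV[R]_d.
Local Notation leb := (@lebesgue_measure R).
Variables (b : 'I_d -> Rd -> R).
Hypothesis bc : forall i, continuous (b i).
Variable p : R -> R.-pker Rd ~> Rd.
Hypothesis pb : forall x f, test_function f ->
  (forall t : R, 0 < t -> is_derive t (1 : R) (fun s => \int[p s x]_y f y)
     (\int[p t x]_y gen b f y)) /\
  (\int[p t x]_y f y) @[t --> 0^'+] --> f x.
Variables (tau : R) (c : R -> probability Rd R) (E : R -> R) (H : R).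
Hypotheses (tau0 : 0 < tau) (EH : forall t : R, 0 <= t <= 1 -> 0 <= E t <= H).
Hypothesis cE : forall s t : R, 0 <= s -> s <= t -> t <= 1 ->
  exists2 pi, coupling (c s) (c t) pi & forall a : Rd * Rd -> R, mbd a ->
  \int[pi]_q (a q - ln (\int[Pr p (tau * (t - s)) q.1]_u expR (a (q.1, u)))) <= E t - E s.
Implicit Types (f : Rd -> R).

Let F f (t : R) : R := \int[c t]_x f x.

Let mfst f : mbd f -> mbd (fun q : Rd * Rd => f q.1).
Proof. exact: mbd_map measurable_fst. Qed.
Let msnd f : mbd f -> mbd (fun q : Rd * Rd => f q.2).
Proof. exact: mbd_map measurable_snd. Qed.

Lemma mbd_expR dT (T : measurableType dT) (f : T -> R) : mbd f -> mbd (fun x => expR (f x)).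
Proof.
move=> [mf [M fM]]; split; first exact: measurableT_comp.
by exists (expR M) => x; rewrite ger0_norm ?expR_ge0// ler_expR (le_trans (ler_norm _)).
Qed.

Lemma mbd_ln_Pr (a : Rd * Rd -> R) r : mbd a ->
  mbd (fun z => ln (\int[Pr p r z]_u expR (a (z, u)))).
Proof.
move=> ma; have mea := mbd_expR ma.
have mZ := mbd_kernel_integral (Pk p r) mea.
split; first by apply: measurableT_comp => //; case: mZ.
have [_ [M aM]] := ma; exists M => z.
have mez := mbd_map (measurable_pair1 z) mea.
have aM' u : - M <= a (z, u) <= M by rewrite -ler_norml.
have Z1 : expR (- M) <= \int[Pr p r z]_u expR (a (z, u)).
  by apply: Int_ge_cst => // u; rewrite ler_expR; case/andP: (aM' u).
have Z2 : \int[Pr p r z]_u expR (a (z, u)) <= expR M.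
  by apply: Int_le_cst => // u; rewrite ler_expR; case/andP: (aM' u).
have Z0 := lt_le_trans (expR_gt0 (- M)) Z1.
by rewrite ler_norml -{1}(expRK (- M)) -{2}(expRK M) !ler_ln ?posrE ?expR_gt0// Z1 Z2.
Qed.

Lemma E_mono (s t : R) : 0 <= s -> s <= t -> t <= 1 -> E s <= E t.
Proof.
move=> s0 st t1; have [pi _ /(_ (fun=> 0))] := cE s0 st t1.
move=> h; rewrite -subr_ge0; apply: (le_trans _ (h (mbd_cst 0))).
apply: Int_ge_cst.
  apply: mbdB; first exact: mbd_cst.
  exact: (mfst (@mbd_ln_Pr (fun=> 0) (tau * (t - s)) (mbd_cst 0))).
move=> q; rewrite (eq_Int _ (g := fun=> 1)) => [|u]; last exact: expR0.
by rewrite Int_cst ln1 subrr.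
Qed.

Let pair_diff f : mbd f -> mbd (fun q : Rd * Rd => f q.2 - f q.1).
Proof. by move=> mf; apply: mbdB; [exact: msnd|exact: mfst]. Qed.

(** The entropy inequality for the pair function f(u) - f(z), whose mean is an increment of F f by
    the marginals of the coupling. *)
Lemma bridge_increment f (s t : R) : mbd f -> 0 <= s -> s <= t -> t <= 1 ->
  F f t - F f s <= E t - E s +
    \int[c s]_z ln (\int[Pr p (tau * (t - s)) z]_u expR (f u - f z)).
Proof.
move=> mf s0 st t1; have [pi cpi /(_ _ (pair_diff mf)) h] := cE s0 st t1.
pose A z := ln (\int[Pr p (tau * (t - s)) z]_u expR (f u - f z)).
have mA : mbd A by exact: (mbd_ln_Pr (tau * (t - s)) (pair_diff mf)).
have h' : \int[pi]_q (f q.2 - f q.1 - A q.1) <= E t - E s by exact: h.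
have e1 : \int[pi]_q (f q.2 - f q.1 - A q.1) =
    \int[pi]_q (f q.2 - f q.1) - \int[pi]_q A q.1.
  by apply: IntB; [exact: pair_diff|exact: mfst].
have e2 : \int[pi]_q (f q.2 - f q.1) = \int[pi]_q f q.2 - \int[pi]_q f q.1.
  by apply: IntB; [exact: msnd|exact: mfst].
move: h'; rewrite e1 e2 (coupling_fst cpi mA) (coupling_fst cpi mf) (coupling_snd cpi mf).
by rewrite -/(F f t) -/(F f s) -/A; lra.
Qed.

(** exp x <= 1 + x + x^2 exp |x| at x = la (f(u) - f(z)), where |x| <= 2 la B. *)
Let ln_lip f la A1 A2 B r z : test_function f -> 0 <= r -> 0 <= la ->
  (forall x, `|f x| <= B) -> (forall x, `|gen b f x| <= A1) ->
  (forall x, `|gen b (fun y => f y * f y) x| <= A2) ->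
  ln (\int[Pr p r z]_u expR (la * f u - la * f z)) <=
    (la * A1 + la ^+ 2 * expR (2 * la * B) * (A2 + 2 * B * A1)) * r.
Proof.
move=> tf r0 la0 fB fA1 fA2; have mf := test_function_mbd tf.
have mc (k : R) : mbd (fun _ : Rd => k) by exact: mbd_cst.
have md : mbd (fun u => f u - f z) by exact: mbdB.
have md2 : mbd (fun u => (f u - f z) ^+ 2).
  by have := mbdM md md; congr mbd; apply/funext => u; rewrite expr2.
have me : mbd (fun u => expR (la * f u - la * f z)).
  by apply: mbd_expR; apply: mbdB => //; exact: mbdM.
have h1 : \int[Pr p r z]_u (f u - f z) <= A1 * r.
  rewrite IntB// Int_cst; have := Pr_lipschitz bc pb z tf r0 (lexx 0) fA1.
  rewrite (Pr0_int _ _ (lexx 0)) ?subr0 ?(ger0_norm r0); last by case: mf.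
  by rewrite ler_norml => /andP[].
have h2 := Pr_square_increment bc pb z tf r0 fB fA1 fA2.
pose k := la ^+ 2 * expR (2 * la * B).
have k0 : 0 <= k by rewrite mulr_ge0 ?sqr_ge0 ?expR_ge0.
have B0 : 0 <= B by exact: le_trans (fB 0).
have mk1 : mbd (fun u => la * (f u - f z)) by exact: mbdM.
have mk2 : mbd (fun u => k * (f u - f z) ^+ 2) by exact: mbdM.
have mk3 : mbd (fun u => 1 + la * (f u - f z)) by exact: mbdD.
have : \int[Pr p r z]_u expR (la * f u - la * f z) <=
    \int[Pr p r z]_u (1 + la * (f u - f z) + k * (f u - f z) ^+ 2).
  apply: le_Int => //; first exact: mbdD.
  move=> u; rewrite -mulrBr; have := expR_remainder (la * (f u - f z)).
  have le1 : expR `|la * (f u - f z)| <= expR (2 * la * B).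
    rewrite ler_expR normrM (ger0_norm la0) mulrAC (mulrC (2 * B)).
    rewrite ler_wpM2l// (le_trans (ler_normB _ _))//.
    by have := fB u; have := fB z; lra.
  have := ler_wpM2l (sqr_ge0 (la * (f u - f z))) le1.
  by rewrite !exprMn /k; lra.
rewrite IntD// IntD// !IntZ// Int_cst => h3.
have pos : 0 < \int[Pr p r z]_u expR (la * f u - la * f z).
  apply: (@lt_le_trans _ _ (expR (- (2 * la * B)))); first exact: expR_gt0.
  apply: Int_ge_cst => // u; rewrite ler_expR -mulrBr.
  have : - (2 * B) <= f u - f z by have := fB u; have := fB z; rewrite !ler_norml; lra.
  by move=> /(ler_wpM2l la0); lra.
apply: (le_trans (ln_le_sub1 pos)); rewrite mulrDl -/k.
have := ler_wpM2l la0 h1; have := ler_wpM2l k0 h2; lra.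
Qed.

(** Testing with la f and dividing by la gives the entropy increment the factor 1 / la, at the cost
    of a larger constant C. *)
Lemma bridge_lipschitz (K : set Rd) la : compact K -> 0 < la -> exists2 C, 0 <= C &
  forall f, test_function_on K f -> bnd 2 1 f -> forall s t : R, 0 <= s -> s <= t -> t <= 1 ->
  `|F f t - F f s| <= la^-1 * (E t - E s) + C * (t - s).
Proof.
move=> cK la0; have [B0 B00 HB] := gen_bnd bc cK.
pose A2 := B0 * (2 ^+ 2 * 1 * 1).
pose C := la^-1 * ((la * (B0 * 1) + la ^+ 2 * expR (2 * la * 1) * (A2 + 2 * 1 * (B0 * 1))) * tau).
have A20 : 0 <= A2 by rewrite !mulr_ge0.
exists C.
  rewrite /C; repeat first [done|exact: ltW|exact: expR_ge0|exact: sqr_ge0|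
    rewrite invr_ge0|apply: mulr_ge0|apply: addr_ge0].
have half f (s t : R) : test_function_on K f -> bnd 2 1 f -> 0 <= s -> s <= t -> t <= 1 ->
    F f t - F f s <= la^-1 * (E t - E s) + C * (t - s).
  move=> fK f1 s0 st t1; have tf := test_function_onW cK fK.
  have mf := test_function_mbd tf.
  have f2 := bndM f1 f1.
  have f2K : test_function_on K (fun x => f x * f x).
    apply: bsmooth_test_function_on.
      by apply: bsmoothM; exact: test_function_bsmooth.
    apply: supp_subset; first exact: compact_closed_rV.
    by move=> x Kx; rewrite supp_out ?mul0r// => /(fK.2).
  have r0 : 0 <= tau * (t - s) by rewrite mulr_ge0 ?(ltW tau0)// subr_ge0.
  have ml : mbd (fun x => la * f x) by apply: mbdM => //; exact: mbd_cst.
  have := bridge_increment ml s0 st t1; rewrite /F !IntZ// => h.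
  have hl z := ln_lip z tf r0 (ltW la0) (fun x => bnd_le_norm x f1) (HB _ _ fK f1) (HB _ _ f2K f2).
  have : \int[c s]_z ln (\int[Pr p (tau * (t - s)) z]_u expR (la * f u - la * f z)) <=
      (la * (B0 * 1) + la ^+ 2 * expR (2 * la * 1) * (A2 + 2 * 1 * (B0 * 1))) * (tau * (t - s)).
    by apply: Int_le_cst => //; exact: (mbd_ln_Pr (tau * (t - s)) (pair_diff ml)).
  set X := (_ + _) * _ => hI.
  have h3 : la * (F f t - F f s) <= E t - E s + X.
    by rewrite mulrBr; apply: (le_trans h); rewrite lerD2l.
  rewrite -/(F f t) -/(F f s) -(ler_pM2l la0); apply: (le_trans h3).
  rewrite mulrDr mulrA mulfV ?gt_eqF// mul1r lerD2l /C !mulrA mulfV ?gt_eqF// mul1r.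
  by rewrite /X !mulrA.
move=> f fK f1 s t s0 st t1; rewrite ler_norml half// andbT lerNl.
have := half (fun x => - f x) s t _ (bndN f1) s0 st t1.
have mf := test_function_mbd (test_function_onW cK fK).
have NE (P : probability Rd R) : \int[P]_y (- f y) = - \int[P]_y f y.
  have := IntZ P (-1) mf; rewrite mulN1r => <-.
  by apply: eq_Int => y; rewrite mulN1r.
rewrite /F !NE opprK addrC opprB; apply.
apply: bsmooth_test_function_on.
  by apply: bsmoothN; exact: test_function_bsmooth (test_function_onW cK fK).
apply: supp_subset; first exact: compact_closed_rV.
by move=> x Kx; rewrite supp_out ?oppr0// => /(fK.2).
Qed.

Let scaled f : test_function f -> exists M : R, 0 < M /\ (test_function_on (supp f) (fun x => M^-1 * f x) /\ bnd 2 1 (fun x => M^-1 * f x)).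
Proof.
move=> tf; have fb := test_function_bsmooth tf; have [M0 fM0] := fb 2.
have M00 := bnd_ge0 fM0; pose M := M0 + 1; have Mp : 0 < M by rewrite ltr_wpDl.
exists M; split => //; split.
  apply: bsmooth_test_function_on; first by apply: bsmoothM => //; exact: bsmooth_cst.
  apply: supp_subset; first by apply: compact_closed_rV; case: tf.
  by move=> x Kx; rewrite supp_out ?mulr0.
apply: bnd_le (bndZ M^-1 fM0).
by rewrite gtr0_norm ?invr_gt0// mulrC ler_pdivrMr// mul1r lerDl.
Qed.

(** la is so large that the total increment of E, at most H, contributes less than e / 2; the length
    of the intervals then controls the term with C. *)
Lemma bridge_AC f : test_function f -> absolutely_continuous01 (F f).
Proof.
move=> tf; have [M [M0 [sK s1]]] := scaled tf; have [_ cK] := tf.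
have mf := test_function_mbd tf.
have FE t : F f t = M * F (fun x => M^-1 * f x) t.
  by rewrite /F IntZ// mulrA mulfV ?gt_eqF// mul1r.
have H0 : 0 <= H by have := EH (t := 0); rewrite lexx ler01 => /(_ isT); lra.
move=> e e0; pose la := 2 * M * (H + 1) / e.
have la0 : 0 < la by rewrite divr_gt0// !mulr_gt0// ltr_wpDl.
have [C C0 HC] := bridge_lipschitz cK la0.
exists (e / (2 * M * (C + 1))); first by rewrite divr_gt0// !mulr_gt0// ltr_wpDl.
move=> n a a' ab tI S.
have ab1 i : [/\ 0 <= a i, a i <= a' i & a' i <= 1] by have [? [? ?]] := ab i.
apply: (@le_lt_trans _ _ (\sum_(i < n) (M * (la^-1 * (E (a' i) - E (a i))) + M * (C * (a' i - a i))))).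
  apply: ler_sum => i _; have [a0 aa a1] := ab1 i.
  by rewrite !FE -mulrBr normrM gtr0_norm// -mulrDr ler_pM2l// HC.
rewrite big_split/= -!mulr_sumr.
have h1 := sum_disjoint_increments E_mono ab tI.
have h2 : E 1 - E 0 <= H.
  by have := EH (t := 0); have := EH (t := 1); rewrite !lexx !ler01 => /(_ isT) + /(_ isT); lra.
have k0 : 0 <= M * la^-1 by rewrite mulr_ge0 ?invr_ge0 ?ltW.
have h3 : M * (la^-1 * (\sum_(i < n) (E (a' i) - E (a i)))) < e / 2.
  rewrite mulrA; apply: (le_lt_trans (ler_wpM2l k0 (le_trans h1 h2))).
  have -> : M * la^-1 * H = (e / 2) * (H / (H + 1)).
    by rewrite /la; field; rewrite !gt_eqF// ltr_wpDl.
  by rewrite gtr_pMr ?divr_gt0// ltr_pdivrMr ?ltr_wpDl// mul1r ltrDl.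
have h4 : M * (C * \sum_(i < n) (a' i - a i)) <= e / 2.
  have S0 : 0 <= \sum_(i < n) (a' i - a i).
    by apply: sumr_ge0 => i _; rewrite subr_ge0; case: (ab1 i).
  move: S; rewrite ltr_pdivlMr ?mulr_gt0 ?ltr_wpDl//.
  move: (\sum_(i < n) (a' i - a i)) S0 => w w0 h.
  have : M * (C * w) <= M * ((C + 1) * w) by rewrite ler_wpM2l ?(ltW M0)// ler_wpM2r// lerDl.
  lra.
lra.
Qed.

Lemma bridge_continuous (G : Rd -> R) (rr x e : R) : continuous G ->
  (forall y, rr < `|y| -> G y = 0) -> 0 <= x <= 1 -> 0 < e ->
  exists2 dl : R, 0 < dl & forall s, 0 <= s <= 1 -> `|s - x| < dl -> F G s <= F G x + e.
Proof.
move=> cG G0 x01 e0; have e3 : 0 < e / 3 by rewrite divr_gt0.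
have [k tk kG] := test_approx cG e3 G0.
have mk := test_function_mbd tk.
have [_ [Mk kM]] := mk.
have mG : mbd G.
  split; first exact: continuous_measurable_rV.
  exists (Mk + e / 3) => y; rewrite -[G y](subrK (k y)) (le_trans (ler_normD _ _))//.
  by rewrite addrC lerD// distrC.
have [dl dl0 Hdl] := AC_single (bridge_AC tk) e3.
exists dl => // s s01 sx; have := Hdl s x s01 x01 sx.
have := Int_close (c s) mk mG kG; have := Int_close (c x) mk mG kG.
rewrite -/(F k s) -/(F k x) -/(F G s) -/(F G x) !ler_norml ltr_norml; lra.
Qed.

End curve_of_bridge.

Section derivative_approximation.
Context {R : realType}.

Lemma is_derive_near (F : R -> R) (x l e : R) : is_derive x (1 : R) F l -> 0 < e ->
  exists2 dl, 0 < dl & forall y, `|y - x| < dl -> `|F y - F x - l * (y - x)| <= e * `|y - x|.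
Proof.
move=> [D E] e0.
have cv : h^-1 *: (F (h *: (1 : R) + x) - F x) @[h --> (0 : R)^'] --> l by rewrite -E; exact: D.
move/cvgrPdist_le : cv => /(_ e e0)[dl /= dl0 Hdl]; exists dl => // y ydl.
have [->|yx] := eqVneq y x; first by rewrite !subrr mulr0 subrr normr0 mulr0.
have yx0 : y - x != 0 by rewrite subr_eq0.
have := Hdl (y - x); rewrite /ball_/= sub0r normrN => /(_ ydl yx0).
rewrite [_ *: 1]mulr1 subrK => h.
have -> : F y - F x - l * (y - x) = - (l - (y - x)^-1 *: (F y - F x)) * (y - x).
  by rewrite /GRing.scale/=; field.
by rewrite normrM normrN ler_wpM2r.
Qed.

(** Cauchy criterion for the difference quotients: the slope l may depend on e. *)
Lemma derivable_near (F : R -> R) (x : R) :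
  (forall e, 0 < e -> exists l, exists2 dl, 0 < dl &
    forall y, `|y - x| < dl -> `|F y - F x - l * (y - x)| <= e * `|y - x|) ->
  derivable F x (1 : R).
Proof.
move=> H; apply/cauchy_cvgP/cauchy_exP => e e0.
have e20 : 0 < e / 2 by rewrite divr_gt0.
have [l [dl dl0 Hl]] := H _ e20; exists l.
exists dl => // h /= hd h0; rewrite sub0r normrN in hd.
rewrite /ball/= [_ *: 1]mulr1.
have := Hl (h + x); rewrite addrK => /(_ hd).
rewrite -ler_pdivrMr ?normr_gt0// -normfV -normrM => h1.
have -> : l - h^-1 *: (F (h + x) - F x) = - ((F (h + x) - F x - l * h) / h).
  by rewrite /GRing.scale/=; field.
by rewrite normrN (le_lt_trans h1)// ltr_pdivrMr// ltr_pMr// ltr1n.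
Qed.

End derivative_approximation.

(** * The action of a bridge is bounded by the entropy *)

Section action_of_bridge.
Context {R : realType} {d : nat}.
Local Notation Rd := 'rV[R]_d.
Local Notation leb := (@lebesgue_measure R).
Variables (Psi : Rd -> R).
Let b := drift Psi.
Hypothesis bc : forall i, continuous (b i).
Variable p : R -> R.-pker Rd ~> Rd.
Hypothesis pb : forall x f, test_function f ->
  (forall t : R, 0 < t -> is_derive t (1 : R) (fun s => \int[p s x]_y f y)
     (\int[p t x]_y gen b f y)) /\
  (\int[p t x]_y f y) @[t --> 0^'+] --> f x.
Variables (tau : R) (c : R -> probability Rd R) (E : R -> R) (H : R).
Hypotheses (tau0 : 0 < tau) (EH : forall t : R, 0 <= t <= 1 -> 0 <= E t <= H).
Hypothesis cE : forall s t : R, 0 <= s -> s <= t -> t <= 1 ->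
  exists2 pi, coupling (c s) (c t) pi & forall a : Rd * Rd -> R, mbd a ->
  \int[pi]_q (a q - ln (\int[Pr p (tau * (t - s)) q.1]_u expR (a (q.1, u)))) <= E t - E s.
Implicit Types (f : Rd -> R).

Let F f (t : R) : R := \int[c t]_x f x.

Let lip K la (cK : compact K) la0 := @bridge_lipschitz R d b bc p pb tau c E tau0 cE K la cK la0.
Let AC f tf : absolutely_continuous01 (F f) := @bridge_AC R d b bc p pb tau c E H tau0 EH cE f tf.

Variable er : R -> R.
Hypotheses (ier : leb.-integrable setT (EFin \o er)) (er0 : forall x, 0 <= er x).

Let upper (x : R) := forall u, (forall e, 0 < e -> \forall n \near \oo, forall a a', 0 <= a ->
  a <= x -> x < a' -> a' <= 1 -> a' - a = n.+1%:R^-1 -> u <= n.+1%:R * (E a' - E a) + e) -> u <= er x.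
Hypothesis Her : {ae leb, forall x : R, 0 < x < 1 -> upper x}.

Let near_small (dl : R) : 0 < dl -> \forall n \near \oo, n.+1%:R^-1 < dl.
Proof.
move=> dl0; have := @cvg_harmonic R; move/cvgr0Pnorm_lt => /(_ _ dl0); apply: filterS => n.
by rewrite /harmonic /= ger0_norm.
Qed.

Let derivative_norm_le K C f x l : test_function_on K f -> bnd 2 1 f ->
  (forall s t : R, 0 <= s -> s <= t -> t <= 1 -> `|F f t - F f s| <= 1^-1 * (E t - E s) + C * (t - s)) ->
  upper x -> is_derive x (1 : R) (F f) l -> `|l| <= er x + C.
Proof.
move=> fK f1 HC ux D; rewrite -lerBlDr; apply: ux => e e0.
have [dl dl0 Hdl] := straddle D e0.
apply: filterS (near_small dl0) => n ndl a a' a0 ax xa a1 aa.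
have := Hdl a a' ax xa; rewrite aa => /(_ ndl) h1.
have := HC a a' a0 (le_trans ax (ltW xa)) a1; rewrite aa invr1 mul1r => h2.
have n0 : (0 : R) < n.+1%:R by [].
have h3 : `|l| * n.+1%:R^-1 <= (E a' - E a) + C * n.+1%:R^-1 + e * n.+1%:R^-1.
  have -> : `|l| * n.+1%:R^-1 = `|l * n.+1%:R^-1| by rewrite normrM (@ger0_norm _ n.+1%:R^-1).
  have -> : l * n.+1%:R^-1 = (F f a' - F f a) - (F f a' - F f a - l * n.+1%:R^-1) by ring.
  by rewrite (le_trans (ler_normB _ _))// lerD.
have n1 : n.+1%:R^-1 * n.+1%:R = 1 :> R by rewrite mulVf// gt_eqF.
have := ler_wpM2r (ltW n0) h3; rewrite !mulrDl -!mulrA n1 !mulr1; lra.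
Qed.

Let Gh t := fine (\int[leb]_(x in `]0%R, t]) (er x)%:E)%E.

Let Gh_AC : absolutely_continuous01 Gh. Proof. exact: integral_AC. Qed.

Let Gh_mono (s t : R) : 0 <= s -> s <= t -> Gh s <= Gh t.
Proof.
move=> s0 st; rewrite -subr_ge0 -lee_fin (integral_increment ier)//.
by apply: integral_ge0 => x _; rewrite lee_fin.
Qed.

(** [bridge_lipschitz] with la = 1 bounds the derivative of F f by er + C almost everywhere;
    integration replaces the increments of E, known only to be monotone, by those of the absolutely
    continuous [Gh]. *)
Lemma density_lipschitz K : compact K -> exists2 C, 0 <= C &
  forall f, test_function_on K f -> bnd 2 1 f -> forall s t : R, 0 <= s -> s <= t -> t <= 1 ->
  `|F f t - F f s| <= Gh t - Gh s + C * (t - s).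
Proof.
move=> cK; have [C C0 HC] := lip cK ltr01; exists C => // f fK f1 s t s0 st t1.
have tf := test_function_onW cK fK.
have [g [ig FE Dg]] := AC_FTC (AC tf).
have mst : measurable (`]s, t]%classic : set R) by exact: measurable_itv.
have igst : leb.-integrable `]s, t]%classic (EFin \o g) by exact: integrableS ig.
have ierst : leb.-integrable `]s, t]%classic (EFin \o er) by exact: integrableS ier.
have mer : measurable_fun `]s, t]%classic er by apply/measurable_EFinP; exact: measurable_int ierst.
have mg : measurable_fun `]s, t]%classic g by apply/measurable_EFinP; exact: measurable_int igst.
have lE : leb `]s, t]%classic = (t - s)%:E.
  rewrite lebesgue_measure_itv/= lte_fin -EFinB.
  by move: st; rewrite le_eqVlt => /predU1P[->|->//]; rewrite ltxx subrr.
have -> : Gh t - Gh s + C * (t - s) = fine (\int[leb]_(x in `]s, t]) (er x + C)%:E)%E.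
  under eq_integral do rewrite EFinD.
  rewrite ge0_integralD//; last 2 first.
  - by move=> x _; rewrite lee_fin.
  - exact: measurable_EFin_line.
  rewrite -(integral_increment ier s0 st).
  by rewrite integral_cst// [X in (_ + _ * X)%E]lE.
have fin_erC : (\int[leb]_(x in `]s, t]) (er x + C)%:E)%E \is a fin_num.
  under eq_integral do rewrite EFinD.
  rewrite ge0_integralD//; last 2 first.
  - by move=> x _; rewrite lee_fin.
  - exact: measurable_EFin_line.
  rewrite -(integral_increment ier s0 st).
  by rewrite integral_cst// [X in (_ + _ * X)%E]lE.
rewrite -lee_fin fineK// -abse_EFin (FE _ _ s0 st t1).
apply: (le_trans (le_abse_integral _ _ _)) => //; first exact: measurable_EFin_line.
have n1 : {ae leb, forall x : R, x != 1}.
  exists [set (1 : R)]; split => //; first exact: lebesgue_measure_set1.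
  by move=> x /= /negP; rewrite negbK => /eqP.
apply: ae_ge0_le_integral => //.
- by apply: (measurable_EFin_line (k := fun x => `|g x|)); exact: measurableT_comp.
- by move=> x _; rewrite lee_fin addr_ge0.
- by apply: measurable_EFin_line; apply: measurable_funD.
apply: filterS3 Her Dg n1; first exact: (ae_filter_ringOfSetsType leb).
move=> x hx Dx x1 /=; rewrite in_itv/= => /andP[sx xt].
have x01 : 0 < x < 1 by rewrite (le_lt_trans s0 sx) lt_neqAle x1 (le_trans xt).
rewrite lee_fin; apply: (derivative_norm_le fK f1 (HC f fK f1)) => //.
  exact: hx.
exact: Dx.
Qed.

Lemma bridge_distr_AC : distr_abs_continuous c.
Proof.
move=> K cK; have [C C0 HC] := density_lipschitz cK.
exists [set f | test_function_on K f /\ bnd 2 1 f], (fun t => Gh t + C * t); split.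
- split; first by move=> f [].
  exists 2%N, 1; split => // f [fK Hf].
  have b2 : bnd 2 1 f by apply: bnd_of_partial; [case: fK|move=> s x s2; exact/ltW/Hf].
  exact: (conj fK b2).
- move=> e e0; have e20 : 0 < e / 2 by rewrite divr_gt0.
  have [dl dl0 Hdl] := Gh_AC e20.
  exists (Num.min dl (e / (2 * (C + 1)))).
    by rewrite lt_min dl0 divr_gt0// mulr_gt0// ltr_wpDl.
  move=> n a a' ab tI; rewrite lt_min => /andP[S1 S2].
  have h1 := Hdl n a a' ab tI S1.
  apply: (@le_lt_trans _ _ (\sum_(i < n) `|Gh (a' i) - Gh (a i)| + C * \sum_(i < n) (a' i - a i))).
    rewrite mulr_sumr -big_split/=; apply: ler_sum => i _; have [_ [aa _]] := ab i.
    rewrite opprD addrACA -mulrBr (le_trans (ler_normD _ _))// lerD2l.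
    by rewrite ger0_norm// mulr_ge0// subr_ge0.
  have S0 : 0 <= \sum_(i < n) (a' i - a i).
    by apply: sumr_ge0 => i _; rewrite subr_ge0; have [_ [aa _]] := ab i.
  move: S2; rewrite ltr_pdivlMr ?mulr_gt0 ?ltr_wpDl//.
  move: (\sum_(i < n) (a' i - a i)) S0 h1 => w w0 h1; move: (\sum_(i < n) _) h1 => v; nra.
- move=> t1 t2 f /andP[t10 t11] /andP[t20 t21] [fK f1].
  rewrite -/(F f t1) -/(F f t2).
  wlog t12 : t1 t2 t10 t11 t20 t21 / t1 <= t2.
    move=> W; have [|/ltW] := leP t1 t2; first exact: W.
    by rewrite distrC (distrC (Gh t2 + _)); exact: W.
  apply: (le_trans (HC f fK f1 t1 t2 (ltW t10) t12 (ltW t21))).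
  have -> : Gh t2 + C * t2 - (Gh t1 + C * t1) = Gh t2 - Gh t1 + C * (t2 - t1) by ring.
  exact: ler_norm.
Qed.

(** The exceptional null set has to serve all test functions at once. It is taken for the countable
    family and for [Gh]; a difference f - f_n is small in C^2, so by [density_lipschitz] its
    increments near x are a small multiple of |y - x|. *)
Let ae_derivable : {ae leb, forall x : R, 0 < x < 1 -> forall f, test_function f ->
  derivable (F f) x (1 : R)}.
Proof.
have [f_ [tf_ dense]] := @countable_dense_test R d.
have Dn : {ae leb, forall x : R, forall n, 0 < x < 1 -> exists l, is_derive x (1 : R) (F (f_ n)) l}.
  apply: ae_foralln => n; have [g [_ _ Dg]] := AC_FTC (AC (tf_ n)).
  apply: filterS Dg; first exact: (ae_filter_ringOfSetsType leb).
  by move=> x Dx x01; exists (g x); exact: Dx.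
have [gG [_ _ DG]] := AC_FTC Gh_AC.
apply: filterS2 Dn DG; first exact: (ae_filter_ringOfSetsType leb).
move=> x Dnx DGx x01 f tf.
have [K [cK HK]] := dense f tf.
have [C C0 HC] := density_lipschitz cK.
have /andP[x0 x1] := x01.
have [dG dG0 HG] := is_derive_near (DGx x01) ltr01.
apply: derivable_near => e e0.
pose e1 := e / (2 * (`|gG x| + 1 + C + 1)).
have q0 : 0 < 2 * (`|gG x| + 1 + C + 1) by rewrite mulr_gt0// ltr_wpDl// addr_ge0// addr_ge0.
have e10 : 0 < e1 by rewrite divr_gt0.
have [n [hK hb]] := HK e1 e10.
have [l Dl] := Dnx n x01; have e20 : 0 < e / 2 by rewrite divr_gt0.
have [dl dl0 Hdl] := is_derive_near Dl e20.
exists l, (Num.min (Num.min x (1 - x)) (Num.min dl dG)).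
  by rewrite !lt_min x0 subr_gt0 x1 dl0 dG0.
move=> y; rewrite !lt_min => /andP[/andP[yx1 yx2] /andP[ydl ydG]].
have y01 : 0 <= y <= 1 by move: yx1 yx2; rewrite !ltr_norml; lra.
pose h z := f z - f_ n z; pose k z := e1^-1 * h z.
have th : test_function h by exact: test_function_onW cK hK.
have kK : test_function_on K k.
  apply: bsmooth_test_function_on.
    by apply: bsmoothM; [exact: bsmooth_cst|exact: test_function_bsmooth].
  apply: supp_subset; first exact: compact_closed_rV.
  by move=> z Kz; rewrite /k /h (@supp_out _ _ (fun z => f z - f_ n z)) ?mulr0// => /(hK.2).
have k1 : bnd 2 1 k.
  by have := bndZ e1^-1 hb; rewrite gtr0_norm ?invr_gt0// mulVf// gt_eqF.
have mh := test_function_mbd th.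
have Fk t : F k t = e1^-1 * F h t by rewrite /F /k IntZ.
have inc : `|F h y - F h x| <= e1 * (`|Gh y - Gh x| + C * `|y - x|).
  have half (s t : R) : 0 <= s -> s <= t -> t <= 1 -> `|F h t - F h s| <= e1 * (`|Gh t - Gh s| + C * `|t - s|).
    move=> s0 st t1; have := HC k kK k1 s t s0 st t1.
    rewrite !Fk -mulrBr normrM gtr0_norm ?invr_gt0// ler_pdivrMl// => /le_trans; apply.
    by rewrite ler_pM2l// ger0_norm ?subr_ge0 ?Gh_mono// ger0_norm ?subr_ge0.
  have /andP[y0 y1] := y01.
  have [xy|/ltW yx] := leP x y; first by apply: half => //; exact: ltW.
  by rewrite distrC (distrC (Gh y)) (distrC y); apply: half => //; exact: ltW.
have FE t : F f t = F (f_ n) t + F h t.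
  rewrite /F -IntD//; last exact: test_function_mbd.
  by apply: eq_Int => z; rewrite /h addrC subrK.
have h1 := Hdl y ydl; have h2 := HG y ydG; rewrite mul1r in h2.
have h3 : `|Gh y - Gh x| <= (`|gG x| + 1) * `|y - x|.
  rewrite -[X in `|X|](subrK (gG x * (y - x))) (le_trans (ler_normD _ _))//.
  by rewrite mulrDl mul1r normrM addrC lerD2l.
have -> : F f y - F f x - l * (y - x) = (F (f_ n) y - F (f_ n) x - l * (y - x)) + (F h y - F h x).
  by rewrite !FE; ring.
rewrite (le_trans (ler_normD _ _))//.
have h4 : `|F h y - F h x| <= e / 2 * `|y - x|.
  apply: (le_trans inc).
  apply: (@le_trans _ _ (e1 * ((`|gG x| + 1 + C) * `|y - x|))).
    by rewrite ler_pM2l// mulrDl lerD2r.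
  have eE : e1 * (2 * (`|gG x| + 1 + C + 1)) = e by rewrite /e1 divfK// gt_eqF.
  by rewrite mulrA ler_wpM2r//; move: e10 eE; move: (`|gG x|) => w; lra.
lra.
Qed.

(** On an interval of length 1/(n+1) around x, [bridge_increment] and [ln_exp_increment] bound the
    increment of F g by that of E plus tau / (n+1) times the mean of L g + |grad g|^2 at the left
    end; [bridge_continuous] moves this mean to x. *)
Let upper_derivative g x l : test_function g -> 0 < x < 1 -> upper x ->
  is_derive x (1 : R) (F g) l ->
  l - tau * \int[c x]_z (gen b g z + sqg g z) <= er x.
Proof.
move=> tg x01 ux D; have gb := test_function_bsmooth tg.
pose G z := gen b g z + sqg g z.
have x01' : 0 <= x <= 1 by case/andP: x01 => /ltW -> /ltW ->.
have cG : continuous G.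
  by apply: contD; [exact: continuous_gen|apply: bsmooth_continuous; exact: bsmooth_sqg].
have [r Gr] : exists r, forall z, r < `|z| -> G z = 0.
  have [r1 h1] := gen_outside b tg; have [_ /compact_bounded [r2 [_ vr]]] := tg.
  exists (Num.max r1 (r2 + 1)) => z; rewrite gt_max => /andP[z1 z2].
  rewrite /G h1// /sqg big1 ?addr0// => i _; rewrite derive_out_supp ?expr0n//.
  move=> sz; have := vr (r2 + 1); rewrite ltrDl => /(_ ltr01 z sz) /=.
  by rewrite leNgt z2.
have mG : mbd G.
  by apply: mbdD; [exact: gen_mbd|apply: bsmooth_mbd; exact: bsmooth_sqg].
apply: ux => e e0; have e3 : 0 < e / 3 by rewrite divr_gt0.
have et : 0 < e / (3 * tau) by rewrite divr_gt0// mulr_gt0.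
have [d1 d10 Hd1] := straddle D e3.
have [r0 r00 Hr] := ln_exp_increment bc pb tg et.
have [d2 d20 Hd2] := bridge_continuous bc pb tau0 EH cE cG Gr x01' et.
have dm : 0 < Num.min d1 (Num.min (r0 / tau) d2) by rewrite !lt_min d10 divr_gt0.
apply: filterS (near_small dm) => n; rewrite !lt_min => /and3P[n1 n2 n3] a a' a0 ax xa a1 aa.
have n0 : (0 : R) < n.+1%:R by [].
have i0 : 0 < n.+1%:R^-1 :> R by rewrite invr_gt0.
have aa' : a <= a' by exact: le_trans ax (ltW xa).
have a01 : 0 <= a <= 1 by rewrite a0 (le_trans aa').
have h1 := Hd1 a a' ax xa; rewrite aa in h1; have {}h1 := h1 n1.
have h2 : F G a <= F G x + e / (3 * tau).
  apply: Hd2 => //; rewrite ler0_norm ?subr_le0// opprB (le_lt_trans _ n3)// -aa.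
  by rewrite lerD2r ltW.
have mg := test_function_mbd tg.
have := bridge_increment cE mg a0 aa' a1; rewrite aa -/(F g a') -/(F g a) => h3.
have h4 : \int[c a]_z ln (\int[Pr p (tau * n.+1%:R^-1) z]_u expR (g u - g z)) <=
    tau * n.+1%:R^-1 * (F G a + e / (3 * tau)).
  have mc : mbd (fun _ : Rd => e / (3 * tau)) by exact: mbd_cst.
  rewrite /F -[X in _ + X](Int_cst (c a)) -IntD// -IntZ; last exact: mbdD.
  apply: le_Int.
  - have mp : mbd (fun q : Rd * Rd => g q.2 - g q.1).
      by apply: mbdB; [exact: mbd_map measurable_snd mg|exact: mbd_map measurable_fst mg].
    exact: (mbd_ln_Pr p (tau * n.+1%:R^-1) mp).
  - by apply: mbdM; [exact: mbd_cst|exact: mbdD].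
  - move=> z; apply: Hr; rewrite mulr_gt0//= mulrC -ler_pdivlMr//; exact: ltW.
have h5 : F G a + e / (3 * tau) <= F G x + 2 * (e / (3 * tau)) by lra.
have ti : 0 <= tau * n.+1%:R^-1 by rewrite mulr_ge0// ltW.
have h6 := le_trans h4 (ler_wpM2l ti h5).
have {}h1 : l * n.+1%:R^-1 <= F g a' - F g a + e / 3 * n.+1%:R^-1.
  move: h1; rewrite ler_norml => /andP[h1' _]; move: h1'.
  move: (F g a' - F g a) (n.+1%:R^-1) => X w; lra.
have h7 : l * n.+1%:R^-1 <= E a' - E a + tau * n.+1%:R^-1 * (F G x + 2 * (e / (3 * tau))) + e / 3 * n.+1%:R^-1.
  by apply: (le_trans h1); rewrite lerD2r; apply: (le_trans h3); rewrite lerD2l.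
have n1' : n.+1%:R^-1 * n.+1%:R = 1 :> R by rewrite mulVf// gt_eqF.
have := ler_wpM2r (ltW n0) h7.
have -> : l * n.+1%:R^-1 * n.+1%:R = l by rewrite -mulrA n1' mulr1.
have -> : (E a' - E a + tau * n.+1%:R^-1 * (F G x + 2 * (e / (3 * tau))) + e / 3 * n.+1%:R^-1) * n.+1%:R =
    n.+1%:R * (E a' - E a) + tau * F G x + e.
  by field; rewrite !gt_eqF.
by rewrite -/G -/(F G x); lra.
Qed.

Let sq (x : R) : \bar R := sqnorm_m1 (continuity_defect Psi tau c x) (c x).

(** With g = f / (2 tau), the bound of [upper_derivative] multiplied by 4 tau is the expression
    under the supremum that defines the norm. *)
Let sq_le : {ae leb, forall x : R, 0 < x < 1 -> (sq x <= (4 * tau * er x)%:E)%E}.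
Proof.
apply: filterS2 Her ae_derivable; first exact: (ae_filter_ringOfSetsType leb).
move=> x hx dx x01; have ux := hx x01.
apply: ge_ereal_sup => _ [f tf <-]; rewrite lee_fin.
have mf := test_function_mbd tf; have fb := test_function_bsmooth tf.
rewrite /continuity_defect -/(F f).
have Df : is_derive x (1 : R) (F f) (derive1 (F f) x).
  by rewrite derive1E; apply: derivableP; exact: dx.
move: Df; set l := derive1 (F f) x => Df.
pose ka := (2 * tau)^-1; have tg := test_functionZ ka tf.
have Fg : F (fun z => ka * f z) = (fun s => ka * F f s) by apply/funext => s; rewrite /F IntZ.
have Dg : is_derive x (1 : R) (F (fun z => ka * f z)) (ka * l).
  by rewrite Fg; exact: (is_deriveZ ka Df).
have := upper_derivative tg x01 ux Dg.
have gE z : gen b (fun z => ka * f z) z + sqg (fun z => ka * f z) z = ka * gen b f z + ka ^+ 2 * sqg f z.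
  rewrite genZ; last exact: bsmooth_derivable2.
  congr (_ + _); rewrite /sqg mulr_sumr; apply: eq_bigr => i _.
  by rewrite (deriveZ ka ((bsmooth_derivable2 fb).1 i z)) exprMn.
rewrite (eq_Int _ gE).
have mg : mbd (gen b f) by exact: gen_mbd.
have ms : mbd (sqg f) by apply: bsmooth_mbd; exact: bsmooth_sqg.
have m1 : mbd (fun z => ka * gen b f z) by apply: mbdM => //; exact: mbd_cst.
have m2 : mbd (fun z => ka ^+ 2 * sqg f z) by apply: mbdM => //; exact: mbd_cst.
rewrite (IntD _ m1 m2) !IntZ//.
have -> : \int[c x]_y (laplacian f y - dotp (grad Psi y) (grad f y)) = \int[c x]_y gen b f y.
  by apply: eq_Int => y; rewrite gen_drift.
have -> : \int[c x]_y enorm (grad f y) ^+ 2 = \int[c x]_y sqg f y.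
  by apply: eq_Int => y; rewrite sqg_enorm.
set I1 := \int[c x]_y gen b f y; set I2 := \int[c x]_y sqg f y => h.
have t4 : 0 <= 4 * tau by rewrite mulr_ge0// ltW.
have := ler_wpM2l t4 h.
have -> : 4 * tau * (ka * l - tau * (ka * I1 + ka ^+ 2 * I2)) = 2 * (l - tau * I1) - I2.
  by rewrite /ka; field; rewrite gt_eqF.
by [].
Qed.

Lemma action_le_density : (\int[leb]_x (er x)%:E <= H%:E)%E -> (action Psi tau c <= H%:E)%E.
Proof.
move=> erH; rewrite /action; case: asboolP => [_|[]]; last exact: bridge_distr_AC.
have [N [mN N0 HN]] := sq_le.
pose N' := N `|` ([set (0 : R)] `|` [set (1 : R)]).
have mN' : measurable N' by apply: measurableU => //; apply: measurableU.
have N'0 : leb N' = 0%E.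
  apply/eqP; rewrite -measure_le0 (le_trans (measureU2 _ _ _))//; first exact: measurableU.
  rewrite [X in (X + _)%E]N0 add0e (le_trans (measureU2 _ _ _))//.
  by rewrite [X in (X + _)%E]lebesgue_measure_set1 [X in (_ + X)%E]lebesgue_measure_set1 adde0.
(* The value +oo on the null set gives a measurable majorant of [sq] at every point of [0, 1], as
   the comparison of lower integrals demands; its integral is not affected. *)
pose fr x : \bar R := ((4 * tau * er x)%:E + +oo * (\1_N' x)%:E)%E.
have mer : measurable_fun setT er by apply/measurable_EFinP; exact: measurable_int ier.
have t4 : 0 <= 4 * tau by rewrite mulr_ge0// ltW.
have m1 : measurable_fun setT (fun x => (4 * tau * er x)%:E).
  by apply: measurable_EFin_line; exact: measurable_funM.
have mI : measurable_fun setT (fun x : R => (\1_N' x : R)%:E).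
  by apply: measurable_EFin_line; exact: measurable_indic.
have m2 : measurable_fun setT (fun x : R => +oo * (\1_N' x : R)%:E)%E.
  exact: measurable_funeM.
have p1 x : (0 <= (4 * tau * er x)%:E)%E by rewrite lee_fin mulr_ge0.
have p2 x : (0 <= +oo * (\1_N' x : R)%:E)%E by rewrite mule_ge0// lee_fin indicE.
have fr0 x : (0 <= fr x)%E by exact: adde_ge0.
have Ifr : (\int[leb]_x fr x <= (4 * tau * H)%:E)%E.
  rewrite /fr ge0_integralD//.
  have -> : (\int[leb]_x (+oo * (\1_N' x)%:E) = 0)%E.
    rewrite ge0_integralZl//.
    have -> : (\int[leb]_x (\1_N' x)%:E = leb N')%E by rewrite integral_indic ?setIT.
    by rewrite N'0 mule0.
  rewrite adde0; under eq_integral do rewrite EFinM.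
  rewrite ge0_integralZl//; last 2 first.
  - exact: measurable_EFin_line.
  - by move=> x _; rewrite lee_fin.
  by rewrite (EFinM (4 * tau) H); apply: lee_wpmul2l erH; rewrite lee_fin.
have sqfr x : `[0%R, 1%R]%classic x -> (sq x <= fr x)%E.
  rewrite /= in_itv/= => /andP[x0 x1]; rewrite /fr indicE.
  have [xN|xN] := boolP (x \in N'); first by rewrite mulyr sgr1 mul1e addey ?leey.
  rewrite mule0 adde0; move: xN; rewrite notin_setE /N' => /not_orP[xN /not_orP[/= n0 n1]].
  have x01 : 0 < x < 1 by rewrite !lt_neqAle x0 x1 eq_sym !andbT; apply/andP; split; exact/eqP.
  by apply: contrapT => nsq; apply: xN; apply: HN => /= h; apply: nsq; exact: h.
have sq0 x : (0 <= sq x)%E by exact: sqnorm_ge0.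
have h1 : (\int[leb]_(x in `[0%R, 1%R]) sq x <= (4 * tau * H)%:E)%E.
  apply: (le_trans (le_lower_integral leb sq0 fr0 sqfr)); apply: le_trans Ifr.
  rewrite [leLHS]integral_mkcond; apply: le_lower_integral => // x.
    by rewrite patchE; case: ifP.
  by move=> _; rewrite patchE; case: ifP.
have t40 : (0 <= (4 * tau)^-1%:E :> \bar R)%E by rewrite lee_fin invr_ge0.
apply: (le_trans (lee_wpmul2l t40 h1)).
by rewrite -EFinM lee_fin mulrA mulVf ?mul1r// gt_eqF// mulr_gt0.
Qed.

End action_of_bridge.

(** * Moments and Wasserstein continuity of a bridge *)

Section saturation.
Context {R : realType}.
Variable M : R.
Hypothesis M0 : 0 <= M.
Implicit Types u y : R.

(* Comparable to u for u >= M, and decreasing to 0 as M grows. *)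
Definition satur u : R := u * u * (M + u)^-1.

Let w y := (M + expR y)^-1.
(** [satur1] and [satur2] are the first and second derivatives of [satur (expR y)] in y. *)
Definition satur1 y : R := satur (expR y) * (2 - expR y * w y).
Definition satur2 y : R := satur (expR y) * (4 - 5 * (expR y * w y) + 2 * (expR y * w y) ^+ 2).

Let Mu y : 0 < M + expR y. Proof. by rewrite ltr_wpDl// expR_gt0. Qed.

Let dw y : is_derive y (1 : R) w (- expR y * w y ^+ 2).
Proof.
have dD : is_derive y (1 : R) (fun z => M + expR z) (expR y).
  by apply: (is_derive_eq (is_deriveD (is_derive_cst M y (1 : R)) (is_derive_expR y))); rewrite add0r.
have n0 : (fun z => M + expR z) y != 0 by rewrite /= gt_eqF.
apply: DeriveDef; first by apply: (@derivableV _ _ (fun z : R => M + expR z)) => //; case: dD.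
rewrite (@deriveV _ _ (fun z : R => M + expR z))//.
case: dD => _ ->; rewrite /GRing.scale/= /w; field; exact: n0.
Qed.

Lemma is_derive_satur y : is_derive y (1 : R) (fun z => satur (expR z)) (satur1 y).
Proof.
have dS : is_derive y (1 : R) (fun z => expR z * expR z * w z)
    (expR y * expR y * w y * (2 - expR y * w y)).
  by have dwy := dw y; apply: is_derive_eq; rewrite /GRing.scale/=; ring.
exact: dS.
Qed.

Lemma is_derive_satur1 y : is_derive y (1 : R) satur1 (satur2 y).
Proof.
have dS : is_derive y (1 : R) (fun z => expR z * expR z * w z * (2 - expR z * w z))
    (expR y * expR y * w y * (4 - 5 * (expR y * w y) + 2 * (expR y * w y) ^+ 2)).
  by have dwy := dw y; apply: is_derive_eq; rewrite /GRing.scale/=; ring.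
exact: dS.
Qed.

Lemma satur_ge0 u : 0 <= u -> 0 <= satur u.
Proof. by move=> u0; rewrite /satur !mulr_ge0// invr_ge0 addr_ge0. Qed.

Let ratio y : 0 <= expR y * w y <= 1.
Proof.
rewrite mulr_ge0 ?expR_ge0 ?invr_ge0 ?(ltW (Mu y))//= ler_pdivrMr// mul1r lerDr//.
Qed.

Lemma satur1_bound y : 0 <= satur1 y <= 2 * satur (expR y).
Proof.
have := satur_ge0 (expR_ge0 y); have := ratio y; rewrite /satur1.
move: (satur _) (expR y * w y) => k t /andP[t0 t1] k0; nra.
Qed.

Lemma satur2_le y : satur2 y <= 4 * satur (expR y).
Proof.
have := satur_ge0 (expR_ge0 y); have := ratio y; rewrite /satur2.
move: (satur _) (expR y * w y) => k t /andP[t0 t1] k0.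
rewrite mulrC ler_wpM2r//; nra.
Qed.

Lemma satur_le u : 0 < u -> satur u <= u.
Proof.
by move=> u0; rewrite /satur ler_pdivrMr ?ltr_wpDl// ler_pM2l// lerDr.
Qed.

Lemma le_satur u : 0 < u -> M <= u -> u <= 2 * satur u.
Proof.
by move=> u0 Mu'; rewrite /satur mulrA ler_pdivlMr ?ltr_wpDl//; nra.
Qed.

Lemma satur_homo u v : 0 < u -> u <= v -> satur u <= satur v.
Proof.
move=> u0 uv; have v0 := lt_le_trans u0 uv.
rewrite /satur ler_pdivrMr ?ltr_wpDl// mulrAC ler_pdivlMr ?ltr_wpDl//.
have h1 : u * u <= v * v by apply: ler_pM => //; exact: ltW.
have h2 : u * u * M <= v * v * M by rewrite ler_wpM2r.
have h3 : u * v * u <= u * v * v by rewrite ler_pM2l// mulr_gt0.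
lra.
Qed.

Lemma satur_scale a u : 1 <= a -> 0 < u -> satur (a * u) <= a ^+ 2 * satur u.
Proof.
move=> a1 u0; have a0 : 0 < a by exact: lt_le_trans a1.
have -> : satur (a * u) = a ^+ 2 * (u * u * (M + a * u)^-1) by rewrite /satur; ring.
rewrite ler_pM2l ?exprn_gt0// /satur ler_pM2l ?mulr_gt0// lef_pV2 ?posrE ?ltr_wpDl ?mulr_gt0//.
by rewrite lerD2l ler_peMl// ltW.
Qed.

End saturation.

Section gronwall.
Context {R : realType}.

(** Explicit Euler steps of length h <= dl: the factor 1 + C h is at most exp(C h), the increments
    of E add up, and so do the errors h e1, where e1 is an arbitrarily small tolerance. *)
Lemma discrete_gronwall (Phi E : R -> R) (C : R) : 0 <= C -> (forall t, 0 <= Phi t) ->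
  (forall s t : R, 0 <= s -> s <= t -> t <= 1 -> E s <= E t) ->
  (forall e, 0 < e -> exists2 dl, 0 < dl & forall s t : R, 0 <= s -> s <= t -> t <= 1 ->
     t - s <= dl -> Phi t - Phi s <= E t - E s + (t - s) * (C * Phi s + e)) ->
  forall s t : R, 0 <= s -> s <= t -> t <= 1 ->
  Phi t <= expR (C * (t - s)) * (Phi s + (E t - E s)).
Proof.
move=> C0 P0 mono step s t s0 st t1; apply/ler_addgt0Pr => e e0.
have X0 := expR_gt0 (C * (t - s)).
have e10 : 0 < e / expR (C * (t - s)) by rewrite divr_gt0.
have [dl dl0 Hdl] := step _ e10; move: e10 Hdl; set e1 := e / _ => e10 Hdl.
pose n := (Num.truncn ((t - s) / dl)).+1; pose h := (t - s) / n%:R.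
have n0 : (0 : R) < n%:R by [].
have ts0 : 0 <= t - s by rewrite subr_ge0.
have h0 : 0 <= h by rewrite divr_ge0// ltW.
have nh : n%:R * h = t - s by rewrite mulrC divfK// gt_eqF.
have hdl : h <= dl.
  rewrite ler_pdivrMr// mulrC -ler_pdivrMr//; apply: ltW.
  by have /andP[] := truncn_itv (divr_ge0 ts0 (ltW dl0)).
have Hj j : (j <= n)%N -> Phi (s + j%:R * h) <=
    expR (C * (j%:R * h)) * (Phi s + (E (s + j%:R * h) - E s) + j%:R * h * e1).
  elim: j => [_|j IH jn]; first by rewrite !mul0r !mulr0 !addr0 expR0 subrr !addr0 mul1r.
  have {}IH := IH (ltnW jn); have j1 : j.+1%:R * h = j%:R * h + h by rewrite -natr1; ring.
  have jh0 : 0 <= j%:R * h by rewrite mulr_ge0.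
  have jh1 : j.+1%:R * h <= t - s by rewrite -nh ler_wpM2r// ler_nat.
  have xj0 : 0 <= s + j%:R * h by rewrite addr_ge0.
  have xj1 : s + j.+1%:R * h <= 1 by lra.
  have xj : s + j%:R * h <= s + j.+1%:R * h by lra.
  have := Hdl _ _ xj0 xj xj1; have := mono _ _ xj0 xj xj1.
  have := mono _ _ s0 (_ : s <= s + j%:R * h) (le_trans xj xj1); rewrite lerDl => /(_ jh0).
  have -> : s + j.+1%:R * h - (s + j%:R * h) = h by rewrite j1; ring.
  have -> : C * (j.+1%:R * h) = C * (j%:R * h) + C * h by rewrite j1; ring.
  have -> : j.+1%:R * h * e1 = j%:R * h * e1 + h * e1 by rewrite j1; ring.
  rewrite expRD; move: IH (P0 (s + j%:R * h)).
  have A1 : 1 <= expR (C * (j%:R * h)) by rewrite -[leLHS]expR0 ler_expR mulr_ge0.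
  have B1 : 1 + C * h <= expR (C * h) := expR_ge1Dx _.
  have B2 : 1 <= expR (C * h) by rewrite -[leLHS]expR0 ler_expR mulr_ge0.
  move: (Phi (s + j%:R * h)) (Phi (s + j.+1%:R * h)) (E (s + j%:R * h)) (E (s + j.+1%:R * h)).
  move: (expR _) (expR _) A1 B1 B2 => B A A1 B1 B2 p p' q q' IH p0 m1 m2 /(_ hdl) st'.
  have he : 0 <= h * e1 by rewrite mulr_ge0// ltW.
  have k1 : (1 + C * h) * p <= B * p by rewrite ler_wpM2r.
  have k2 : B * p <= B * (A * (Phi s + (q - E s) + j%:R * h * e1)).
    by rewrite ler_wpM2l//; lra.
  have k3 : q' - q + h * e1 <= A * B * (q' - q + h * e1).
    by apply: ler_peMl; [rewrite addr_ge0 ?subr_ge0|exact: mulr_ege1].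
  lra.
have := Hj n (leqnn n); rewrite nh (addrC s) subrK => /le_trans; apply.
rewrite mulrDr lerD2l; apply: (@le_trans _ _ (expR (C * (t - s)) * e1)).
  rewrite ler_wpM2l ?expR_ge0// ler_piMl ?(ltW e10)//; lra.
by rewrite /e1 mulrC divfK// gt_eqF.
Qed.

End gronwall.

(** * Growth of saturated moments *)

Section moment_growth.
Context {R : realType} {d : nat}.
Local Notation Rd := 'rV[R]_d.
Variables (b : 'I_d -> Rd -> R) (CV : R).
Hypothesis bc : forall i, continuous (b i).
Hypotheses (CV0 : 0 <= CV) (bV : forall x, gen b V x <= CV).
Variables (M s1 : R).
Hypotheses (M0 : 0 <= M) (s10 : 0 <= s1).
Implicit Types x : Rd.

Let v x : R := trunc s1 1 0 (V x).
(** A bounded smooth function that dominates the saturation of 1 + |x|^2 where V <= s1; the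
    truncation of V costs at most a factor [expR 1] inside [satur]. *)
Definition moment_fun x : R := satur M (expR (v x)).

Let v_ge0 x : 0 <= v x.
Proof. by apply: le_trans (trunc_ge s1 ltr01 _); rewrite le_min V_ge0. Qed.

Let dv j x : is_derive x (ei j) v (trunc s1 1 1 (V x) * 'D_(ei j) V x).
Proof.
exact: (derive_comp (D := setT) (fun y _ => is_derive_trunc s1 ltr01 0 y)
  (fun _ => I) (derivable2_V.1 j x)).
Qed.

Let vb : bsmooth v.
Proof.
apply: (@bsmooth_comp_gen _ _ (trunc s1 1) [set t | 0 <= t] V) => //.
- by move=> n y _; exact: is_derive_trunc.
- by move=> n; exact: trunc_bounded.
- by move=> x; exact: V_ge0.
- exact: continuous_V.
- exact: derivable2_V.1.
- exact: bsmooth_derive_V.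
Qed.

Lemma sqg_V_le x : sqg V x <= 4 / U x.
Proof.
have U0 := U_gt0 x.
have -> : sqg V x = dotp x x * (4 * (U x) ^- 2).
  rewrite /sqg /dotp mulr_suml; apply: eq_bigr => j _.
  case: (is_derive_V x j) => _ ->; rewrite /qU; field; by rewrite gt_eqF.
have -> : 4 / U x = U x * (4 * (U x) ^- 2) by field; rewrite gt_eqF.
by rewrite ler_wpM2r ?mulr_ge0 ?invr_ge0 ?exprn_ge0 ?(ltW U0)// /U lerDr.
Qed.

Let sqg_v x : expR (v x) * sqg v x <= 4 * expR 1.
Proof.
have t0 := trunc'_ge0 s1 1 (V x); have t1 := trunc'_le1 s1 1 (V x).
have -> : sqg v x = trunc s1 1 1 (V x) ^+ 2 * sqg V x.
  rewrite /sqg mulr_sumr; apply: eq_bigr => j _.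
  by case: (dv j x) => _ ->; rewrite exprMn.
have h1 : trunc s1 1 1 (V x) ^+ 2 * sqg V x <= 4 / U x.
  by apply: le_trans (sqg_V_le x); rewrite ler_piMl ?sqg_ge0// expr_le1.
have h2 : expR (v x) <= U x * expR 1.
  rewrite -[U x]lnK ?posrE ?U_gt0// -expRD ler_expR; exact: trunc_le_id.
apply: (le_trans (ler_wpM2l (expR_ge0 _) h1)).
have U40 : 0 <= 4 / U x by rewrite divr_ge0// ltW// U_gt0.
apply: (le_trans (ler_wpM2r U40 h2)).
have -> : U x * expR 1 * (4 / U x) = 4 * expR 1 by field; rewrite gt_eqF// U_gt0.
by [].
Qed.

Let gen_v x : gen b v x <= CV.
Proof.
have -> := gen_comp b x (D := setT) (fun y _ => is_derive_trunc s1 ltr01 0 y)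
  (fun y _ => is_derive_trunc s1 ltr01 1 y) (fun _ => I) derivable2_V.
have t0 := trunc'_ge0 s1 1 (V x); have t1 := trunc'_le1 s1 1 (V x).
have t2 := trunc''_le0 s1 ltr01 (V x).
have h2 : trunc s1 1 2 (V x) * sqg V x <= 0 by rewrite mulr_le0_ge0 ?sqg_ge0.
have h1 : trunc s1 1 1 (V x) * gen b V x <= CV.
  by apply: le_trans (ler_wpM2l t0 (bV x)) _; rewrite ler_piMl.
by rewrite -[leRHS]addr0 lerD.
Qed.

Lemma moment_fun_ge0 x : 0 <= moment_fun x.
Proof. exact/satur_ge0/expR_ge0. Qed.

Let kb : bsmooth moment_fun.
Proof.
have eb := bsmooth_expR vb; have e1 x : 1 <= M + expR (v x).
  rewrite (@le_trans _ _ (expR (v x))) ?lerDr// -expR0 ler_expR; exact: v_ge0.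
apply: bsmoothM; first exact: bsmoothM.
by apply: (bsmooth_inv ltr01 e1); apply: bsmoothD => //; exact: bsmooth_cst.
Qed.

Lemma moment_fun_mbd : mbd moment_fun.
Proof. exact: bsmooth_mbd. Qed.

Variable la : R.
Hypothesis la0 : 0 < la.
Let g y : R := la * (satur M (expR y) - satur M (expR s1)).
Let dg y : is_derive y (1 : R) g (la * satur1 M y).
Proof.
have dS := is_derive_satur M0 y.
by apply: is_derive_eq; rewrite /GRing.scale/= subr0.
Qed.
Let dg1 y : is_derive y (1 : R) (fun z => la * satur1 M z) (la * satur2 M y).
Proof. exact: (is_deriveZ la (is_derive_satur1 M0 y)). Qed.

(** The subtracted constant is the value outside a compact set, so that this is a test function. *)
Definition moment_test x : R := la * (moment_fun x - satur M (expR s1)).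

Lemma moment_test_test : test_function moment_test.
Proof.
apply: (@bsmooth_test _ _ _ (expR s1)) => [|x xs].
  apply: bsmoothM; first exact: bsmooth_cst.
  by apply: bsmoothD => //; exact: bsmooth_cst.
rewrite /moment_test /moment_fun /v trunc_eq ?subrr ?mulr0//.
rewrite -(expRK s1) /V ler_ln ?posrE ?expR_gt0 ?U_gt0//.
exact: ltW (lt_le_trans xs (norm_le_U x)).
Qed.

(** The quadratic term is kept linear in the moment by satur <= exp(v) and by exp(v) |grad v|^2 <= 4
    [expR 1], at the price of a rate that grows with la. The contributions 2 CV, 16 and 16 [expR 1]
    la come from the first-order, second-order and quadratic terms. *)
Lemma moment_test_gen x : gen b moment_test x + sqg moment_test x <=
  (2 * CV + 16 + 16 * expR 1 * la) * (la * moment_fun x).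
Proof.
have -> : gen b moment_test x = la * satur1 M (v x) * gen b v x + la * satur2 M (v x) * sqg v x.
  exact: (gen_comp b x (D := setT) (fun y _ => dg y) (fun y _ => dg1 y) (fun _ => I)
    (bsmooth_derivable2 vb)).
have -> : sqg moment_test x = (la * satur1 M (v x)) ^+ 2 * sqg v x.
  rewrite /sqg mulr_sumr; apply: eq_bigr => j _; rewrite -exprMn; congr (_ ^+ 2).
  by case: (derive_comp (D := setT) (fun y _ => dg y) (fun _ => I)
    ((bsmooth_derivable2 vb).1 j x)).
have /andP[S10 S1] := satur1_bound M0 (v x); have S2 := satur2_le M0 (v x).
have k0 := moment_fun_ge0 x; have s0 := sqg_ge0 v x; have G := gen_v x.
have sl := sqg_v x; have e1 := expR_gt0 (v x).
have ev1 : 1 <= expR (v x) by rewrite -expR0 ler_expR; exact: v_ge0.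
have ke : moment_fun x <= expR (v x) by exact: satur_le.
rewrite -/(moment_fun x) in S1 S2.
have s4 : sqg v x <= 4.
  have U1 := U_ge1 x; have t0 := trunc'_ge0 s1 1 (V x); have t1 := trunc'_le1 s1 1 (V x).
  have -> : sqg v x = trunc s1 1 1 (V x) ^+ 2 * sqg V x.
    rewrite /sqg mulr_sumr; apply: eq_bigr => j _.
    by case: (dv j x) => _ ->; rewrite exprMn.
  apply: (@le_trans _ _ (sqg V x)); first by rewrite ler_piMl ?sqg_ge0// expr_le1.
  by apply: (le_trans (sqg_V_le x)); rewrite ler_pdivrMr ?U_gt0//; lra.
have a1 : satur1 M (v x) * gen b v x <= 2 * moment_fun x * CV.
  apply: (le_trans (ler_wpM2l S10 G)); exact: ler_wpM2r.
have a2 : satur2 M (v x) * sqg v x <= 4 * moment_fun x * 4.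
  apply: (le_trans (ler_wpM2r s0 S2)); apply: ler_wpM2l => //; exact: mulr_ge0.
have a3 : satur1 M (v x) ^+ 2 * sqg v x <= 16 * expR 1 * moment_fun x.
  have : satur1 M (v x) ^+ 2 <= (2 * moment_fun x) ^+ 2.
    by rewrite lerXn2r ?nnegrE// mulr_ge0.
  move=> /(ler_wpM2r s0) /le_trans; apply.
  have -> : (2 * moment_fun x) ^+ 2 * sqg v x = 4 * moment_fun x * (moment_fun x * sqg v x) by ring.
  have -> : 16 * expR 1 * moment_fun x = 4 * moment_fun x * (4 * expR 1) by ring.
  apply: ler_wpM2l; first exact: mulr_ge0.
  exact: le_trans (ler_wpM2r s0 ke) sl.
have b1 := ler_wpM2l (ltW la0) a1; have b2 := ler_wpM2l (ltW la0) a2.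
have b3 := ler_wpM2l (sqr_ge0 la) a3.
clear S10 S1 S2 k0 s0 G sl ke s4 a1 a2 a3; move: b1 b2 b3.
move: (moment_fun x) (satur1 M (v x)) (satur2 M (v x)) (gen b v x) (sqg v x) => k S1 S2 gv sv; lra.
Qed.

Variable p : R -> R.-pker Rd ~> Rd.
Hypothesis pb : forall x f, test_function f ->
  (forall t : R, 0 < t -> is_derive t (1 : R) (fun s => \int[p s x]_y f y)
     (\int[p t x]_y gen b f y)) /\
  (\int[p t x]_y f y) @[t --> 0^'+] --> f x.
Variables (tau : R) (c : R -> probability Rd R) (E : R -> R).
Hypothesis tau0 : 0 < tau.
Hypothesis cE : forall s t : R, 0 <= s -> s <= t -> t <= 1 ->
  exists2 pi, coupling (c s) (c t) pi & forall a : Rd * Rd -> R, mbd a ->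
  \int[pi]_q (a q - ln (\int[Pr p (tau * (t - s)) q.1]_u expR (a (q.1, u)))) <= E t - E s.

Definition growth_rate (l : R) : R := tau * (2 * CV + 16 + 16 * expR 1 * l).

Lemma growth_rate_ge0 : 0 <= growth_rate la.
Proof.
by rewrite mulr_ge0 ?(ltW tau0)// !addr_ge0 ?mulr_ge0 ?expR_ge0 ?(ltW la0).
Qed.

(** [bridge_increment] and [ln_exp_increment] for [moment_test] give the one-step inequality of
    [discrete_gronwall]; the subtracted constant cancels in the increment. *)
Lemma moment_growth (s t : R) : 0 <= s -> s <= t -> t <= 1 ->
  la * \int[c t]_x moment_fun x <= expR (growth_rate la * (t - s)) *
    (la * \int[c s]_x moment_fun x + (E t - E s)).
Proof.
have mk := moment_fun_mbd; have tf := moment_test_test.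
have mf := test_function_mbd tf.
apply: (@discrete_gronwall _ (fun t => la * \int[c t]_x moment_fun x) E) => [|r||e e0].
- exact: growth_rate_ge0.
- by rewrite mulr_ge0 ?(ltW la0)//; apply: Int_ge_cst => // x; exact: moment_fun_ge0.
- exact: (E_mono cE).
have et : 0 < e / tau by rewrite divr_gt0.
have [r0 r00 Hr] := ln_exp_increment bc pb tf et.
exists (r0 / tau); first by rewrite divr_gt0.
move=> {}s {}t s0 st t1 ts.
move: (st); rewrite le_eqVlt => /predU1P[->|lst].
  by rewrite !subrr mul0r addr0.
have := bridge_increment cE mf s0 st t1.
have FE r : \int[c r]_x moment_test x =
    la * (\int[c r]_x moment_fun x - satur M (expR s1)).
  rewrite IntZ; last by apply: mbdB => //; exact: mbd_cst.
  by rewrite IntB ?Int_cst//; exact: mbd_cst.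
rewrite !FE -mulrBr opprB addrA subrK mulrBr => /le_trans; apply.
rewrite lerD2l; set r := tau * (t - s).
have rr : 0 < r <= r0.
  by rewrite /r mulr_gt0 ?subr_gt0//= mulrC -ler_pdivlMr.
pose C := 2 * CV + 16 + 16 * expR 1 * la.
have -> : (t - s) * (growth_rate la * (la * \int[c s]_x moment_fun x) + e) =
    \int[c s]_x (r * (C * la * moment_fun x + e / tau)).
  have m1 : mbd (fun x => C * la * moment_fun x) by apply: mbdM => //; exact: mbd_cst.
  rewrite IntZ; last by apply: mbdD => //; exact: mbd_cst.
  rewrite IntD ?Int_cst ?IntZ//; last exact: mbd_cst.
  by rewrite /growth_rate -/C /r; field; rewrite gt_eqF.
apply: le_Int.
- have mp : mbd (fun q : Rd * Rd => moment_test q.2 - moment_test q.1).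
    by apply: mbdB; [exact: mbd_map measurable_snd mf|exact: mbd_map measurable_fst mf].
  exact: (mbd_ln_Pr p r mp).
- apply: mbdM; first exact: mbd_cst.
  by apply: mbdD; [apply: mbdM => //; exact: mbd_cst|exact: mbd_cst].
- move=> z; apply: (le_trans (Hr r z rr)); case/andP: rr => r1 _.
  by rewrite ler_pM2l// lerD2r -mulrA; exact: moment_test_gen.
Qed.

Let exp1 : 1 <= expR 1 :> R. Proof. by rewrite -expR0 ler_expR. Qed.

Lemma moment_fun_le x : moment_fun x <= expR 1 ^+ 2 * satur M (U x).
Proof.
apply: le_trans (satur_scale M0 exp1 (U_gt0 x)); apply: satur_homo => //; first exact: expR_gt0.
rewrite mulrC -[U x]lnK ?posrE ?U_gt0// -expRD ler_expR; exact: trunc_le_id.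
Qed.

Lemma moment_fun_ge x : V x <= s1 -> satur M (U x) <= moment_fun x.
Proof.
move=> Vs; apply: satur_homo => //; first exact: U_gt0.
rewrite -[U x]lnK ?posrE ?U_gt0// ler_expR.
by apply: le_trans (trunc_ge s1 ltr01 _); rewrite le_min lexx.
Qed.

End moment_growth.

(** * Transport cost and tails *)

Section transport_distance.
Context {R : realType} {d : nat}.
Local Notation Rd := 'rV[R]_d.
Implicit Types (f : Rd -> R) (mu nu : probability Rd R).
Local Notation cost := (fun q : Rd * Rd => enorm (q.1 - q.2) ^+ 2).

Lemma mbd_EFin dT (T : measurableType dT) (mu : probability T R) (f : T -> R) : mbd f ->
  (\int[mu]_x (f x)%:E = (\int[mu]_x f x)%:E)%E.
Proof.
move=> mf; rewrite /Rintegral fineK//; apply: (integrable_fin_num measurableT).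
exact: mbd_integrable.
Qed.

Lemma Int_sum dT (T : measurableType dT) (mu : probability T R) (I : Type) (r : seq I)
    (f : I -> T -> R) : (forall i, mbd (f i)) ->
  mbd (fun x => \sum_(i <- r) f i x) /\
  \int[mu]_x (\sum_(i <- r) f i x) = \sum_(i <- r) \int[mu]_x f i x.
Proof.
move=> mf; elim: r => [|i r [IH1 IH2]].
  split; last by rewrite big_nil -[RHS](Int_cst mu); apply: eq_Int => x; rewrite big_nil.
  by under eq_fun do rewrite big_nil; exact: mbd_cst.
have E : (fun x => \sum_(j <- i :: r) f j x) = (fun x => f i x + \sum_(j <- r) f j x).
  by apply/funext => x; rewrite big_cons.
by rewrite E big_cons -IH2 IntD//; split => //; exact: mbdD.
Qed.

Lemma law_ge0_integral d1 d2 (T1 : measurableType d1) (T2 : measurableType d2)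
  (mu : probability T1 R) (m : T1 -> T2) (mm : measurable_fun setT m) (f : T2 -> R) :
  measurable_fun setT f -> (forall x, 0 <= f x) ->
  (\int[law mu mm]_x (f x)%:E = \int[mu]_x (f (m x))%:E)%E.
Proof.
move=> mf f0.
rewrite -[LHS]/(\int[pushforward mu m]_x (EFin \o f) x)%E ge0_integral_pushforward//.
- exact/measurable_EFinP.
- by move=> x _; rewrite lee_fin.
Qed.

Lemma coupling_fst_ge0 mu nu g f : coupling mu nu g -> measurable_fun setT f ->
  (forall x, 0 <= f x) -> (\int[g]_q (f q.1)%:E = \int[mu]_x (f x)%:E)%E.
Proof.
move=> gc mf f0; have m1 : measurable_fun setT (@fst Rd Rd) := measurable_fst.
rewrite -(law_ge0_integral g m1 mf f0); apply: eq_measure_integral => A mA _.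
transitivity (g (A `*` setT)); last exact: (gc A mA).1.
by rewrite /law /pushforward; congr (g _); apply/seteqP; split => x //= [].
Qed.

Lemma coupling_snd_ge0 mu nu g f : coupling mu nu g -> measurable_fun setT f ->
  (forall x, 0 <= f x) -> (\int[g]_q (f q.2)%:E = \int[nu]_x (f x)%:E)%E.
Proof.
move=> gc mf f0; have m2 : measurable_fun setT (@snd Rd Rd) := measurable_snd.
rewrite -(law_ge0_integral g m2 mf f0); apply: eq_measure_integral => A mA _.
transitivity (g (setT `*` A)); last exact: (gc A mA).2.
by rewrite /law /pushforward; congr (g _); apply/seteqP; split => x //= [].
Qed.

Lemma enorm_sqE (x : Rd) : enorm x ^+ 2 = dotp x x.
Proof. by rewrite /enorm sqr_sqrtr// dotp_ge0. Qed.

Lemma W2_le mu nu g (k : R) : coupling mu nu g -> 0 <= k ->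
  (\int[g]_q (cost q)%:E <= (k ^+ 2)%:E)%E -> (W2 mu nu <= k%:E)%E.
Proof.
move=> gc k0 gk; rewrite /W2; set I := ereal_inf _.
have I0 : (0 <= I)%E.
  apply: le_ereal_inf_tmp => _ [g' _ <-]; apply: integral_ge0 => x _; rewrite lee_fin; exact: sqr_ge0.
have Ik : (I <= (k ^+ 2)%:E)%E.
  by apply: le_trans gk; apply: ereal_inf_lbound; exists g.
case: I I0 Ik => [r| |]// r0; rewrite lee_fin => rk.
rewrite poweR_EFin lee_fin powR12_sqrt//.
by rewrite -(ger0_norm k0) -sqrtr_sqr; apply: ler_wsqrtr.
Qed.

Lemma coupling_swap mu nu g : coupling mu nu g -> exists2 g', coupling nu mu g' &
  (\int[g']_q (cost q)%:E = \int[g]_q (cost q)%:E)%E.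
Proof.
move=> gc; pose sw (q : Rd * Rd) := (q.2, q.1).
have msw : measurable_fun setT sw.
  by apply/measurable_fun_pairP; split; [exact: measurable_snd|exact: measurable_fst].
exists (law g msw).
  move=> A mA; split.
    rewrite -(gc A mA).2 /law /pushforward; congr (g _).
    by apply/seteqP; split => -[x y] /= [].
  rewrite -(gc A mA).1 /law /pushforward; congr (g _).
  by apply/seteqP; split => -[x y] /= [].
rewrite (law_ge0_integral g msw (measurable_cost (R := R) (d := d))) => [|q]; last exact: sqr_ge0.
apply: eq_integral => q _; rewrite !enorm_sqE; congr (_%:E).
by apply: eq_bigr => i _; rewrite !mxE; ring.
Qed.

(** If both points satisfy U <= M, the coordinates are replaced by the f i. Otherwise |z - z'|^2 <=
    2 U z + 2 U z', the larger of the two values exceeds M, and beyond M one has U <= 2 satur M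
    U. *)
Lemma cost_le (f : 'I_d -> Rd -> R) (M e : R) z z' : 0 <= M -> 0 <= e ->
  (forall i x, U x <= M -> `|f i x - x ord0 i| <= e) ->
  enorm (z - z') ^+ 2 <= 2 * (\sum_(i < d) (f i z' - f i z) ^+ 2) + 8 * d%:R * e ^+ 2 +
    8 * satur M (U z) + 8 * satur M (U z').
Proof.
move=> M0 e0 fM; rewrite enorm_sqE.
have sz := satur_ge0 M0 (ltW (U_gt0 z)); have sz' := satur_ge0 M0 (ltW (U_gt0 z')).
have S0 : 0 <= \sum_(i < d) (f i z' - f i z) ^+ 2 by apply: sumr_ge0 => i _; exact: sqr_ge0.
have d0 : 0 <= 8 * d%:R * e ^+ 2 by rewrite mulr_ge0 ?sqr_ge0// mulr_ge0.
have far : dotp (z - z') (z - z') <= 2 * U z + 2 * U z'.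
  apply: (@le_trans _ _ (2 * dotp z z + 2 * dotp z' z')); last by rewrite /U; lra.
  rewrite /dotp !mulr_sumr -big_split/=; apply: ler_sum => i _; rewrite !mxE.
  by have := sqr_ge0 (z ord0 i + z' ord0 i); nra.
have [zM|Mz] := leP (U z) M; have [z'M|Mz'] := leP (U z') M.
- have h : dotp (z - z') (z - z') <= 2 * (\sum_(i < d) (f i z' - f i z) ^+ 2) + 8 * d%:R * e ^+ 2.
    have -> : 8 * d%:R * e ^+ 2 = \sum_(i < d) 8 * e ^+ 2.
      by rewrite sumr_const card_ord -mulr_natr; ring.
    rewrite /dotp mulr_sumr -big_split/=; apply: ler_sum => i _; rewrite !mxE.
    have := fM i z zM; have := fM i z' z'M; rewrite !ler_norml.
    move: (f i z) (f i z') (z ord0 i) (z' ord0 i) => a a' x x' /andP[h1 h2] /andP[h3 h4].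
    have hb : (a' - x' - (a - x)) ^+ 2 <= (2 * e) ^+ 2.
      by rewrite -ler_sqrt ?sqr_ge0// !sqrtr_sqr (ger0_norm (_ : 0 <= 2 * e)) ?mulr_ge0// ler_norml; lra.
    have := sqr_ge0 (a' - a + (a' - x' - (a - x))); nra.
  lra.
- have := le_satur M0 (U_gt0 z') (ltW Mz'); lra.
- have := le_satur M0 (U_gt0 z) (ltW Mz); lra.
- have := le_satur M0 (U_gt0 z) (ltW Mz); have := le_satur M0 (U_gt0 z') (ltW Mz'); lra.
Qed.

Lemma measurable_satur_U (M : R) : 0 <= M -> measurable_fun setT (fun x : Rd => satur M (U x)).
Proof.
move=> M0; apply: continuous_measurable_rV; apply: contM.
  by apply: contM; exact: continuous_U.
have cMU : continuous (fun x : Rd => M + U x).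
  by apply: contD; [exact: cont_cst|exact: continuous_U].
move=> x; have n0 : M + U x != 0 by rewrite gt_eqF// ltr_wpDl// U_gt0.
exact: (cvgV n0 (cMU x)).
Qed.

(** Dominated convergence: satur n u tends to 0 as n grows and never exceeds u. *)
Lemma satur_vanish mu (B e : R) : (\int[mu]_x (U x)%:E <= B%:E)%E -> 0 < e ->
  exists n : nat, (\int[mu]_x (satur n%:R (U x))%:E <= e%:E)%E.
Proof.
move=> UB e0; have mU : measurable_fun setT (U : Rd -> R).
  by apply: continuous_measurable_rV; exact: continuous_U.
have iU : mu.-integrable setT (fun x : Rd => (U x)%:E).
  apply/integrableP; split; first exact/measurable_EFinP.
  under eq_integral do rewrite abse_EFin gtr0_norm ?U_gt0//.
  exact: le_lt_trans UB (ltry _).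
have [] := @dominated_convergence _ _ _ mu setT measurableT
  (fun n x => (satur n%:R (U x))%:E) (fun=> 0%E) (fun x => (U x)%:E).
- by move=> n; apply/measurable_EFinP; exact: measurable_satur_U.
- exact: measurable_cst.
- apply: aeW => x _; apply: cvg_EFin; first exact: nearW.
  have U1 := U_ge1 x; have U0 := U_gt0 x.
  have c0 : U x * U x * n.+1%:R^-1 @[n --> \oo] --> 0.
    by rewrite -[X in _ --> X](mulr0 (U x * U x)); apply: cvgMr; exact: cvg_harmonic.
  apply: (squeeze_cvgr _ (cvg_cst 0) c0); apply: nearW => n.
  have nU : 0 < n%:R + U x by apply: ltr_wpDl.
  rewrite satur_ge0 ?(ltW U0)//= /satur ler_pM2l ?mulr_gt0// lef_pV2 ?posrE//.
  by rewrite -natr1 lerD2l.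
- exact: iU.
- apply: aeW => x n _; rewrite abse_EFin lee_fin ger0_norm ?satur_ge0 ?(ltW (U_gt0 x))//.
  exact: satur_le (U_gt0 x).
move=> _ _; rewrite integral0 => /fine_cvgP[fn /cvgr0Pnorm_lt /(_ e e0) cn].
have [n _ /(_ n (leqnn n))[f1 f2]] := filterI fn cn.
exists n; move: f1 f2 => /=; set I := integral _ _ _ => f1 f2.
by rewrite -(fineK f1) lee_fin (le_trans (ler_norm _))// ltW.
Qed.

End transport_distance.

Section moments_of_bridge.
Context {R : realType} {d : nat}.
Local Notation Rd := 'rV[R]_d.
Variables (b : 'I_d -> Rd -> R) (CV : R).
Hypothesis bc : forall i, continuous (b i).
Hypotheses (CV0 : 0 <= CV) (bV : forall x, gen b V x <= CV).
Variable p : R -> R.-pker Rd ~> Rd.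
Hypothesis pb : forall x f, test_function f ->
  (forall t : R, 0 < t -> is_derive t (1 : R) (fun s => \int[p s x]_y f y)
     (\int[p t x]_y gen b f y)) /\
  (\int[p t x]_y f y) @[t --> 0^'+] --> f x.
Variables (tau : R) (c : R -> probability Rd R) (E : R -> R) (H : R).
Hypotheses (tau0 : 0 < tau) (EH : forall t : R, 0 <= t <= 1 -> 0 <= E t <= H).
Hypothesis cE : forall s t : R, 0 <= s -> s <= t -> t <= 1 ->
  exists2 pi, coupling (c s) (c t) pi & forall a : Rd * Rd -> R, mbd a ->
  \int[pi]_q (a q - ln (\int[Pr p (tau * (t - s)) q.1]_u expR (a (q.1, u)))) <= E t - E s.
Hypothesis P20 : P2 (c 0).
Implicit Types (x : Rd) (f : Rd -> R).

Let K := growth_rate CV tau.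

Let E_incr (s t : R) : 0 <= s -> s <= t -> t <= 1 -> 0 <= E t - E s <= H.
Proof.
move=> s0 st t1; have := E_mono cE s0 st t1.
have := EH (t := s); have := EH (t := t).
rewrite s0 t1 (le_trans s0 st) (le_trans st t1) => /(_ isT) h1 /(_ isT) h2 h3; lra.
Qed.

(** [moment_growth] concerns truncated moments. At time t the truncation level goes to infinity by
    Fatou; at time s the truncated moment is at most [expR 1 ^+ 2] times the saturated one. *)
Lemma moment_transfer (la M B s t : R) : 0 < la -> 0 <= M -> 0 <= s -> s <= t -> t <= 1 ->
  (\int[c s]_x (satur M (U x))%:E <= B%:E)%E ->
  (\int[c t]_x (satur M (U x))%:E <=
    (expR (K la * (t - s)) * (expR 1 ^+ 2 * B + la^-1 * (E t - E s)))%:E)%E.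
Proof.
move=> la0 M0 s0 st t1 HB; set D := expR _ * _.
have mS := @measurable_satur_U R d M M0.
have S0 x : 0 <= satur M (U x) by apply: satur_ge0 => //; exact: ltW (U_gt0 x).
have n0 (n : nat) : 0 <= n%:R :> R by [].
pose f_ (n : nat) x := Num.min (satur M (U x)) (moment_fun M n%:R x).
have mk n := moment_fun_mbd (d := d) M0 (n0 n).
apply: (@fatou_le _ _ _ (c t) f_ (fun x => satur M (U x)) (fun=> D) D) => //.
- by move=> n; apply: measurable_minr => //; case: (mk n).
- by move=> n x; rewrite le_min S0 moment_fun_ge0.
- apply: aeW => x; apply: cvg_near_cst.
  have : \forall n \near \oo, V x <= n%:R by exact: nbhs_infty_ger.
  by apply: filterS => n Vn; rewrite /f_ min_l// moment_fun_ge.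
- move=> n; apply: (@le_trans _ _ (\int[c t]_x (moment_fun M n%:R x)%:E)%E).
    apply: ge0_le_integral => //.
    + by move=> x _; rewrite lee_fin le_min S0 moment_fun_ge0.
    + by apply/measurable_EFinP; apply: measurable_minr => //; case: (mk n).
    + by apply/measurable_EFinP; case: (mk n).
    + by move=> x _; rewrite lee_fin ge_min lexx orbT.
  rewrite mbd_EFin// lee_fin.
  have h1 : \int[c s]_x moment_fun M n%:R x <= expR 1 ^+ 2 * B.
    rewrite -lee_fin -mbd_EFin//.
    apply: (@le_trans _ _ (\int[c s]_x ((expR 1 ^+ 2)%:E * (satur M (U x))%:E))%E).
      apply: ge0_le_integral => //.
      + by move=> x _; rewrite lee_fin moment_fun_ge0.
      + by apply/measurable_EFinP; case: (mk n).
      + by apply: measurable_funeM; exact/measurable_EFinP.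
      + by move=> x _; rewrite -EFinM lee_fin; exact: moment_fun_le.
    rewrite ge0_integralZl//; last 2 first.
    + exact/measurable_EFinP.
    + by move=> x _; rewrite lee_fin.
    by rewrite (EFinM (expR 1 ^+ 2) B); apply: lee_wpmul2l => //; rewrite lee_fin exprn_ge0// expR_ge0.
  have := moment_growth bc CV0 bV M0 (n0 n) la0 pb tau0 cE s0 st t1; rewrite -/K => h2.
  rewrite -(ler_pM2l la0) (le_trans h2)// /D.
  have -> : la * (expR (K la * (t - s)) * (expR 1 ^+ 2 * B + la^-1 * (E t - E s))) =
    expR (K la * (t - s)) * (la * (expR 1 ^+ 2 * B) + (E t - E s)).
    by field; rewrite gt_eqF.
  by rewrite ler_wpM2l ?expR_ge0// lerD2r ler_pM2l.
- exact: cvg_cst.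
Qed.

Let satur0 x : satur 0 (U x) = U x.
Proof. by rewrite /satur add0r; field; rewrite gt_eqF// U_gt0. Qed.

Let mU : measurable_fun setT (U : Rd -> R).
Proof. by apply: continuous_measurable_rV; exact: continuous_U. Qed.

(** The case M = 0 of [moment_transfer], where satur 0 u = u, with la = 1 and starting time 0. *)
Lemma bridge_moment (t : R) : 0 <= t <= 1 -> exists B, (\int[c t]_x (U x)%:E <= B%:E)%E.
Proof.
move=> /andP[t0 t1].
have [B HB] : exists B, (\int[c 0]_x (U x)%:E <= B%:E)%E.
  under eq_integral do rewrite U_enorm EFinD.
  rewrite ge0_integralD//; last 2 first.
  - by move=> x _; rewrite lee_fin sqr_ge0.
  - by apply/measurable_EFinP; exact: measurable_sqenorm.
  rewrite integral_cst// mul1e [X in (X + _)%E]probability_setT.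
  have I0 : (0 <= \int[c 0]_x (enorm x ^+ 2)%:E)%E.
    by apply: integral_ge0 => x _; rewrite lee_fin sqr_ge0.
  have := P20; rewrite /P2/=; case: (integral _ _ _) I0 => [r| |]// _ _.
  by exists (1 + r).
exists (expR (K 1 * (t - 0)) * (expR 1 ^+ 2 * B + 1^-1 * (E t - E 0))).
under eq_integral do rewrite -satur0.
apply: moment_transfer => //.
by under eq_integral do rewrite satur0.
Qed.

Lemma bridge_P2 (t : R) : 0 <= t <= 1 -> P2 (c t).
Proof.
move=> t01; have [B HB] := bridge_moment t01; rewrite /P2/=.
apply: le_lt_trans (ltry B); apply: le_trans HB; apply: ge0_le_integral => //.
- by move=> x _; rewrite lee_fin sqr_ge0.
- by apply/measurable_EFinP; exact: measurable_sqenorm.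
- exact/measurable_EFinP.
- by move=> x _; rewrite lee_fin U_enorm lerDr.
Qed.

Let H0 : 0 <= H.
Proof. by have := E_incr (lexx 0) ler01 (lexx 1); case/andP; exact: le_trans. Qed.

(** Saturated moments are transferred from one fixed time s before t0, or s = 0, at which a large n
    makes them small. The entropy increment is only bounded by H, so la is taken large; dl is chosen
    after la and keeps the exponential factor below [expR 1]. *)
Lemma bridge_tail (t0 e : R) : 0 <= t0 <= 1 -> 0 < e ->
  exists (n : nat) (dl : R), 0 < dl /\ forall t : R, 0 <= t <= 1 -> `|t - t0| < dl ->
  (\int[c t]_x (satur n%:R (U x))%:E <= e%:E)%E.
Proof.
move=> /andP[t00 t01] e0; have X0 : 0 < expR 1 :> R by exact: expR_gt0.
pose la := expR 1 * (2 * (H + 1)) / e.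
have Hp : 0 < H + 1 by rewrite ltr_wpDl.
have la0 : 0 < la by rewrite divr_gt0// !mulr_gt0.
have K0 : 0 <= K la by exact: growth_rate_ge0.
pose dl := (2 * (K la + 1))^-1; pose s := Num.max 0 (t0 - dl).
have dl0 : 0 < dl by rewrite invr_gt0 mulr_gt0// ltr_wpDl.
have Kdl : K la * (2 * dl) <= 1.
  by rewrite /dl invfM mulrA -mulrA mulVKf// ?mulrA; rewrite -ler_pdivlMr ?invr_gt0 ?ltr_wpDl// invrK; lra.
have s0 : 0 <= s by rewrite le_max lexx.
have s1 : s <= 1 by rewrite ge_max ler01/=; lra.
have [B0 HB0] : exists B, (\int[c s]_x (U x)%:E <= B%:E)%E by apply: bridge_moment; rewrite s0.
pose B := e / (2 * expR 1 ^+ 3).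
have Bp : 0 < B by rewrite divr_gt0// mulr_gt0// exprn_gt0.
have [n Hn] := satur_vanish HB0 Bp; exists n, dl; split => // t /andP[t0' t1'] tt.
move: tt; rewrite ltr_norml => /andP[tt1 tt2].
have st : s <= t by rewrite ge_max t0'/=; lra.
have ts : t - s <= 2 * dl by rewrite lerBlDr -lerBlDl le_max; apply/orP; right; lra.
have n0 : 0 <= n%:R :> R by [].
apply: (le_trans (moment_transfer la0 n0 s0 st t1' Hn)); rewrite lee_fin.
have /andP[E0 E1] := E_incr s0 st t1'.
have Xle : expR (K la * (t - s)) <= expR 1.
  by rewrite ler_expR (le_trans _ Kdl)// ler_wpM2l.
have laH : la^-1 * (E t - E s) <= la^-1 * (H + 1) by rewrite ler_pM2l ?invr_gt0//; lra.
apply: (@le_trans _ _ (expR 1 * (expR 1 ^+ 2 * B + la^-1 * (H + 1)))).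
  apply: ler_pM => //; last by rewrite lerD2l.
  by apply: addr_ge0; apply: mulr_ge0; rewrite ?invr_ge0 ?exprn_ge0 ?expR_ge0// ?ltW.
have -> : expR 1 * (expR 1 ^+ 2 * B + la^-1 * (H + 1)) = e.
  by rewrite /B /la; field; rewrite !gt_eqF.
by [].
Qed.

(** The entropy inequality for a(q) = la (f q.2 - f q.1)^2; the exponential is linearized with the
    help of a <= 4 la B^2. *)
Lemma square_deviation f (la : R) : test_function f -> 0 < la -> exists2 C, 0 <= C &
  forall (s t : R) (pi : probability (Rd * Rd)%type R), 0 <= s -> s <= t -> t <= 1 ->
  (forall a : Rd * Rd -> R, mbd a ->
  \int[pi]_q (a q - ln (\int[Pr p (tau * (t - s)) q.1]_u expR (a (q.1, u)))) <= E t - E s) ->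
  \int[pi]_q (f q.2 - f q.1) ^+ 2 <= la^-1 * H + C * (t - s).
Proof.
move=> tf la0; have mf := test_function_mbd tf; have [_ [B fB]] := mf.
have [_ [A1 fA1]] := gen_mbd bc tf.
have [_ [A2 fA2]] := gen_mbd bc (test_functionM tf (test_function_bsmooth tf)).
have B0 : 0 <= B by exact: le_trans (fB 0).
have A10 : 0 <= A1 by exact: le_trans (fA1 0).
have A20 : 0 <= A2 by exact: le_trans (fA2 0).
pose X := expR (4 * la * B ^+ 2).
have X0 : 0 <= X by exact: expR_ge0.
exists (X * (A2 + 2 * B * A1) * tau).
  by rewrite !mulr_ge0 ?(ltW tau0)// addr_ge0 ?mulr_ge0.
move=> s t pi s0 st t1 Hpi.
have mdf : mbd (fun q : Rd * Rd => f q.2 - f q.1).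
  by apply: mbdB; [exact: mbd_map measurable_snd mf|exact: mbd_map measurable_fst mf].
pose a (q : Rd * Rd) := la * (f q.2 - f q.1) ^+ 2.
have ms : mbd (fun q : Rd * Rd => (f q.2 - f q.1) ^+ 2).
  by under [X in mbd X]eq_fun do rewrite expr2; exact: mbdM.
have ma : mbd a by apply: mbdM => //; exact: mbd_cst.
have a0 q : 0 <= a q by rewrite mulr_ge0 ?sqr_ge0// ltW.
have aB q : a q <= 4 * la * B ^+ 2.
  have := fB q.1; have := fB q.2; rewrite !ler_norml => /andP[h1 h2] /andP[h3 h4].
  have -> : 4 * la * B ^+ 2 = la * (2 * B) ^+ 2 by ring.
  rewrite ler_pM2l//; set w := f q.2 - f q.1.
  by rewrite -ler_sqrt ?sqr_ge0// !sqrtr_sqr (ger0_norm (_ : 0 <= 2 * B)) ?mulr_ge0// ler_norml /w; lra.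
set r := tau * (t - s) in Hpi *.
have r0 : 0 <= r by rewrite mulr_ge0 ?subr_ge0// ltW.
have lnle z : ln (\int[Pr p r z]_u expR (a (z, u))) <= la * X * ((A2 + 2 * B * A1) * r).
  have maz : mbd (fun u => a (z, u)) := mbd_map (measurable_pair1 z) ma.
  have mez := mbd_expR maz.
  have msz : mbd (fun u => (f u - f z) ^+ 2) := mbd_map (measurable_pair1 z) ms.
  have Z1 : 1 <= \int[Pr p r z]_u expR (a (z, u)).
    by apply: Int_ge_cst => // u; rewrite -[leLHS]expR0 ler_expR.
  apply: (le_trans (ln_le_sub1 (lt_le_trans ltr01 Z1))).
  rewrite lerBlDl; have h := Pr_square_increment bc pb z tf r0 fB fA1 fA2.
  have mc (k : R) : mbd (fun _ : Rd => k) by exact: mbd_cst.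
  apply: (@le_trans _ _ (\int[Pr p r z]_u (1 + la * X * (f u - f z) ^+ 2))).
    apply: le_Int => //; first by apply: mbdD => //; exact: mbdM.
    move=> u; rewrite -lerBlDl (le_trans (expRm1_le _))//.
    rewrite (_ : la * X * (f u - f z) ^+ 2 = a (z, u) * X); last by rewrite /a /=; ring.
    by rewrite ler_wpM2l// /X ler_expR.
  rewrite IntD ?Int_cst ?IntZ//; last exact: mbdM.
  by rewrite lerD2l ler_wpM2l// mulr_ge0// ltW.
have mA : mbd (fun z => ln (\int[Pr p r z]_u expR (a (z, u)))) := mbd_ln_Pr p r ma.
have mAq : mbd (fun q : Rd * Rd => ln (\int[Pr p r q.1]_u expR (a (q.1, u)))).
  exact: mbd_map measurable_fst mA.
have h : \int[pi]_q a q - \int[pi]_q ln (\int[Pr p r q.1]_u expR (a (q.1, u))) <= E t - E s.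
  by rewrite -(IntB pi ma mAq); exact: Hpi.
have h2 := Int_le_cst pi mAq (fun q => lnle q.1).
have h3 : \int[pi]_q a q = la * \int[pi]_q (f q.2 - f q.1) ^+ 2 by rewrite -IntZ.
have /andP[_ h4] := E_incr s0 st t1.
rewrite -(ler_pM2l la0).
have -> : la * (la^-1 * H + X * (A2 + 2 * B * A1) * tau * (t - s)) =
  H + la * X * ((A2 + 2 * B * A1) * r) by rewrite /r; field; rewrite gt_eqF.
rewrite -h3; lra.
Qed.

Let budget (S u w g q : R) : S <= u + w -> w <= q / 16 -> u <= q / 16 -> g <= q / 8 ->
  0 <= q -> 2 * S + g <= q / 2.
Proof. lra. Qed.

(** Far away the saturated moments control the cost; elsewhere the coordinates are replaced by test
    functions f i, whose square deviations are small. The parameters la, eta and dl2 are chosen so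
    that all contributions add up to e^2. *)
Lemma bridge_cost (t0 e : R) : 0 <= t0 <= 1 -> 0 < e -> exists2 dl, 0 < dl &
  forall s t : R, 0 <= s -> s <= t -> t <= 1 -> `|s - t0| < dl -> `|t - t0| < dl ->
  exists2 pi, coupling (c s) (c t) pi &
    (\int[pi]_q (enorm (q.1 - q.2) ^+ 2)%:E <= (e ^+ 2)%:E)%E.
Proof.
move=> t01 e0; have e32 : 0 < e ^+ 2 / 32 by rewrite divr_gt0// exprn_gt0.
have [n [dl1 [dl10 Hn]]] := bridge_tail t01 e32.
have n0 : 0 <= n%:R :> R by [].
pose eta := e / (8 * (d%:R + 1)).
have d1 : 0 < d%:R + 1 :> R by rewrite ltr_wpDl.
have eta0 : 0 < eta by rewrite divr_gt0// mulr_gt0.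
(* The coordinate, cut off continuously between U = n and U = n + 1; smoothness is restored by
   [test_approx]. *)
pose G (i : 'I_d) x := x ord0 i * Num.max 0 (Num.min 1 (n%:R + 1 - U x)).
have cG i : continuous (G i).
  apply: contM; first exact: continuous_coord.
  have c0 (k : R) : continuous (fun _ : Rd => k) by exact: cont_cst.
  have c1 : continuous (fun x : Rd => n%:R + 1 - U x).
    by apply: contD; [exact: c0|apply: contN; exact: continuous_U].
  by move=> x; exact: (continuous_max (c0 0 x) (continuous_min (c0 1 x) (c1 x))).
have Gout i x : n%:R + 1 < `|x| -> G i x = 0.
  move=> nx; have Ux := norm_le_U x.
  by rewrite /G max_l ?mulr0// ge_min; apply/orP; right; lra.
have /choice[f Hf] : forall i, exists f, test_function f /\ forall x, `|f x - G i x| <= eta.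
  by move=> i; have [f tf fG] := test_approx (cG i) eta0 (Gout i); exists f.
have fM i x : U x <= n%:R -> `|f i x - x ord0 i| <= eta.
  move=> xn; have := (Hf i).2 x; rewrite /G min_l; last by lra.
  by rewrite max_r// mulr1.
have Hp : 0 < H + 1 by rewrite ltr_wpDl.
pose la := 16 * (d%:R + 1) * (H + 1) / e ^+ 2.
have la0 : 0 < la by rewrite divr_gt0 ?exprn_gt0// !mulr_gt0.
have /choice[C HC] : forall i, exists C, 0 <= C /\ forall (s t : R) (pi : probability (Rd * Rd)%type R), 0 <= s -> s <= t -> t <= 1 ->
  (forall a : Rd * Rd -> R, mbd a ->
  \int[pi]_q (a q - ln (\int[Pr p (tau * (t - s)) q.1]_u expR (a (q.1, u)))) <= E t - E s) ->
  \int[pi]_q (f i q.2 - f i q.1) ^+ 2 <= la^-1 * H + C * (t - s).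
  by move=> i; have [C C0 HC] := square_deviation (Hf i).1 la0; exists C.
pose CC := \sum_(i < d) C i.
have CC0 : 0 <= CC by apply: sumr_ge0 => i _; exact: (HC i).1.
pose dl2 := e ^+ 2 / (16 * (CC + 1)).
have dl20 : 0 < dl2 by rewrite divr_gt0 ?exprn_gt0// mulr_gt0// ltr_wpDl.
exists (Num.min dl1 (dl2 / 2)); first by rewrite lt_min dl10 divr_gt0.
move=> s t s0 st t1; rewrite !lt_min => /andP[sd1 sd2] /andP[td1 td2].
have [pi cpi Hpi] := cE s0 st t1; exists pi => //.
have ts : t - s <= dl2 by move: sd2 td2; rewrite !ltr_norml; lra.
have ss : 0 <= s <= 1 by rewrite s0 (le_trans st).
have tt : 0 <= t <= 1 by rewrite t1 (le_trans s0).
pose S (q : Rd * Rd) := 2 * (\sum_(i < d) (f i q.2 - f i q.1) ^+ 2) + 8 * d%:R * eta ^+ 2.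
have mi i : mbd (fun q : Rd * Rd => (f i q.2 - f i q.1) ^+ 2).
  have mf := test_function_mbd (Hf i).1.
  have mdf : mbd (fun q : Rd * Rd => f i q.2 - f i q.1).
    by apply: mbdB; [exact: mbd_map measurable_snd mf|exact: mbd_map measurable_fst mf].
  by under [X in mbd X]eq_fun do rewrite expr2; exact: mbdM.
have [msum Esum] : mbd (fun q : Rd * Rd => \sum_(i < d) (f i q.2 - f i q.1) ^+ 2) /\
    \int[pi]_q (\sum_(i < d) (f i q.2 - f i q.1) ^+ 2) =
    \sum_(i < d) \int[pi]_q (f i q.2 - f i q.1) ^+ 2.
  exact: Int_sum.
have mS : mbd S by apply: mbdD; [apply: mbdM => //; exact: mbd_cst|exact: mbd_cst].
have S0 q : 0 <= S q.
  apply: addr_ge0; last by rewrite mulr_ge0 ?sqr_ge0// mulr_ge0.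
  by rewrite mulr_ge0//; apply: sumr_ge0 => i _; exact: sqr_ge0.
have mT : measurable_fun setT (fun x : Rd => 8 * satur n%:R (U x)).
  by apply: measurable_funM => //; exact: measurable_satur_U.
have T0 x : 0 <= 8 * satur n%:R (U x).
  by rewrite mulr_ge0// satur_ge0// ltW// U_gt0.
have mT1 : measurable_fun setT (fun q : Rd * Rd => (8 * satur n%:R (U q.1))%:E).
  by apply/measurable_EFinP; exact: measurableT_comp mT measurable_fst.
have mT2 : measurable_fun setT (fun q : Rd * Rd => (8 * satur n%:R (U q.2))%:E).
  by apply/measurable_EFinP; exact: measurableT_comp mT measurable_snd.
have mS' : measurable_fun setT (fun q => (S q)%:E) by apply/measurable_EFinP; case: mS.
have tail r : 0 <= r <= 1 -> `|r - t0| < dl1 ->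
    (\int[c r]_x (8 * satur n%:R (U x))%:E <= (e ^+ 2 / 4)%:E)%E.
  move=> r01 rd; under eq_integral do rewrite EFinM.
  rewrite ge0_integralZl//; last 2 first.
  - by apply/measurable_EFinP; exact: measurable_satur_U.
  - by move=> x _; rewrite lee_fin satur_ge0// ltW// U_gt0.
  have -> : e ^+ 2 / 4 = 8 * (e ^+ 2 / 32) by field.
  by rewrite (EFinM 8); apply: lee_wpmul2l; [rewrite lee_fin|exact: Hn].
apply: (@le_trans _ _ (\int[pi]_q ((S q)%:E + (8 * satur n%:R (U q.1))%:E + (8 * satur n%:R (U q.2))%:E))%E).
  apply: ge0_le_integral => //.
  - by move=> q _; rewrite lee_fin sqr_ge0.
  - by apply/measurable_EFinP; exact: measurable_cost.
  - by apply: emeasurable_funD => //; exact: emeasurable_funD.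
  - by move=> q _; rewrite -!EFinD lee_fin; apply: cost_le => //; exact: ltW.
have p0 q : [set: Rd * Rd] q -> (0 <= (S q)%:E)%E by rewrite lee_fin.
have p1 q : [set: Rd * Rd] q -> (0 <= (8 * satur n%:R (U q.1))%:E)%E by rewrite lee_fin.
have p2 q : [set: Rd * Rd] q -> (0 <= (8 * satur n%:R (U q.2))%:E)%E by rewrite lee_fin.
have p01 q : [set: Rd * Rd] q -> (0 <= (S q)%:E + (8 * satur n%:R (U q.1))%:E)%E.
  by move=> _; rewrite adde_ge0 ?p0 ?p1.
rewrite (ge0_integralD pi measurableT p01 (emeasurable_funD mS' mT1) p2 mT2).
rewrite (ge0_integralD pi measurableT p0 mS' p1 mT1).
rewrite (coupling_fst_ge0 cpi mT T0) (coupling_snd_ge0 cpi mT T0) (mbd_EFin pi mS).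
have -> : (e ^+ 2 = e ^+ 2 / 2 + e ^+ 2 / 4 + e ^+ 2 / 4)%R by field.
rewrite (EFinD (_ + _)) (EFinD (e ^+ 2 / 2)); apply: leeD; last exact: tail.
apply: leeD; last exact: tail.
rewrite lee_fin /S IntD; [|by apply: mbdM => //; exact: mbd_cst|exact: mbd_cst].
rewrite Int_cst IntZ// Esum.
have h1 : \sum_(i < d) \int[pi]_q (f i q.2 - f i q.1) ^+ 2 <= d%:R * (la^-1 * H) + CC * dl2.
  have -> : d%:R * (la^-1 * H) + CC * dl2 = \sum_(i < d) (la^-1 * H + C i * dl2).
    rewrite big_split/= sumr_const card_ord /CC mulr_suml; congr (_ + _).
    exact: mulr_natl.
  apply: ler_sum => i _; have [Ci0 HCi] := HC i.
  by apply: (le_trans (HCi s t pi s0 st t1 Hpi)); rewrite lerD2l ler_wpM2l.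
have h2 : CC * dl2 <= e ^+ 2 / 16.
  have -> : e ^+ 2 / 16 = (CC + 1) * dl2 by rewrite /dl2; field; rewrite gt_eqF// ltr_wpDl.
  by rewrite ler_wpM2r ?(ltW dl20)// lerDl.
have h3 : d%:R * (la^-1 * H) <= e ^+ 2 / 16.
  have -> : e ^+ 2 / 16 = (d%:R + 1) * (la^-1 * (H + 1)).
    by rewrite /la; field; rewrite !gt_eqF ?exprn_gt0.
  have l0 : 0 <= la^-1 * H by rewrite mulr_ge0// invr_ge0 ltW.
  apply: ler_pM => //; first by rewrite lerDl.
  by rewrite ler_wpM2l ?lerDl// invr_ge0 ltW.
have h4 : 8 * d%:R * eta ^+ 2 <= e ^+ 2 / 8.
  have -> : e ^+ 2 / 8 = 8 * (d%:R + 1) ^+ 2 * eta ^+ 2 by rewrite /eta; field; rewrite gt_eqF.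
  rewrite ler_wpM2r ?sqr_ge0// ler_pM2l//.
  apply: (@le_trans _ _ (d%:R + 1)); first by rewrite lerDl.
  by rewrite expr2 ler_peMl ?(ltW d1)// lerDr.
exact: (budget h1 h2 h3 h4 (sqr_ge0 e)).
Qed.

Lemma bridge_W2_continuous (t0 : R) : `[0%R, 1%R]%classic t0 ->
  W2 (c s) (c t0) @[s --> within `[0%R, 1%R]%classic (nbhs t0)] --> 0%E.
Proof.
rewrite /= in_itv/= => t01.
have near_le (e : R) : 0 < e ->
    \forall s \near within `[0%R, 1%R]%classic (nbhs t0), (W2 (c s) (c t0) <= e%:E)%E.
  move=> e0; have [dl dl0 Hdl] := bridge_cost t01 e0.
  exists dl => // s /= sd; rewrite in_itv/= => s01.
  have sd' : `|s - t0| < dl by rewrite distrC.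
  have z0 : `|t0 - t0| < dl by rewrite subrr normr0.
  case/andP: s01 => s0 s1; case/andP: (t01) => t00 t10.
  have [st|/ltW ts] := leP s t0.
    by have [pi cpi Hpi] := Hdl s t0 s0 st t10 sd' z0; apply: W2_le cpi (ltW e0) Hpi.
  have [pi cpi Hpi] := Hdl t0 s t00 ts s1 z0 sd'.
  have [g cg Hg] := coupling_swap cpi.
  by apply: (W2_le cg (ltW e0)); rewrite Hg.
have W0 s : (0 <= W2 (c s) (c t0))%E by exact: poweR_ge0.
apply/fine_cvgP; split.
  apply: filterS (near_le 1 ltr01) => s Ws.
  by rewrite ge0_fin_numE// (le_lt_trans Ws)// ltry.
apply/cvgr0Pnorm_le => e e0; apply: filterS (near_le e e0) => s Ws /=.
have fW : W2 (c s) (c t0) \is a fin_num by rewrite ge0_fin_numE// (le_lt_trans Ws)// ltry.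
by rewrite ger0_norm ?fine_ge0// -lee_fin fineK.
Qed.

End moments_of_bridge.

(** * The two inequalities *)

Section large_deviations.
Context {R : realType} {d : nat}.
Hypothesis hd : (0 < d)%N.
Local Notation Rd := 'rV[R]_d.
Variables (Psi : Rd -> R) (tau CV : R) (p : R -> R.-pker Rd ~> Rd).
Hypotheses (tau0 : 0 < tau) (bc : forall i, continuous (drift Psi i)) (CV0 : 0 <= CV)
  (bV : forall x, gen (drift Psi) V x <= CV).
Hypothesis pb : forall x f, test_function f ->
  (forall t : R, 0 < t -> is_derive t (1 : R) (fun s => \int[p s x]_y f y)
     (\int[p t x]_y gen (drift Psi) f y)) /\
  (\int[p t x]_y f y) @[t --> 0^'+] --> f x.
Variables (rho0 rho : probability Rd R).

Lemma rate_le_action c : W2_curve rho0 rho c ->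
  (rate_functional p tau rho rho0 <= action Psi tau c)%E.
Proof.
move=> cW; rewrite /action; case: asboolP => [cAC|_]; last exact: leey.
rewrite -/(lact Psi tau c 1).
have t40 : 0 < (4 * tau)^-1 by rewrite invr_gt0 mulr_gt0.
have L0 : (0 <= lact Psi tau c 1)%E by apply: integral_ge0 => t _; exact: sqnorm_ge0.
have [fin|] := ltP (lact Psi tau c 1) +oo%E; last first.
  by rewrite leye_eq => /eqP ->; rewrite gt0_muley ?lte_fin// leey.
have dual phi : test_function phi -> \int[rho]_x phi x -
    \int[rho0]_x ln (\int[kpr (Pk p tau) x]_y expR (phi y)) <=
    (4 * tau)^-1 * fine (lact Psi tau c 1).
  move=> tphi; have [_ [B HB]] := test_function_mbd tphi.
  have B1 : 1 <= Num.max B 1 by rewrite le_max lexx orbT.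
  have HB' x : `|phi x| <= Num.max B 1 by rewrite le_max HB.
  exact: (dual_bound hd tau0 bc CV0 bV pb cW cAC fin tphi B1 HB').
have [g cg gA] := dual_entropy dual.
have fL : lact Psi tau c 1 \is a fin_num by rewrite ge0_fin_numE.
rewrite -(fineK fL) -EFinM; apply: le_trans gA.
by rewrite /rate_functional -(PkE p tau0); apply: ereal_inf_lbound; exists g.
Qed.

(** A coupling of infinite entropy is trivial. Otherwise the Radon-Nikodym density is finite and
    nonnegative everywhere, and the bridge built from it is an admissible curve whose action is at
    most the entropy. *)
Lemma inf_action_le_entropy g : P2 rho0 -> coupling rho0 rho g ->
  (ereal_inf [set action Psi tau c | c in W2_curve rho0 rho] <=
   relative_entropy g (semidirect rho0 (p tau)))%E.
Proof.
move=> hrho0 cg; rewrite -(PkE p tau0).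
pose nu : probability (Rd * Rd)%type R := semidirect rho0 (Pk p tau).
rewrite -[semidirect _ _]/(nu : set (Rd * Rd) -> \bar R).
have [gnu|gnu] := pselect (g `<< nu); last first.
  by rewrite /relative_entropy; case: asboolP => // _; exact: leey.
pose f := Radon_Nikodym_SigmaFinite.f g nu; pose h q := fine (f q).
have f0 q : (0 <= f q)%E by exact: Radon_Nikodym_SigmaFinite.f_ge0.
have hE q : (h q)%:E = f q by rewrite fineK//; exact: Radon_Nikodym_SigmaFinite.f_fin_num.
have mf : measurable_fun setT f.
  exact: measurable_int (Radon_Nikodym_SigmaFinite.f_integrable gnu).
have mh : measurable_fun setT h by exact: measurableT_comp.
have h0 q : 0 <= h q by rewrite fine_ge0.
have gh A : measurable A -> g A = (\int[nu]_(q in A) (h q)%:E)%E.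
  move=> mA; rewrite (Radon_Nikodym_SigmaFinite.f_integral gnu)//.
  by apply: eq_integral => q _; rewrite hE.
rewrite (relative_entropy_density mh h0 gh).
have I0 : (0 <= \int[nu]_q (h q * ln (h q) - h q + 1)%:E)%E.
  by apply: integral_ge0 => q _; rewrite lee_fin; exact: ent_ge0.
case IE : (\int[nu]_q (h q * ln (h q) - h q + 1)%:E)%E I0 => [H| |]// _; last exact: leey.
have hH : (\int[nu]_q (ent (h q))%:E <= H%:E)%E by rewrite -IE.
have [c [E [c0 c1 EH cE]]] := bridge hd bc CV0 bV pb tau0 cg mh h0 gh hH.
have [er [ier er0 erH Her]] := upper_density (E_mono cE) EH.
have P20 : P2 (c 0).
  rewrite /P2/= (eq_measure_integral rho0)// => A mA _; exact: c0.
apply: (@le_trans _ _ (action Psi tau c)).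
  apply: ereal_inf_lbound; exists c => //; split => // t.
    by rewrite /= in_itv/= => t01; apply: (bridge_P2 bc CV0 bV pb tau0 cE P20 t01).
  by move=> t01; apply: (bridge_W2_continuous bc CV0 bV pb tau0 EH cE P20 t01).
exact: (action_le_density bc pb tau0 EH cE ier er0 Her erH).
Qed.

End large_deviations.

Unset Implicit Arguments.

Theorem corollary4p10 (R : realType) (d : nat) (hd : (0 < d)%N)
    (Psi : 'rV[R]_d -> R) (p : R -> R.-pker 'rV[R]_d ~> 'rV[R]_d)
    (rho0 : probability 'rV[R]_d R)
    (hrho0 : P2 rho0) (hF : (free_energy Psi rho0 < +oo)%E)
    (hC2 : C_k 2 Psi)
    (hPsi : subquadratic Psi \/ superquadratic Psi)
    (hp : fundamental_solution Psi p)
    (tau : R) (htau : 0 < tau)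
    (rho : probability 'rV[R]_d R) (hrho : P2 rho) :
  rate_functional p tau rho rho0 =
  ereal_inf [set action Psi tau c | c in W2_curve rho0 rho].
Proof.
have bc := drift_continuous hC2.
have [C C0 HC] := drift_bound hC2 hPsi.
have bV := gen_V_le HC.
have CV0 : 0 <= 2 * d%:R + 2 * C by rewrite addr_ge0 ?mulr_ge0.
have pb x f : test_function f ->
    (forall t : R, 0 < t -> is_derive t (1 : R) (fun s => \int[p s x]_y f y)
       (\int[p t x]_y gen (drift Psi) f y)) /\
    (\int[p t x]_y f y) @[t --> 0^'+] --> f x.
  move=> tf; have [D L] := hp x f tf; split => // t t0; apply: is_derive_eq (D t t0) _.
  by apply: eq_Rintegral => y _; rewrite gen_drift.
apply/eqP; rewrite eq_le; apply/andP; split.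
  apply: le_ereal_inf_tmp => _ [c cW <-]; exact: (rate_le_action hd htau bc CV0 bV pb cW).
apply: le_ereal_inf_tmp => _ [g cg <-].
exact: (inf_action_le_entropy hd htau bc CV0 bV pb hrho0 cg).
Qed.
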